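(* Let $d\geq 2$ and let $k$ be a field of prime characteristic $p>2$. Let $(R,\mathfrak{m},k)$ be a local ring of prime characteristic $p$ with residue field $k$ that is a non-regular complete intersection of dimension $d$, and let $M$ be a finitely generated $R$-module. Let $R_d=k[[x_0,\dots,x_d]]/(x_0^2+\cdots+x_d^2)$. Let $R\ltimes M$ be the idealization of $M$ and $\mathfrak{m}\ltimes\mathfrak{m}M=\{(a,x): a\in\mathfrak{m},\ x\in\mathfrak{m}M\}$, an ideal of $R\ltimes M$. Then for every real $s>0$, $$e_s(\mathfrak{m}\ltimes\mathfrak{m}M)\geq e_s(R_d),$$ where the left-hand side is the $s$-multiplicity of the ideal $\mathfrak{m}\ltimes\mathfrak{m}M$ of the local ring $R\ltimes M$.
   Context: All rings are commutative, Noetherian, local, with identity. Idealization: for a ring $R$ and an $R$-module $M$, $R\ltimes M$ is the set of pairs $(r,m)$, $r\in R$, $m\in M$, with componentwise addition and multiplication $(r,m)(r',m')=(rr',rm'+r'm)$. If $(R,\mathfrak{m})$ is local and $M$ is finitely generated, then $R\ltimes M$ is local with maximal ideal $\mathfrak{m}\ltimes M$, has the same characteristic as $R$, and $\dim(R\ltimes M)=\dim R$. $s$-multiplicity: let $(A,\mathfrak{n})$ be a local ring of prime characteristic $p>0$ and dimension $d>0$, let $I,J$ be $\mathfrak{n}$-primary ideals, $N$ a finitely generated $A$-module, $s>0$ real. Put $$h_s(I,J;N)=\lim_{e\to\infty}\frac{\ell_A\big(N/(I^{\lceil sp^e\rceil}+J^{[p^e]})N\big)}{p^{ed}},$$ where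 $\ell_A$ is length and $J^{[p^e]}$ is the ideal generated by the $p^e$-th powers of elements of $J$ (the limit is known to exist), and $$e_s(I,J;N)=\frac{h_s(I,J;N)}{\mathcal{H}_s(d)},\qquad \mathcal{H}_s(d)=\sum_{i=0}^{\lfloor s\rfloor}\frac{(-1)^i}{d!}\binom{d}{i}(s-i)^d .$$ For an $\mathfrak{n}$-primary ideal $I$ of $A$, $e_s(I):=e_s(I,I;A)$; and $e_s(A):=e_s(\mathfrak{n},\mathfrak{n};A)$. *)

(* Defs.v *)
From HB Require Import structures.
From mathcomp Require Import all_boot all_order all_algebra.
From mathcomp Require mpoly.
From mathcomp Require Import generic_quotient ring_quotient.
From mathcomp Require Import boolp classical_sets functions reals.
From mathcomp Require Import topology normedtype sequences.

Set Implicit Arguments.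
Unset Strict Implicit.
Unset Printing Implicit Defensive.

Import Order.TTheory GRing.Theory Num.Theory.
Import numFieldNormedType.Exports.
Import (canonicals, coercions) mpoly.

Local Open Scope classical_set_scope.
Local Open Scope ring_scope.
Local Open Scope quotient_scope.

Section Chains.
Variables (T : Type) (P : set (set T)).

Definition has_chain (n : nat) : Prop :=
  exists L : nat -> set T,
    (forall i, (i <= n)%N -> P (L i)) /\
    (forall i, (i < n)%N -> L i `<` L i.+1).

(* Equal to 0 when the chains have unbounded length. *)
Definition max_chain : nat :=
  get [set n | has_chain n /\ forall l, has_chain l -> (l <= n)%N].

End Chains.

Section Submodules.
Variables (A : comNzRingType) (N : lmodType A).

Definition submodule (L : set N) : Prop :=
  [/\ L 0, forall x y, L x -> L y -> L (x + y)
    & forall (a : A) x, L x -> L (a *: x)].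

Definition span (X : set N) : set N := smallest submodule X.

Definition finitely_generated : Prop :=
  exists s : seq N, span [set` s] = [set: N].

Lemma span_submodule (X : set N) : submodule (span X).
Proof.
split=> [L [[L0 _ _] _]//|x y sx sy L LP|a x sx L LP].
  by case: (LP) => -[_ LD _] _; apply: LD; [exact: sx | exact: sy].
by case: (LP) => -[_ _ LZ] _; apply: LZ; exact: sx.
Qed.

Definition span_pred (X : set N) : {pred N} := fun x => `[< span X x >].

Lemma span_pred_closed (X : set N) : GRing.submod_closed (span_pred X).
Proof.
case: (span_submodule X) => X0 XD XZ; split; first exact/asboolP.
move=> a x y /asboolP sx /asboolP sy; apply/asboolP.
by apply: XD sy; exact: XZ.
Qed.

HB.instance Definition _ (X : set N) :=
  GRing.isSubmodClosed.Build A N (span_pred X) (span_pred_closed X).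

(* N / span X *)
Definition quotmod (X : set N) : Type := Quotient.quot (span_pred X).

HB.instance Definition _ (X : set N) := GRing.Zmodule.on (quotmod X).

Section QuotModule.
Variable X : set N.
Local Notation Q := (Quotient.quot (span_pred X)).

Definition quotmod_scale (a : A) (q : quotmod X) : quotmod X :=
  \pi_Q (a *: repr (q : Q)).

Lemma quotmod_scale_pi a (x : N) :
  quotmod_scale a (\pi_Q x) = \pi_Q (a *: x).
Proof.
rewrite /quotmod_scale; apply/eqP.
by rewrite -Quotient.idealrBE -scalerBr rpredZ// Quotient.idealrBE reprK.
Qed.

Lemma quotmod_pi_add (x y : N) :
  (\pi_Q x : quotmod X) + (\pi_Q y : quotmod X) = \pi_Q (x + y).
Proof. exact/esym/(raddfD \pi_Q). Qed.

Lemma quotmod_scaleA a b q :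
  quotmod_scale a (quotmod_scale b q) = quotmod_scale (a * b) q.
Proof.
by elim/(@quotW _ Q): q => x; rewrite !quotmod_scale_pi scalerA.
Qed.

Lemma quotmod_scale1 : left_id 1 quotmod_scale.
Proof. by elim/(@quotW _ Q) => x; rewrite quotmod_scale_pi scale1r. Qed.

Lemma quotmod_scaleDr : right_distributive quotmod_scale +%R.
Proof.
move=> a; elim/(@quotW _ Q) => x; elim/(@quotW _ Q) => y.
by rewrite quotmod_pi_add !quotmod_scale_pi scalerDr quotmod_pi_add.
Qed.

Lemma quotmod_scaleDl q : {morph quotmod_scale^~ q : a b / a + b}.
Proof.
move=> a b; elim/(@quotW _ Q): q => x.
by rewrite !quotmod_scale_pi scalerDl quotmod_pi_add.
Qed.

HB.instance Definition _ :=
  GRing.Zmodule_isLmodule.Build A (quotmod X)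
    quotmod_scaleA quotmod_scale1 quotmod_scaleDr quotmod_scaleDl.

End QuotModule.

Definition module_length : nat := max_chain submodule.

Definition ideal_smul (I : set A) : set N :=
  span [set a *: x | a in I & x in [set: N]].

End Submodules.

Arguments finitely_generated {A} N.
Arguments module_length {A} N.
Arguments ideal_smul {A} N I.
Arguments quotmod {A N} X.

Section Ideals.
Variable A : comNzRingType.
Implicit Types I J : set A.

Definition ideal I : Prop := @submodule A A^o I.

Definition ideal_gen (X : set A) : set A := @span A A^o X.

Definition ideal_add I J : set A := [set a + b | a in I & b in J].

Definition ideal_mul I J : set A := ideal_gen [set a * b | a in I & b in J].

Definition ideal_exp I (n : nat) : set A := iter n (ideal_mul I) [set: A].

(* J^[q] *)
Definition frobenius_power J (q : nat) : set A :=
  ideal_gen [set a ^+ q | a in J].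

Definition prime_ideal I : Prop :=
  [/\ ideal I, ~ I 1 & forall a b, I (a * b) -> I a \/ I b].

Definition maximal_ideal I : Prop :=
  [/\ ideal I, ~ I 1 & forall J, ideal J -> ~ J 1 -> I `<=` J -> J = I].

Definition noetherian : Prop :=
  forall I, ideal I -> exists s : seq A, ideal_gen [set` s] = I.

Definition noetherian_local (m : set A) : Prop :=
  [/\ noetherian, maximal_ideal m & forall n, maximal_ideal n -> n = m].

Definition krull_dim : nat := max_chain prime_ideal.

Definition regular_local (m : set A) : Prop :=
  noetherian_local m /\
  exists s : seq A, size s = krull_dim /\ ideal_gen [set` s] = m.

Definition regular_sequence (s : seq A) : Prop :=
  ~ ideal_gen [set` s] 1 /\
  forall i, (i < size s)%N -> forall a,
    ideal_gen [set` take i s] (s`_i * a) -> ideal_gen [set` take i s] a.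

End Ideals.

Arguments noetherian : clear implicits.
Arguments krull_dim : clear implicits.

(* f exhibits B as the m-adic completion of A: it induces isomorphisms
   A / m^n -> B / m^n B for all n, and B is separated and complete for the
   topology defined by the ideals m^n B. *)
Definition is_adic_completion (A B : comNzRingType) (m : set A)
    (f : {rmorphism A -> B}) : Prop :=
  let F n : set B := ideal_gen (f @` ideal_exp m n) in
  [/\ forall n a, F n (f a) -> ideal_exp m n a,
      forall n b, exists a, F n (b - f a),
      forall b, (forall n, F n b) -> b = 0
    & forall u : nat -> B, (forall n, F n (u n.+1 - u n)) ->
        exists b, forall n, F n (b - u n)].

Definition complete_intersection (A : comNzRingType) (m : set A) : Prop :=
  noetherian_local m /\
  exists (B : comNzRingType) (f : {rmorphism A -> B}),
    is_adic_completion m f /\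
    exists (Q : comNzRingType) (mQ : set Q) (s : seq Q)
           (g : {rmorphism Q -> B}),
      [/\ regular_local mQ, regular_sequence s, range g = [set: B]
        & g @^-1` [set 0] = ideal_gen [set` s]].

Section Idealization.
Variables (A : comNzRingType) (M : lmodType A).

Definition idealization : Type := (A * M)%type.

HB.instance Definition _ := GRing.Zmodule.on idealization.

Definition idealization_one : idealization := (1, 0).

Definition idealization_mul (x y : idealization) : idealization :=
  (x.1 * y.1, x.1 *: y.2 + y.1 *: x.2).

Lemma idealization_mulA : associative idealization_mul.
Proof.
move=> [a x] [b y] [c z]; rewrite /idealization_mul /= mulrA.
by rewrite !scalerDr !scalerA [c * a]mulrC [c * b]mulrC addrA.
Qed.

Lemma idealization_mulC : commutative idealization_mul.
Proof. by move=> [a x] [b y]; rewrite /idealization_mul /= mulrC addrC. Qed.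

Lemma idealization_mul1 : left_id idealization_one idealization_mul.
Proof.
by move=> [a x]; rewrite /idealization_mul /= mul1r scale1r scaler0 addr0.
Qed.

Lemma idealization_mulDl : left_distributive idealization_mul +%R.
Proof.
move=> [a x] [b y] [c z]; rewrite /idealization_mul /=; congr pair => /=.
  by rewrite mulrDl.
by rewrite scalerDl scalerDr addrACA.
Qed.

Lemma idealization_one_neq0 : idealization_one != 0.
Proof. by apply/eqP => -[] /eqP; rewrite oner_eq0. Qed.

HB.instance Definition _ := GRing.Zmodule_isComNzRing.Build idealization
  idealization_mulA idealization_mulC idealization_mul1 idealization_mulDl
  idealization_one_neq0.

End Idealization.

(* Formal power series in n variables, a series being the function mapping an
   exponent to the corresponding coefficient. *)
Section PowerSeries.
Variables (n : nat) (k : comNzRingType).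

Local Notation mon := (mpoly.multinom n).
Local Notation mdeg := mpoly.mdeg.
Local Notation madd := mpoly.mnm_add.
Local Notation bmon m := (mpoly.bmultinom n (mdeg m).+1).

Definition mpseries : Type := mon -> k.

HB.instance Definition _ := GRing.Zmodule.on mpseries.

Definition mpseries_one : mpseries := fun m => (m == mpoly.mnm0)%:R.

(* Cauchy product; the degree bound only serves to make the index type
   finite. *)
Definition mpseries_mul (f g : mpseries) : mpseries := fun m =>
  \sum_(c : bmon m * bmon m | m == madd c.1 c.2) f c.1 * g c.2.

Definition mpseries_trunc d (f : mpseries) : mpoly.mpoly n k :=
  \sum_(m : mpoly.bmultinom n d) f m *: mpoly.mpolyX k m.

Lemma mpseries_truncE d (f : mpseries) m :
  (mdeg m < d)%N -> mpoly.mcoeff m (mpseries_trunc d f) = f m.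
Proof. exact: mpoly.mcoeff_mpoly. Qed.

Lemma mpseries_mulE (f g : mpseries) (P Q : mpoly.mpoly n k) d m :
    (forall m', (mdeg m' < d)%N -> mpoly.mcoeff m' P = f m') ->
    (forall m', (mdeg m' < d)%N -> mpoly.mcoeff m' Q = g m') ->
  (mdeg m < d)%N -> mpseries_mul f g m = mpoly.mcoeff m (P * Q).
Proof.
move=> hP hQ md; rewrite mpoly.mcoeffM; apply: eq_bigr => -[c1 c2] /= _.
by rewrite hP ?hQ//; apply: leq_trans md; apply: mpoly.bmdeg.
Qed.

Lemma mpseries_mulA : associative mpseries_mul.
Proof.
move=> f g h; apply/funext => m; set d := (mdeg m).+1.
have tr u : forall m', (mdeg m' < d)%N ->
    mpoly.mcoeff m' (mpseries_trunc d u) = u m' by exact: mpseries_truncE.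
have trM u v : forall m', (mdeg m' < d)%N ->
    mpoly.mcoeff m' (mpseries_trunc d u * mpseries_trunc d v) =
    mpseries_mul u v m'.
  by move=> m' m'd; rewrite (mpseries_mulE (tr u) (tr v)).
by rewrite (mpseries_mulE (tr f) (trM g h))// (mpseries_mulE (trM f g) (tr h))//
  mulrA.
Qed.

Lemma mpseries_mulC : commutative mpseries_mul.
Proof.
move=> f g; apply/funext => m; set d := (mdeg m).+1.
have tr u : forall m', (mdeg m' < d)%N ->
    mpoly.mcoeff m' (mpseries_trunc d u) = u m' by exact: mpseries_truncE.
by rewrite (mpseries_mulE (tr f) (tr g))// (mpseries_mulE (tr g) (tr f))// mulrC.
Qed.

Lemma mpseries_mul1 : left_id mpseries_one mpseries_mul.
Proof.
move=> f; apply/funext => m; set d := (mdeg m).+1.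
have tr u : forall m', (mdeg m' < d)%N ->
    mpoly.mcoeff m' (mpseries_trunc d u) = u m' by exact: mpseries_truncE.
have tr1 : forall m', (mdeg m' < d)%N ->
    mpoly.mcoeff m' (1 : mpoly.mpoly n k) = mpseries_one m'.
  by move=> m' _; rewrite mpoly.mcoeff1.
by rewrite (mpseries_mulE tr1 (tr f))// mul1r tr.
Qed.

Lemma mpseries_mulDl : left_distributive mpseries_mul +%R.
Proof.
move=> f g h; apply/funext => m.
rewrite [RHS]/= /mpseries_mul -[RHS]/(_ + _) -big_split/=.
by apply: eq_bigr => c _; rewrite -mulrDl.
Qed.

Lemma mpseries_one_neq0 : mpseries_one != 0.
Proof.
apply/eqP => /(congr1 (@^~ mpoly.mnm0)) /eqP.
by rewrite /mpseries_one eqxx oner_eq0.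
Qed.

HB.instance Definition _ := GRing.Zmodule_isComNzRing.Build mpseries
  mpseries_mulA mpseries_mulC mpseries_mul1 mpseries_mulDl mpseries_one_neq0.

Definition mpseriesX (i : 'I_n) : mpseries :=
  fun m => (m == mpoly.mnm1 i)%:R.

Lemma mpseries_mul_const (f g : mpseries) :
  (f * g) mpoly.mnm0 = f mpoly.mnm0 * g mpoly.mnm0.
Proof.
have tr u : forall m', (mdeg m' < 1)%N ->
    mpoly.mcoeff m' (mpseries_trunc 1 u) = u m' by exact: mpseries_truncE.
rewrite [LHS](mpseries_mulE (tr f) (tr g)) ?mpoly.mdeg0//.
by rewrite (rmorphM (mpoly.mcoeff _)) /= !tr ?mpoly.mdeg0.
Qed.

End PowerSeries.

Section Quadric.
Variables (k : fieldType) (d : nat).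

Definition sum_squares : mpseries d.+1 k :=
  \sum_(i < d.+1) mpseriesX k i ^+ 2.

Definition quadric_ideal : {pred mpseries d.+1 k} :=
  fun f => `[< ideal_gen [set sum_squares] f >].

Lemma quadric_ideal_closed : idealr_closed quadric_ideal.
Proof.
case: (span_submodule (N := (mpseries d.+1 k)^o) [set sum_squares])
  => I0 ID IZ.
split; first exact/asboolP.
  apply/negP => /asboolP /(_ [set f : mpseries d.+1 k | f mpoly.mnm0 = 0]).
  apply: contraPP => _ /(_ _)/= h; have : (1 : mpseries d.+1 k) mpoly.mnm0 = 0.
    apply: h; split.
      split=> [//|x y /= x0 y0|a x /= x0].
        by rewrite -[LHS]/(_ + _) x0 y0 addr0.
      by rewrite [LHS]mpseries_mul_const x0 mulr0.
    move=> _ -> /=; rewrite /sum_squares.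
    elim/big_ind : _ => [//|x y x0 y0|i _].
      by rewrite -[LHS]/(_ + _) x0 y0 addr0.
    by rewrite expr2 mpseries_mul_const /mpseriesX eq_sym mpoly.mnm1_eq0 mul0r.
  by move=> /eqP; rewrite -[X in X == _]/((_ == _)%:R) eqxx oner_eq0.
move=> a x y /asboolP sx /asboolP sy; apply/asboolP.
by apply: ID sy; exact: IZ.
Qed.

HB.instance Definition _ := isIdealr.Build (mpseries d.+1 k) quadric_ideal
  quadric_ideal_closed.

(* k[[x_0, ..., x_d]] / (x_0^2 + ... + x_d^2) *)
Definition quadric_ring : comNzRingType := {ideal_quot quadric_ideal}.

End Quadric.

Section SMultiplicity.
Variables (RR : realType) (p : nat) (s : RR).

Definition ceil_exp (e : nat) : nat := `|Num.ceil (s * (p ^ e)%:R)|%N.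

Definition h_mult (A : comNzRingType) (I J : set A) (N : lmodType A) : RR :=
  limn (fun e : nat =>
    (module_length (quotmod (ideal_smul N
       (ideal_add (ideal_exp I (ceil_exp e)) (frobenius_power J (p ^ e))))))%:R
    / (p ^ (e * krull_dim A))%:R : RR).

Definition H_norm (d : nat) : RR :=
  \sum_(0 <= i < (Num.truncn s).+1)
     (-1) ^+ i / d`!%:R * 'C(d, i)%:R * (s - i%:R) ^+ d.

Definition s_mult (A : comNzRingType) (I J : set A) (N : lmodType A) : RR :=
  h_mult I J N / H_norm (krull_dim A).

Definition s_mult_ideal (A : comNzRingType) (I : set A) : RR :=
  s_mult I I A^o.

Definition s_mult_ring (A : comNzRingType) : RR :=
  s_mult_ideal (get (@maximal_ideal A)).

End SMultiplicity.

Arguments s_mult_ring {RR} p s A.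

(* Main.v *)
(** Modulo a high power of [m], a coefficient field and lifts of a regular system of parameters of
    the regular ring [Q] present [R] as [k[x, y] / (F_1, .., F_c, H)] with [d + 1] variables [y];
    since [R] is not regular, [H] can be chosen without linear term. The family
    [x_i + t F_i, sum y_l ^ 2 + t H] degenerates to the quadric at [t = 0] and to [R] at
    [t = infinity]. Over [k[[y]][t] / (t ^ L)] it is trivial up to coordinates (Morse lemma, as
    [p > 2]), and counting lengths modulo [t ^ L] for all [L] yields that
    [m ^ a + m ^ [q]] has in the quadric at most the colength it has in [R], for all [a] and [q].
    The same colength in the idealization is that of its extension to the [R]-module [R + M], which
    projects onto [R]. It remains to divide by [p ^ (e d)] and let [e] tend to infinity: the limit
    on the side of the idealization exists because, over an F-finite ring with perfect residue
    field, lengths on a module and on its Frobenius push-forward are compared by ranks at the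
    minimal primes, up to lower order; power series over a perfect closure reduce to this case. *)

Require Import Defs.
From HB Require Import structures.
From mathcomp Require Import all_boot all_order all_algebra.
From mathcomp Require mpoly.
From mathcomp Require Import generic_quotient ring_quotient.
From mathcomp Require Import boolp classical_sets functions reals zify ring lra.
From mathcomp Require Import topology normedtype sequences.
Import Defs.

Set Implicit Arguments.
Unset Strict Implicit.
Unset Printing Implicit Defensive.

Import Order.TTheory GRing.Theory Num.Theory.
Import numFieldNormedType.Exports.
Import (canonicals, coercions) mpoly.

Local Open Scope classical_set_scope.
Local Open Scope ring_scope.

(** * Submodules and lengths *)

(** All lengths in play are lengths modulo a power of [m], and [R] is neither complete nor known to
    contain a coefficient field. Presentations are therefore maps that are homomorphisms only modulo
    [m ^ t], up to choice of representatives, and lengths are transported by matching lattices of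
    submodules. Lengths and dimensions are maxima over chains chosen by [get], so they are handled
    through explicit bounds; the dimension is converted into the order of growth of the length of
    [A / (J + m ^ N)], the form in which it meets the Frobenius estimates. The residue field may be
    imperfect: coefficient fields modulo [m ^ t] are lifted step by step with Zorn's lemma, the
    canonical lift of [p]-th powers being the starting point, and in the passage to the perfect
    closure [K] a [k]-linear retraction [K -> k] plays the role of faithful flatness. In the
    degeneration each new power of [t] costs at most the colength in [R], whereas the quadric
    contributes its own colength to every power; the bounded initial cost disappears as [L] grows.
    The final division is harmless because the quadric and the idealization both have dimension [d]
    and the normalizing constant is nonnegative. *)

Section SubmoduleCalculus.
Variables (A : comNzRingType) (N : lmodType A).
Implicit Types (U V W L : set N) (I : set A).

Lemma sub0 U : submodule U -> U 0. Proof. by case. Qed.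
Lemma subD U x y : submodule U -> U x -> U y -> U (x + y).
Proof. by move=> [_ h _]; exact: h. Qed.
Lemma subZ U a x : submodule U -> U x -> U (a *: x).
Proof. by move=> [_ _ h]; exact: h. Qed.
Lemma subN U x : submodule U -> U x -> U (- x).
Proof. by move=> hU Ux; rewrite -scaleN1r; exact: subZ. Qed.
Lemma subB U x y : submodule U -> U x -> U y -> U (x - y).
Proof. by move=> hU Ux Uy; apply: subD => //; exact: subN. Qed.
Lemma sub_sum U (J : Type) (r : seq J) (Q : pred J) (F : J -> N) :
  submodule U -> (forall j, Q j -> U (F j)) -> U (\sum_(j <- r | Q j) F j).
Proof.
move=> hU h; elim/big_rec : _ => [|j x Qj Ux]; first exact: sub0.
by apply: subD => //; exact: h.
Qed.

Lemma submoduleT : submodule [set: N]. Proof. by []. Qed.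
Lemma submodule_zero : submodule [set (0 : N)].
Proof. by split=> //= [x y -> ->|a x ->]; rewrite ?addr0 ?scaler0. Qed.
Lemma submoduleI U V : submodule U -> submodule V -> submodule (U `&` V).
Proof.
move=> hU hV; split; first by split; exact: sub0.
  by move=> x y [Ux Vx] [Uy Vy]; split; exact: subD.
by move=> a x [Ux Vx]; split; exact: subZ.
Qed.

Definition sadd U V : set N := [set x + y | x in U & y in V].

Lemma submodule_sadd U V : submodule U -> submodule V -> submodule (sadd U V).
Proof.
move=> hU hV; split; first by exists 0; [exact: sub0|exists 0; [exact: sub0|rewrite addr0]].
  move=> _ _ [x Ux [y Vy <-]] [x' Ux' [y' Vy' <-]].
  by exists (x + x'); [exact: subD|exists (y + y'); [exact: subD|rewrite addrACA]].
move=> a _ [x Ux [y Vy <-]].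
by exists (a *: x); [exact: subZ|exists (a *: y); [exact: subZ|rewrite scalerDr]].
Qed.

Lemma saddl U V : submodule V -> U `<=` sadd U V.
Proof. by move=> hV x Ux; exists x => //; exists 0; [exact: sub0|rewrite addr0]. Qed.
Lemma saddr U V : submodule U -> V `<=` sadd U V.
Proof. by move=> hV x Ux; exists 0; [exact: sub0|exists x => //; rewrite add0r]. Qed.
Lemma sadd_sub U V W : submodule W -> U `<=` W -> V `<=` W -> sadd U V `<=` W.
Proof. by move=> hW hU hV _ [x /hU Wx [y /hV Wy <-]]; exact: subD. Qed.
Lemma saddS U V U' V' : U `<=` U' -> V `<=` V' -> sadd U V `<=` sadd U' V'.
Proof. by move=> hU hV _ [x /hU Ux [y /hV Vy <-]]; exists x => //; exists y. Qed.
Lemma saddC U V : sadd U V = sadd V U.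
Proof.
by apply/seteqP; split=> _ [x Ux [y Vy <-]]; exists y => //; exists x => //; rewrite addrC.
Qed.
Lemma saddA U V W : sadd U (sadd V W) = sadd (sadd U V) W.
Proof.
apply/seteqP; split.
  move=> _ [x Ux [_ [y Vy [z Wz <-]] <-]].
  by exists (x + y); [exists x => //; exists y|exists z => //; rewrite addrA].
move=> _ [_ [x Ux [y Vy <-]] [z Wz <-]].
by exists x => //; exists (y + z); [exists y => //; exists z|rewrite addrA].
Qed.
Lemma sadd_idl U V : submodule U -> submodule V -> U `<=` V -> sadd U V = V.
Proof.
by move=> hU hV UV; apply/seteqP; split; [exact: sadd_sub|exact: saddr].
Qed.

Lemma span_sub (X W : set N) : submodule W -> X `<=` W -> span X `<=` W.
Proof. by move=> hW XW x; apply. Qed.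
Lemma sub_span (X : set N) : X `<=` span X.
Proof. by move=> x Xx W [_]; exact. Qed.
Lemma span_mono (X Y : set N) : X `<=` Y -> span X `<=` span Y.
Proof. by move=> XY; apply: span_sub; [exact: span_submodule|move=> x /XY; exact: sub_span]. Qed.
Lemma span_id U : submodule U -> span U = U.
Proof. by move=> hU; apply/seteqP; split; [exact: span_sub|exact: sub_span]. Qed.

Lemma span_seqP (s : seq N) x :
  span [set` s] x <-> exists c : nat -> A, x = \sum_(i < size s) c i *: s`_i.
Proof.
split; last first.
  move=> [c ->]; apply: sub_sum; first exact: span_submodule.
  move=> i _; apply: (subZ _ (span_submodule _)).
  by apply: sub_span; rewrite /= mem_nth.
move: x; apply: span_sub.
  split; first by exists (fun=> 0); rewrite big1 // => i _; rewrite scale0r.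
    move=> _ _ [c ->] [c' ->]; exists (fun i => c i + c' i).
    by rewrite -big_split; apply: eq_bigr => i _; rewrite scalerDl.
  move=> a _ [c ->]; exists (fun i => a * c i).
  by rewrite scaler_sumr; apply: eq_bigr => i _; rewrite scalerA.
move=> x /= xs; exists (fun i => (i == index x s)%:R).
have hi : (index x s < size s)%N by rewrite index_mem.
rewrite (bigD1 (Ordinal hi)) //= eqxx scale1r nth_index // big1 ?addr0 // => i.
by rewrite -val_eqE /= => /negPf ->; rewrite scale0r.
Qed.

Lemma span_cons g (s : seq N) :
  span [set` g :: s] = sadd (span [set g]) (span [set` s]).
Proof.
apply/seteqP; split.
  apply: span_sub; first by apply: submodule_sadd; exact: span_submodule.
  move=> x /=; rewrite inE => /orP[/eqP ->|xs].
    by apply: saddl; [exact: span_submodule|exact: sub_span].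
  by apply: saddr; [exact: span_submodule|exact: sub_span].
apply: sadd_sub; first exact: span_submodule.
  by apply: span_mono => x /= ->; rewrite mem_head.
by apply: span_mono => x /= xs; rewrite inE xs orbT.
Qed.

Lemma span1P (g x : N) : span [set g] x <-> exists a : A, x = a *: g.
Proof.
split; last by move=> [a ->]; apply: (subZ _ (span_submodule _)); exact: sub_span.
move: x; apply: span_sub; last by move=> _ ->; exists 1; rewrite scale1r.
split; first by exists 0; rewrite scale0r.
  by move=> _ _ [a ->] [b ->]; exists (a + b); rewrite scalerDl.
by move=> a _ [b ->]; exists (a * b); rewrite scalerA.
Qed.

Lemma span_nil : span [set` ([::] : seq N)] = [set 0].
Proof.
apply/seteqP; split; last by move=> _ ->; exact: sub0 (span_submodule _).
by apply: span_sub => //; exact: submodule_zero.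
Qed.

Definition smul I V : set N := span [set a *: x | a in I & x in V].

Lemma submodule_smul I V : submodule (smul I V).
Proof. exact: span_submodule. Qed.
Lemma smul_in I V a x : I a -> V x -> smul I V (a *: x).
Proof. by move=> Ia Vx; apply: sub_span; exists a => //; exists x. Qed.
Lemma smul_sub I V W : submodule W -> (forall a x, I a -> V x -> W (a *: x)) ->
  smul I V `<=` W.
Proof. by move=> hW h; apply: span_sub => // _ [a Ia [x Vx <-]]; exact: h. Qed.
Lemma smulS I I' V V' : I `<=` I' -> V `<=` V' -> smul I V `<=` smul I' V'.
Proof.
by move=> II' VV'; apply: smul_sub; [exact: submodule_smul|move=> a x /II' ? /VV' ?; exact: smul_in].
Qed.
Lemma smul_subr I V : submodule V -> smul I V `<=` V.
Proof. by move=> hV; apply: smul_sub => // a x _; exact: subZ. Qed.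
Lemma smul_setT V : submodule V -> smul [set: A] V = V.
Proof.
move=> hV; apply/seteqP; split; first exact: smul_subr.
by move=> x Vx; rewrite -(scale1r x); exact: smul_in.
Qed.
Lemma ideal_smulE I : ideal_smul N I = smul I [set: N]. Proof. by []. Qed.

Lemma smul_saddr I V W : submodule V -> submodule W ->
  smul I (sadd V W) = sadd (smul I V) (smul I W).
Proof.
move=> hV hW; apply/seteqP; split.
  apply: smul_sub; first by apply: submodule_sadd; exact: submodule_smul.
  move=> a _ Ia [x Vx [y Wy <-]]; rewrite scalerDr.
  by exists (a *: x); [exact: smul_in|exists (a *: y) => //; exact: smul_in].
apply: sadd_sub; first exact: submodule_smul.
  by apply: smulS => //; exact: saddl.
by apply: smulS => //; exact: saddr.
Qed.

End SubmoduleCalculus.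

Definition rscal (B A : comNzRingType) (f : {rmorphism B -> A}) (N : lmodType A) :
  Type := N.

Section Restriction.
Variables (B A : comNzRingType) (f : {rmorphism B -> A}) (N : lmodType A).
Local Notation rscal := (rscal f N).
HB.instance Definition _ := GRing.Zmodule.on rscal.
Definition rscal_scale (b : B) (x : rscal) : rscal := (f b *: (x : N)).
Lemma rscal_scaleA a b x : rscal_scale a (rscal_scale b x) = rscal_scale (a * b) x.
Proof. by rewrite /rscal_scale scalerA rmorphM. Qed.
Lemma rscal_scale1 : left_id 1 rscal_scale.
Proof. by move=> x; rewrite /rscal_scale rmorph1 scale1r. Qed.
Lemma rscal_scaleDr : right_distributive rscal_scale +%R.
Proof. by move=> a x y; rewrite /rscal_scale -scalerDr. Qed.
Lemma rscal_scaleDl x : {morph rscal_scale^~ x : a b / a + b}.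
Proof. by move=> a b; rewrite /rscal_scale rmorphD scalerDl. Qed.
HB.instance Definition _ := GRing.Zmodule_isLmodule.Build B rscal
  rscal_scaleA rscal_scale1 rscal_scaleDr rscal_scaleDl.
Lemma rscalE (b : B) (x : rscal) : b *: x = f b *: (x : N) :> N. Proof. by []. Qed.
Lemma rscal_submodule (U : set N) : submodule U -> @submodule B rscal U.
Proof. by case=> h0 hD hZ; split=> // b x; exact: hZ. Qed.
End Restriction.

Section Length.
Variables (A : comNzRingType) (N : lmodType A).
Implicit Types (U V W X Y : set N).

(** The ends of the chain are only enclosed by [U] and [V], which need not be submodules; chains
    thus survive an enlargement of the interval and can be concatenated or cut. *)
Definition chain U V n := exists L : nat -> set N,
  [/\ forall i, (i <= n)%N -> submodule (L i),
      forall i, (i < n)%N -> L i `<` L i.+1, U `<=` L 0%N & L n `<=` V].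

(** Most arguments work with the bounds [lenle] and [finlen], since [len] is chosen by [get] and is
    meaningful only once chains are bounded. *)
Definition lenle U V n := forall l, chain U V l -> (l <= n)%N.
Definition finlen U V := exists n, lenle U V n.
Definition len U V : nat := get [set n | chain U V n /\ lenle U V n].

Lemma chainS U V U' V' n : U' `<=` U -> V `<=` V' -> chain U V n -> chain U' V' n.
Proof.
by move=> h h' [L [a b c d]]; exists L; split=> //; [exact: subset_trans c|exact: subset_trans h'].
Qed.

Lemma chain0 U V : submodule U -> U `<=` V -> chain U V 0.
Proof. by move=> hU UV; exists (fun=> U); split. Qed.

Lemma chain_ext U X Y n : chain U X n -> submodule Y -> X `<` Y -> chain U Y n.+1.
Proof.
move=> [L [a b c d]] hY [XY nYX]; exists (fun i => if (i <= n)%N then L i else Y); split.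
- by move=> i _; case: ifP => // /a.
- move=> i; rewrite ltnS => hi; rewrite hi; case: ltnP => hi'; first exact: b.
  have -> : i = n by apply/eqP; rewrite eqn_leq hi hi'.
  split; first exact: subset_trans XY.
  by move=> YL; apply: nYX; exact: subset_trans d.
- by rewrite leq0n.
- by rewrite ltnn.
Qed.

Lemma chain_cat U V W a b : chain U V a -> chain V W b -> chain U W (a + b).
Proof.
move=> [L [La Lb Lc Ld]] [M [Ma Mb Mc Md]].
exists (fun i => if (i < a)%N then L i else M (i - a)%N); split.
- move=> i hi; case: ltnP => h; first by apply: La; exact: ltnW.
  by apply: Ma; rewrite leq_subLR.
- move=> i hi; case: (ltnP i a) => h.
    case: ltnP => h'; first exact: Lb.
    have e : i.+1 = a by apply/eqP; rewrite eqn_leq h h'.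
    rewrite -e subnn; have [] := Lb i h; rewrite e => l1 l2.
    have LM : L a `<=` M 0%N by apply: subset_trans Mc.
    by split; [exact: subset_trans LM|move=> ML; apply: l2; exact: subset_trans ML].
  rewrite ltnNge (leqW h) /= subSn //; apply: Mb.
  by rewrite ltn_subLR.
- case: ltnP => // h; move: h Ld; rewrite leqn0 => /eqP -> Ld.
  by rewrite subnn; apply: subset_trans (subset_trans Lc Ld) Mc.
- by rewrite ltnNge leq_addr /= addKn.
Qed.

(** If neither inclusion were strict, any [y] in [Y] would be [x + v] with [v = y - x] in [Y] and
    [V], hence in [X]. *)
Lemma modular_strict X Y V : submodule X -> submodule Y -> submodule V ->
  X `<` Y -> X `&` V `<` Y `&` V \/ sadd X V `<` sadd Y V.
Proof.
move=> hX hY hV [XY nYX]; apply: contrapT => /not_orP[n1 n2]; apply: nYX => y Yy.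
have h1 : Y `&` V `<=` X `&` V.
  by apply: contrapT => h; apply: n1; split=> //; exact: setSI.
have h2 : sadd Y V `<=` sadd X V.
  by apply: contrapT => h; apply: n2; split=> //; exact: saddS.
have [x Xx [v Vv e]] := h2 y (saddl hV Yy).
have : (Y `&` V) v by split=> //; rewrite -(addKr x v) e addrC; apply: subB => //; exact: XY.
by move=> /h1 [Xv _]; rewrite -e; exact: subD.
Qed.

(** Each strict step of the chain stays strict after intersecting with [V] or after adding [V]. This
    is what makes length additive. *)
Lemma chain_split U V W n : submodule U -> submodule V -> submodule W ->
  U `<=` V -> V `<=` W -> chain U W n ->
  exists a b, [/\ (n <= a + b)%N, chain U V a & chain V W b].
Proof.
move=> hU hV hW UV VW [L [La Lb Lc Ld]].
suff h i : (i <= n)%N -> exists a b,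
    [/\ (i <= a + b)%N, chain U (L i `&` V) a & chain V (sadd (L i) V) b].
  have [a [b [h1 h2 h3]]] := h n (leqnn n); exists a, b; split=> //.
    by apply: chainS h2 => //; exact: subIsetr.
  by apply: chainS h3 => //; exact: sadd_sub.
elim: i => [_|i IH hi].
  exists 0%N, 0%N; split=> //; first by apply: chain0 => //; rewrite subsetI.
  by apply: chain0 => //; apply: saddr; exact: La.
have [a [b [h1 h2 h3]]] := IH (ltnW hi).
have hLi := La i (ltnW hi); have hLi1 := La _ hi.
have [hs|hs] := modular_strict hLi hLi1 hV (Lb i hi).
  exists a.+1, b; split; first by rewrite addSn ltnS.
    by apply: chain_ext hs => //; exact: submoduleI.
  by apply: chainS h3 => //; apply: saddS => //; case: (Lb i hi).
exists a, b.+1; split; first by rewrite addnS ltnS.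
  by apply: chainS h2 => //; apply: setSI; case: (Lb i hi).
by apply: chain_ext hs => //; exact: submodule_sadd.
Qed.

Lemma lenP U V : submodule U -> U `<=` V -> finlen U V ->
  chain U V (len U V) /\ lenle U V (len U V).
Proof.
move=> hU UV [n]; elim: n => [|n IH] hn.
  by apply: (@getPex nat [set n | chain U V n /\ lenle U V n]); exists 0%N; split=> //; exact: chain0.
case: (pselect (chain U V n.+1)) => [c|nc].
  by apply: (@getPex nat [set n | chain U V n /\ lenle U V n]); exists n.+1.
apply: IH => l cl; move: (hn l cl); rewrite leq_eqVlt => /predU1P[e|//].
by case: nc; rewrite -e.
Qed.

Lemma lenle_len U V : submodule U -> U `<=` V -> finlen U V -> lenle U V (len U V).
Proof. by move=> h1 h2 h3; case: (lenP h1 h2 h3). Qed.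
Lemma chain_len U V : submodule U -> U `<=` V -> finlen U V -> chain U V (len U V).
Proof. by move=> h1 h2 h3; case: (lenP h1 h2 h3). Qed.
Lemma len_leq U V n : submodule U -> U `<=` V -> lenle U V n -> (len U V <= n)%N.
Proof. by move=> hU UV h; apply: (h); apply: chain_len => //; exists n. Qed.
Lemma leq_len U V n : submodule U -> U `<=` V -> finlen U V -> chain U V n -> (n <= len U V)%N.
Proof. by move=> hU UV h; exact: lenle_len. Qed.

Lemma lenle_cat U V W a b : submodule U -> submodule V -> submodule W ->
  U `<=` V -> V `<=` W -> lenle U V a -> lenle V W b -> lenle U W (a + b).
Proof.
move=> hU hV hW UV VW ha hb n /(chain_split hU hV hW UV VW)[a' [b' [h1 /ha h2 /hb h3]]].
by apply: leq_trans h1 _; exact: leq_add.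
Qed.
Lemma lenle_leq U V a b : (a <= b)%N -> lenle U V a -> lenle U V b.
Proof. by move=> ab h n /h na; exact: leq_trans ab. Qed.
Lemma lenleS U V U' V' n : U `<=` U' -> V' `<=` V -> lenle U V n -> lenle U' V' n.
Proof. by move=> h1 h2 h l c; apply: h; exact: chainS c. Qed.
Lemma finlenS U V U' V' : U `<=` U' -> V' `<=` V -> finlen U V -> finlen U' V'.
Proof. by move=> h1 h2 [n h]; exists n; exact: lenleS h. Qed.
Lemma finlen_cat U V W : submodule U -> submodule V -> submodule W ->
  U `<=` V -> V `<=` W -> finlen U V -> finlen V W -> finlen U W.
Proof. by move=> hU hV hW UV VW [a ha] [b hb]; exists (a + b)%N; exact: (lenle_cat hU hV hW UV VW ha hb). Qed.

Lemma lenD U V W : submodule U -> submodule V -> submodule W ->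
  U `<=` V -> V `<=` W -> finlen U W -> len U W = (len U V + len V W)%N.
Proof.
move=> hU hV hW UV VW f; have UW := subset_trans UV VW.
have fUV : finlen U V by exact: finlenS f.
have fVW : finlen V W by exact: finlenS f.
apply/eqP; rewrite eqn_leq; apply/andP; split.
  by apply: len_leq => //; apply: (lenle_cat hU hV hW UV VW); apply: lenle_len.
by apply: leq_len => //; apply: chain_cat; exact: chain_len.
Qed.

Lemma len_mono U V U' V' : submodule U -> submodule U' ->
  U `<=` U' -> U' `<=` V' -> V' `<=` V -> finlen U V -> (len U' V' <= len U V)%N.
Proof.
move=> hU hU' h1 h2 h3 f; apply: leq_len => //.
  exact: subset_trans (subset_trans h2 h3).
by apply: chainS (chain_len hU' h2 (finlenS h1 h3 f)).
Qed.

Lemma lenle0 U : lenle U U 0.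
Proof.
move=> [//|n] [L [La Lb Lc Ld]]; exfalso; have [_] := Lb 0%N (ltn0Sn n); apply.
apply: subset_trans Lc; apply: subset_trans Ld.
have h i : (i < n.+1)%N -> L 1%N `<=` L i.+1.
  elim: i => [_|i IH hi]; first exact: subset_refl.
  by apply: subset_trans (IH (ltnW hi)) _; case: (Lb _ hi).
exact: h.
Qed.
Lemma len0 U : submodule U -> len U U = 0%N.
Proof. by move=> hU; apply/eqP; rewrite -leqn0; apply: len_leq => //; exact: lenle0. Qed.

Lemma module_lengthE : module_length N = len [set 0] [set: N].
Proof.
rewrite /module_length /max_chain /len; congr get.
have e n : has_chain (@submodule A N) n <-> chain [set 0] [set: N] n.
  split=> [[L [a b]]|[L [a b _ _]]]; exists L; split=> //.
  by move=> _ ->; apply: sub0; exact: a.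
by apply/seteqP; split=> n /= [/e h1 h2]; split=> // l /e; exact: h2.
Qed.

End Length.

Section ChainTransfer.
Variables (A A' : comNzRingType) (N : lmodType A) (N' : lmodType A').
Implicit Types U V : set N.

(** A monotone map on submodules that reflects inclusions between comparable ones carries chains to
    chains. The comparisons of lengths along pullbacks, images and changes of scalars rest on it. *)
Lemma chain_transfer (Phi : set N' -> set N) U V (U' V' : set N') n :
  (forall L, submodule L -> U' `<=` L -> L `<=` V' ->
     [/\ submodule (Phi L), U `<=` Phi L & Phi L `<=` V]) ->
  (forall L1 L2, L1 `<=` L2 -> Phi L1 `<=` Phi L2) ->
  (forall L1 L2, submodule L1 -> submodule L2 -> U' `<=` L1 -> L1 `<=` L2 ->
     L2 `<=` V' -> Phi L2 `<=` Phi L1 -> L2 `<=` L1) ->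
  chain U' V' n -> chain U V n.
Proof.
move=> h1 h2 h3 [L [La Lb Lc Ld]].
have mono i j : (i <= j)%N -> (j <= n)%N -> L i `<=` L j.
  elim: j => [|j IH]; first by rewrite leqn0 => /eqP -> *; exact: subset_refl.
  rewrite leq_eqVlt => /predU1P[->|ij jn]; first by move=> *; exact: subset_refl.
  by apply: subset_trans (IH ij (ltnW jn)) _; case: (Lb _ jn).
have UL i : (i <= n)%N -> U' `<=` L i by move=> hi; apply: subset_trans (mono 0%N i _ hi).
have LV i : (i <= n)%N -> L i `<=` V' by move=> hi; apply: subset_trans Ld; exact: mono.
exists (Phi \o L); split=> /=.
- by move=> i hi; case: (h1 (L i) (La i hi) (UL i hi) (LV i hi)).
- move=> i hi; have [l1 l2] := Lb i hi; split; first exact: h2.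
  move=> hP; apply: l2; apply: h3 hP => //; [exact/La/ltnW|exact: La|exact/UL/ltnW|exact: LV].
- by case: (h1 (L 0%N) (La 0%N isT) (UL 0%N isT) (LV 0%N isT)).
- by case: (h1 (L n) (La n _) (UL n _) (LV n _)).
Qed.

(* [f] only has to be additive and to pull submodules back to submodules, so
   that it may be semilinear along an arbitrary change of scalars. *)
Lemma chain_pull (f : N -> N') U V (U' V' : set N') n :
  submodule V -> submodule V' -> {morph f : x y / x + y} ->
  (forall L, submodule L -> submodule (f @^-1` L)) ->
  (forall x, U x -> U' (f x)) -> U `<=` V ->
  (forall y, V' y -> exists2 x, V x & U' (y - f x)) ->
  chain U' V' n -> chain U V n.
Proof.
move=> hV hV' fD fs fU UV fV; apply: (@chain_transfer (fun L => f @^-1` L `&` V)).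
- move=> L hL UL LV; split; first by apply: submoduleI => //; exact: fs.
    by move=> x Ux; split; [exact/UL/fU|exact: UV].
  exact: subIsetr.
- by move=> L1 L2 h x [h1 h2]; split=> //; exact: h.
- move=> L1 L2 hL1 hL2 UL1 L12 L2V h y Ly.
  have [x Vx hx] := fV y (L2V y Ly).
  have L1x : L1 (y - f x) by exact: UL1.
  have L2x : L2 (f x).
    by rewrite -(subKr y (f x)); apply: subB => //; exact: L12.
  have [L1fx _] := h x (conj L2x Vx).
  by rewrite -(subrK (f x) y); exact: subD.
Qed.

Lemma lenle_pull (f : N -> N') U V (U' V' : set N') n :
  submodule V -> submodule V' -> {morph f : x y / x + y} ->
  (forall L, submodule L -> submodule (f @^-1` L)) ->
  (forall x, U x -> U' (f x)) -> U `<=` V ->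
  (forall y, V' y -> exists2 x, V x & U' (y - f x)) ->
  lenle U V n -> lenle U' V' n.
Proof. by move=> h1 h2 h3 h4 h5 h6 h7 h l c; apply: h; exact: chain_pull c. Qed.

End ChainTransfer.

Section ResidueLength.
Variables (B A : comNzRingType) (f : {rmorphism B -> A}) (m : set A) (N : lmodType A).
Hypothesis fm : forall a, exists b, m (a - f b).

(** Modulo [m] every scalar comes from [B], and [m] sends [L] into [U], which is part of [L]. *)
Lemma rscal_submodule_inv (L : set N) (U : set N) :
  U `<=` L -> (forall a x, m a -> L x -> U (a *: x)) ->
  @submodule B (rscal f N) L -> submodule L.
Proof.
move=> UL mL [L0 LD LZ]; split=> // a x Lx; have [b hb] := fm a.
rewrite -(subrK (f b) a) scalerDl; apply: LD; first exact/UL/mL.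
exact: (LZ b x Lx).
Qed.

Lemma chain_rscal (U V : set N) n : chain U V n -> @chain B (rscal f N) U V n.
Proof. by move=> [L [a b c d]]; exists L; split=> // i /a; exact: rscal_submodule. Qed.

Lemma chain_rscal_inv (U V : set N) n : (forall a x, m a -> V x -> U (a *: x)) ->
  @chain B (rscal f N) U V n -> chain U V n.
Proof.
move=> mV; apply: (@chain_transfer A B N (rscal f N) (fun L => L) U V U V n) => // L hL UL LV; split=> //.
by apply: rscal_submodule_inv UL _ hL => a x ma /LV; exact: mV.
Qed.

Lemma finlen_rscal_inv (U V : set N) : @finlen B (rscal f N) U V -> finlen U V.
Proof. by move=> [n h]; exists n => l /chain_rscal/h. Qed.

End ResidueLength.

Arguments ideal_exp : simpl never.

Section IdealCalculus.
Variable A : comNzRingType.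
Implicit Types (I J : set A) (m : set A).

Lemma idealMl I a x : ideal I -> I x -> I (a * x).
Proof. exact: (@subZ A A^o). Qed.
Lemma idealMr I a x : ideal I -> I x -> I (x * a).
Proof. by move=> hI Ix; rewrite mulrC; exact: idealMl. Qed.
Lemma ideal0 I : ideal I -> I 0. Proof. exact: (@sub0 A A^o). Qed.
Lemma idealD I x y : ideal I -> I x -> I y -> I (x + y).
Proof. exact: (@subD A A^o). Qed.
Lemma idealB I x y : ideal I -> I x -> I y -> I (x - y).
Proof. exact: (@subB A A^o). Qed.
Lemma ideal_sum I (J : Type) (r : seq J) (Q : pred J) (F : J -> A) :
  ideal I -> (forall j, Q j -> I (F j)) -> I (\sum_(j <- r | Q j) F j).
Proof. exact: (@sub_sum A A^o). Qed.
Lemma ideal_ofP I : I 0 -> (forall x y, I x -> I y -> I (x + y)) ->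
  (forall a x, I x -> I (a * x)) -> ideal I.
Proof. by move=> h0 hD hZ; split. Qed.
Lemma idealX I x n : ideal I -> I x -> (0 < n)%N -> I (x ^+ n).
Proof. by move=> hI Ix; case: n => // n _; rewrite exprS; exact: idealMr. Qed.
Lemma ideal_full I : ideal I -> I 1 -> I = [set: A].
Proof.
by move=> hI I1; apply/seteqP; split=> // x _; rewrite -(mulr1 x); exact: idealMl.
Qed.

Definition colon (N : lmodType A) (V : set N) (g : N) : set A := [set a | V (a *: g)].
Lemma ideal_colon (N : lmodType A) (V : set N) g : submodule V -> ideal (colon V g).
Proof.
move=> hV; apply: ideal_ofP => [|a b|a b]; rewrite /colon /= ?scale0r.
- exact: sub0.
- by rewrite scalerDl; exact: subD.
- by rewrite -scalerA; exact: subZ.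
Qed.

Lemma ideal_expS m n : ideal_exp m n.+1 = @smul A A^o m (ideal_exp m n).
Proof. by []. Qed.
Lemma ideal_ideal_exp m n : ideal (ideal_exp m n).
Proof. by case: n => [|n]; [exact: submoduleT|exact: submodule_smul]. Qed.
Lemma exp_mul m a b x y : ideal_exp m a x -> ideal_exp m b y -> ideal_exp m (a + b) (x * y).
Proof.
elim: a x y => [|a IH] x y.
  by move=> _ hy; apply: idealMl => //; exact: ideal_ideal_exp.
move=> hx hy; move: x hx; rewrite ideal_expS addSn.
apply: (@smul_sub A A^o m (ideal_exp m a)
  [set x | ideal_exp m (a + b).+1 (x * y)]) => /=.
  split=> [|x1 x2|c x1] /=; rewrite ?mul0r ?mulrDl.
  - exact: ideal0 (ideal_ideal_exp _ _).
  - exact: idealD (ideal_ideal_exp _ _).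
  - by rewrite -mulrA; exact: idealMl (ideal_ideal_exp _ _).
move=> u v mu hv; rewrite /= -mulrA ideal_expS.
by apply: (@smul_in A A^o) => //; exact: IH.
Qed.
Lemma exp1 m x : m x -> ideal_exp m 1 x.
Proof.
move=> mx; rewrite ideal_expS -(mulr1 x); exact: (@smul_in A A^o).
Qed.
Lemma exp1_sub m : ideal m -> ideal_exp m 1 = m.
Proof.
move=> hm; apply/seteqP; split; last by move=> x; exact: exp1.
by apply: (@smul_sub A A^o) => // a x ma _; exact: idealMr.
Qed.
Lemma exp_antitone m a b : (a <= b)%N -> ideal_exp m b `<=` ideal_exp m a.
Proof.
elim: b => [|b IH]; first by rewrite leqn0 => /eqP ->; exact: subset_refl.
rewrite leq_eqVlt => /predU1P[->|ab]; first exact: subset_refl.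
apply: subset_trans (IH ab); apply: (@smul_subr A A^o); exact: ideal_ideal_exp.
Qed.
Lemma exp_subr m n : ideal m -> (0 < n)%N -> ideal_exp m n `<=` m.
Proof. by move=> hm hn; rewrite -{2}(exp1_sub hm); exact: exp_antitone. Qed.
Lemma expX m x n : m x -> ideal_exp m n (x ^+ n).
Proof.
by move=> mx; elim: n => [//|n IH]; rewrite exprS ideal_expS; exact: (@smul_in A A^o).
Qed.

Section OnModule.
Variable N : lmodType A.
Lemma smul_mulA I J (V : set N) : submodule V ->
  smul (ideal_mul I J) V = smul I (smul J V).
Proof.
move=> hV; apply/seteqP; split.
  apply: smul_sub => [|a x aIJ Vx]; first exact: submodule_smul.
  move: a aIJ.
  apply: (@smul_sub A A^o I J [set a | smul I (smul J V) (a *: x)]).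
    exact: (ideal_colon x (submodule_smul I (smul J V))).
  move=> a b Ia Jb; rewrite /= -scalerA; apply: smul_in => //; exact: smul_in.
apply: smul_sub => [|a x Ia hx]; first exact: submodule_smul.
move: x hx; apply: (@smul_sub A N J V [set x | smul (ideal_mul I J) V (a *: x)]).
  split=> [|x y|b x] /=; rewrite ?scaler0 ?scalerDr.
  - exact: sub0 (submodule_smul _ _).
  - exact: subD (submodule_smul _ _).
  - by rewrite scalerA mulrC -scalerA; exact: subZ (submodule_smul _ _).
move=> b x Jb Vx; rewrite /= scalerA; apply: smul_in => //.
exact: (@smul_in A A^o).
Qed.
Lemma smul_expS m n (V : set N) : submodule V ->
  smul (ideal_exp m n.+1) V = smul m (smul (ideal_exp m n) V).
Proof. exact: smul_mulA. Qed.
Lemma smul_exp0 m (V : set N) : submodule V -> smul (ideal_exp m 0) V = V.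
Proof. exact: smul_setT. Qed.

Lemma smul_span_seqP I (s : seq N) x : ideal I ->
  smul I (span [set` s]) x <->
  exists2 c : nat -> A, (forall i, I (c i)) & x = \sum_(i < size s) c i *: s`_i.
Proof.
move=> hI; split; last first.
  move=> [c Ic ->]; apply: sub_sum; first exact: submodule_smul.
  by move=> i _; apply: smul_in => //; apply: sub_span; rewrite /= mem_nth.
move: x; apply: smul_sub.
  split; first by exists (fun=> 0) => [_|]; [exact: ideal0|rewrite big1 // => i _; rewrite scale0r].
    move=> _ _ [c Ic ->] [c' Ic' ->]; exists (fun i => c i + c' i) => [i|]; first exact: idealD.
    by rewrite -big_split; apply: eq_bigr => i _; rewrite scalerDl.
  move=> a _ [c Ic ->]; exists (fun i => a * c i) => [i|]; first exact: idealMl.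
  by rewrite scaler_sumr; apply: eq_bigr => i _; rewrite scalerA.
move=> a x Ia /span_seqP[c ->]; exists (fun i => a * c i) => [i|]; first exact: idealMr.
by rewrite scaler_sumr; apply: eq_bigr => i _; rewrite scalerA.
Qed.
End OnModule.

Lemma ideal_ideal_gen (X : set A) : ideal (ideal_gen X).
Proof. exact: span_submodule. Qed.
Lemma ideal_ideal_add I J : ideal I -> ideal J -> ideal (ideal_add I J).
Proof. exact: (@submodule_sadd A A^o). Qed.
Lemma ideal_addE I J : ideal_add I J = @sadd A A^o I J. Proof. by []. Qed.
Lemma ideal_gen_sub (X I : set A) : ideal I -> X `<=` I -> ideal_gen X `<=` I.
Proof. exact: (@span_sub A A^o). Qed.
Lemma sub_ideal_gen (X : set A) : X `<=` ideal_gen X.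
Proof. exact: (@sub_span A A^o). Qed.
Lemma ideal_gen_seqP (s : seq A) x :
  ideal_gen [set` s] x <-> exists c : nat -> A, x = \sum_(i < size s) c i * s`_i.
Proof. exact: (@span_seqP A A^o). Qed.
Lemma ideal_gen1P (g x : A) : ideal_gen [set g] x <-> exists a, x = a * g.
Proof. exact: (@span1P A A^o). Qed.
Lemma ideal_addlP I J : ideal J -> I `<=` ideal_add I J.
Proof. exact: (@saddl A A^o). Qed.
Lemma ideal_addrP I J : ideal I -> J `<=` ideal_add I J.
Proof. exact: (@saddr A A^o). Qed.
Lemma ideal_add_sub I J K : ideal K -> I `<=` K -> J `<=` K -> ideal_add I J `<=` K.
Proof. exact: (@sadd_sub A A^o). Qed.
Lemma ideal_addS I J I1 J1 : I `<=` I1 -> J `<=` J1 -> ideal_add I J `<=` ideal_add I1 J1.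
Proof. exact: (@saddS A A^o). Qed.

End IdealCalculus.

(** * Noetherian modules, primes over an ideal, Nakayama's lemma *)

Section Noetherian.
Variable A : comNzRingType.

Definition noethm (N : lmodType A) := forall L : set N, submodule L ->
  exists s : seq N, span [set` s] = L.

(** Without a maximal member above [L0], dependent choice yields a strictly increasing sequence; its
    union is finitely generated, hence contained in one of its terms. *)
Lemma noeth_max (N : lmodType A) (F : set (set N)) L0 : noethm N ->
  (forall L, F L -> submodule L) -> F L0 ->
  exists L, [/\ F L, L0 `<=` L & forall L', F L' -> L `<=` L' -> L' `<=` L].
Proof.
move=> hN Fs F0; apply: contrapT => hno.
have step (X : {L | F L /\ L0 `<=` L}) : {Y : {L | F L /\ L0 `<=` L} | sval X `<` sval Y}.
  apply: cid; case: X => L [FL L0L] /=; apply: contrapT => h; apply: hno.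
  exists L; split=> // L' FL' LL'; apply: contrapT => nL'; apply: h.
  by exists (exist _ L' (conj FL' (subset_trans L0L LL'))); split.
have [f [_ hf]] := dependent_choice step (exist _ L0 (conj F0 (@subset_refl _ L0))).
pose W := \bigcup_i sval (f i).
have mono i j : (i <= j)%N -> sval (f i) `<=` sval (f j).
  elim: j => [|j IH]; first by rewrite leqn0 => /eqP ->; exact: subset_refl.
  rewrite leq_eqVlt => /predU1P[->|ij]; first exact: subset_refl.
  by apply: subset_trans (IH ij) _; case: (hf j).
have sf i : submodule (sval (f i)) by case: (f i) => L /= [FL _]; exact: Fs.
have hW : submodule W.
  split; first by exists 0%N => //; exact: sub0.
    move=> x y [i _ xi] [j _ yj]; exists (maxn i j) => //.
    by apply: subD => //; [apply: mono xi; exact: leq_maxl|apply: mono yj; exact: leq_maxr].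
  by move=> a x [i _ xi]; exists i => //; exact: subZ.
have [s hs] := hN W hW.
have [n hn] : exists n, [set` s] `<=` sval (f n).
  have : [set` s] `<=` W by rewrite -hs; exact: sub_span.
  elim: s {hs} => [|x s IH] sW; first by exists 0%N.
  have [n hn] := IH (fun y ys => sW y (@mem_behead _ (x :: s) y ys)).
  have [k _ hk] := sW x (mem_head _ _).
  exists (maxn n k) => y /=; rewrite inE => /orP[/eqP ->|ys].
    by apply: mono hk; exact: leq_maxr.
  by apply: (mono n); [exact: leq_maxl|exact: hn].
have [_] := hf n; apply; apply: subset_trans (span_sub (sf n) hn).
by rewrite hs => x xn; exists n.+1.
Qed.

Hypothesis hA : noetherian A.

(** Induction on the generators: the ideal [I] of coefficients of [g] in elements of [L] is finitely
    generated, and lifts of its generators to [L], together with generators of the part of [L]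
    spanned by the other generators, span [L]. *)
Lemma noethm_span (N : lmodType A) (s : seq N) (L : set N) : submodule L ->
  L `<=` span [set` s] -> exists t : seq N, span [set` t] = L.
Proof.
elim: s L => [|g s IH] L hL Ls.
  exists [::]; rewrite span_nil; apply/seteqP; split; last by move=> x /Ls; rewrite span_nil.
  by move=> _ ->; exact: sub0.
pose I := [set a : A | exists2 y, span [set` s] y & L (a *: g + y)].
have hI : ideal I.
  apply: ideal_ofP.
  - by exists 0; [exact: sub0 (span_submodule _)|rewrite scale0r addr0; exact: sub0].
  - move=> a b [y sy Ly] [z sz Lz]; exists (y + z); first exact: subD (span_submodule _) _ _.
    by rewrite scalerDl addrACA; exact: subD.
  - move=> b a [y sy Ly]; exists (b *: y); first exact: subZ (span_submodule _) _.
    by rewrite -scalerA -scalerDr; exact: subZ.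
have [r hr] := hA hI.
have hs : @submodule A N (span [set` s]) by exact: span_submodule.
have [t ht] := IH (L `&` span [set` s]) (submoduleI hL hs) (@subIsetr _ _ _).
have : forall a, {l | I a -> L l /\ span [set` s] (l - a *: g)}.
  move=> a; apply: cid; case: (pselect (I a)) => [[y sy Ly]|nI]; last by exists 0.
  by exists (a *: g + y) => _; split=> //; rewrite addrAC subrr add0r.
move=> /all_sig[c hc]; exists ([seq c a | a <- r] ++ t).
have rI a : a \in r -> I a by move=> ar; rewrite -hr; exact: sub_ideal_gen.
apply/seteqP; split.
  apply: span_sub => // x /=; rewrite mem_cat => /orP[/mapP[a /rI/hc[? _] -> //]|xt].
  by have: (L `&` span [set` s]) x by [rewrite -ht; exact: sub_span]; case.
set T := span _; have hT : submodule T by exact: span_submodule.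
have tT : L `&` span [set` s] `<=` T.
  by rewrite -ht; apply: span_mono => x /= xt; rewrite mem_cat xt orbT.
move=> x Lx; have := Ls x Lx; rewrite span_cons => -[_ /span1P[a ->] [y sy exy]].
have Ia : I a by exists y => //; rewrite exy.
suff [l Tl hl] : exists2 l, T l & L l /\ span [set` s] (l - a *: g).
  rewrite -(subrK l x); apply: (subD hT) => //; apply: tT; split; first by apply: subB => //; case: hl.
  have -> : x - l = y - (l - a *: g) by rewrite -exy opprB addrA [a *: g + y]addrC.
  by apply: (subB hs) => //; case: hl.
move: Ia; rewrite -hr => /ideal_gen_seqP[d ->].
exists (\sum_(i < size r) d i *: c r`_i).
  apply: (sub_sum _ hT) => i _; apply: (subZ _ hT); apply: sub_span => /=.
  by rewrite mem_cat map_f // mem_nth.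
split.
  by apply: sub_sum => // i _; apply: subZ => //; case: (hc r`_i (rI _ (mem_nth _ (ltn_ord i)))).
rewrite scaler_suml -sumrB; apply: sub_sum => // i _.
rewrite -scalerA -scalerBr; apply: (subZ _ hs).
by case: (hc r`_i (rI _ (mem_nth _ (ltn_ord i)))).
Qed.

Lemma noethm_fg (N : lmodType A) : finitely_generated N -> noethm N.
Proof. by move=> [s hs] L hL; apply: (@noethm_span _ s) => //; rewrite hs. Qed.

Lemma ideal_max (F : set (set A)) I0 : (forall I, F I -> ideal I) -> F I0 ->
  exists I, [/\ F I, I0 `<=` I & forall J, F J -> I `<=` J -> J `<=` I].
Proof. exact: (@noeth_max A^o). Qed.

Lemma ideal_ind (Phi : set A -> Prop) :
  (forall I, ideal I ->
    (forall J, ideal J -> I `<` J -> Phi J) -> Phi I) ->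
  forall I, ideal I -> Phi I.
Proof.
move=> h I hI; apply: contrapT => nI.
have [J [[hJ nJ] _ Jmax]] :=
  @ideal_max [set I | ideal I /\ ~ Phi I] I (fun I h => proj1 h) (conj hI nI).
apply: nJ; apply: h => // K hK [JK nKJ]; apply: contrapT => nK; apply: nKJ.
exact: Jmax.
Qed.

Lemma prime_or_split (I : set A) : ideal I ->
  [\/ I 1, prime_ideal I | exists a b, [/\ I (a * b), ~ I a & ~ I b]].
Proof.
move=> hI; case: (pselect (I 1)) => I1; first by constructor 1.
case: (pselect (exists a b, [/\ I (a * b), ~ I a & ~ I b])) => h; first by constructor 3.
constructor 2; split=> // a b Iab; apply: contrapT => /not_orP[na nb].
by apply: h; exists a, b.
Qed.

(** A colon [V : g] that is maximal among those with [g] outside [V] is an associated prime of the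
    quotient by [V]. *)
Lemma exists_prime_colon (N : lmodType A) (V : set N) : submodule V ->
  V <> [set: N] -> exists2 g, ~ V g & prime_ideal (colon V g).
Proof.
move=> hV nV; have [g0 Vg0] : exists g, ~ V g.
  by apply: contrapT => /forallNP h; apply: nV; apply/seteqP; split=> // x _; apply: contrapT; exact: h.
have [I [[g Vg eI] _ Imax]] := @ideal_max [set I | exists2 g, ~ V g & I = colon V g]
   (colon V g0) (fun I h => match h with ex_intro2 g _ e => eq_ind_r _ (ideal_colon g hV) e end)
   (ex_intro2 _ _ g0 Vg0 erefl).
exists g => //; split; first exact: ideal_colon.
  by rewrite /colon /= scale1r.
move=> a b /= hab; apply: contrapT => /not_orP[na nb]; apply: na.
have Ib : I `<=` colon V (b *: g).
  rewrite eI => c hc; rewrite /colon /= scalerA mulrC -scalerA; exact: subZ.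
have := Imax (colon V (b *: g)) (ex_intro2 _ _ (b *: g) nb erefl) Ib a.
by rewrite eI; apply; rewrite /colon /= scalerA.
Qed.

(** Noetherian induction: if [a * b] lies in [I], the primes for [I + (a)] and those for [I + (b)]
    together serve for [I]. A list of minimal length is irredundant, which yields elements lying in
    all the primes but one. *)
Lemma radical_primes (I : set A) : ideal I -> exists (t : nat) (P : nat -> set A),
  [/\ forall i, (i < t)%N -> prime_ideal (P i) /\ I `<=` P i,
      exists n, forall z, (forall i, (i < t)%N -> P i z) -> I (z ^+ n)
    & forall i, (i < t)%N -> exists c, ~ P i c /\ forall j, (j < t)%N -> j != i -> P j c].
Proof.
move=> hI.
pose good t := exists P : nat -> set A,
  (forall i, (i < t)%N -> prime_ideal (P i) /\ I `<=` P i) /\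
  exists n, forall z, (forall i, (i < t)%N -> P i z) -> I (z ^+ n).
have : exists t, `[< good t >].
  suff [t ht] : exists t, good t by exists t; apply/asboolP.
  rewrite /good => {good}; move: I hI; apply: ideal_ind => I hI IH.
  case: (prime_or_split hI) => [I1|pI|[a [b [Iab na nb]]]].
  - by exists 0%N, (fun=> setT); split=> //; exists 0%N => z _; rewrite expr0.
  - exists 1%N, (fun=> I); split=> //; first by move=> i _; split=> //; exact: subset_refl.
    by exists 1%N => z h; rewrite expr1; exact: (h 0%N).
  have lt c : ~ I c -> I `<` ideal_add I (ideal_gen [set c]).
    move=> nc; split; first exact: ideal_addlP (ideal_ideal_gen _).
    move=> h; apply: nc; apply: h; apply: ideal_addrP => //; exact: sub_ideal_gen.
  have idg c : ideal (ideal_add I (ideal_gen [set c])).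
    by apply: ideal_ideal_add => //; exact: ideal_ideal_gen.
  have [t [P [hP [n hn]]]] := IH _ (idg a) (lt a na).
  have [u [Q [hQ [k hk]]]] := IH _ (idg b) (lt b nb).
  have sub c : I `<=` ideal_add I (ideal_gen [set c]) by case: (idg c) (ideal_addlP (I := I) (ideal_ideal_gen [set c])).
  exists (t + u)%N, (fun i => if (i < t)%N then P i else Q (i - t)%N); split.
    move=> i hi; case: ltnP => h.
      by have [p1 p2] := hP i h; split=> //; exact: subset_trans p2.
    have hi' : (i - t < u)%N by rewrite ltn_subLR.
    by have [p1 p2] := hQ _ hi'; split=> //; exact: subset_trans p2.
  exists (n + k)%N => z hz; rewrite exprD.
  have [i1 I1 [_ /ideal_gen1P[r ->] <-]] : ideal_add I (ideal_gen [set a]) (z ^+ n).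
    by apply: hn => i hi; have := hz i (leq_trans hi (leq_addr _ _)); rewrite hi.
  have [i2 I2 [_ /ideal_gen1P[s ->] <-]] : ideal_add I (ideal_gen [set b]) (z ^+ k).
    apply: hk => i hi; have := hz (t + i)%N; rewrite ltn_add2l => /(_ hi).
    by rewrite ltnNge leq_addr /= addKn.
  rewrite mulrDl; apply: idealD => //; first exact: idealMr.
  rewrite mulrDr; apply: idealD => //; first exact: idealMl.
  by rewrite mulrACA; exact: idealMl.
move=> ex; case: (ex_minnP ex) => t /asboolP[P [hP [n hn]]] tmin.
exists t, P; split=> //; first by exists n.
move=> i it; apply: contrapT => /forallNP hno.
case: t hP hn tmin it hno => // t hP hn tmin it hno.
(* If no such element existed, [P i] could be dropped from the list; [bump i] enumerates the
   remaining indices. *)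
suff /asboolP/tmin : good t by rewrite ltnn.
exists (fun j => P (bump i j)); have bt j : (j < t)%N -> (bump i j < t.+1)%N.
  by move=> jt; rewrite /bump; case: (i <= j)%N; rewrite ?add1n ?add0n ?ltnS //; exact: ltnW.
split; first by move=> j /bt; exact: hP.
exists n => z hz; apply: hn => j jt.
have [->|ji] := eqVneq j i.
  apply: contrapT => nPi; apply: (hno z); split=> // l lt li.
  have := hz (unbump i l); rewrite unbumpK ?inE //; apply.
  by rewrite /unbump; case: ltnP; lia.
have := hz (unbump i j); rewrite unbumpK ?inE //; apply.
by rewrite /unbump; case: ltnP; lia.
Qed.

End Noetherian.

Section Local.
Variables (A : comNzRingType) (m : set A).
Hypothesis hm : noetherian_local m.

Lemma local_noeth : noetherian A. Proof. by case: hm. Qed.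
Lemma local_ideal : ideal m. Proof. by case: hm => _ [] . Qed.
Lemma local_n1 : ~ m 1. Proof. by case: hm => _ []. Qed.

Lemma local_max (I : set A) : ideal I -> ~ I 1 -> I `<=` m.
Proof.
move=> hI nI; have [J [[hJ nJ] IJ Jmax]] := @ideal_max _ local_noeth
  [set J | ideal J /\ ~ J 1] I (fun J h => proj1 h) (conj hI nI).
case: hm => _ _ /(_ J) <- //; split=> // K hK nK JK; apply/seteqP; split=> //.
exact: Jmax.
Qed.

Lemma local_unit a : ~ m a -> exists b, b * a = 1.
Proof.
move=> na; apply: contrapT => h; apply: na.
apply: (local_max (ideal_ideal_gen [set a])); last exact: sub_ideal_gen.
by move=> /ideal_gen1P[b e]; apply: h; exists b.
Qed.

Lemma local_prime : prime_ideal m.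
Proof.
split; [exact: local_ideal|exact: local_n1|move=> a b mab].
apply: contrapT => /not_orP[/local_unit[u hu] nb]; apply: nb.
by rewrite -(mul1r b) -hu -mulrA; apply: idealMl => //; exact: local_ideal.
Qed.

(** The form relative to a submodule [U]. Generators are eliminated one at a time: the coefficient
    [a] of [g] on the right-hand side lies in [m], and [1 - a] is invertible. *)
Lemma nakayama (N : lmodType A) (U : set N) (s : seq N) : submodule U ->
  span [set` s] `<=` sadd U (smul m (span [set` s])) -> span [set` s] `<=` U.
Proof.
move=> hU; elim: s => [|g s IH]; first by rewrite span_nil => _ _ ->; exact: sub0.
have hs : @submodule A N (span [set` s]) by exact: span_submodule.
have hg : @submodule A N (span [set g]) by exact: span_submodule.
rewrite span_cons smul_saddr // => h.
have gU : sadd U (span [set` s]) g.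
  have [u Uu [_ [x hx [y hy <-]] e]] := h g (saddl hs (sub_span (erefl g))).
  have [a ma ex] : exists2 a, m a & x = a *: g.
    move: x hx {e}; apply: smul_sub.
      split; first by exists 0; [exact: ideal0 local_ideal|rewrite scale0r].
        move=> _ _ [a ma ->] [b mb ->]; exists (a + b); last by rewrite scalerDl.
        exact: idealD local_ideal ma mb.
      move=> c _ [a ma ->]; exists (c * a); last by rewrite scalerA.
      exact: idealMl local_ideal ma.
    move=> a _ ma /span1P[b ->]; exists (a * b); last by rewrite scalerA.
    exact: idealMr local_ideal ma.
  have [|b hb] := @local_unit (1 - a).
    move=> h1; apply: local_n1; rewrite -(subrK a 1); exact: idealD local_ideal h1 ma.
  rewrite -(scale1r g) -hb -scalerA; apply: subZ; first exact: submodule_sadd.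
  exists u => //; exists y; first exact: smul_subr hy.
  by rewrite scalerBl scale1r -ex -{1}e [x + y]addrC addrA addrK.
have mg : smul m (span [set g]) `<=` sadd U (smul m (span [set` s])).
  have hW : submodule (sadd U (smul m (span [set` s]))).
    by apply: submodule_sadd => //; exact: submodule_smul.
  apply: smul_sub => // a _ ma /span1P[b ->]; rewrite scalerA mulrC -scalerA.
  apply: subZ => //; have [u Uu [y sy <-]] := gU; rewrite scalerDr.
  by exists (a *: u); [exact: subZ|exists (a *: y) => //; exact: smul_in].
have sU : span [set` s] `<=` U.
  apply: IH => x sx; have := h x (saddr hg sx).
  have hW : submodule (sadd U (smul m (span [set` s]))).
    by apply: submodule_sadd => //; exact: submodule_smul.
  apply: sadd_sub => //; first by apply: saddl; exact: submodule_smul.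
  by apply: sadd_sub => //; exact: saddr.
apply: sadd_sub => //; apply: span_sub => // _ ->.
by have [u Uu [y /sU Uy <-]] := gU; exact: subD.
Qed.

End Local.

(** * Growth of Hilbert functions and dimension *)

Section HilbertBasis.
Variable A : comNzRingType.
Hypothesis hA : noetherian A.

(** [Ln n] is the ideal of coefficients of degree [n] of the members of [U] of degree at most [n].
    These ideals increase with [n] and are constant from [n0] on. *)
Lemma hilbert_basis : noetherian {poly A}.
Proof.
move=> U hU.
pose Ln n : set A := [set a | exists2 f : {poly A}, U f & (size f <= n.+1)%N /\ f`_n = a].
have idLn n : ideal (Ln n).
  apply: ideal_ofP => [|a b|c a].
  - by exists 0; [exact: ideal0|rewrite size_poly0 coef0].
  - move=> [f Uf [sf <-]] [g Ug [sg <-]]; exists (f + g); first exact: idealD.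
    by rewrite coefD; split=> //; apply: leq_trans (size_polyD _ _) _; rewrite geq_max sf.
  - move=> [f Uf [sf <-]]; exists (c%:P * f); first exact: idealMl.
    by rewrite coefCM mul_polyC; split=> //; apply: leq_trans (size_scale_leq _ _) _.
have Lmono n k : (n <= k)%N -> Ln n `<=` Ln k.
  move=> nk a [f Uf [/leq_sizeP sf <-]]; exists (f * 'X^(k - n)); first exact: idealMr.
  rewrite coefMXn ltnNge leq_subr /= subKn //; split=> //.
  apply/leq_sizeP => j hj; rewrite coefMXn; case: ltnP => // h; apply: sf; lia.
have [_ [[n0 ->] _ max0]] := ideal_max hA (F := [set I | exists n, I = Ln n])
  (fun I h => match h with ex_intro n e => eq_ind_r _ (idLn n) e end) (ex_intro _ 0%N erefl).
have Ln0 n : (n0 <= n)%N -> Ln n `<=` Ln n0.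
  by move=> h; apply: max0; [exists n|exact: Lmono].
have : forall na : nat * A, {f | Ln na.1 na.2 -> [/\ U f, (size f <= na.1.+1)%N & f`_na.1 = na.2]}.
  move=> [n a]; apply: cid; case: (pselect (Ln n a)) => [[f Uf [s e]]|h]; last by exists 0.
  by exists f.
move=> /all_sig[h hh].
have : forall n, {s : seq A | ideal_gen [set` s] = Ln n} by move=> n; apply: cid; exact: hA.
move=> /all_sig[s hs].
pose G := flatten [seq [seq h (n, a) | a <- s n] | n <- iota 0 n0.+1].
exists G; have hG : ideal (ideal_gen [set` G]) by exact: ideal_ideal_gen.
have sL n a : a \in s n -> Ln n a by move=> as_; rewrite -hs; exact: sub_ideal_gen.
apply/seteqP; split.
  apply: ideal_gen_sub => // f /= /flattenP[_ /mapP[n _ ->] /mapP[a /sL aL ->]].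
  by case: (hh (n, a) aL).
suff H k (f : {poly A}) : (size f <= k)%N -> U f -> ideal_gen [set` G] f.
  by move=> f; exact: H (leqnn _).
elim: k f => [|k IH] f; first by rewrite leqn0 size_poly_eq0 => /eqP -> _; exact: ideal0.
(* Beyond degree [n0] the generators of degree [n0], shifted by ['X^(k - n)], produce all leading
   coefficients. *)
move=> sf Uf; pose n := minn k n0.
have nk : (n <= k)%N by exact: geq_minl.
have : Ln n f`_k.
  have : Ln k f`_k by exists f.
  rewrite /n; case: (leqP k n0) => // h'; apply: Ln0; exact: ltnW.
rewrite -hs => /ideal_gen_seqP[c ec].
pose g := \sum_(i < size (s n)) (c i)%:P * 'X^(k - n) * h (n, (s n)`_i).
have hi (i : 'I_(size (s n))) : let f' := h (n, nth 0 (s n) i) in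
    [/\ U f', (size f' <= n.+1)%N & f'`_n = nth 0 (s n) i].
  by apply: (hh (n, _)); apply: sL; rewrite mem_nth.
have Gg : ideal_gen [set` G] g.
  apply: ideal_sum => // i _; apply: (idealMl _ hG); apply: sub_ideal_gen => /=.
  apply/flattenP; exists [seq h (n, a) | a <- s n]; last by apply/mapP; exists (nth 0 (s n) i) => //; rewrite mem_nth.
  by apply/mapP; exists n => //; rewrite mem_iota add0n ltnS geq_minr.
have Ug : U g by apply: ideal_sum => // i _; apply: idealMl => //; case: (hi i).
have cg j : (k <= j)%N -> g`_j = if j == k then f`_k else 0.
  move=> kj; rewrite coef_sum.
  have -> : (if j == k then f`_k else 0) = \sum_(i < size (s n)) c i * (if j == k then (s n)`_i else 0).
    case: eqVneq => _; first by rewrite ec.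
    by rewrite big1 // => i _; rewrite mulr0.
  apply: eq_bigr => i _; rewrite -mulrA coefCM mulrC -commr_polyXn coefMXn mulrC; congr (_ * _).
  rewrite ltnNge (leq_trans (leq_subr _ _) kj) /=; have [_ /leq_sizeP sz e] := hi i.
  case: eqVneq => [->|jk]; first by rewrite subKn.
  by apply: sz; move: jk kj; lia.
rewrite -(subrK g f); apply: (idealD hG) => //; apply: IH; last exact: (idealB hU).
apply/leq_sizeP => j kj; rewrite coefB cg //; case: eqVneq => [->|jk]; first by rewrite subrr.
by rewrite subr0; move/leq_sizeP: sf; apply; move: jk kj; lia.
Qed.

End HilbertBasis.

(** The Rees algebra [B[s X]] inside [{poly A}] appears as the image of a Noetherian ring [T], an
    iterated polynomial ring over [B], instead of being built as a subring. It serves for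
    Artin-Rees, with [B = A], and for power series, with [B] the field of coefficients. *)
Lemma rees_algebra (B A : comNzRingType) (iota : {rmorphism B -> A}) (m : set A) (s : seq A) :
  noetherian B -> ideal m -> (forall x, x \in s -> m x) ->
  exists (T : comNzRingType) (f : {rmorphism T -> {poly A}}),
  [/\ noetherian T, forall b, exists t, f t = (iota b)%:P,
      forall x, x \in s -> exists t, f t = x *: 'X
    & forall t i, ideal_exp m i (f t)`_i].
Proof.
move=> hB hm; elim: s => [|x s IH] sm.
  exists B, (polyC \o iota); split=> // [b|t [|i]]; first by exists b.
    by [].
  by rewrite /= coefC; exact: ideal0 (ideal_ideal_exp _ _).
have [|T [f [hT fB fs fm]]] := IH; first by move=> y ys; apply: sm; rewrite inE ys orbT.
exists {poly T}, (horner_eval (x *: 'X) \o map_poly f).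
have hC t : (horner_eval (x *: 'X : {poly A}) \o map_poly f) t%:P = f t.
  by rewrite /= map_polyC /= /horner_eval hornerC.
split; first exact: hilbert_basis.
- by move=> b; have [t e] := fB b; exists t%:P; exact: etrans (hC t) e.
- move=> y; rewrite inE => /orP[/eqP ->|/fs[t e]]; last by exists t%:P; exact: etrans (hC t) e.
  by exists 'X; rewrite /= map_polyX /horner_eval hornerX.
- move=> q i; rewrite /= /horner_eval horner_coef coef_sum.
  apply: ideal_sum; first exact: ideal_ideal_exp.
  move=> j _; rewrite exprZn -scalerAr coefZ coefMXn coef_map.
  case: ltnP => h; first by rewrite mulr0; exact: ideal0 (ideal_ideal_exp _ _).
  rewrite -{1}(subnKC h); apply: exp_mul; last exact: fm.
  by apply: expX; apply: sm; rewrite mem_head.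
Qed.

Section ArtinRees.
Variables (A : comNzRingType) (m U : set A).
Hypotheses (hA : noetherian A) (hm : ideal m) (hU : ideal U).

(** For [y] in [U] and in [m ^ (c + n)], the monomial [y X ^ (c + n)] comes from the ideal [Id] of
    elements with all coefficients in [U]. As [c] bounds the degrees of finitely many generators of
    [Id], their multipliers contribute degree at least [n]. *)
Lemma artin_rees : exists c, forall n y, U y -> ideal_exp m (c + n) y ->
  @smul A A^o (ideal_exp m n) U y.
Proof.
have [s hs] := hA hm.
have [|T [f [hT fC fX fm]]] := @rees_algebra A A idfun m s hA hm.
  by move=> x xs; rewrite -hs; exact: sub_ideal_gen.
pose R n : set A := [set y | exists t, f t = y *: 'X^n].
have idR n : ideal (R n).
  apply: ideal_ofP => [|y z [t et] [u eu]|a y [t et]].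
  - by exists 0; rewrite rmorph0 scale0r.
  - by exists (t + u); rewrite rmorphD et eu scalerDl.
  - by have [u eu] := fC a; exists (u * t); rewrite rmorphM eu et mul_polyC scalerA.
have mR : m `<=` R 1%N.
  by rewrite -hs; apply: ideal_gen_sub => // x /fX[t et]; exists t; rewrite et expr1.
have expR n : ideal_exp m n `<=` R n.
  elim: n => [|n IH]; first by move=> a _; have [t et] := fC a; exists t; rewrite et expr0 alg_polyC.
  rewrite ideal_expS; apply: (@smul_sub A A^o); first exact: (idR n.+1).
  move=> a y /mR[t et] /IH[u eu].
  exists (t * u); rewrite rmorphM et eu -scalerAl -scalerAr scalerA expr1.
  by rewrite exprS.
pose Id : set T := [set t | forall j, U (f t)`_j].
have hId : ideal Id.
  apply: ideal_ofP => [j|t u ht hu j|t u hu j].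
  - by rewrite rmorph0 coef0; exact: ideal0.
  - by rewrite rmorphD coefD; exact: idealD.
  - rewrite rmorphM coefM; apply: ideal_sum => // i _; exact: idealMl.
have [gs hgs] := hT _ hId.
exists (\max_(g <- gs) size (f g)) => n y Uy.
set c := \max_(g <- gs) size (f g) => /expR[t et].
have : Id t.
  move=> j; rewrite et coefZ coefXn; case: eqP => _; rewrite ?mulr1 //.
  by rewrite mulr0; exact: ideal0.
rewrite -hgs => /ideal_gen_seqP[a ea].
have -> : y = (f t)`_(c + n) by rewrite et coefZ coefXn eqxx mulr1.
rewrite ea rmorph_sum coef_sum.
apply: (@sub_sum A A^o _ _ _ _ _ (submodule_smul _ _)) => i _.
rewrite rmorphM coefMr.
apply: (@sub_sum A A^o _ _ _ _ _ (submodule_smul _ _)) => j _.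
have gi : gs`_i \in gs by rewrite mem_nth.
case: (ltnP j (size (f gs`_i))) => h; last first.
  by rewrite [(f gs`_i)`_j]nth_default // mulr0; exact: sub0 (submodule_smul _ _).
have jc : (j <= c)%N by apply: leq_trans (ltnW h) _; exact: (@leq_bigmax_seq _ _ xpredT (fun g => size (f g)) _ gi).
apply: (@smul_in A A^o).
  by apply: (@exp_antitone _ _ n (c + n - j)); [lia|exact: fm].
have : Id gs`_i by rewrite -hgs; exact: sub_ideal_gen.
exact.
Qed.

End ArtinRees.

Section LengthBounds.
Variables (A : comNzRingType) (m : set A).
Hypothesis hm : noetherian_local m.

Lemma lenle_residue : @lenle A A^o m [set: A] 1.
Proof.
move=> [|[|n]] // [L [La Lb Lc Ld]].
have [l01 n01] := Lb 0%N isT; have [l12 n12] := Lb 1%N isT.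
exfalso; apply: n12 => x _; apply: contrapT => nx; apply: n01.
apply: subset_trans Lc; apply: (local_max hm); first exact: (La 1%N).
by move=> h1; apply: nx; rewrite (ideal_full (La 1%N isT) h1).
Qed.

Section FG.
Variable N : lmodType A.
Implicit Types (U V : set N) (I : set A) (s : seq N).

Lemma lenle_cyc U g I n : submodule U -> ideal I -> (forall a, I a -> U (a *: g)) ->
  @lenle A A^o I [set: A] n -> lenle U (sadd U (span [set g])) n.
Proof.
move=> hU hI Ig; have hg : @submodule A N (span [set g]) by exact: span_submodule.
apply: (@lenle_pull A A A^o N (fun a => a *: g)) => //.
- exact: submodule_sadd.
- by move=> a b; exact: scalerDl.
- by move=> L hL; exact: (ideal_colon g hL).
- by move=> y [u Uu [_ /span1P[a ->] <-]]; exists a => //; rewrite addrK.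
Qed.

Lemma lenle_fg U s I n : submodule U -> ideal I -> (forall a g, I a -> g \in s -> U (a *: g)) ->
  @lenle A A^o I [set: A] n -> lenle U (sadd U (span [set` s])) (size s * n).
Proof.
move=> hU hI hIs hn; elim: s hIs => [|g s IH] hIs.
  have -> : sadd U (span [set` [::]]) = U.
    rewrite span_nil saddC sadd_idl //; first exact: submodule_zero.
    by move=> _ ->; exact: sub0.
  exact: lenle0.
have hs : @submodule A N (span [set` s]) by exact: span_submodule.
have hg : @submodule A N (span [set g]) by exact: span_submodule.
rewrite span_cons [sadd (span [set g]) _]saddC saddA /= mulSn addnC.
apply: (@lenle_cat _ _ _ (sadd U (span [set` s]))) => //.
- exact: submodule_sadd.
- by apply: submodule_sadd => //; exact: submodule_sadd.
- exact: saddl.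
- exact: saddl.
- by apply: IH => a h Ia hs'; apply: hIs => //; rewrite inE hs' orbT.
apply: lenle_cyc hn => //; first exact: submodule_sadd.
by move=> a Ia; apply: saddl => //; apply: hIs => //; rewrite mem_head.
Qed.

Lemma lenle_fg_sub U V s I n : submodule U -> ideal I ->
  V `<=` sadd U (span [set` s]) -> (forall a g, I a -> g \in s -> U (a *: g)) ->
  @lenle A A^o I [set: A] n -> lenle U V (size s * n).
Proof. by move=> hU hI VU h hn; apply: lenleS (lenle_fg hU hI h hn). Qed.

Lemma finlen_exp U k : finitely_generated N -> submodule U ->
  finlen (sadd U (smul (ideal_exp m k) [set: N])) [set: N].
Proof.
move=> fgN hU; have hN := noethm_fg (local_noeth hm) fgN.
have hme j : submodule (smul (ideal_exp m j) [set: N]) by exact: submodule_smul.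
elim: k => [|k IH].
  exists 0%N; apply: lenleS (@lenle0 _ _ [set: N]) => //.
  by rewrite smul_exp0 // => x _; exact: saddr.
apply: (@finlen_cat _ _ _ (sadd U (smul (ideal_exp m k) [set: N]))) => //.
- exact: submodule_sadd.
- exact: submodule_sadd.
- by apply: saddS => //; rewrite smul_expS //; exact: smul_subr.
have [s hs] := hN _ (hme k); exists (size s * 1)%N.
apply: (@lenle_fg_sub _ _ s m) => //.
- exact: submodule_sadd.
- exact: local_ideal hm.
- rewrite hs; apply: sadd_sub; first by apply: submodule_sadd => //; exact: submodule_sadd.
    by move=> x Ux; apply: saddl => //; exact: saddl.
  by apply: saddr; exact: submodule_sadd.
- move=> a g ma gs; apply: saddr => //; rewrite smul_expS //; apply: smul_in => //.
  by rewrite -hs; exact: sub_span.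
- exact: lenle_residue.
Qed.

End FG.

Lemma fg_regular : finitely_generated A^o.
Proof.
exists [:: 1 : A^o]; apply/seteqP; split=> // x _.
rewrite -[x]mulr1; apply: (@subZ A A^o) (span_submodule _) _.
by apply: sub_span; rewrite /= mem_head.
Qed.

(** The Hilbert function of [A / J] is bounded by a multiple of [N ^ d]: a working form of
    [dim A / J <= d]. The lemmas [growth_krull] and [krull_growth] relate it to chains of primes. *)
Definition growth (J : set A) d := exists C, forall N,
  @lenle A A^o (ideal_add J (ideal_exp m N)) [set: A] (C * N.+1 ^ d).

Lemma growthS J J' d : J `<=` J' -> growth J d -> growth J' d.
Proof. by move=> JJ [C h]; exists C => N; apply: lenleS (h N) => //; exact: ideal_addS. Qed.
Lemma growth_leq J d d' : (d <= d')%N -> growth J d -> growth J d'.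
Proof.
move=> dd [C h]; exists C => N; apply: lenle_leq (h N).
by rewrite leq_mul2l leq_pexp2l ?orbT.
Qed.

(** Exact sequence [0 -> A / (I : a) -> A / I -> A / (I + (a)) -> 0], whose first map is
    multiplication by [a]. *)
Lemma growth_split I a d : ideal I -> growth (ideal_add I (ideal_gen [set a])) d ->
  growth (@colon A A^o I a) d -> growth I d.
Proof.
move=> hI [C hC] [C' hC']; exists (C + C')%N => N; rewrite mulnDl addnC.
have hmN : ideal (ideal_exp m N) by exact: ideal_ideal_exp.
have ha : ideal (ideal_gen [set a]) by exact: ideal_ideal_gen.
have hIa : ideal (ideal_add I (ideal_gen [set a])) by exact: ideal_ideal_add.
have hIm : ideal (ideal_add I (ideal_exp m N)) by exact: ideal_ideal_add.
have hc : ideal (@colon A A^o I a) by exact: ideal_colon.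
have sub : ideal_add I (ideal_exp m N) `<=` ideal_add (ideal_add I (ideal_gen [set a])) (ideal_exp m N).
  by apply: ideal_addS => //; exact: ideal_addlP.
apply: (@lenle_cat _ A^o _ (ideal_add (ideal_add I (ideal_gen [set a])) (ideal_exp m N))) => //.
- exact: ideal_ideal_add.
apply: (@lenle_pull A A A^o A^o (fun x => x * a) _ _ _ _ _ _ _ _ _ _ _ _ (hC' N)) => //.
- exact: ideal_ideal_add.
- by move=> x y; rewrite mulrDl.
- by move=> L hL; exact: (@ideal_colon A A^o L a hL).
- move=> _ [x hx [y hy <-]]; rewrite mulrDl; exists (x * a) => //; exists (y * a) => //.
  exact: idealMr.
- move=> _ [_ [x Ix [_ /ideal_gen1P[b ->] <-]] [y hy <-]]; exists b => //.
  have -> : x + b * a + y - b * a = x + y by ring.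
  by exists x => //; exists y.
Qed.

Lemma growth_full J d : J 1 -> ideal J -> growth J d.
Proof.
move=> J1 hJ; exists 0%N => N; apply: lenleS (@lenle0 _ A^o [set: A]) => //.
by rewrite (ideal_full hJ J1); exact: ideal_addlP (ideal_ideal_exp _ _).
Qed.

(** Noetherian induction through [growth_split]: if [a * b] is in [I] but neither factor is, both
    [I + (a)] and [I : a] are strictly larger than [I]. *)
Lemma growth_primes I d : ideal I ->
  (forall P, prime_ideal P -> I `<=` P -> growth P d) -> growth I d.
Proof.
move: I; apply: (ideal_ind (local_noeth hm)) => I hI IH hP.
case: (prime_or_split hI) => [I1|pI|[a [b [Iab na nb]]]]; first exact: growth_full.
  exact: hP.
apply: (@growth_split _ a) => //.
  apply: IH; first by apply: ideal_ideal_add => //; exact: ideal_ideal_gen.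
    split; first exact: ideal_addlP (ideal_ideal_gen _).
    by move=> h; apply: na; apply: h; apply: ideal_addrP => //; exact: sub_ideal_gen.
  move=> P pP IP; apply: hP => //; apply: subset_trans IP.
  exact: ideal_addlP (ideal_ideal_gen _).
have sI : I `<=` @colon A A^o I a by move=> x Ix; exact: idealMr.
apply: IH; first exact: (@ideal_colon A A^o).
  by split=> // h; apply: nb; apply: h; rewrite /colon /= [_ *: _]mulrC.
by move=> P pP IP; apply: hP => //; exact: subset_trans IP.
Qed.

(** Multiplication by [x] maps [J + m ^ N] into [J + m ^ N.+1], so passing from [N] to [N.+1] adds
    at most a length of the quotient by [J + (x)], which is of order [N ^ d]. *)
Lemma growth_step J x d : ideal J ->
  growth (ideal_add J (ideal_gen [set x])) d -> m x -> growth J d.+1.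
Proof.
move=> hJ [C hC] mx; exists C.
have hg : ideal (ideal_gen [set x]) by exact: ideal_ideal_gen.
have hJx : ideal (ideal_add J (ideal_gen [set x])) by exact: ideal_ideal_add.
have hm' N : ideal (ideal_exp m N) by exact: ideal_ideal_exp.
have hH N : ideal (ideal_add J (ideal_exp m N)) by exact: ideal_ideal_add.
have hL N : ideal (ideal_add (ideal_add J (ideal_gen [set x])) (ideal_exp m N)) by exact: ideal_ideal_add.
suff h N : @lenle A A^o (ideal_add J (ideal_exp m N)) [set: A] (C * (N * N.+1 ^ d)).
  by move=> N; apply: lenle_leq (h N); rewrite expnS leq_mul2l leq_mul2r leqnSn !orbT.
elim: N => [|N IH].
  by rewrite mul0n muln0; apply: lenleS (@lenle0 _ A^o [set: A]) => //; exact: ideal_addrP.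
have -> : (C * (N.+1 * N.+2 ^ d) = C * (N * N.+2 ^ d) + C * N.+2 ^ d)%N.
  by rewrite mulSn mulnDr addnC.
apply: (@lenle_cat _ A^o _ (ideal_add (ideal_add J (ideal_gen [set x])) (ideal_exp m N.+1))) => //.
- exact: hH.
- exact: hL.
- by apply: ideal_addS => //; exact: ideal_addlP.
have IH' : @lenle A A^o (ideal_add J (ideal_exp m N)) [set: A] (C * (N * N.+2 ^ d)).
  by apply: lenle_leq IH; do 2!(rewrite leq_mul2l; apply/orP; right); case: (d) => [//|d']; rewrite leq_exp2r.
apply: (@lenle_pull A A A^o A^o (fun a => a * x) _ _ _ _ _ _ _ _ _ _ _ _ IH') => //.
- exact: hL.
- by move=> a b; rewrite mulrDl.
- by move=> L hL'; exact: (@ideal_colon A A^o L x hL').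
- move=> _ [a Ja [b mb <-]]; rewrite mulrDl; exists (a * x); first exact: idealMr.
  exists (b * x) => //; rewrite mulrC ideal_expS; exact: (@smul_in A A^o).
- move=> _ [_ [a Ja [_ /ideal_gen1P[b ->] <-]] [y hy <-]]; exists b => //.
  have -> : a + b * x + y - b * x = a + y by ring.
  by exists a => //; exists y.
Qed.

Lemma growth_top J : m `<=` J -> growth J 0.
Proof.
move=> mJ; exists 1%N => N; rewrite expn0 mul1n; apply: lenleS lenle_residue => //.
exact: subset_trans (ideal_addlP (ideal_ideal_exp _ _)).
Qed.

Lemma ideal_gen_cons x (s : seq A) :
  ideal_gen [set` x :: s] = ideal_add (ideal_gen [set x]) (ideal_gen [set` s]).
Proof. exact: (@span_cons A A^o). Qed.

Lemma ideal_addA (I J K : set A) : ideal_add I (ideal_add J K) = ideal_add (ideal_add I J) K.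
Proof. exact: (@saddA A A^o). Qed.

Lemma growth_gens J s : ideal J -> {in s, forall x, m x} ->
  m `<=` ideal_add J (ideal_gen [set` s]) -> growth J (size s).
Proof.
elim: s J => [|x s IH] J hJ sm h.
  apply: growth_top; apply: subset_trans h _; apply: ideal_add_sub => //.
  by apply: ideal_gen_sub.
apply: (@growth_step _ x) => //; last by apply: sm; rewrite mem_head.
apply: IH.
- by apply: ideal_ideal_add => //; exact: ideal_ideal_gen.
- by move=> y ys; apply: sm; rewrite inE ys orbT.
- by apply: subset_trans h _; rewrite ideal_gen_cons ideal_addA.
Qed.

Definition nzd (J : set A) x := forall a, J (a * x) -> J a.

Let Hf J N := @len A A^o (ideal_add J (ideal_exp m N)) [set: A].

Lemma finlen_add J N : ideal J -> @finlen A A^o (ideal_add J (ideal_exp m N)) [set: A].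
Proof.
move=> hJ; have := @finlen_exp A^o J N fg_regular hJ; apply: finlenS => //.
apply: ideal_addS => // x; apply: (@smul_sub A A^o); first exact: ideal_ideal_exp.
by move=> a y ma _; exact: (@idealMr _ _ _ _ (ideal_ideal_exp m N) ma).
Qed.

(** By Artin-Rees for [J + (x)], the colon [(J + m ^ (c + n)) : x] lies in [J + m ^ n]. Hence
    [Hf J (c + n)] exceeds [Hf J n] by at least the value at [c + n] of the Hilbert function of
    [J + (x)]; this is iterated [N.+1] times. *)
Lemma nzd_length J x : ideal J -> nzd J x -> exists c, forall N,
  (N.+1 * Hf (ideal_add J (ideal_gen [set x])) N <= Hf J (N.+1 * c.+1))%N.
Proof.
move=> hJ hx.
have hg : ideal (ideal_gen [set x]) by exact: ideal_ideal_gen.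
have hX : ideal (ideal_add J (ideal_gen [set x])) by exact: ideal_ideal_add.
have hm' N : ideal (ideal_exp m N) by exact: ideal_ideal_exp.
have hH N : ideal (ideal_add J (ideal_exp m N)) by exact: ideal_ideal_add.
have hL N : ideal (ideal_add (ideal_add J (ideal_gen [set x])) (ideal_exp m N)) by exact: ideal_ideal_add.
have [c hc] := artin_rees (local_noeth hm) (local_ideal hm) hX.
have colonE n a : ideal_add J (ideal_exp m (c + n)) (a * x) -> ideal_add J (ideal_exp m n) a.
  move=> [j Jj [u mu e]].
  have Xu : ideal_add J (ideal_gen [set x]) u.
    have -> : u = - j + a * x by rewrite -e addKr.
    exists (- j); first exact: (@subN A A^o).
    by exists (a * x) => //; apply: (idealMl _ hg); exact: sub_ideal_gen.
  have [j' Jj' [u' mu' e']] : exists2 j', J j' & exists2 u', ideal_exp m n u' & u = j' + u' * x.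
    move: u {mu e Xu} (hc n u Xu mu); apply: (@smul_sub A A^o).
      split.
      - by exists 0; [exact: ideal0|exists 0; [exact: ideal0|rewrite mul0r addr0]].
      - move=> _ _ [j1 J1 [u1 m1 ->]] [j2 J2 [u2 m2 ->]]; exists (j1 + j2); first exact: idealD.
        by exists (u1 + u2); [exact: idealD|rewrite mulrDl addrACA].
      - move=> b _ [j1 J1 [u1 m1 ->]]; exists (b * j1); first exact: idealMl.
        by exists (b * u1); [exact: idealMl|rewrite /GRing.scale /= mulrDr mulrA].
    move=> b _ mb [j1 J1 [_ /ideal_gen1P[r ->] <-]]; exists (b * j1); first exact: idealMl.
    by exists (b * r); [exact: idealMr|rewrite /GRing.scale /= mulrDr mulrA].
  exists (a - u'); last by exists u' => //; rewrite subrK.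
  apply: hx; rewrite mulrBl -e e' addrA addrK; exact: idealD.
have key n : (Hf J n + Hf (ideal_add J (ideal_gen [set x])) (c + n) <= Hf J (c + n))%N.
  rewrite [leqRHS]/Hf (@lenD _ A^o _ (ideal_add (ideal_add J (ideal_gen [set x])) (ideal_exp m (c + n)))) //; last first.
  - exact: finlen_add.
  - by apply: ideal_addS => //; exact: ideal_addlP.
  - exact: hL.
  - exact: hH.
  rewrite leq_add2r; apply: (@leq_len A A^o) => //.
  - exact: hH.
  - by apply: ideal_addS => //; exact: ideal_addlP.
  - by apply: finlenS (finlen_add (c + n) hJ).
  have := @chain_len A A^o _ _ (hH n) (@subsetT _ _) (finlen_add n hJ); rewrite -/(Hf J n).
  pose W := ideal_add J (ideal_exp m (c + n)).
  apply: (@chain_transfer A A A^o A^o (fun L => [set y | exists2 a, L a & W (y - a * x)])).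
  - move=> L hL' WL _; split.
    + split; first by exists 0; [exact: (@sub0 A A^o)|rewrite mul0r subr0; exact: (ideal0 (hH _))].
        move=> y z [a La Wa] [b Lb Wb]; exists (a + b); first exact: (@subD A A^o).
        by rewrite mulrDl opprD addrACA; exact: (idealD (hH _)).
      move=> r y [a La Wa]; exists (r * a); first exact: (@subZ A A^o).
      by rewrite -mulrA -mulrBr; exact: (idealMl _ (hH _)).
    + by move=> y Wy; exists 0; [exact: (@sub0 A A^o)|rewrite mul0r subr0].
    + move=> y [a _ [j Jj [u mu e]]]; exists (j + a * x).
        by exists j => //; exists (a * x) => //; apply: (idealMl _ hg); exact: sub_ideal_gen.
      by exists u => //; rewrite addrAC e subrK.
  - by move=> L1 L2 L12 y [a /L12 La h]; exists a.
  - move=> L1 L2 hL1 hL2 UL1 L12 _ h a L2a.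
    have [|b L1b Wb] := h (a * x); first by exists a => //; rewrite subrr; exact: (ideal0 (hH _)).
    rewrite -(subrK b a); apply: (@subD A A^o) => //; apply: UL1; apply: colonE.
    by rewrite mulrBl.
have mono i j : (i <= j)%N -> (Hf (ideal_add J (ideal_gen [set x])) i <= Hf (ideal_add J (ideal_gen [set x])) j)%N.
  move=> ij; apply: (@len_mono A A^o) => //; [exact: hL|exact: hL| |exact: finlen_add].
  by apply: ideal_addS => //; exact: exp_antitone.
exists c => N.
suff h i : (i * Hf (ideal_add J (ideal_gen [set x])) N <= Hf J (i * c + N))%N.
  apply: leq_trans (h N.+1) _; apply: (@len_mono A A^o) => //; [exact: hH|exact: hH| |exact: finlen_add].
  by apply: ideal_addS => //; apply: exp_antitone; rewrite mulnS addnC leq_add2r.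
elim: i => [|i IH]; first by rewrite mul0n.
rewrite mulSn [(i.+1 * c)%N]mulSn -addnA addnC; apply: leq_trans (key _).
by apply: leq_add => //; apply: mono; lia.
Qed.

Lemma growth_nzd J x d : ideal J -> nzd J x -> growth J d.+1 ->
  growth (ideal_add J (ideal_gen [set x])) d.
Proof.
move=> hJ hx [C hC]; have [c hc] := nzd_length hJ hx.
have hX : ideal (ideal_add J (ideal_gen [set x])).
  by apply: ideal_ideal_add => //; exact: ideal_ideal_gen.
have hI I N : ideal I -> ideal (ideal_add I (ideal_exp m N)).
  by move=> h; apply: ideal_ideal_add => //; exact: ideal_ideal_exp.
exists (C * c.+2 ^ d.+1)%N => N.
apply: lenle_leq (lenle_len (hI _ _ hX) (@subsetT _ _) (finlen_add N hX)).
rewrite -(@leq_pmul2l N.+1) //; apply: leq_trans (hc N) _.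
apply: leq_trans (len_leq (hI _ _ hJ) (@subsetT _ _) (hC _)) _.
have -> : (N.+1 * (C * c.+2 ^ d.+1 * N.+1 ^ d) = C * (N.+1 * c.+2) ^ d.+1)%N.
  by rewrite expnMn [(N.+1 ^ d.+1)%N]expnS; ring.
rewrite leq_mul2l leq_exp2r //; apply/orP; right; rewrite !mulnS; lia.
Qed.

Lemma growth0_nzd J x : ideal J -> nzd J x -> growth J 0 ->
  ideal_add J (ideal_gen [set x]) 1.
Proof.
move=> hJ hx [C hC]; have [c hc] := nzd_length hJ hx.
have hX : ideal (ideal_add J (ideal_gen [set x])).
  by apply: ideal_ideal_add => //; exact: ideal_ideal_gen.
have hI I N : ideal I -> ideal (ideal_add I (ideal_exp m N)).
  by move=> h; apply: ideal_ideal_add => //; exact: ideal_ideal_exp.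
apply: contrapT => n1.
(* If [J + (x)] is proper, its quotient has length at least 1, and [C.+2] times this length would be
   at most [C]. *)
have h : (1 <= Hf (ideal_add J (ideal_gen [set x])) C.+1)%N.
  apply: (@leq_len A A^o); [exact: hI|by []|exact: finlen_add|].
  apply: (@chainS A A^o m [set: A]) => //.
    apply: ideal_add_sub; first exact: local_ideal hm.
      exact: (local_max hm).
    by apply: exp_subr => //; exact: local_ideal hm.
  apply: (@chain_ext A A^o _ m); [exact: (@chain0 A A^o m m (local_ideal hm))|by []|].
  by split=> // h; apply: (local_n1 hm); exact: h.
have := leq_trans (hc C.+1) (len_leq (hI _ _ hJ) (@subsetT _ _) (hC _)).
rewrite expn0 muln1 leqNgt => /negP; apply.
by apply: leq_trans (leq_pmulr _ h).
Qed.

Definition pchain (P : set A) l := exists L : nat -> set A,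
  [/\ L 0%N = P, forall i, (i <= l)%N -> prime_ideal (L i)
    & forall i, (i < l)%N -> L i `<` L i.+1].

Lemma prime_nzd P x : prime_ideal P -> ~ P x -> nzd P x.
Proof. by move=> [_ _ h] nx a /h[]. Qed.

Lemma pchain_cons P Q l : prime_ideal P -> P `<` Q -> pchain Q l -> pchain P l.+1.
Proof.
move=> pP PQ [L [L0 Lp Ls]]; exists (fun i => if i is j.+1 then L j else P); split=> //.
  by case.
by case=> [|i] hi; [rewrite L0|exact: Ls].
Qed.

(** Cutting by an [x] in [m] outside [P] accounts for one degree of growth, and a chain starting at
    a prime over [P + (x)] is extended by [P]. *)
Lemma growth_dim P d : prime_ideal P -> (forall l, pchain P l -> (l <= d)%N) -> growth P d.
Proof.
elim: d P => [|d IH] P pP h.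
  apply: growth_top; apply: contrapT => nm.
  suff /h : pchain P 1 by [].
  have Pm : P `<` m by split=> //; case: pP => hP nP _; exact: (local_max hm).
  apply: pchain_cons Pm _ => //; exists (fun=> m); split=> // i _; exact: local_prime hm.
case: (pselect (m `<=` P)) => [/growth_top|nm]; first exact: growth_leq.
have [x [mx nx]] : exists x, m x /\ ~ P x.
  apply: contrapT => /forallNP hn; apply: nm => x mx; apply: contrapT => nx.
  by apply: (hn x).
have hP : ideal P by case: pP.
apply: (@growth_step _ x) => //; apply: growth_primes.
  by apply: ideal_ideal_add => //; exact: ideal_ideal_gen.
move=> Q pQ PxQ; apply: IH => // l hl; rewrite -ltnS; apply: h.
apply: pchain_cons hl => //; split.
  exact: subset_trans (ideal_addlP (ideal_ideal_gen _)) PxQ.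
move=> QP; apply: nx; apply: QP; apply: PxQ; apply: ideal_addrP => //.
exact: sub_ideal_gen.
Qed.

(** An element of the second prime outside the first is a nonzerodivisor modulo the first, so each
    step along the chain lowers the growth. *)
Lemma dim_growth P d l : growth P d -> pchain P l -> (l <= d)%N.
Proof.
elim: l P d => [//|l IH] P d gP [L [L0 Lp Ls]].
have pP : prime_ideal P by rewrite -L0; exact: Lp.
have [hP _ _] := pP.
have [P1 n1] := Ls 0%N isT; rewrite L0 in P1 n1.
have [x [L1x nx]] : exists x, L 1%N x /\ ~ P x.
  apply: contrapT => /forallNP hn; apply: n1 => x mx; apply: contrapT => nx.
  by apply: (hn x).
have [hL1 nL1 _] := Lp 1%N isT.
have PxL : ideal_add P (ideal_gen [set x]) `<=` L 1%N.
  by apply: ideal_add_sub => //; apply: ideal_gen_sub => // _ ->.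
have hx := prime_nzd pP nx.
case: d gP => [|d] gP; first by case: nL1; apply: PxL; exact: growth0_nzd.
rewrite ltnS; apply: (IH (L 1%N)); first exact: growthS PxL (growth_nzd hP hx gP).
by exists (fun i => L i.+1); split=> // i hi; [exact: Lp|exact: Ls].
Qed.

Lemma growth_krull d : (forall l, has_chain (@prime_ideal A) l -> (l <= d)%N) ->
  growth [set 0] d.
Proof.
move=> h; apply: growth_primes; first exact: (@submodule_zero A A^o).
move=> P pP _; apply: growth_dim => // l [L [_ a b]]; apply: h; exists L; split=> //.
Qed.

Lemma krull_growth d l : growth [set 0] d -> has_chain (@prime_ideal A) l -> (l <= d)%N.
Proof.
move=> g [L [a b]]; apply: (@dim_growth (L 0%N)); last by exists L.
have [h _ _] := a 0%N isT.
by apply: growthS g => _ ->; exact: ideal0.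
Qed.

(** Regular local rings are domains, for [A / J] whose maximal ideal has [size s] generators and
    whose growth is not smaller. By induction [J + (x)] is prime, and a prime [P] over [J] of full
    growth lies in it. Then [P = J + x P], and [P = J] by Nakayama. *)
Lemma regular_prime J s : ideal J -> J `<=` m -> {in s, forall x, m x} ->
  m `<=` ideal_add J (ideal_gen [set` s]) ->
  (forall d, d.+1 = size s -> ~ growth J d) -> prime_ideal J.
Proof.
elim: s J => [|x s IH] J hJ Jm sm mJ ng.
  have -> : J = m; last exact: local_prime hm.
  apply/seteqP; split=> //; apply: subset_trans mJ _; apply: ideal_add_sub => //.
  exact: ideal_gen_sub.
have sm' : {in s, forall x, m x} by move=> y ys; apply: sm; rewrite inE ys orbT.
have mx : m x by apply: sm; rewrite mem_head.
have hg : ideal (ideal_gen [set x]) by exact: ideal_ideal_gen.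
pose J' := ideal_add J (ideal_gen [set x]).
have hJ' : ideal J' by exact: ideal_ideal_add.
have ideal_m := local_ideal hm.
have J'm : J' `<=` m by apply: ideal_add_sub => //; apply: ideal_gen_sub => // _ ->.
have mJ' : m `<=` ideal_add J' (ideal_gen [set` s]) by rewrite /J' -ideal_addA -ideal_gen_cons.
have pJ' : prime_ideal J'.
  apply: IH => // d ds gJ'; apply: (ng d.+1); first by rewrite /= ds.
  exact: growth_step gJ' mx.
have [P [pP JP nP]] : exists P, [/\ prime_ideal P, J `<=` P & ~ growth P (size s)].
  apply: contrapT => h; apply: (ng (size s)) => //; apply: growth_primes => // P pP JP.
  by apply: contrapT => nP; apply: h; exists P.
have [hP nP1 _] := pP; have Pm : P `<=` m by exact: (local_max hm).
have nPx : ~ P x.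
  move=> Px; apply: nP; apply: growth_gens => //; apply: subset_trans mJ' _.
  by apply: ideal_addS => //; apply: ideal_add_sub => //; apply: ideal_gen_sub => // _ ->.
(* An element [y] of [P] outside the prime [J'] is a nonzerodivisor modulo [J']; then [J' + (y)],
   and with it [P + (x)], would have too small a growth. *)
have PJ' : P `<=` J'.
  move=> y Py; apply: contrapT => ny; case: (posnP (size s)) => [/size0nil s0|s0].
    apply: ny; have := mJ' y (Pm y Py); rewrite s0; apply: ideal_add_sub => //.
    exact: ideal_gen_sub.
  apply: nP; rewrite -(prednK s0); apply: (@growth_step _ x) => //.
  have : growth (ideal_add J' (ideal_gen [set y])) (size s).-1.
    by apply: growth_nzd => //; [exact: prime_nzd|rewrite prednK //; exact: growth_gens].
  apply: growthS; apply: ideal_add_sub; first exact: ideal_ideal_add.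
    exact: ideal_addS.
  by apply: ideal_gen_sub; [exact: ideal_ideal_add|move=> _ ->; exact: ideal_addlP].
have [t ht] := local_noeth hm hP.
suff PJ : P `<=` J by have -> : J = P by apply/seteqP.
rewrite -ht; apply: (@nakayama A m hm A^o) => //.
rewrite -[span _]/(ideal_gen _) ht => z Pz; have [j Jj [_ /ideal_gen1P[a ->] e]] := PJ' z Pz.
have Pa : P a.
  apply: (prime_nzd pP nPx); have -> : a * x = z - j by rewrite -e addrAC subrr add0r.
  by apply: idealB => //; exact: JP.
exists j => //; exists (a * x) => //; rewrite mulrC; exact: (@smul_in A A^o).
Qed.

(** Initial segments of a regular system of parameters generate prime ideals by [regular_prime], and
    the next parameter lies outside, again for reasons of growth. *)
Lemma regular_nzd s i : {in s, forall x, m x} -> m `<=` ideal_gen [set` s] ->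
  (forall d, d.+1 = size s -> ~ growth [set 0] d) -> (i < size s)%N ->
  nzd (ideal_gen [set` take i s]) s`_i.
Proof.
move=> sm ms ng hi.
have idg t : ideal (ideal_gen [set` t : seq A]) by exact: ideal_ideal_gen.
have tm (t : seq A) : {subset t <= s} -> ideal_gen [set` t] `<=` m.
  by move=> h; apply: ideal_gen_sub; [exact: local_ideal hm|move=> x /h/sm].
have cat (t u : seq A) : ideal_gen [set` t ++ u] `<=` ideal_add (ideal_gen [set` t]) (ideal_gen [set` u]).
  apply: ideal_gen_sub; first exact: ideal_ideal_add.
  move=> x /=; rewrite mem_cat => /orP[h|h].
    by apply: ideal_addlP => //; exact: sub_ideal_gen.
  by apply: ideal_addrP => //; exact: sub_ideal_gen.
have ng' j : (j <= size s)%N -> forall d, d.+1 = (size s - j)%N -> ~ growth (ideal_gen [set` take j s]) d.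
  elim: j => [|j IH] hj d.
    rewrite subn0 take0 => e g; apply: (ng d e); apply: growthS g.
    by apply: ideal_gen_sub => //; exact: (@submodule_zero A A^o).
  move=> e g; apply: (IH (ltnW hj) d.+1); first by rewrite e subnSK.
  apply: (@growth_step _ s`_j) => //; last by apply: sm; rewrite mem_nth.
  apply: growthS g; apply: ideal_gen_sub; first by apply: ideal_ideal_add => //; exact: ideal_ideal_gen.
  move=> x /=; rewrite (take_nth 0 hj) mem_rcons inE => /orP[/eqP ->|xj].
    by apply: ideal_addrP => //; exact: sub_ideal_gen.
  by apply: (ideal_addlP (ideal_ideal_gen _)); exact: sub_ideal_gen.
apply: prime_nzd.
  apply: (@regular_prime _ (drop i s)) => //.
  - by apply: tm => x; exact: mem_take.
  - by move=> x /mem_drop; exact: sm.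
  - by apply: subset_trans ms _; rewrite -{1}(cat_take_drop i s).
  - by move=> d; rewrite size_drop => e; apply: ng' => //; exact: ltnW.
move=> si; have e : (size s - i.+1).+1 = (size s - i)%N by rewrite subnSK.
apply: (ng' i (ltnW hi) _ e); rewrite -size_drop; apply: growth_gens => //.
  by move=> x /mem_drop; exact: sm.
apply: subset_trans ms _; rewrite -{1}(cat_take_drop i s) (drop_nth 0 hi).
apply: subset_trans (cat _ _) _; rewrite ideal_gen_cons ideal_addA.
apply: ideal_addS => //; apply: ideal_add_sub => //.
by apply: ideal_gen_sub => // _ ->.
Qed.

End LengthBounds.

(** The last coefficient [b n] lies in the ideal of the previous elements, and absorbing [b n * y n]
    into the earlier terms leaves a shorter syzygy. The vanishing of [k i i] is stated separately,
    as antisymmetry does not give it when 2 is a zero divisor. *)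
Lemma koszul_syzygy (A : comNzRingType) (y b : nat -> A) n :
  (forall t a, (t < n)%N -> (exists c : nat -> A, a * y t = \sum_(i < t) c i * y i) ->
     exists c : nat -> A, a = \sum_(i < t) c i * y i) ->
  \sum_(i < n) b i * y i = 0 ->
  exists k : nat -> nat -> A, [/\ forall i l, k i l = - k l i, forall i, k i i = 0
    & forall i, (i < n)%N -> b i = \sum_(l < n) k i l * y l].
Proof.
elim: n b => [|n IH] b reg.
  by move=> _; exists (fun _ _ => 0); split=> // i l; rewrite oppr0.
rewrite big_ord_recr /= => e.
have [|c ec] := reg n (b n) (ltnSn n).
  exists (fun i => - b i); move: e; rewrite addrC => /eqP; rewrite addr_eq0 => /eqP ->.
  by rewrite -sumrN; apply: eq_bigr => i _; rewrite mulNr.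
have [||k [k1 k2 k3]] := IH (fun i => b i + c i * y n).
- by move=> t a tn; apply: reg; exact: ltnW.
- rewrite -[RHS]e ec mulr_suml -big_split /=; apply: eq_bigr => i _.
  by rewrite mulrDl mulrAC.
exists (fun i l => if (i < n)%N then (if (l < n)%N then k i l else if l == n then - c i else 0)
                  else if i == n then (if (l < n)%N then c l else 0) else 0); split.
- move=> i l; case: (ltngtP i n) => hi; case: (ltngtP l n) => hl //; rewrite ?opprK ?oppr0 //.
- by move=> i; case: (ltngtP i n) => //.
- move=> i; rewrite ltnS leq_eqVlt => /predU1P[->|hi].
    rewrite ec big_ord_recr /= ltnn eqxx mul0r addr0; apply: eq_bigr => l _.
    by rewrite ltn_ord.
  rewrite hi big_ord_recr /= ltnn eqxx mulNr; apply/eqP; rewrite eq_sym subr_eq; apply/eqP.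
  by rewrite k3 //; apply: eq_bigr => l _; rewrite ltn_ord.
Qed.

Section ResidueLength.
Variables (B A : comNzRingType) (f : {rmorphism B -> A}) (m : set A) (N : lmodType A).
Hypothesis fm : forall a, exists b, m (a - f b).
Hypothesis hm : ideal m.
Variables (Z V : set N) (k : nat).
Hypotheses (hZ : submodule Z) (hV : submodule V) (ZV : Z `<=` V).
Hypothesis kV : smul (ideal_exp m k) V `<=` Z.
Hypothesis fin : finlen Z V.

(** On the layers between [W i.+1] and [W i] the ideal [m] acts as zero, so the submodules over [A]
    and over [B] coincide there. The layers add up, and [W k = Z]. *)
Lemma lenle_rscal : @lenle B (rscal f N) Z V (len Z V).
Proof.
pose W i := sadd Z (smul (ideal_exp m i) V).
have hW i : submodule (W i) by apply: submodule_sadd => //; exact: submodule_smul.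
have WV i : W i `<=` V by apply: sadd_sub => //; exact: smul_subr.
have ZW i : Z `<=` W i by apply: saddl; exact: submodule_smul.
have finW i : finlen (W i) V by apply: finlenS fin.
have hB (U : set N) : @submodule A N U -> @submodule B (rscal f N) U.
  by move=> hU; exact: (rscal_submodule f hU).
suff h i : @lenle B (rscal f N) (W i) V (len (W i) V).
  have <- : W k = Z; last exact: h.
  by apply/seteqP; split=> //; exact: sadd_sub.
elim: i => [|i IH].
  have -> : W 0%N = V.
    by apply/seteqP; split=> //; rewrite /W smul_exp0 //; exact: saddr.
  by apply: lenle_leq (leq0n _) (@lenle0 _ _ _).
have WW : W i.+1 `<=` W i.
  by apply: saddS => //; apply: smulS => //; exact: exp_antitone.
rewrite (@lenD _ _ (W i.+1) (W i) V) //.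
apply: (@lenle_cat B (rscal f N) _ (W i)) => //; try exact: hB.
move=> n /(chain_rscal_inv fm) c; apply: lenle_len => //.
  by apply: finlenS (finW i.+1).
apply: c => a x ma [z Zz [y hy <-]]; rewrite scalerDr; apply: subD => //.
  by apply: ZW; exact: subZ.
by apply: saddr => //; rewrite smul_expS //; exact: smul_in.
Qed.

Lemma len_rscal : @len B (rscal f N) Z V = len Z V.
Proof.
have hB (U : set N) : @submodule A N U -> @submodule B (rscal f N) U.
  by move=> hU; exact: (rscal_submodule f hU).
apply/eqP; rewrite eqn_leq; apply/andP; split.
  by apply: (@len_leq B (rscal f N)) => //; [exact: hB|exact: lenle_rscal].
apply: (@leq_len B (rscal f N)) => //; first exact: hB.
  by exists (len Z V); exact: lenle_rscal.
by apply: chain_rscal; exact: chain_len.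
Qed.

End ResidueLength.

Section LengthTools.
Variables (A : comNzRingType) (N : lmodType A).
Implicit Types (U V W : set N).

Lemma chain_cyc W g (I : set A) n : submodule W -> colon W g `<=` I ->
  @chain A A^o I [set: A] n -> chain W (sadd W (span [set g])) n.
Proof.
move=> hW WI; have hg : @submodule A N (span [set g]) by exact: span_submodule.
apply: (@chain_transfer A A N A^o (fun L => [set y | exists2 a, L a & W (y - a *: g)])).
- move=> L hL' IL _; split.
  + split; first by exists 0; [exact: (@sub0 A A^o)|rewrite scale0r subr0; exact: sub0].
      move=> y z [a La Wa] [b Lb Wb]; exists (a + b); first exact: (@subD A A^o).
      by rewrite scalerDl opprD addrACA; exact: subD.
    move=> r y [a La Wa]; exists (r * a); first exact: (@subZ A A^o).
    by rewrite -scalerA -scalerBr; exact: subZ.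
  + by move=> y Wy; exists 0; [exact: (@sub0 A A^o)|rewrite scale0r subr0].
  + move=> y [a _ Wy]; exists (y - a *: g) => //; exists (a *: g); last by rewrite subrK.
    by apply/span1P; exists a.
- by move=> L1 L2 L12 y [a /L12 La h]; exists a.
- move=> L1 L2 hL1 hL2 UL1 L12 _ h a L2a.
  have [|b L1b Wb] := h (a *: g); first by exists a => //; rewrite subrr; exact: sub0.
  rewrite -(subrK b a); apply: (@subD A A^o) => //; apply: UL1; apply: WI.
  by rewrite /colon /= scalerBl.
Qed.

Definition scaled x V : set N := [set x *: y | y in V].

Lemma submodule_scaled x V : submodule V -> submodule (scaled x V).
Proof.
move=> hV; split; first by exists 0; [exact: sub0|rewrite scaler0].
  by move=> _ _ [y Vy <-] [z Vz <-]; exists (y + z); [exact: subD|rewrite scalerDr].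
by move=> a _ [y Vy <-]; exists (a *: y); [exact: subZ|rewrite !scalerA mulrC].
Qed.

Lemma chain_scaled x U V W n : submodule U -> submodule V -> submodule W -> U `<=` V ->
  (forall y, U y -> W (x *: y)) ->
  chain W (sadd W (scaled x V)) n -> chain U V n.
Proof.
move=> hU hV hW UV h; apply: (@chain_pull A A N N (fun y => x *: y)) => //.
- by apply: submodule_sadd => //; exact: submodule_scaled.
- by move=> y z; exact: scalerDr.
- move=> L hL; split=> [|y z|a y] /=; rewrite ?scaler0 ?scalerDr.
  + exact: sub0.
  + exact: subD.
  + by rewrite scalerA mulrC -scalerA; exact: subZ.
- by move=> _ [w Ww [_ [y Vy <-] <-]]; exists y => //; rewrite addrK.
Qed.

(** For multiplication by [x] on [V / W], with kernel [T / W], the quotient [V / T] is isomorphic to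
    the image [(W + x V) / W]. Hence the kernel is no longer than the cokernel. *)
Lemma torsion_len x V W : submodule V -> submodule W -> W `<=` V -> finlen W V ->
  (len W [set y | V y /\ W (x *: y)] <= len (sadd W (scaled x V)) V)%N.
Proof.
move=> hV hW WV fin; set T := [set y | _].
have hT : submodule T.
  split; first by split; [exact: sub0|rewrite scaler0; exact: sub0].
    by move=> y z [? ?] [? ?]; split; [exact: subD|rewrite scalerDr; exact: subD].
  move=> a y [? ?]; split; first exact: subZ.
  by rewrite scalerA mulrC -scalerA; exact: subZ.
have WT : W `<=` T by move=> y Wy; split; [exact: WV|exact: subZ].
have TV : T `<=` V by move=> y [].
have hX := submodule_scaled x hV.
have hWX : submodule (sadd W (scaled x V)) by exact: submodule_sadd.
have WWX : W `<=` sadd W (scaled x V) by exact: saddl.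
have WXV : sadd W (scaled x V) `<=` V.
  by apply: sadd_sub => // _ [y Vy <-]; exact: subZ.
have := @lenD _ _ W T V hW hT hV WT TV fin.
rewrite (@lenD _ _ W (sadd W (scaled x V)) V) // => e.
have h : (len W (sadd W (scaled x V)) <= len T V)%N.
  apply: leq_len => //; first exact: finlenS fin.
  apply: (@chain_scaled x _ _ W) => //; first by move=> y [].
  by apply: chain_len => //; apply: finlenS fin.
by rewrite -(leq_add2r (len T V)) -e addnC leq_add2l.
Qed.

Lemma chain_second_iso W V n : submodule W -> submodule V ->
  chain (W `&` V) V n -> chain W (sadd W V) n.
Proof.
move=> hW hV; apply: (@chain_transfer A A N N (fun L => sadd W L)).
- move=> L hL _ LV; split; [exact: submodule_sadd|exact: saddl|exact: saddS].
- by move=> L1 L2 L12; exact: saddS.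
- move=> L1 L2 hL1 hL2 UL1 L12 L2V h y L2y.
  have [w Ww [z L1z e]] := h y (saddr hW L2y).
  rewrite -e; apply: subD => //; apply: UL1; split=> //.
  have -> : w = y - z by rewrite -e addrK.
  by apply: subB => //; [exact: L2V|apply/L2V/L12].
Qed.

Lemma chain_second_iso_inv U W V n : submodule W -> submodule V -> U `<=` W `&` V ->
  chain W (sadd W V) n -> chain U V n.
Proof.
move=> hW hV UWV; apply: (@chain_pull A A N N id) => //.
- exact: submodule_sadd.
- by move=> x /UWV[].
- by move=> x /UWV[].
- by move=> _ [w Ww [v Vv <-]]; exists v => //; rewrite addrK.
Qed.

End LengthTools.

(** * Ranks at the minimal primes *)

Section RankLemma.
Variables (A : comNzRingType) (m : set A).
Hypothesis hm : noetherian_local m.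
Variables (I : set A) (t : nat) (P : nat -> set A) (c : nat -> A) (d : nat).
Hypothesis hI : ideal I.
Hypothesis hIP : forall a, I a <-> forall i, (i < t)%N -> P i a.
Hypothesis hP : forall i, (i < t)%N -> prime_ideal (P i).
Hypothesis hc : forall i, (i < t)%N -> ~ P i (c i) /\
  forall j, (j < t)%N -> j != i -> P j (c i).
Hypothesis hg : growth m I d.+1.

(** Modulo [P i] only the term [c i * w i] survives, and it lies outside [P i]: an explicit form of
    prime avoidance. *)
Lemma sum_nzd (w : nat -> A) : (forall i, (i < t)%N -> ~ P i (w i)) ->
  nzd I (\sum_(i < t) c i * w i).
Proof.
move=> hw a /hIP h; apply/hIP => i it; have [hPi _ Pm] := hP it.
have /Pm[//|] := h i it; rewrite (bigD1 (Ordinal it)) //= => hs; exfalso.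
have : P i (c i * w i).
  rewrite -(addrK (\sum_(i0 < t | i0 != Ordinal it) c i0 * w i0) (c i * w i)).
  apply: idealB => //; apply: ideal_sum => // j ji; apply: idealMr => //.
  by have [_] := hc (ltn_ord j); apply => //; rewrite eq_sym.
by move=> /Pm[]; [case: (hc it)|exact: hw].
Qed.


Section Fixed.
Variables (N : lmodType A) (U0 : set N) (K : nat -> set A) (nu : nat -> nat).
Hypotheses (fgN : finitely_generated N) (hU0 : submodule U0).
Hypothesis IN : forall a x, I a -> U0 (a *: x).
Hypothesis hK : forall e, ideal (K e).
Hypothesis mK : forall e, ideal_exp m (nu e) `<=` K e.

Let hN : noethm N := noethm_fg (local_noeth hm) fgN.
Let W V e := sadd U0 (smul (K e) V).

Lemma submodule_W V e : submodule (W V e).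
Proof. by apply: submodule_sadd => //; exact: submodule_smul. Qed.

Lemma W_sub V e : submodule V -> U0 `<=` V -> W V e `<=` V.
Proof. by move=> hV UV; apply: sadd_sub => //; exact: smul_subr. Qed.

Lemma len_mod_x V x : submodule V -> U0 `<=` V ->
  growth m (ideal_add I (ideal_gen [set x])) d ->
  exists C, forall e, lenle (sadd (W V e) (scaled x V)) V (C * (nu e).+1 ^ d).
Proof.
move=> hV UV [C hC]; have [s hs] := hN hV; exists (size s * C)%N => e.
have hX := submodule_scaled x hV.
have hWX : submodule (sadd (W V e) (scaled x V)) by apply: submodule_sadd => //; exact: submodule_W.
rewrite -mulnA; apply: (lenle_fg_sub hWX _ _ _ (hC (nu e))).
- by apply: ideal_ideal_add; [apply: ideal_ideal_add => //; exact: ideal_ideal_gen|exact: ideal_ideal_exp].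
- by rewrite hs; exact: saddr.
- move=> a g [_ [b Ib [_ /ideal_gen1P[r ->] <-]] [z mz <-]] gs.
  have Vg : V g by rewrite -hs; exact: sub_span.
  rewrite !scalerDl; apply: subD => //; first apply: subD => //.
  + by apply: (saddl hX); apply: (saddl (submodule_smul _ _)); exact: IN.
  + by apply: saddr; [exact: submodule_W|exists (r *: g); [exact: subZ|rewrite scalerA mulrC]].
  + by apply: saddl => //; apply: saddr => //; apply: smul_in => //; exact: mK.
Qed.

Lemma finlen_W V e : submodule V -> U0 `<=` V -> finlen (W V e) V.
Proof.
move=> hV UV; have [s hs] := hN hV.
have [n hn] := @finlen_add A m hm [set 0] (nu e) (@submodule_zero A A^o).
exists (size s * n)%N; apply: (lenle_fg_sub (submodule_W V e) _ _ _ hn).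
- apply: ideal_ideal_add; [exact: (@submodule_zero A A^o)|exact: ideal_ideal_exp].
- by rewrite hs; apply: saddr; exact: submodule_W.
- move=> a g [_ -> [z mz <-]] gs; rewrite add0r; apply: saddr => //.
  by apply: smul_in; [exact: mK|rewrite -hs; exact: sub_span].
Qed.

Let lenV V e := len (W V e) V.
Let lenP Q e := @len A A^o (ideal_add Q (K e)) [set: A].

(* Up to an error of lower order, the lengths of [V] are those of a direct sum of copies of the
   quotients of [A] by the minimal primes over [I]. *)
Definition ranked V := exists (r : nat -> nat) C, forall e,
  (lenV V e <= \sum_(i < t) r i * lenP (P i) e + C * (nu e).+1 ^ d)%N /\
  (\sum_(i < t) r i * lenP (P i) e <= lenV V e + C * (nu e).+1 ^ d)%N.

Lemma finlen_K Q e : ideal Q -> @finlen A A^o (ideal_add Q (K e)) [set: A].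
Proof.
by move=> hQ; apply: finlenS (finlen_add hm (nu e) hQ) => //; exact: ideal_addS.
Qed.

(** The quotient of the larger module by [V] is [A / Q] with [Q] prime. Lengths add up except that
    [W V' e] may meet [V] in more than [W V e]; this excess is killed by an element regular modulo
    [I], hence is of lower order by [torsion_len] and [len_mod_x]. If [Q] is some [P i], the rank
    there goes up by one; otherwise [A / Q] is itself of lower order. *)
Lemma ranked_step V g : submodule V -> U0 `<=` V -> prime_ideal (colon V g) ->
  ranked V -> ranked (sadd V (span [set g])).
Proof.
move=> hV UV pQ [r [C hr]]; set Q := colon V g in pQ.
have hgs : @submodule A N (span [set g]) by exact: span_submodule.
pose V' := sadd V (span [set g]).
have hV' : submodule V' by exact: submodule_sadd.
have VV' : V `<=` V' by exact: saddl.
have UV' : U0 `<=` V' by exact: subset_trans VV'.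
have [hQ nQ1 mQ] := pQ.
have IQ : I `<=` Q by move=> a Ia; apply: UV; exact: IN.
have V'g x : V' x -> exists2 v, V v & exists a, x = v + a *: g.
  by move=> [v Vv [_ /span1P[a ->] <-]]; exists v => //; exists a.
have KV'E e x : smul (K e) V' x -> exists2 z, smul (K e) V z & exists2 a, K e a & x = z + a *: g.
  move: x; apply: smul_sub.
    split; first by exists 0; [exact: sub0 (submodule_smul _ _)|exists 0; [exact: ideal0|rewrite scale0r addr0]].
      move=> _ _ [z1 h1 [a1 k1 ->]] [z2 h2 [a2 k2 ->]].
      exists (z1 + z2); first exact: subD (submodule_smul _ _) _ _.
      by exists (a1 + a2); [exact: idealD|rewrite scalerDl addrACA].
    move=> b _ [z1 h1 [a1 k1 ->]]; exists (b *: z1); first exact: subZ (submodule_smul _ _) _.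
    by exists (b * a1); [exact: idealMl|rewrite scalerDr scalerA].
  move=> a _ Ka /V'g[v Vv [b ->]]; exists (a *: v); first exact: smul_in.
  by exists (a * b); [exact: idealMr|rewrite scalerDr scalerA].
have lenE e : lenV V' e = (len (W V' e) (sadd (W V' e) V) + lenP Q e)%N.
  have hWV : submodule (sadd (W V' e) V) by apply: submodule_sadd => //; exact: submodule_W.
  have WVV : sadd (W V' e) V `<=` V' by apply: sadd_sub => //; exact: W_sub.
  rewrite /lenV (@lenD _ _ _ (sadd (W V' e) V)) //; [|exact: submodule_W|exact: saddl|exact: finlen_W].
  congr (_ + _)%N; have e1 : V' = sadd (sadd (W V' e) V) (span [set g]).
    apply/seteqP; split; first by apply: saddS => //; apply: saddr; exact: submodule_W.
    by apply: sadd_sub => //; exact: saddr.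
  have fl : finlen (sadd (W V' e) V) V' by apply: finlenS (finlen_W e hV' UV') => //; exact: saddl.
  have hQK : ideal (ideal_add Q (K e)) by exact: ideal_ideal_add.
  apply/eqP; rewrite eqn_leq; apply/andP; split.
    apply: len_leq => //; rewrite {2}e1; apply: (lenle_cyc hWV hQK); last first.
      apply: (@lenle_len A A^o) => //; exact: finlen_K.
    move=> _ [a Qa [b Kb <-]]; rewrite scalerDl; apply: subD => //.
      by apply: saddr => //; exact: submodule_W.
    apply: saddl => //; apply: saddr => //; apply: smul_in => //.
    by apply: saddr => //; exact: sub_span.
  apply: leq_len => //; rewrite {2}e1; apply: (@chain_cyc _ _ _ _ (ideal_add Q (K e))) => //; last first.
    apply: (@chain_len A A^o) => //; exact: finlen_K.
  move=> a [_ [u Uu [x /KV'E[z hz [b Kb ->]] <-]] [v Vv e2]].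
  exists (a - b); last by exists b => //; rewrite subrK.
  rewrite /Q /colon /= scalerBl -e2.
  have -> : u + (z + b *: g) + v - b *: g = u + z + v.
    by rewrite addrAC; congr (_ + _); rewrite addrA addrK.
  by apply: subD => //; apply: subD => //; [exact: UV|exact: (smul_subr hV hz)].
have up e : (len (W V' e) (sadd (W V' e) V) <= lenV V e)%N.
  apply: leq_len; [exact: submodule_W|exact: W_sub|exact: finlen_W|].
  have hW' := submodule_W V' e.
  apply: (@chain_second_iso_inv _ _ _ (W V' e)) => //.
    move=> x Wx; split; last exact: (W_sub hV UV Wx).
    by move: x Wx; apply: saddS => //; exact: smulS.
  apply: chain_len => //; first exact: saddl.
  apply: finlenS (finlen_W e hV' UV') => //.
  by apply: sadd_sub => //; exact: W_sub.
(* The condition on [x] says that it sends into [W V e] the elements that [W V' e] and [V] share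
   beyond [W V e]. *)
have low x : nzd I x -> (forall e k, K e k -> Q k -> W V e ((x * k) *: g)) ->
    exists D, forall e, (lenV V e <= len (W V' e) (sadd (W V' e) V) + D * (nu e).+1 ^ d)%N.
  move=> hx hxk; have [D hD] := len_mod_x hV UV (growth_nzd hm hI hx hg).
  exists D => e; have hW' := submodule_W V' e; have hWe := submodule_W V e.
  have WVe := W_sub (e := e) hV UV; have fW := finlen_W e hV UV.
  have WW : W V e `<=` W V' e by apply: saddS => //; exact: smulS.
  have hWI : submodule (W V' e `&` V) by exact: submoduleI.
  have s1 : W V e `<=` W V' e `&` V by move=> y Wy; split; [exact: WW|exact: WVe].
  rewrite /lenV (@lenD _ _ _ (W V' e `&` V)) // [X in (X <= _)%N]addnC; apply: leq_add.
    apply: leq_len => //; first exact: saddl.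
      apply: finlenS (finlen_W e hV' UV') => //.
      by apply: sadd_sub => //; exact: W_sub.
    apply: chain_second_iso => //; apply: chain_len => //.
    by apply: finlenS fW.
  apply: leq_trans (len_leq _ _ (hD e)); last 2 first.
  - by apply: submodule_sadd => //; exact: submodule_scaled.
  - by apply: sadd_sub => // _ [y Vy <-]; exact: subZ.
  apply: leq_trans (torsion_len x hV hWe WVe fW).
  have sT : W V' e `&` V `<=` [set y | V y /\ W V e (x *: y)].
    move=> y [[u Uu [z /KV'E[z1 hz1 [b Kb ->]] e1]] Vy]; split=> //.
    have Qb : Q b.
      rewrite /Q /colon /=; have -> : b *: g = y - (u + z1).
        by rewrite -e1 [u + (z1 + _)]addrA [X in X - _]addrC addrK.
      by apply: subB => //; apply: subD => //; [exact: UV|exact: (smul_subr hV hz1)].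
    rewrite -e1 !scalerDr; apply: subD => //; first by apply: saddl; [exact: submodule_smul|exact: subZ].
    apply: subD => //; last by rewrite scalerA; exact: hxk.
    by apply: saddr => //; exact: (subZ _ (submodule_smul _ _)).
  apply: (len_mono hWe hWe _ s1 sT) => //.
  by apply: finlenS fW => // y [].
have [[i [it Qi]]|nQ] := pselect (exists i, (i < t)%N /\ Q `<=` P i).
  have [hPi nPi mPi] := hP it; have [nci hci] := hc it.
  have QE : Q = P i.
    apply/seteqP; split=> // a Pa.
    have Ica : I (c i * a).
      apply/hIP => j jt; have [hPj _ _] := hP jt.
      by have [->|ji] := eqVneq j i; [exact: idealMl|apply: idealMr => //; exact: hci].
    by have /mQ[/Qi|] := IQ _ Ica.
  (* For [Q = P i], take for [x] the sum of the [c j]. The product of [c i] with an element of [Q]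
     lies in every [P l], so it acts into [U0]; for [j] other than [i], [c j] lies in [Q], so
     [c j *: g] lies in [V]. *)
  have [||D hD] := low (\sum_(i < t) c i * 1).
  - by apply: (@sum_nzd (fun=> 1)) => j jt P1; case: (hP jt).
  - move=> e k Kk Qk; rewrite mulr_suml scaler_suml.
    have hWe := submodule_W V e; apply: (sub_sum _ hWe) => j _; rewrite mulr1.
    have [ji|ji] := eqVneq (j : nat) i.
      apply: saddl; first exact: submodule_smul.
      apply: IN; apply/hIP => l lt; have [hPl _ _] := hP lt.
      have [li|li] := eqVneq l i; first by rewrite li; apply: idealMl; rewrite -?QE.
      by apply: idealMr => //; rewrite ji; exact: hci.
    apply: saddr => //; rewrite mulrC -scalerA; apply: smul_in => //.
    have : Q (c j) by rewrite QE; have [_] := hc (ltn_ord j); apply; rewrite // eq_sym.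
    by [].
  exists (fun j => if j == i then (r j).+1 else r j), (C + D)%N => e.
  have -> : (\sum_(j < t) (if j == i :> nat then (r j).+1 else r j) * lenP (P j) e
      = \sum_(j < t) r j * lenP (P j) e + lenP Q e)%N.
    rewrite (bigD1 (Ordinal it)) //= eqxx [in RHS](bigD1 (Ordinal it)) //= mulSn QE.
    rewrite [in RHS]addnC addnA; congr (_ + _)%N; apply: eq_bigr => j.
    by rewrite -val_eqE /= => /negPf ->.
  have [h1 h2] := hr e; have := up e; have := hD e; rewrite lenE mulnDl; lia.
(* When [Q] is contained in no [P i], the element [x] can be chosen inside [Q], and the quotient by
   [Q] has growth [d] only. *)
have hw i : exists w, (i < t)%N -> Q w /\ ~ P i w.
  case: (pselect (i < t)%N) => it; last by exists 0.
  apply: contrapT => /forallNP h; apply: nQ; exists i; split=> // w Qw.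
  by apply: contrapT => nP; apply: (h w).
have /all_sig[w {}hw] : forall i, {w | (i < t)%N -> Q w /\ ~ P i w} by move=> i; exact: cid.
pose x := \sum_(i < t) c i * w i.
have hx : nzd I x by apply: sum_nzd => i it; case: (hw i it).
have Qx : Q x.
  by apply: ideal_sum => // i _; apply: idealMl => //; case: (hw i (ltn_ord i)).
have [|D hD] := low x hx.
  move=> e k Kk Qk; apply: saddr => //; rewrite mulrC -scalerA; exact: smul_in.
have [E hE] := growth_nzd hm hI hx hg.
have hQE e : (lenP Q e <= E * (nu e).+1 ^ d)%N.
  apply: (@len_leq A A^o) => //; first exact: ideal_ideal_add.
  apply: lenleS (hE (nu e)) => //; apply: ideal_addS => //.
  by apply: ideal_add_sub => //; apply: ideal_gen_sub => // _ ->.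
exists r, (C + D + E)%N => e.
by have [h1 h2] := hr e; have := up e; have := hD e; have := hQE e; rewrite lenE !mulnDl; lia.
Qed.

(** A maximal [ranked] submodule over [U0] is everything: otherwise an associated prime of the
    quotient would allow one more step. *)
Lemma rank_lemma : ranked [set: N].
Proof.
have r0 : ranked U0.
  exists (fun=> 0%N), 0%N => e; rewrite mul0n !addn0 big1 => [|i _]; last by rewrite mul0n.
  split=> //; rewrite /lenV.
  have -> : W U0 e = U0 by apply/seteqP; split; [exact: W_sub|apply: saddl; exact: submodule_smul].
  by rewrite len0.
have [V [[hV [UV rV]] _ Vmax]] := @noeth_max A N [set V | submodule V /\ (U0 `<=` V /\ ranked V)] U0
  hN (fun V h => proj1 h) (conj hU0 (conj (@subset_refl _ _) r0)).
have [<- //|nV] := pselect (V = [set: N]).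
have [g ng pg] := exists_prime_colon (local_noeth hm) hV nV.
have hgs : @submodule A N (span [set g]) by exact: span_submodule.
exfalso; apply: ng; apply: (Vmax (sadd V (span [set g]))).
- split; first exact: submodule_sadd.
  split; last exact: ranked_step.
  by apply: subset_trans UV _; exact: saddl.
- exact: saddl.
- by apply: saddr => //; exact: sub_span.
Qed.

End Fixed.
End RankLemma.

(** * Frobenius and existence of the limit *)

Definition frobe (A : comNzRingType) (p : nat) (hp : p \in [pchar A]) (e : nat) (x : A) : A :=
  x ^+ (p ^ e).

Section Frobe.
Variables (A : comNzRingType) (p : nat) (hp : p \in [pchar A]) (e : nat).

Lemma prime_pchar : prime p. Proof. by case/andP: hp. Qed.

Lemma exprDp (x y : A) : (x + y) ^+ (p ^ e) = x ^+ (p ^ e) + y ^+ (p ^ e).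
Proof. by apply: exprDn_pchar; rewrite pnatX pnatE ?prime_pchar // hp. Qed.

Lemma frobe_zmod : zmod_morphism (frobe hp e).
Proof.
move=> x y; apply/eqP; rewrite eq_sym subr_eq /frobe -exprDp subrK //.
Qed.
Lemma frobe_monoid : monoid_morphism (frobe hp e).
Proof. by split=> [|x y]; rewrite /frobe ?expr1n ?exprMn. Qed.
HB.instance Definition _ := GRing.isZmodMorphism.Build A A (frobe hp e) frobe_zmod.
HB.instance Definition _ := GRing.isMonoidMorphism.Build A A (frobe hp e) frobe_monoid.
End Frobe.

Section IdealPowers.
Variable A : comNzRingType.
Implicit Types (m I J : set A) (s : seq A).

Definition Ipow m a q := ideal_add (ideal_exp m a) (frobenius_power m q).

Lemma ideal_frobenius_power m q : ideal (frobenius_power m q).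
Proof. exact: ideal_ideal_gen. Qed.
Lemma ideal_Ipow m a q : ideal (Ipow m a q).
Proof.
by apply: ideal_ideal_add; [exact: ideal_ideal_exp|exact: ideal_frobenius_power].
Qed.
Lemma exp_Ipow m a q : ideal_exp m a `<=` Ipow m a q.
Proof. exact: ideal_addlP (ideal_frobenius_power _ _). Qed.
Lemma Ipow_sub m a q I : ideal I -> ideal_exp m a `<=` I ->
  (forall x, m x -> I (x ^+ q)) -> Ipow m a q `<=` I.
Proof.
move=> hI h1 h2; apply: ideal_add_sub => //; apply: ideal_gen_sub => //.
by move=> _ [x mx <-]; exact: h2.
Qed.

Definition monomials s k : set A :=
  [set x | exists2 al : nat -> nat, (\sum_(i < size s) al i = k)%N
         & x = \prod_(i < size s) s`_i ^+ al i].

Lemma exp_monomials s k :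
  ideal_exp (ideal_gen [set` s]) k `<=` ideal_gen (monomials s k).
Proof.
elim: k => [|k IH].
  move=> x _; rewrite -(mulr1 x); apply: (idealMl _ (ideal_ideal_gen _)).
  apply: sub_ideal_gen; exists (fun=> 0%N); first by rewrite big1.
  by rewrite big1 // => i _; rewrite expr0.
pose G := ideal_gen (monomials s k.+1); have hG : ideal G by exact: ideal_ideal_gen.
apply: (@smul_sub A A^o); first exact: hG.
move=> a y /ideal_gen_seqP[b ->] /IH.
have hI : ideal [set y | G ((\sum_(i < size s) b i * s`_i) * y)].
  by apply: ideal_ofP => [|u v|c u] /=; rewrite ?mulr0 ?mulrDr ?(mulrCA _ c);
    [exact: ideal0|exact: idealD|exact: idealMl].
move: y; apply: ideal_gen_sub => // _ [al sal ->] /=.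
rewrite /GRing.scale /= mulr_suml; apply: (ideal_sum _ hG) => j _; rewrite -mulrA; apply: (idealMl _ hG).
apply: sub_ideal_gen; exists (fun i => (al i + (i == j))%N).
  rewrite big_split /= sal (bigD1 j) //= eqxx big1 ?addn0 ?addn1 // => i.
  by rewrite -val_eqE /= => /negPf ->.
rewrite (bigD1 j) //= [in RHS](bigD1 j) //= eqxx addn1 exprS mulrA; congr (_ * _).
by apply: eq_bigr => i; rewrite -val_eqE /= => /negPf ->; rewrite addn0.
Qed.

(** A monomial of degree [q * (a + size s)] is divisible by the [q]-th power of the monomial whose
    exponents are the quotients by [q]. Each of the [size s] remainders is less than [q], so these
    quotients add up to at least [a]. *)
Lemma exp_sub_frobenius s a q : (0 < q)%N ->
  ideal_exp (ideal_gen [set` s]) (q * (a + size s)) `<=`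
  frobenius_power (ideal_exp (ideal_gen [set` s]) a) q.
Proof.
move=> q0 x /exp_monomials; move: x.
have hF := ideal_frobenius_power (ideal_exp (ideal_gen [set` s]) a) q.
apply: ideal_gen_sub => // _ [al sal ->].
have -> : \prod_(i < size s) s`_i ^+ al i =
    (\prod_(i < size s) s`_i ^+ (al i %% q)) * (\prod_(i < size s) s`_i ^+ (al i %/ q)) ^+ q.
  rewrite -prodrXl -big_split /=; apply: eq_bigr => i _.
  by rewrite -exprM -exprD addnC -divn_eq.
apply: (idealMl _ hF); apply: sub_ideal_gen.
exists (\prod_(i < size s) s`_i ^+ (al i %/ q)) => //.
apply: (@exp_antitone _ _ a (\sum_(i < size s) al i %/ q)).
  suff : (q * (a + size s) <= q * (\sum_(i < size s) al i %/ q) + q * size s)%N.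
    by rewrite -mulnDr leq_pmul2l // leq_add2r.
  have -> : (q * size s = \sum_(i < size s) q)%N by rewrite sum_nat_const card_ord mulnC.
  rewrite -sal big_distrr /= -big_split /=.
  apply: leq_sum => i _; rewrite {1}(divn_eq (al i) q) mulnC leq_add2l ltnW //.
  exact: ltn_pmod.
elim/big_rec2 : _ => [//|i y1 y2 _ IH].
apply: exp_mul => //; apply: expX; apply: sub_ideal_gen.
by rewrite /= mem_nth.
Qed.

End IdealPowers.

Section FrobeniusComparison.
Variables (A : comNzRingType) (m : set A) (hm : noetherian_local m).
Variables (p : nat) (hp : p \in [pchar A]).
Hypothesis perf : forall a, exists b, m (a - b ^+ p).

Lemma frobe_residue e a : exists b, m (a - frobe hp e b).
Proof.
have hmi := local_ideal hm.
elim: e a => [|e IH] a.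
  by exists a; rewrite /frobe expn0 expr1 subrr; exact: ideal0.
have [b hb] := IH a; have [c hc] := perf b; exists c.
have -> : a - frobe hp e.+1 c = (a - frobe hp e b) + frobe hp e (b - c ^+ p).
  by rewrite rmorphB /= /frobe -exprM -expnS addrA subrK.
apply: idealD => //; apply: idealX => //; rewrite expn_gt0 prime_gt0 //.
exact: prime_pchar hp.
Qed.

Section FFinite.
Variables (bs : seq A).
Hypothesis hbs : forall a, exists c : nat -> A, a = \sum_(i < size bs) c i ^+ p * bs`_i.

(** Writing a scalar as a combination of terms [c ^ p * b], its [p ^ e]-th power acts through the
    next Frobenius of [c] on [b ^ (p ^ e) *: x]. *)
Lemma fg_frobe (N : lmodType A) e : finitely_generated N ->
  finitely_generated (rscal (frobe hp e) N).
Proof.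
move=> [s hs]; elim: e => [|e [u hu]].
  exists s; apply/seteqP; split=> // x _; have : span [set` s] x by rewrite hs.
  move=> /span_seqP[c ->]; apply/(@span_seqP A (rscal (frobe hp 0) N)); exists c.
  have e0 (a : A) : frobe hp 0 a = a by rewrite /frobe expn0 expr1.
  by apply: eq_bigr => i _; exact: (congr1 (fun a => a *: nth 0 s i) (esym (e0 (c i)))).
exists [seq b ^+ (p ^ e) *: (x : N) | b <- bs, x <- u].
set T := span _; have hT : @submodule A (rscal (frobe hp e.+1) N) T by exact: span_submodule.
apply/seteqP; split=> // x _.
have : @span A (rscal (frobe hp e) N) [set` u] x by rewrite hu.
move=> /(@span_seqP A (rscal (frobe hp e) N))[c ->].
apply: (sub_sum _ hT) => i _; rewrite rscalE; have [c' ->] := hbs (c i).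
rewrite rmorph_sum scaler_suml; apply: (sub_sum _ hT) => j _.
rewrite rmorphM /= /frobe -exprM -expnS -scalerA.
apply: (@subZ A (rscal (frobe hp e.+1) N) _ (c' j) _ hT).
apply: (@sub_span A (rscal (frobe hp e.+1) N)); rewrite /=; apply/allpairsP.
by exists (bs`_j, nth 0 u i); rewrite !mem_nth.
Qed.
End FFinite.

Section OneModule.
Variables (N : lmodType A) (fgN : finitely_generated N) (U0 : set N) (I : set A) (x : A) (d : nat).
Hypotheses (hU0 : submodule U0) (hI : ideal I) (IN : forall a y, I a -> U0 (a *: y)).
Hypotheses (mx : m x) (hx : growth m (ideal_add I (ideal_gen [set x])) d).

Let M a := sadd U0 (smul (ideal_exp m a) [set: N]).
Lemma submodule_M a : submodule (M a).
Proof. by apply: submodule_sadd => //; exact: submodule_smul. Qed.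
Lemma M_antitone a b : (a <= b)%N -> M b `<=` M a.
Proof. by move=> ab; apply: saddS => //; apply: smulS => //; exact: exp_antitone. Qed.
Lemma finlen_M a : finlen (M a) [set: N]. Proof. exact: finlen_exp. Qed.

(** Multiplication by [x] maps [N / M a] to [N / M a.+1] with a cokernel of order [a ^ d], which
    bounds the difference of the two lengths, that is, the length of [M a / M a.+1]. *)
Lemma hilbert_bound : exists C, forall a, (len (M a.+1) (M a) <= C * a.+2 ^ d)%N.
Proof.
have [C hC] := hx; have [s hs] := fgN; exists (size s * C)%N => a.
have hM1 := submodule_M a.+1; have hM0 := submodule_M a.
have hX := @submodule_scaled A N x [set: N] (@submoduleT A N).
have hMX : submodule (sadd (M a.+1) (scaled x [set: N])) by exact: submodule_sadd.
have MM : M a.+1 `<=` M a by exact: M_antitone.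
have f1 := finlen_M a.+1.
have e1 := @lenD A N _ (M a) [set: N] hM1 hM0 (@submoduleT A N) MM (@subsetT _ _) f1.
have e2 := @lenD A N _ (sadd (M a.+1) (scaled x [set: N])) [set: N] hM1 hMX (@submoduleT A N)
  (saddl hX) (@subsetT _ _) f1.
have h1 : (len (M a.+1) (sadd (M a.+1) (scaled x [set: N])) <= len (M a) [set: N])%N.
  apply: leq_len => //; first exact: finlen_M.
  apply: (@chain_scaled _ _ x _ _ (M a.+1)) => //.
    move=> _ [u Uu [y hy <-]]; rewrite scalerDr; exists (x *: u); first exact: subZ.
    by exists (x *: y) => //; rewrite smul_expS //; exact: smul_in.
  by apply: chain_len => //; [exact: saddl|apply: finlenS f1].
have h2 : (len (sadd (M a.+1) (scaled x [set: N])) [set: N] <= size s * C * a.+2 ^ d)%N.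
  apply: len_leq => //; rewrite -mulnA; apply: (lenle_fg_sub hMX _ _ _ (hC a.+1)).
  - by apply: ideal_ideal_add; [apply: ideal_ideal_add => //; exact: ideal_ideal_gen|exact: ideal_ideal_exp].
  - by rewrite hs; exact: saddr.
  - move=> _ g [_ [b Ib [_ /ideal_gen1P[r ->] <-]] [z mz <-]] gs.
    rewrite !scalerDl; apply: subD => //; first apply: subD => //.
    + by apply: (saddl hX); apply: (saddl (submodule_smul _ _)); exact: IN.
    + by apply: (saddr hM1); exists (r *: g) => //; rewrite scalerA mulrC.
    + by apply: (saddl hX); apply: (saddr hU0); exact: smul_in.
lia.
Qed.

Lemma hilbert_bound_sum : exists C, forall a b,
  (len (M (a + b)) (M a) <= b * (C * (a + b).+1 ^ d))%N.
Proof.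
have [C hC] := hilbert_bound; exists C => a; elim=> [|b IH].
  by rewrite addn0 len0 //; exact: submodule_M.
rewrite addnS (@lenD _ _ _ (M (a + b))) //; [|exact: submodule_M..|exact: M_antitone| |].
- rewrite mulSn; apply: leq_add; first exact: hC.
  apply: leq_trans IH _; do 2!(rewrite leq_mul2l; apply/orP; right).
  by case: (d) => [//|d']; rewrite leq_exp2r.
- by apply: M_antitone; exact: leq_addr.
- by apply: (finlenS (@subset_refl _ _) (@subsetT _ _)); exact: finlen_M.
Qed.

Variables (nu : nat -> nat) (e0 : nat).
Hypothesis nu1 : forall e, (nu (e + e0) <= p ^ e0 * nu e)%N.
Hypothesis nu2 : forall e, (p ^ e0 * nu e <= nu (e + e0) + p ^ e0)%N.

Let N1 := rscal (frobe hp e0) N.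
Let K e := Ipow m (nu e) (p ^ e).

(* Replacing [e] by [e + e0] amounts to replacing [N] by its restriction of scalars along the
   [e0]-th iterate of Frobenius, except for the rounding in [nu]. *)
Lemma frobenius_comparison : exists C, forall e,
  (len (sadd U0 (smul (K (e + e0)) [set: N])) [set: N] <=
     @len A N1 (@sadd A N1 U0 (@smul A N1 (K e) [set: N1])) [set: N1])%N /\
  (@len A N1 (@sadd A N1 U0 (@smul A N1 (K e) [set: N1])) [set: N1] <=
     len (sadd U0 (smul (K (e + e0)) [set: N])) [set: N] + C * (nu e).+1 ^ d)%N.
Proof.
have [s hs] := local_noeth hm (local_ideal hm); have [D hD] := hilbert_bound_sum.
pose q := (p ^ e0)%N; have q0 : (0 < q)%N by rewrite expn_gt0 prime_gt0 // (prime_pchar hp).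
pose n := size s.
exists (q * n.+1 * (D * (q * n.+1) ^ d))%N => e.
pose Z : set N := @sadd A N1 U0 (@smul A N1 (K e) [set: N1]).
pose W := sadd U0 (smul (K (e + e0)) [set: N]).
have hW : submodule W by apply: submodule_sadd => //; exact: submodule_smul.
have hS : submodule (@smul A N1 (K e) [set: N1] : set N).
  split; first exact: (@sub0 A N1 _ (submodule_smul _ _)).
    by move=> y z; exact: (@subD A N1 _ _ _ (submodule_smul _ _)).
  move=> a; apply: (@smul_sub A N1).
    split; first by rewrite /= scaler0; exact: (@sub0 A N1 _ (submodule_smul _ _)).
      by move=> y z; rewrite /= scalerDr; exact: (@subD A N1 _ _ _ (submodule_smul _ _)).
    move=> b y; rewrite /= rscalE scalerA mulrC -scalerA.
    exact: (@subZ A N1 _ b _ (submodule_smul _ _)).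
  move=> b y Kb _; rewrite /= rscalE scalerA mulrC -scalerA.
  exact: (@smul_in A N1 _ _ b (a *: (y : N))).
have hZ : submodule (Z : set N) by exact: (@submodule_sadd A N U0 (@smul A N1 (K e) [set: N1])).
have frobI (J : set A) : ideal J -> ideal [set f | J (frobe hp e0 f)].
  move=> hJ; apply: ideal_ofP => [|f g|a f] /=; rewrite ?rmorph0 ?rmorphD ?rmorphM.
  - exact: ideal0.
  - exact: idealD.
  - exact: idealMl.
have ZW : Z `<=` W.
  apply: (@sadd_sub A N U0 (@smul A N1 (K e) [set: N1]) W hW).
    exact: (@saddl A N U0 (smul (K (e + e0)) [set: N]) (submodule_smul _ _)).
  apply: (@smul_sub A N1); first exact: (rscal_submodule (frobe hp e0) hW).
  move=> a y Ka _; apply: (saddr hU0); rewrite rscalE; apply: smul_in => //.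
  move: a Ka; apply: Ipow_sub; first exact: (frobI _ (ideal_Ipow _ _ _)).
    move=> a ma; apply: exp_Ipow; rewrite /frobe /=.
    apply: (@exp_antitone _ _ _ (p ^ e0 * nu e)) => //.
    have expXX k : ideal_exp m (k * nu e) (a ^+ k).
      elim: k => [//|k IHk]; rewrite exprS mulSn; exact: exp_mul.
    exact: expXX.
  move=> a ma; apply: (ideal_addrP (ideal_ideal_exp _ _)).
  by apply: sub_ideal_gen; exists a => //; rewrite expnD exprM.
(* For this exponent [exp_sub_frobenius] puts [m ^ B] into the [q]-th Frobenius power of [m ^ nu e],
   which acts into [Z]. *)
pose B := (q * (nu e + n))%N.
have MB : smul (ideal_exp m B) [set: N] `<=` Z.
  apply: smul_sub => // a y + _.
  rewrite -{1}hs => /(exp_sub_frobenius q0); rewrite hs; move: a.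
  apply: ideal_gen_sub; first exact: (ideal_colon y hZ).
  move=> _ [a ma <-]; rewrite /colon /=; apply: (saddr hU0).
  by apply: (@smul_in A N1 _ _ a y) => //; exact: exp_Ipow.
have fZ : finlen (Z : set N) [set: N].
  apply: finlenS (finlen_M B) => //; apply: sadd_sub => //; apply: saddl.
  exact: hS.
have -> : @len A N1 Z [set: N1] = @len A N Z [set: N].
  exact: (@len_rscal A A (frobe hp e0) m N (frobe_residue e0) Z [set: N] B).
have e1 := @lenD A N Z W [set: N] hZ hW (@submoduleT A N) ZW (@subsetT _ _) fZ.
rewrite -/W e1; split; first exact: leq_addl.
rewrite addnC leq_add2l; pose a := nu (e + e0).
have ab : (a <= B)%N by apply: leq_trans (nu1 e) _; rewrite leq_mul2l leq_addr orbT.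
have hMa := submodule_M a; have hMB := submodule_M B.
have W' : W `<=` sadd Z (M a).
  apply: sadd_sub; first exact: submodule_sadd.
    by move=> y Uy; apply: (saddr hZ); apply: (saddl (submodule_smul _ _)).
  apply: smul_sub; first exact: submodule_sadd.
  move=> b y + _; move: b; apply: Ipow_sub.
  - by apply: (ideal_colon y); exact: submodule_sadd.
  - move=> b mb; apply: (saddr hZ); apply: (saddr hU0); exact: smul_in.
  - move=> b mb; rewrite /colon /=; apply: (saddl hMa); apply: (saddr hU0).
    have -> : b ^+ (p ^ (e + e0)) = frobe hp e0 (b ^+ (p ^ e)) by rewrite /frobe -exprM -expnD.
    apply: (@smul_in A N1 (K e) _ (b ^+ (p ^ e)) y) => //.
    by apply: (ideal_addrP (ideal_ideal_exp _ _)); apply: sub_ideal_gen; exists b.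
have sZM : submodule (sadd Z (M a)) by exact: submodule_sadd.
(* [W] lies in [Z + M a] and [M B] lies in [Z], so the defect is bounded by the layers between [a]
   and [B]. Their number is bounded independently of [e], because [nu] is multiplicative in powers
   of [p] up to a constant. *)
have h : (len Z W <= len (M B) (M a))%N.
  have Ba : M B `<=` M a by exact: M_antitone.
  apply: (@leq_trans (len Z (sadd Z (M a)))).
    by apply: len_mono => //; exact: finlenS fZ.
  apply: leq_len => //; first by apply: finlenS (finlen_M B).
  apply: (@chain_second_iso_inv A N (M B) Z (M a)) => //.
    move=> y My; split; last exact: Ba.
    by move: y My; apply: sadd_sub => //; apply: saddl; exact: hS.
  by apply: chain_len => //; [exact: saddl|exact: finlenS fZ].
apply: leq_trans h _; rewrite -{1}(subnKC ab); apply: leq_trans (hD _ _) _; rewrite subnKC //.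
have h1 : (B - a <= q * n.+1)%N.
  by have := nu2 e; rewrite -/q -/a /B mulnDr mulnS; lia.
have h2 : (B.+1 ^ d <= (q * n.+1) ^ d * (nu e).+1 ^ d)%N.
  rewrite -expnMn; have : (B.+1 <= q * n.+1 * (nu e).+1)%N.
    rewrite /B -mulnA ltn_pmul2l // mulSn mulnS; lia.
  by case: (d) => // d'; rewrite leq_exp2r.
apply: leq_trans (leq_mul h1 (leq_mul (leqnn D) h2)) _.
by rewrite !mulnA.
Qed.

End OneModule.
End FrobeniusComparison.

Section CeilExp.
Variables (RR : realType) (p : nat) (s : RR).
Hypotheses (s0 : 0 < s) (p0 : (0 < p)%N).

Lemma ceil_exp_itv e : s * (p ^ e)%:R <= (ceil_exp p s e)%:R < s * (p ^ e)%:R + 1.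
Proof.
have h0 : 0 < s * (p ^ e)%:R by rewrite mulr_gt0 // ltr0n expn_gt0 p0.
have hc : 0 <= Num.ceil (s * (p ^ e)%:R) by rewrite ltW // ceil_gt0.
rewrite /ceil_exp; have -> : (`|Num.ceil (s * (p ^ e)%:R)|%N)%:R = (Num.ceil (s * (p ^ e)%:R))%:~R :> RR.
  by rewrite -[X in _ = X%:~R](gez0_abs hc).
have /andP[h1 h2] := ceil_itv (s * (p ^ e)%:R).
by rewrite h2 /= -ltrBlDr; move: h1; rewrite intrD.
Qed.

Lemma ceil_exp_mulr e e0 : (ceil_exp p s (e + e0) <= p ^ e0 * ceil_exp p s e)%N.
Proof.
rewrite -ltnS -(ltr_nat RR) -addn1 natrD.
have /andP[_ h] := ceil_exp_itv (e + e0); apply: lt_le_trans h _.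
rewrite lerD2r expnD natrM mulrA mulrC natrM ler_wpM2l //.
by have /andP[] := ceil_exp_itv e.
Qed.

Lemma ceil_exp_mull e e0 : (p ^ e0 * ceil_exp p s e <= ceil_exp p s (e + e0) + p ^ e0)%N.
Proof.
rewrite -(ler_nat RR) natrD natrM.
have /andP[h _] := ceil_exp_itv (e + e0); apply: le_trans (lerD h (lexx _)).
rewrite expnD natrM mulrA [_ * (p ^ e0)%:R]mulrC -{3}(mulr1 (p ^ e0)%:R) -mulrDr ler_wpM2l //.
by have /andP[_ /ltW] := ceil_exp_itv e.
Qed.
End CeilExp.

Section Sequences.
Variables (RR : realType) (p d : nat).
Hypothesis p1 : (1 < p)%N.

Let P : RR := p%:R.
Let P0 : 0 < P. Proof. by rewrite ltr0n ltnW. Qed.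
Let P2 : 2 <= P. Proof. by rewrite (ler_nat RR 2). Qed.

Lemma cvg_expVn (C : RR) : (fun e => C * P^-1 ^+ e) @ \oo --> (0 : RR).
Proof.
rewrite -[X in _ --> X](mulr0 C); apply: cvgMr; apply: cvg_expr.
rewrite ger0_norm ?invr_ge0 ?(ltW P0) // invf_lt1 //.
by apply: lt_le_trans P2; rewrite ltr1n.
Qed.

(** For the normalized sequence [b] and [q = p ^ d.+1], the hypotheses read [q b (e + 1) = rho b e]
    up to [C / p ^ e]. If [rho <= q], [b + t] is nonincreasing; otherwise [b - t] is nondecreasing.
    Here [t] dominates the tail of the errors, and its factor 2 suffices because [p >= 2]. *)
Lemma seq_cvg_rec (x : nat -> nat) rho C D :
  (forall e, (x e.+1 <= rho * x e + C * p ^ (e * d))%N) ->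
  (forall e, (rho * x e <= x e.+1 + C * p ^ (e * d))%N) ->
  (forall e, (x e <= D * p ^ (e * d.+1))%N) ->
  cvgn (fun e => (x e)%:R / (p ^ (e * d.+1))%:R : RR).
Proof.
move=> h1 h2 h3; set b := fun e => _.
have pe e k : 0 < (p ^ (e * k))%:R :> RR by rewrite ltr0n expn_gt0 ltnW.
pose q : RR := P ^+ d.+1; have q0 : 0 < q by exact: exprn_gt0.
have q1 : 1 <= q by rewrite exprn_ege1 // (le_trans _ P2) // ler1n.
have bS e : q * b e.+1 = (x e.+1)%:R / (p ^ (e * d.+1))%:R.
  rewrite /b mulSn expnD natrM natrX -/P -/q; field.
  by rewrite gt_eqF ?gt_eqF.
have pV e : (p ^ (e * d))%:R / (p ^ (e * d.+1))%:R = P^-1 ^+ e :> RR.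
  by rewrite mulnS expnD natrM exprVn [in RHS]/P -natrX; field; rewrite !gt_eqF // ltr0n expn_gt0 ltnW.
have b0 e : 0 <= b e by rewrite divr_ge0.
have bD e : b e <= D%:R by rewrite ler_pdivrMr // -natrM ler_nat.
have u1 e : q * b e.+1 <= rho%:R * b e + C%:R * P^-1 ^+ e.
  rewrite bS -pV /b !mulrA -mulrDl ler_pM2r ?invr_gt0 //.
  by rewrite -!natrM -natrD ler_nat.
have u2 e : rho%:R * b e <= q * b e.+1 + C%:R * P^-1 ^+ e.
  rewrite bS -pV /b !mulrA -mulrDl ler_pM2r ?invr_gt0 //.
  by rewrite -!natrM -natrD ler_nat.
pose t e : RR := 2 * C%:R * P^-1 ^+ e.
have tcv : cvgn t by apply/cvg_ex; exists 0; exact: cvg_expVn.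
have t0 e : 0 <= P^-1 ^+ e by rewrite exprn_ge0 // invr_ge0 ltW.
have tS e : C%:R * P^-1 ^+ e + t e.+1 <= t e.
  rewrite /t exprS; set z := P^-1 ^+ e; have z0 : 0 <= z by exact: t0.
  have hP : 2 * P^-1 <= 1 by rewrite ler_pdivrMr // mul1r.
  have -> : 2 * C%:R * (P^-1 * z) = 2 * P^-1 * (C%:R * z) by ring.
  have : 2 * P^-1 * (C%:R * z) <= 1 * (C%:R * z) by apply: ler_wpM2r => //; rewrite mulr_ge0.
  by rewrite -mulrA; lra.
have sub (u v : nat -> RR) : cvgn u -> cvgn (u \+ v) -> cvgn v.
  move=> cu cuv; have -> : v = (u \+ v) \- u by apply/funext => e /=; ring.
  exact: is_cvgB.
case: (lerP rho%:R q) => hrq.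
  apply: (sub t) => //; apply: nonincreasing_is_cvgn.
    apply/nonincreasing_seqP => e /=; suff : b e.+1 <= b e + C%:R * P^-1 ^+ e.
      by have := tS e; lra.
    rewrite -(ler_pM2l q0); apply: le_trans (u1 e) _; rewrite mulrDr; apply: lerD.
      exact: ler_wpM2r.
    by rewrite ler_peMl // mulr_ge0.
  exists 0 => _ [e _ <-]; rewrite /= addr_ge0 // /t mulr_ge0 // mulr_ge0 //.
apply: (sub (fun e => - t e)); first exact: is_cvgN.
apply: nondecreasing_is_cvgn.
  apply/nondecreasing_seqP => e /=; suff : b e <= b e.+1 + C%:R * P^-1 ^+ e.
    by have := tS e; lra.
  rewrite -(ler_pM2l q0); apply: (@le_trans _ _ (rho%:R * b e)).
    by apply: ler_wpM2r => //; exact: ltW.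
  apply: le_trans (u2 e) _; rewrite mulrDr lerD2l ler_peMl // mulr_ge0 //.
exists D%:R => _ [e _ <-] /=; have := bD e; have : 0 <= t e; last by lra.
by rewrite /t !mulr_ge0.
Qed.

Lemma seq_cvg_sum (a : nat -> nat) (t : nat) (r : nat -> nat) (x : nat -> nat -> nat) e0 C :
  (forall i, (i < t)%N -> cvgn (fun e => (x i e)%:R / (p ^ (e * d.+1))%:R : RR)) ->
  (forall e, (a (e + e0) <= \sum_(i < t) r i * x i e + C * p ^ (e * d))%N) ->
  (forall e, (\sum_(i < t) r i * x i e <= a (e + e0) + C * p ^ (e * d))%N) ->
  cvgn (fun e => (a e)%:R / (p ^ (e * d.+1))%:R : RR).
Proof.
move=> hx h1 h2.
have pe e k : 0 < (p ^ (e * k))%:R :> RR by rewrite ltr0n expn_gt0 ltnW.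
have pV e : (p ^ (e * d))%:R / (p ^ (e * d.+1))%:R = P^-1 ^+ e :> RR.
  by rewrite mulnS expnD natrM exprVn [in RHS]/P -natrX; field; rewrite !gt_eqF // ltr0n expn_gt0 ltnW.
pose S e : RR := (\sum_(i < t) r i * x i e)%:R / (p ^ (e * d.+1))%:R.
have cS : cvgn S.
  rewrite /S {h1 h2 S}; elim: t hx => [|t IH] hx.
    have -> : (fun e => (\sum_(i < 0) r i * x i e)%:R / (p ^ (e * d.+1))%:R : RR) = fun=> 0.
      by apply/funext => e; rewrite big_ord0 mul0r.
    exact: is_cvg_cst.
  have -> : (fun e => (\sum_(i < t.+1) r i * x i e)%:R / (p ^ (e * d.+1))%:R : RR) =
     (fun e => (\sum_(i < t) r i * x i e)%:R / (p ^ (e * d.+1))%:R) \+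
     (fun e => (r t)%:R * ((x t e)%:R / (p ^ (e * d.+1))%:R)).
    by apply/funext => e; rewrite big_ord_recr natrD mulrDl natrM /= mulrA.
  apply: is_cvgD; first by apply: IH => i it; apply: hx; exact: ltnW.
  apply: is_cvgM; [exact: is_cvg_cst|exact: hx].
pose w e : RR := (a (e + e0)%N)%:R / (p ^ (e * d.+1))%:R.
have hw e : S e - C%:R * P^-1 ^+ e <= w e <= S e + C%:R * P^-1 ^+ e.
  rewrite lerBlDr /S /w -pV mulrA -!mulrDl !ler_pM2r ?invr_gt0 //.
  by rewrite -natrM -!natrD !ler_nat h1 h2.
have cw : cvgn w.
  apply/cvg_ex; exists (limn S); apply: (squeeze_cvgr (nearW _ hw)).
    rewrite -[X in _ --> X]subr0; apply: cvgB => //; exact: cvg_expVn.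
  rewrite -[X in _ --> X]addr0; apply: cvgD => //; exact: cvg_expVn.
have q0 : 0 < (p ^ (e0 * d.+1))%:R :> RR by [].
apply/cvg_ex; exists (limn w / (p ^ (e0 * d.+1))%:R).
rewrite -(cvg_shiftn e0).
have -> : [sequence (a (n + e0)%N)%:R / (p ^ ((n + e0) * d.+1))%:R : RR]_n =
   (fun e => w e * (p ^ (e0 * d.+1))%:R^-1).
  apply/funext => e; rewrite /w /= mulnDl expnD natrM invfM mulrA //.
by apply: cvgM => //; exact: cvg_cst.
Qed.

End Sequences.

Section LimitTheorem.
Variables (RR : realType) (A : comNzRingType) (m : set A) (hm : noetherian_local m).
Variables (p : nat) (hp : p \in [pchar A]) (s : RR).
Hypothesis perf : forall a, exists b, m (a - b ^+ p).
Variables (bs : seq A).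
Hypothesis hbs : forall a, exists c : nat -> A, a = \sum_(i < size bs) c i ^+ p * bs`_i.
Hypothesis s0 : 0 < s.

Let pp : prime p := prime_pchar hp.
Let nu := ceil_exp p s.
Let K e := Ipow m (nu e) (p ^ e).
Let hK e : ideal (K e) := ideal_Ipow _ _ _.
Let mK e : ideal_exp m (nu e) `<=` K e := @exp_Ipow _ _ _ _.

Lemma nu_leq e : ((nu e).+1 <= (nu 0).+1 * p ^ e)%N.
Proof.
have := ceil_exp_mulr s0 (prime_gt0 pp) 0 e; rewrite add0n -/nu mulnC => h.
rewrite mulSn; apply: leq_ltn_trans h _.
by rewrite -[X in (X < _)%N]add0n ltn_add2r expn_gt0 prime_gt0.
Qed.

Lemma nu_exp e d : ((nu e).+1 ^ d <= (nu 0).+1 ^ d * p ^ (e * d))%N.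
Proof.
by rewrite expnM -expnMn; case: d => // d; rewrite leq_exp2r // nu_leq.
Qed.

Lemma smul_regular (I : set A) : ideal I -> @smul A A^o I [set: A] = I.
Proof.
move=> hI; apply/seteqP; split; first by apply: (@smul_sub A A^o) => // a x Ia _; exact: idealMr.
by move=> x Ix; rewrite -(mulr1 x); exact: (@smul_in A A^o).
Qed.

Lemma prime_expn (Q : set A) z n : prime_ideal Q -> Q (z ^+ n) -> Q z.
Proof.
move=> [hQ n1 mQ]; elim: n => [|n IH]; rewrite ?expr0 ?exprS; last by case/mQ.
by move=> h; rewrite (ideal_full hQ h).
Qed.

(** Over a single prime there is a single rank: up to lower order, the lengths on the Frobenius
    push-forward of [A / Q] are [r 0] times those on [A / Q], which is the recursion of
    [seq_cvg_rec]. *)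
Lemma prime_ratio_cvg (Q : set A) x d : prime_ideal Q -> m x -> ~ Q x ->
  growth m Q d.+1 -> growth m (ideal_add Q (ideal_gen [set x])) d ->
  cvgn (fun e => (@len A A^o (ideal_add Q (K e)) [set: A])%:R / (p ^ (e * d.+1))%:R : RR).
Proof.
move=> pQ mx nQx gQ gQx; have [hQ nQ1 mQ] := pQ.
have QN a (y : A) : Q a -> Q (a * y) by exact: idealMr.
have [C1 h1] := frobenius_comparison hm hp perf (fg_regular A) hQ hQ QN mx gQx
  (fun e => ceil_exp_mulr s0 (prime_gt0 pp) e 1) (fun e => ceil_exp_mull s0 (prime_gt0 pp) e 1).
pose N1 := rscal (frobe hp 1) A^o.
have fgN1 : finitely_generated N1 by exact: (fg_frobe hp hbs 1 (fg_regular A)).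
have hQ1 : @submodule A N1 Q by exact: (@rscal_submodule A A (frobe hp 1) A^o Q).
have QN1 a (y : N1) : Q a -> Q (a *: y).
  by move=> Qa; rewrite rscalE; apply: QN; apply: idealX => //; rewrite expn1 prime_gt0.
have hQP a : Q a <-> forall i, (i < 1)%N -> Q a by split=> [//|h]; exact: (h 0%N).
have hc i : (i < 1)%N -> ~ Q 1 /\ forall j, (j < 1)%N -> j != i -> Q 1.
  by move=> i1; split=> // j j1; rewrite (_ : j = i) ?eqxx //; lia.
have [r [C2 h2]] := @rank_lemma A m hm Q 1 (fun=> Q) (fun=> 1) d hQ hQP
  (fun _ _ => pQ) hc gQ N1 Q K nu fgN1 hQ1 QN1 hK mK.
have e1 e : @sadd A A^o Q (@smul A A^o (K e) [set: A]) = ideal_add Q (K e) by rewrite smul_regular.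
have [D hD] := gQ.
apply: (@seq_cvg_rec _ p d (prime_gt1 pp) _ (r 0%N) ((C1 + C2) * (nu 0).+1 ^ d) (D * (nu 0).+1 ^ d.+1)).
- move=> e; have [a1 a2] := h1 e; have [b1 b2] := h2 e.
  move: a1 a2 b1 b2; rewrite addn1 !big_ord1 -/nu -/(K _) -/(K _) e1 => a1 a2 b1 b2.
  apply: leq_trans a1 _; apply: leq_trans b1 _; rewrite leq_add2l -mulnA.
  by apply: leq_mul; [exact: leq_addl|exact: nu_exp].
- move=> e; have [a1 a2] := h1 e; have [b1 b2] := h2 e.
  move: a1 a2 b1 b2; rewrite addn1 !big_ord1 -/nu -/(K _) -/(K _) e1 => a1 a2 b1 b2.
  apply: leq_trans b2 _; apply: leq_trans (leq_add a2 (leqnn _)) _.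
  by rewrite -addnA leq_add2l -mulnDl -mulnA leq_mul2l nu_exp orbT.
- move=> e; apply: (@leq_trans (D * (nu e).+1 ^ d.+1)).
    apply: (@len_leq A A^o) => //; first exact: ideal_ideal_add.
    by apply: lenleS (hD (nu e)) => //; exact: ideal_addS.
  by rewrite -mulnA leq_mul2l nu_exp orbT.
Qed.

Section Module.
Variables (N : lmodType A) (U0 : set N) (I : set A) (d : nat).
Hypotheses (fgN : finitely_generated N) (hU0 : submodule U0) (hI : ideal I).
Hypothesis IN : forall a y, I a -> U0 (a *: y).
Hypothesis gI : growth m I d.+1.

(** The ideal [I] may fail to be radical. After [n] Frobenius push-forwards, the intersection [J] of
    the [P i] acts into [U0], since [p ^ n]-th powers of its elements lie in [I]. The rank lemma
    then applies to the push-forward, and the lengths for each [P i] converge. *)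
Lemma length_ratio_cvg :
  cvgn (fun e => (len (sadd U0 (smul (K e) [set: N])) [set: N])%:R / (p ^ (e * d.+1))%:R : RR).
Proof.
have [t [P [hP [n hn] hc]]] := radical_primes (local_noeth hm) hI.
have hmi := local_ideal hm.
have hW e : submodule (sadd U0 (smul (K e) [set: N])).
  by apply: submodule_sadd => //; exact: submodule_smul.
(* If [m] is one of the [P i], then [I] contains a power of [m] and the lengths are bounded, so the
   recursion holds with [rho = 0]. *)
have [[i [it mPi]]|nmP] := pselect (exists i, (i < t)%N /\ m `<=` P i).
  have mI z : m z -> I (z ^+ n.+1).
    move=> mz; rewrite exprS; apply: idealMl => //; apply: hn => j jt.
    have [->|ji] := eqVneq j i; first exact: mPi.
    have [ci [nci hci]] := hc i it; have [[hPj nj _] _] := hP j jt.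
    have /(local_unit hm)[u hu] : ~ m ci by move=> /mPi.
    by case: nj; rewrite -hu; apply: idealMl => //; exact: hci.
  have [sm hs] := local_noeth hm hmi; pose B := (n.+1 * (1 + size sm))%N.
  have BI : ideal_exp m B `<=` I.
    rewrite -{1}hs => x /(exp_sub_frobenius (ltn0Sn n)); rewrite hs (exp1_sub hmi); move: x.
    by apply: ideal_gen_sub => // _ [z mz <-]; exact: mI.
  have [c hcB] := @finlen_exp A m hm N U0 B fgN hU0.
  apply: (@seq_cvg_rec _ p d (prime_gt1 pp) _ 0 (c * p ^ d) (c * p ^ d)) => e; last 2 first.
  - by rewrite mul0n.
  - rewrite (@leq_trans c) //; last by rewrite -mulnA leq_pmulr // muln_gt0 !expn_gt0 prime_gt0.
    apply: len_leq => //; apply: lenleS hcB => //.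
    apply: sadd_sub => //; first exact: saddl (submodule_smul _ _).
    by apply: smul_sub => // a x /BI Ia _; apply: (saddl (submodule_smul _ _)); exact: IN.
  rewrite mul0n add0n (@leq_trans c) //; last by rewrite -mulnA leq_pmulr // muln_gt0 !expn_gt0 prime_gt0.
  apply: len_leq => //; apply: lenleS hcB => //.
  apply: sadd_sub => //; first exact: saddl (submodule_smul _ _).
  by apply: smul_sub => // a x /BI Ia _; apply: (saddl (submodule_smul _ _)); exact: IN.
have /all_sig[y hy] : forall i, {y | (i < t)%N -> m y /\ ~ P i y}.
  move=> i; apply: cid; case: (pselect (i < t)%N) => it; last by exists 0.
  apply: contrapT => /forallNP h; apply: nmP; exists i; split=> // z mz.
  by apply: contrapT => nP; apply: (h z).
have /all_sig[c0 hc0] : forall i, {c | (i < t)%N -> ~ P i c /\ forall j, (j < t)%N -> j != i -> P j c}.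
  move=> i; apply: cid; case: (pselect (i < t)%N) => it; last by exists 0.
  by have [c h] := hc i it; exists c.
pose J : set A := [set a | forall i, (i < t)%N -> P i a].
have hPi i : (i < t)%N -> prime_ideal (P i) by move=> /hP[].
have hJ : ideal J.
  apply: ideal_ofP => [i it|a b ha hb i it|a b hb i it]; have [h _ _] := hPi i it.
  - exact: ideal0.
  - by apply: idealD => //; [exact: ha|exact: hb].
  - by apply: idealMl => //; exact: hb.
have IJ : I `<=` J by move=> a Ia i it; have [_] := hP i it; exact.
have gJ : growth m J d.+1 by exact: growthS gI.
have hJP a : J a <-> forall i, (i < t)%N -> P i a by [].
pose x := \sum_(i < t) c0 i * y i.
have hx : nzd J x by apply: (sum_nzd hJP hPi hc0) => i it; case: (hy i it).
have mx : m x by apply: ideal_sum => // i _; apply: idealMl => //; case: (hy i (ltn_ord i)).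
have gJx := growth_nzd hm hJ hx gJ.
have hgx : ideal (ideal_gen [set x]) by exact: ideal_ideal_gen.
have gIx : growth m (ideal_add I (ideal_gen [set x])) d.
  apply: (growth_primes hm); first exact: ideal_ideal_add.
  move=> Q pQ IQ; apply: growthS gJx; have [hQ _ _] := pQ.
  apply: ideal_add_sub => //; last by apply: subset_trans IQ; exact: ideal_addrP.
  move=> z Jz; apply: (prime_expn (n := n) pQ); apply: IQ; apply: ideal_addlP => //.
  exact: hn.
have nPx i : (i < t)%N -> ~ P i x.
  move=> it Px; have [hPi' nP1 _] := hPi i it; have [nci hci] := hc0 i it.
  have /hx Jc : J (c0 i * x).
    move=> j jt; have [hPj _ _] := hPi j jt.
    by have [->|ji] := eqVneq j i; [exact: idealMl|apply: idealMr => //; exact: hci].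
  by apply: nci; exact: Jc.
have pn : (n <= p ^ n)%N by apply: ltnW; rewrite ltn_expl // prime_gt1.
pose N1 := rscal (frobe hp n) N.
have fgN1 : finitely_generated N1 by exact: (fg_frobe hp hbs n fgN).
have hU1 : @submodule A N1 U0 by exact: (@rscal_submodule A A (frobe hp n) N U0).
have JN1 a (z : N1) : J a -> U0 (a *: z).
  move=> Ja; have Ia : I (a ^+ (p ^ n)) by rewrite -(subnK pn) exprD; apply: idealMl => //; exact: hn.
  by rewrite rscalE; exact: IN.
have [r [C2 h2]] := @rank_lemma A m hm J t P c0 d hJ hJP hPi hc0 gJ
  N1 U0 K nu fgN1 hU1 JN1 hK mK.
have [C1 h1] := frobenius_comparison hm hp perf fgN hU0 hI IN mx gIx
  (fun e => ceil_exp_mulr s0 (prime_gt0 pp) e n) (fun e => ceil_exp_mull s0 (prime_gt0 pp) e n).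
apply: (@seq_cvg_sum _ p d (prime_gt1 pp) _ t r
  (fun i e => @len A A^o (ideal_add (P i) (K e)) [set: A]) n ((C1 + C2) * (nu 0).+1 ^ d)).
- move=> i it; apply: (@prime_ratio_cvg (P i) x) => //; [exact: hPi|exact: nPx| |].
    by apply: growthS gI; case: (hP i it).
  by apply: growthS gJx; apply: ideal_addS => // a; exact.
- move=> e; have [a1 a2] := h1 e; have [b1 b2] := h2 e.
  apply: leq_trans a1 _; apply: leq_trans b1 _; rewrite leq_add2l -mulnA.
  by apply: leq_mul; [exact: leq_addl|exact: nu_exp].
- move=> e; have [a1 a2] := h1 e; have [b1 b2] := h2 e.
  apply: leq_trans b2 _; apply: leq_trans (leq_add a2 (leqnn _)) _.
  by rewrite -addnA leq_add2l -mulnDl -mulnA leq_mul2l nu_exp orbT.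
Qed.
End Module.
End LimitTheorem.

(** * Power series *)

Local Notation mdeg := mpoly.mdeg.
Local Notation mcoeff := mpoly.mcoeff.

Section MPSeries.
Variables (n : nat) (K : comNzRingType).
Local Notation mon := (mpoly.multinom n).
Local Notation S := (mpseries n K).
Local Notation P := (mpoly.mpoly n K).
Local Notation "m1 +m m2" := (mpoly.mnm_add m1 m2) (at level 50).
Local Notation "m1 -m m2" := (mpoly.mnm_sub m1 m2) (at level 50).

Lemma mpsD (f g : S) m : (f + g) m = f m + g m. Proof. by []. Qed.
Lemma mpsB (f g : S) m : (f - g) m = f m - g m. Proof. by []. Qed.
Lemma mps_sum (J : Type) (r : seq J) (Q : pred J) (F : J -> S) m :
  (\sum_(j <- r | Q j) F j) m = \sum_(j <- r | Q j) F j m.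
Proof. by elim/big_rec2 : _ => [//|j x y _ <-]. Qed.

Definition mps_of (q : P) : S := fun m => mcoeff m q.

Lemma mps_of_zmod : zmod_morphism mps_of.
Proof. by move=> q r; apply/funext => m; rewrite /mps_of raddfB. Qed.
Lemma mps_of_monoid : monoid_morphism mps_of.
Proof.
split; first by apply/funext => m; rewrite /mps_of mpoly.mcoeff1.
move=> q r; apply/funext => m; apply/esym.
by rewrite -[_ m]/(mpseries_mul _ _ m) (@mpseries_mulE _ _ _ _ q r (mdeg m).+1).
Qed.
HB.instance Definition _ := GRing.isZmodMorphism.Build P S mps_of mps_of_zmod.
HB.instance Definition _ := GRing.isMonoidMorphism.Build P S mps_of mps_of_monoid.

Definition mpsC : {rmorphism K -> S} := mps_of \o @mpoly.mpolyC n K.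

Definition vanish d : set S := [set f | forall m, (mdeg m < d)%N -> f m = 0].

Lemma vanish_mul a b (f g : S) : vanish a f -> vanish b g -> vanish (a + b) (f * g).
Proof.
move=> hf hg m hm; rewrite -[LHS]/(mpseries_mul f g m) /mpseries_mul big1 // => c /eqP e.
have hd : mdeg m = (mdeg c.1 + mdeg c.2)%N by rewrite [in LHS]e mpoly.mdegD.
case: (ltnP (mdeg c.1) a) => h1; first by rewrite hf ?mul0r.
by rewrite hg ?mulr0 // -(ltn_add2l (mdeg c.1)) -hd (leq_trans hm) // leq_add2r.
Qed.
Lemma vanish0 (f : S) : vanish 0 f. Proof. by []. Qed.
Lemma ideal_vanish d : ideal (vanish d).
Proof.
apply: ideal_ofP => [//|f g hf hg m hm|f g hg].
  by rewrite mpsD hf ?hg ?addr0.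
by rewrite -[d]add0n; exact: vanish_mul.
Qed.
Lemma vanishS a b : (a <= b)%N -> vanish b `<=` vanish a.
Proof. by move=> ab f hf m hm; apply: hf; exact: leq_trans ab. Qed.
Lemma vanish_eq0 (f : S) : (forall d, vanish d f) -> f = 0.
Proof. by move=> h; apply/funext => m; exact: (h (mdeg m).+1). Qed.

Lemma trunc_vanish d (f : S) : vanish d (f - mps_of (mpseries_trunc d f)).
Proof. by move=> m hm; rewrite mpsB /mps_of mpseries_truncE ?subrr. Qed.

Lemma mps_mulXm (al : mon) (f : S) m :
  (mps_of (mpoly.mpolyX K al) * f) m = if mpoly.lem al m then f (m -m al) else 0.
Proof.
rewrite -[LHS]/(mpseries_mul _ _ m).
have hX m' : (mdeg m' < (mdeg m).+1)%N ->
    mcoeff m' (mpoly.mpolyX K al) = mps_of (mpoly.mpolyX K al) m'.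
  by [].
rewrite (mpseries_mulE hX (Q := mpseries_trunc (mdeg m).+1 f) (d := (mdeg m).+1)) //; last first.
  by move=> m'; exact: mpseries_truncE.
case: ifP => [le|hi].
  rewrite mulrC -{1}(mpoly.submK le) mpoly.addmC mpoly.mcoeffMX mpseries_truncE //.
  by rewrite ltnS; exact: mpoly.mdegB.
rewrite mpoly.mcoeffM big1 // => c /eqP e; rewrite mpoly.mcoeffX.
case: eqVneq => [e1|]; last by rewrite mul0r.
move/negP: hi; case; apply/mpoly.mnm_lepP => i.
by have := congr1 (fun m : mon => m i) e; rewrite mpoly.mnmDE -e1 /= => ->; exact: leq_addr.
Qed.

Lemma mps_mulX i (f : S) m :
  (mps_of (mpoly.mpolyX K (mpoly.mnm1 i)) * f) m =
  if (0 < m i)%N then f (m -m mpoly.mnm1 i) else 0.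
Proof.
rewrite mps_mulXm; congr (if _ then _ else _); apply/mpoly.mnm_lepP/idP => [/(_ i)|hi j].
  by rewrite mpoly.mnm1E eqxx.
by rewrite mpoly.mnm1E; case: eqVneq => [<-|].
Qed.

Definition Xs : seq S := [seq mps_of (mpoly.mpolyX K (mpoly.mnm1 i)) | i <- enum 'I_n].

Lemma vanish_divX d (f : S) : vanish d.+1 f -> exists g : 'I_n -> S,
  (forall i, vanish d (g i)) /\
  f = \sum_i mps_of (mpoly.mpolyX K (mpoly.mnm1 i)) * g i.
Proof.
move=> hf.
(* Each monomial is divided by the first variable that occurs in it. *)
exists (fun (i : 'I_n) (m : mon) => if [forall j : 'I_n, (j < i)%N ==> (m j == 0%N)] then f (m +m mpoly.mnm1 i) else 0).
split.
  move=> i m hm; case: ifP => // _; apply: hf.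
  by rewrite mpoly.mdegD mpoly.mdeg1 addn1 ltnS.
apply/funext => m; rewrite mps_sum.
have [/eqP m0|m0] := boolP (mdeg m == 0%N).
  rewrite hf ?m0 // big1 // => i _; rewrite mps_mulX; case: ltnP => //.
  by move/eqP: m0; rewrite mpoly.mdeg_eq0 => /eqP ->; rewrite mpoly.mnm0E.
have [i0 hi0] : exists i, (m i != 0)%N.
  apply/existsP; apply: contraNT m0; rewrite negb_exists mpoly.mdeg_eq0 => /forallP h.
  by apply/eqP/mpoly.mnmP => i; rewrite mpoly.mnm0E; apply/eqP; move: (h i); rewrite negbK.
pose i1 := [arg min_(i < i0 | m i != 0%N) (i : nat)].
have [hi1 min1] : m i1 != 0%N /\ forall j : 'I_n, m j != 0%N -> (i1 <= j)%N.
  by rewrite /i1; case: arg_minnP.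
rewrite (bigD1 i1) //= mps_mulX lt0n hi1 [X in _ + X]big1 ?addr0 => [|i ii1]; last first.
  rewrite mps_mulX; case: ltnP => // hi; case: ifP => // /forallP /(_ i1).
  have li : (i1 < i)%N by rewrite ltn_neqAle min1 -?lt0n // andbT val_eqE eq_sym.
  rewrite li mpoly.mnmBE mpoly.mnm1E; rewrite (negPf ii1) subn0 => /eqP e.
  by rewrite e in hi1.
rewrite mpoly.submK; last first.
  by apply/mpoly.mnm_lepP => j; rewrite mpoly.mnm1E; case: eqVneq => [<-|] //; rewrite lt0n.
case: ifP => // /negP[]; apply/forallP => j; apply/implyP => ji; rewrite mpoly.mnmBE.
apply: contraLR ji => h; rewrite -leqNgt; apply: min1.
by apply: contraNneq h => ->.
Qed.

Lemma ideal_gen_Xs : ideal_gen [set` Xs] = vanish 1.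
Proof.
apply/seteqP; split.
  apply: ideal_gen_sub; first exact: ideal_vanish.
  move=> _ /mapP[i _ ->] m; rewrite ltnS leqn0 mpoly.mdeg_eq0 => /eqP ->.
  by rewrite /mps_of mpoly.mcoeffX mpoly.mnm1_eq0.
move=> f /vanish_divX[g [_ ->]]; apply: ideal_sum; first exact: ideal_ideal_gen.
move=> i _; apply: (idealMr _ (ideal_ideal_gen _)); apply: sub_ideal_gen.
by apply/mapP; exists i => //; rewrite mem_enum.
Qed.

Lemma exp_vanish d : ideal_exp (vanish 1) d = vanish d.
Proof.
elim: d => [|d IH]; first by apply/seteqP; split.
rewrite ideal_expS IH; apply/seteqP; split.
  apply: (@smul_sub S S^o); first exact: ideal_vanish.
  by move=> f g hf hg; exact: (vanish_mul hf hg).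
move=> f /vanish_divX[g [hg ->]].
apply: (@sub_sum S S^o _ _ _ _ _ (@submodule_smul S S^o _ _)) => i _.
apply: (@smul_in S S^o) => //; rewrite -ideal_gen_Xs; apply: sub_ideal_gen.
by apply/mapP; exists i => //; rewrite mem_enum.
Qed.

Lemma vanish_agree d (f g h : S) : vanish d (g - h) -> vanish d (f * g - f * h).
Proof. by rewrite -mulrBr; exact: idealMl (ideal_vanish d). Qed.

(* Sum of a series whose [j]-th term has order at least [j - c]. *)
Definition mps_series c (h : nat -> S) : S := fun m => \sum_(j < (mdeg m).+1 + c) h j m.

Lemma mps_seriesE c (h : nat -> S) d : (forall j, vanish (j - c) (h j)) ->
  vanish d (mps_series c h - \sum_(j < d + c) h j).
Proof.
move=> hh m hm; rewrite mpsB /mps_series mps_sum.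
rewrite -(big_mkord xpredT (fun j => h j m)) -(big_mkord xpredT (fun j => h j m)).
rewrite (@big_cat_nat _ _ _ ((mdeg m).+1 + c) 0 (d + c)) //= ?leq_add2r //.
have -> : \sum_((mdeg m).+1 + c <= j < d + c) h j m = 0.
  by rewrite big_nat_cond big1 // => j; rewrite andbT => /andP[h1 _]; apply: hh; lia.
by rewrite addr0 subrr.
Qed.

End MPSeries.

Section MPSeriesField.
Variables (n : nat) (K : fieldType).
Local Notation mon := (mpoly.multinom n).
Local Notation S := (mpseries n K).

Lemma mpsC_const (c : K) m : mpsC n K c m = c * (m == mpoly.mnm0)%:R.
Proof. by rewrite /= /mps_of mpoly.mcoeffC. Qed.

Lemma vanish1P (f : S) : vanish 1 f <-> f mpoly.mnm0 = 0.
Proof.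
split=> [h|h m]; first by apply: h; rewrite mpoly.mdeg0.
by rewrite ltnS leqn0 mpoly.mdeg_eq0 => /eqP ->.
Qed.

Lemma vanish1_const (f : S) : vanish 1 (f - mpsC n K (f mpoly.mnm0)).
Proof. by apply/vanish1P; rewrite mpsB mpsC_const eqxx mulr1 subrr. Qed.

Lemma mps_unit (f : S) : ~ vanish 1 f -> exists g, g * f = 1.
Proof.
move=> /vanish1P/eqP f0; pose c := f mpoly.mnm0.
pose h := 1 - mpsC n K c^-1 * f.
have hh : vanish 1 h.
  apply/vanish1P; rewrite /h mpsB mpseries_mul_const mpsC_const eqxx mulr1 mulVf ?subrr //.
  by rewrite -[X in X - _]/((_ == _)%:R) eqxx subrr.
have hX j : vanish (j - 0) (h ^+ j).
  rewrite subn0; elim: j => [//|j IH]; rewrite exprS -add1n; exact: vanish_mul.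
exists (mps_series 0 (fun j => h ^+ j) * mpsC n K c^-1); rewrite -mulrA.
have -> : mpsC n K c^-1 * f = 1 - h by rewrite /h opprB addrC subrK.
apply/eqP; rewrite -subr_eq0; apply/eqP/vanish_eq0 => d.
have := @vanish_agree _ _ d (1 - h) _ _ (@mps_seriesE _ _ 0 _ d hX); rewrite addn0.
set G := mps_series _ _; have -> : \sum_(j < d) h ^+ j = \sum_(0 <= j < d) h ^+ j by rewrite big_mkord.
have -> : (1 - h) * \sum_(0 <= j < d) h ^+ j = 1 - h ^+ d.
  by rewrite big_mkord -(opprB h 1) mulNr -subrX1 opprB.
move=> hv.
have -> : G * (1 - h) - 1 = ((1 - h) * G - (1 - h ^+ d)) - h ^+ d by rewrite [G * _]mulrC; ring.
have hd : vanish d (h ^+ d) by have := hX d; rewrite subn0.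
exact: (@idealB S _ _ _ (@ideal_vanish n K d) hv hd).
Qed.

Lemma field_noetherian : noetherian K.
Proof.
move=> I hI; have [[x [Ix x0]]|h] := pselect (exists x, I x /\ x != 0).
  exists [:: 1]; rewrite [RHS]ideal_full //; last first.
    by rewrite -(mulVf x0); exact: idealMl.
  by apply: ideal_full; [exact: ideal_ideal_gen|apply: sub_ideal_gen; rewrite /= mem_head].
exists [::]; apply/seteqP; split; first by apply: ideal_gen_sub.
move=> x Ix; have [->|x0] := eqVneq x 0; first exact: ideal0 (ideal_ideal_gen _).
by case: h; exists x.
Qed.

(** [Id] collects the [t] whose coefficient of each degree [j] agrees through order [j] with a
    member of [U]. Members [w k l] of [U] approximating the coefficients of finitely many generators
    of [Id] generate [U]: an element is reduced one order at a time, and the multipliers found at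
    order [i] have order at least [i - c], so they can be summed. *)
Lemma mps_noetherian : noetherian S.
Proof.
move=> U hU; have hv d := @ideal_vanish n K d.
have sX x : x \in Xs n K -> vanish 1 x.
  by move=> xs; rewrite -ideal_gen_Xs; exact: sub_ideal_gen.
have [T [f [hT fC fX fm]]] := rees_algebra (mpsC n K) field_noetherian (hv 1%N) sX.
have fv t i : vanish i (f t)`_i by rewrite -exp_vanish; exact: fm.
pose R i : set S := [set y | exists y' t, f t = y' *: 'X^i /\ vanish i.+1 (y - y')].
have idR i : ideal (R i).
  apply: ideal_ofP.
  - by exists 0, 0; rewrite rmorph0 scale0r subr0; split=> //; exact: (ideal0 (hv _)).
  - move=> y z [y' [t [et hy]]] [z' [u [eu hz]]]; exists (y' + z'), (t + u).
    by rewrite rmorphD et eu scalerDl opprD addrACA; split=> //; exact: (idealD (hv _)).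
  - move=> a y [y' [t [et hy]]]; have [u eu] := fC (a mpoly.mnm0).
    have y'v : vanish i y' by have := fv t i; rewrite et coefZ coefXn eqxx mulr1.
    exists (mpsC n K (a mpoly.mnm0) * y'), (u * t).
    rewrite rmorphM et eu mul_polyC scalerA; split=> //.
    set c := mpsC _ _ _; have -> : a * y - c * y' = a * (y - y') + (a - c) * y' by ring.
    apply: (idealD (hv _)); first exact: (idealMl _ (hv _)).
    by rewrite -add1n; apply: vanish_mul => //; exact: vanish1_const.
have vR i : vanish i `<=` R i.
  elim: i => [|i IH].
    move=> y _; rewrite -(mulr1 y); apply: (idealMl _ (idR _)).
    by exists 1, 1; rewrite rmorph1 expr0 alg_polyC subrr; split=> //; exact: (ideal0 (hv _)).
  rewrite -exp_vanish ideal_expS exp_vanish; apply: (@smul_sub S S^o); first exact: (idR i.+1).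
  move=> a y; rewrite -{1}ideal_gen_Xs => ha hy; move: a ha.
  have [y' [t [et hy']]] := IH y hy.
  have idc : ideal [set a | R i.+1 (a * y)].
    by apply: ideal_ofP => [|a b|c a] /=; rewrite ?mul0r ?mulrDl -?mulrA;
      [exact: (ideal0 (idR _))|exact: (idealD (idR _))|exact: (idealMl _ (idR _))].
  apply: ideal_gen_sub => // x xs; have [u eu] := fX x xs.
  exists (x * y'), (u * t); rewrite rmorphM et eu -scalerAl -scalerAr scalerA -exprS; split=> //.
  by rewrite -mulrBr -add1n; apply: vanish_mul => //; exact: sX.
pose Id : set T := [set t | forall j, exists2 u, U u & vanish j.+1 ((f t)`_j - u)].
have hId : ideal Id.
  apply: ideal_ofP.
  - by move=> j; exists 0; [exact: (ideal0 hU)|rewrite rmorph0 coef0 subrr; exact: (ideal0 (hv _))].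
  - move=> t u ht hu j; have [v Uv hv'] := ht j; have [w Uw hw] := hu j.
    exists (v + w); first exact: (idealD hU).
    by rewrite rmorphD coefD opprD addrACA; exact: (idealD (hv _)).
  - move=> t u hu j; have /all_sig[w hw] : forall l, {w | U w /\ vanish l.+1 ((f u)`_l - w)}.
      by move=> l; apply: cid; have [w ? ?] := hu l; exists w.
    exists (\sum_(i < j.+1) (f t)`_i * w (j - i)%N).
      by apply: (ideal_sum _ hU) => i _; apply: (idealMl _ hU); case: (hw (j - i)%N).
    rewrite rmorphM coefM -sumrB; apply: (ideal_sum _ (hv _)) => i _; rewrite -mulrBr.
    have {1}<- : (i + (j - i).+1)%N = j.+1 by rewrite addnS subnKC // -ltnS.
    by apply: vanish_mul => //; case: (hw (j - i)%N).
have [gs hgs] := hT _ hId.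
pose c := \max_(g <- gs) size (f g).
have wE k l : {w | U w /\ ((k < size gs)%N -> vanish l.+1 ((f gs`_k)`_l - w))}.
  apply: cid; case: (pselect (k < size gs)%N) => hk; last by exists 0; split=> //; exact: (ideal0 hU).
  have : Id gs`_k by rewrite -hgs; apply: sub_ideal_gen; rewrite /= mem_nth.
  by move=> /(_ l)[u Uu hu]; exists u.
pose w k l := projT1 (wE k l).
have Uw k l : U (w k l) by case: (projT2 (wE k l)).
have hw k l : (k < size gs)%N -> vanish l.+1 ((f gs`_k)`_l - w k l) by case: (projT2 (wE k l)).
pose comb (a : nat -> nat -> S) := \sum_(k < size gs) \sum_(l < c.+1) a k l * w k l.
have Ucomb a : U (comb a).
  by apply: (ideal_sum _ hU) => k _; apply: (ideal_sum _ hU) => l _; exact: (idealMl _ hU).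
pose G := [seq w k l | k <- iota 0 (size gs), l <- iota 0 c.+1].
exists G; have hG := ideal_ideal_gen [set` G].
apply/seteqP; split.
  by apply: ideal_gen_sub => // _ /allpairsP[kl [_ _ ->]].
move=> y Uy.
have step i z : U z -> vanish i z -> exists a : nat -> nat -> S,
    (forall k l, vanish (i - c) (a k l)) /\ vanish i.+1 (z - comb a).
  move=> Uz vz; have [z' [t [et hz']]] := vR i z vz.
  have : Id t.
    move=> j; rewrite et coefZ coefXn; case: eqVneq => [->|_]; last first.
      by exists 0; [exact: (ideal0 hU)|rewrite mulr0 subrr; exact: (ideal0 (hv _))].
    by exists z => //; rewrite mulr1 -opprB; exact: (@subN S S^o _ _ (hv _)).
  rewrite -hgs => /ideal_gen_seqP[b eb].
  exists (fun k l => if (l <= minn i c)%N then (f (b k))`_(i - l) else 0); split.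
    move=> k l; case: leqP => hl; last exact: (ideal0 (hv _)).
    by apply: vanishS (fv _ _); lia.
  have -> : z - comb (fun k l => if (l <= minn i c)%N then (f (b k))`_(i - l) else 0) =
      (z - z') + \sum_(k < size gs) \sum_(l < c.+1)
        (if (l <= minn i c)%N then (f (b k))`_(i - l) else 0) * ((f gs`_k)`_l - w k l).
    rewrite -(subrKA z'); congr (_ + _).
    have -> : z' = (f t)`_i by rewrite et coefZ coefXn eqxx mulr1.
    rewrite eb rmorph_sum coef_sum -sumrB; apply: eq_bigr => k _.
    rewrite rmorphM coefMr.
    under [in RHS]eq_bigr do rewrite mulrBr.
    rewrite sumrB; congr (_ - _).
    have szk l : (c < l)%N -> (f gs`_k)`_l = 0.
      move=> cl; apply: nth_default; apply: leq_trans (ltnW cl).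
      by rewrite /c (big_nth 0) big_mkord (leq_bigmax k).
    rewrite (big_ord_widen (i.+1 + c.+1) (fun l => (f (b k))`_(i - l) * (f gs`_k)`_l)) ?leq_addr //.
    rewrite (big_ord_widen (i.+1 + c.+1)
      (fun l => (if (l <= minn i c)%N then (f (b k))`_(i - l) else 0) * (f gs`_k)`_l)) ?leq_addl //.
    rewrite big_mkcond [RHS]big_mkcond; apply: eq_bigr => l _; rewrite !ltnS leq_min.
    case: (leqP l i) => hli; case: (leqP l c) => hlc //=; rewrite ?mul0r //.
    by rewrite szk ?mulr0.
  apply: (idealD (hv _)) => //.
  apply: (ideal_sum _ (hv _)) => k _; apply: (ideal_sum _ (hv _)) => l _.
  case: leqP => hl; last by rewrite mul0r; exact: (ideal0 (hv _)).
  have {1}<- : (i - l + l.+1)%N = i.+1 by lia.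
  by apply: vanish_mul => //; exact: hw.
have stE iz : {a : nat -> nat -> S | U iz.2 -> vanish iz.1 iz.2 ->
    (forall k l, vanish (iz.1 - c) (a k l)) /\ vanish iz.1.+1 (iz.2 - comb a)}.
  apply: cid; case: (pselect (U iz.2 /\ vanish iz.1 iz.2)) => [[h1 h2]|h].
    by have [a ha] := step _ _ h1 h2; exists a.
  by exists (fun _ _ => 0) => h1 h2; case: h.
pose st i z := projT1 (stE (i, z)).
(* [zs i] is the remainder after [i] corrections; it lies in [U] and has order at least [i]. *)
pose zs := fix zs i := if i is i'.+1 then zs i' - comb (st i' (zs i')) else y.
have zsP i : U (zs i) /\ vanish i (zs i).
  elim: i => [//|i [h1 h2]] /=; split; first exact: (idealB hU).
  by case: (projT2 (stE (i, zs i)) h1 h2).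
pose a i := st i (zs i).
have av i k l : vanish (i - c) (a i k l).
  by case: (zsP i) => h1 h2; case: (projT2 (stE (i, zs i)) h1 h2) => ha _; exact: ha.
have zsE d : y - \sum_(i < d) comb (a i) = zs d.
  elim: d => [|d IH]; first by rewrite big_ord0 subr0.
  by rewrite big_ord_recr /= opprD addrA IH.
pose h k l := mps_series c (fun i => a i k l).
have -> : y = comb h.
  apply/eqP; rewrite -subr_eq0; apply/eqP/vanish_eq0 => d.
  have -> : y - comb h = zs (d + c)%N - (comb h - \sum_(i < d + c) comb (a i)).
    by rewrite -zsE; ring.
  apply: (idealB (hv _)).
    by case: (zsP (d + c)%N) => _; apply: vanishS; exact: leq_addr.
  rewrite /comb [X in _ - X]exchange_big -sumrB /=; apply: (ideal_sum _ (hv _)) => k _.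
  rewrite [X in _ - X]exchange_big -sumrB /=; apply: (ideal_sum _ (hv _)) => l _.
  rewrite -mulr_suml -mulrBl; apply: (idealMr _ (hv _)).
  exact: mps_seriesE.
apply: (ideal_sum _ hG) => k _; apply: (ideal_sum _ hG) => l _.
apply: (idealMl _ hG); apply: sub_ideal_gen.
by apply/allpairsP; exists (k : nat, l : nat); split; rewrite ?mem_iota ?add0n ?ltn_ord //=; exact: ltn_ord.
Qed.

Lemma mps_noetherian_local : noetherian_local (vanish 1 : set S).
Proof.
have hv d := @ideal_vanish n K d.
have n1 : ~ vanish 1 (1 : S).
  by move/vanish1P; rewrite -[LHS]/((_ == _)%:R) eqxx => /eqP; rewrite oner_eq0.
have sub J : ideal J -> ~ J 1 -> J `<=` (vanish 1 : set S).
  move=> hJ J1 f Jf; apply: contrapT => /mps_unit[g e].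
  by apply: J1; rewrite -e; exact: idealMl.
split; first exact: mps_noetherian.
  by split=> // J hJ J1 IJ; apply/seteqP; split=> //; exact: sub.
by move=> J [hJ J1 hmax]; apply/esym/hmax => //; exact: sub.
Qed.

Lemma mps_pchar p : p \in [pchar K] -> p \in [pchar S].
Proof. exact: (rmorph_pchar (mpsC n K)). Qed.

Section Frobenius.
Variables (p : nat) (hp : p \in [pchar K]).
Hypothesis perf : forall a : K, exists b, a = b ^+ p.

Lemma mps_expp (g : S) m :
  (g ^+ p) m = if [forall i, (p %| m i)%N]
    then g (mpoly.Multinom [tuple (m i %/ p)%N | i < n]) ^+ p else 0.
Proof.
have p0 : (0 < p)%N by rewrite prime_gt0 ?(pcharf_prime hp).
set d := (mdeg m).+1; set q := mpseries_trunc d g.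
have -> : (g ^+ p) m = (mps_of q ^+ p) m.
  apply/eqP; rewrite -subr_eq0 -mpsB subrXX; apply/eqP.
  apply: (idealMr _ (@ideal_vanish n K d)) (ltnSn _); exact: trunc_vanish.
have hP : p \in [pchar (mpoly.mpoly n K)] := rmorph_pchar (@mpoly.mpolyC n K) hp.
have -> : mps_of q ^+ p = mps_of (q ^+ p) by rewrite rmorphXn.
rewrite /mps_of -[q ^+ p]/(pFrobenius_aut hP q) /q /mpseries_trunc rmorph_sum /=.
rewrite raddf_sum /=.
under eq_bigr => m' _ do rewrite pFrobenius_autE exprZn mpoly.mpolyXn mpoly.mcoeffZ mpoly.mcoeffX.
set m1 := mpoly.Multinom _; case: ifP => [/forallP hm|hm]; last first.
  rewrite big1 // => m' _; case: eqVneq => [e|]; last by rewrite mulr0.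
  by move/negP: hm; case; apply/forallP => i; rewrite -e mpoly.mulmnE dvdn_mull.
have e1 : mpoly.mnm_muln m1 p = m.
  by apply/mpoly.mnmP => i; rewrite mpoly.mulmnE mpoly.mnmE divnK.
have d1 : (mdeg m1 < d)%N.
  by rewrite ltnS -e1 mpoly.mdegMn leq_pmulr.
rewrite (bigD1 (mpoly.BMultinom d1)) //= e1 eqxx mulr1 big1 ?addr0 // => m' hm'.
case: eqVneq => [e|]; last by rewrite mulr0.
case/negP: hm'; apply/eqP/val_inj/mpoly.mnmP => i /=.
by rewrite mpoly.mnmE -e mpoly.mulmnE mulnK.
Qed.

Definition mnm_digits (al : {ffun 'I_n -> 'I_p}) : mon :=
  mpoly.Multinom [tuple (al i : nat) | i < n].

(** The monomials are sorted by their exponents modulo [p], and coefficients have [p]-th roots since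
    [K] is perfect. *)
Lemma mps_ffinite : exists s : seq S, forall f : S, exists c : nat -> S,
  f = \sum_(i < size s) c i ^+ p * s`_i.
Proof.
have p0 : (0 < p)%N by rewrite prime_gt0 ?(pcharf_prime hp).
pose X (al : {ffun 'I_n -> 'I_p}) : S := mps_of (mpoly.mpolyX K (mnm_digits al)).
exists [seq X al | al <- enum {ffun 'I_n -> 'I_p}] => f.
have /all_sig[rt hrt] : forall a : K, {b | a = b ^+ p} by move=> a; apply: cid.
pose g al : S := fun m => rt (f (mpoly.mnm_add (mnm_digits al) (mpoly.mnm_muln m p))).
have e : f = \sum_al g al ^+ p * X al.
  apply/funext => m; rewrite mps_sum.
  pose al0 : {ffun 'I_n -> 'I_p} := [ffun i => Ordinal (ltn_pmod (m i) p0)].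
  rewrite (bigD1 al0) //= mulrC mps_mulXm ifT; last first.
    by apply/mpoly.mnm_lepP => i; rewrite mpoly.mnmE ffunE /= leq_mod.
  rewrite mps_expp ifT; last first.
    apply/forallP => i; rewrite mpoly.mnmBE mpoly.mnmE ffunE /=.
    by rewrite {1}(divn_eq (m i) p) addnK dvdn_mull.
  rewrite /g -hrt; set m' := mpoly.mnm_add _ _.
  have -> : m' = m.
    apply/mpoly.mnmP => i; rewrite /m' mpoly.mnmDE mpoly.mulmnE !mpoly.mnmE ffunE /=.
    by rewrite {2}(divn_eq (m i) p) addnK mulnK // addnC -divn_eq.
  rewrite big1 ?addr0 // => al hal; rewrite mulrC mps_mulXm; case: ifP => // /mpoly.mnm_lepP hle.
  rewrite mps_expp; case: ifP => // /forallP hdv; case/negP: hal; apply/eqP/ffunP => i.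
  apply: val_inj; rewrite ffunE /=; move: (hdv i) (hle i); rewrite mpoly.mnmBE mpoly.mnmE.
  move=> /dvdnP[c ec] hl; rewrite -(subnK hl) ec modnMDl modn_small //.
exists (fun i => g (nth [ffun=> Ordinal p0] (enum {ffun 'I_n -> 'I_p}) i)).
rewrite size_map {1}e; set E := enum _.
have -> : \sum_al g al ^+ p * X al = \sum_(al <- E) g al ^+ p * X al by rewrite big_enum.
rewrite (big_nth [ffun=> Ordinal p0]) big_mkord.
apply: eq_bigr => i _; congr (_ * _).
exact/esym/(nth_map [ffun=> Ordinal p0] 0 X (ltn_ord i)).
Qed.

End Frobenius.

End MPSeriesField.

(** * Perfect closure and linear retractions *)

Section PerfectClosure.
Local Open Scope quotient_scope.
Variables (k : fieldType) (p : nat) (hp : p \in [pchar k]).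
Local Notation F := (frobe hp).

Lemma frobe_comp i j a : F i (F j a) = F (i + j) a.
Proof. by rewrite /frobe -exprM -expnD addnC. Qed.

(* [(e, a)] stands for the [p ^ e]-th root of [a]. *)
Definition pcl_equiv (x y : nat * k) := F y.1 x.2 == F x.1 y.2.

Lemma pcl_equiv_refl : reflexive pcl_equiv.
Proof. by move=> x; exact: eqxx. Qed.
Lemma pcl_equiv_sym : symmetric pcl_equiv.
Proof. by move=> x y; rewrite /pcl_equiv eq_sym. Qed.
Lemma pcl_equiv_trans : transitive pcl_equiv.
Proof.
move=> y x z /eqP exy /eqP eyz; apply/eqP/(fmorph_inj (F y.1)).
by rewrite /= !frobe_comp addnC -frobe_comp exy frobe_comp addnC -frobe_comp eyz frobe_comp addnC.
Qed.
Canonical pcl_equiv_equiv :=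
  EquivRel pcl_equiv pcl_equiv_refl pcl_equiv_sym pcl_equiv_trans.

Definition pclosure := {eq_quot pcl_equiv}.
HB.instance Definition _ : EqQuotient _ pcl_equiv pclosure := EqQuotient.on pclosure.
HB.instance Definition _ := Choice.on pclosure.

Lemma pcl_reprP x : F (repr (\pi_pclosure x)).1 x.2 = F x.1 (repr (\pi_pclosure x)).2.
Proof.
have /eqmodP/eqP e : x = repr (\pi_pclosure x) %[mod pclosure] by rewrite reprK.
exact: e.
Qed.

Definition pcl_add0 (x y : nat * k) := ((x.1 + y.1)%N, F y.1 x.2 + F x.1 y.2).
Definition pcl_add := lift_op2 pclosure pcl_add0.
Lemma pi_pcl_add : {morph \pi : x y / pcl_add0 x y >-> pcl_add x y}.
Proof.
move=> x y; unlock pcl_add; apply/eqmodP/eqP; rewrite /= !rmorphD /= !frobe_comp.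
have := pcl_reprP x; have := pcl_reprP y.
set x' := repr (\pi_pclosure x); set y' := repr (\pi_pclosure y) => ey ex.
have -> : (x'.1 + y'.1 + y.1 = (y'.1 + y.1) + x'.1)%N by lia.
have -> : (x'.1 + y'.1 + x.1 = (x'.1 + x.1) + y'.1)%N by lia.
have -> : (x.1 + y.1 + y'.1 = (y'.1 + y.1) + x.1)%N by lia.
have -> : (x.1 + y.1 + x'.1 = (x'.1 + x.1) + y.1)%N by lia.
by rewrite -[F (_ + x'.1) _]frobe_comp -[F (_ + y'.1) _]frobe_comp ex ey !frobe_comp.
Qed.
Canonical pi_pcl_add_morph := PiMorph2 pi_pcl_add.

Definition pcl_mul0 (x y : nat * k) := ((x.1 + y.1)%N, F y.1 x.2 * F x.1 y.2).
Definition pcl_mul := lift_op2 pclosure pcl_mul0.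
Lemma pi_pcl_mul : {morph \pi : x y / pcl_mul0 x y >-> pcl_mul x y}.
Proof.
move=> x y; unlock pcl_mul; apply/eqmodP/eqP; rewrite /= !rmorphM /= !frobe_comp.
have := pcl_reprP x; have := pcl_reprP y.
set x' := repr (\pi_pclosure x); set y' := repr (\pi_pclosure y) => ey ex.
have -> : (x'.1 + y'.1 + y.1 = (y'.1 + y.1) + x'.1)%N by lia.
have -> : (x'.1 + y'.1 + x.1 = (x'.1 + x.1) + y'.1)%N by lia.
have -> : (x.1 + y.1 + y'.1 = (y'.1 + y.1) + x.1)%N by lia.
have -> : (x.1 + y.1 + x'.1 = (x'.1 + x.1) + y.1)%N by lia.
by rewrite -[F (_ + x'.1) _]frobe_comp -[F (_ + y'.1) _]frobe_comp ex ey !frobe_comp.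
Qed.
Canonical pi_pcl_mul_morph := PiMorph2 pi_pcl_mul.

Definition pcl_opp0 (x : nat * k) := (x.1, - x.2).
Definition pcl_opp := lift_op1 pclosure pcl_opp0.
Lemma pi_pcl_opp : {morph \pi : x / pcl_opp0 x >-> pcl_opp x}.
Proof.
by move=> x; unlock pcl_opp; apply/eqmodP/eqP; rewrite /= !rmorphN /= pcl_reprP.
Qed.
Canonical pi_pcl_opp_morph := PiMorph1 pi_pcl_opp.

Definition pcl_inv0 (x : nat * k) := (x.1, x.2^-1).
Definition pcl_inv := lift_op1 pclosure pcl_inv0.
Lemma pi_pcl_inv : {morph \pi : x / pcl_inv0 x >-> pcl_inv x}.
Proof.
by move=> x; unlock pcl_inv; apply/eqmodP/eqP; rewrite /= !fmorphV /= pcl_reprP.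
Qed.
Canonical pi_pcl_inv_morph := PiMorph1 pi_pcl_inv.

Definition pcl_of := lift_embed pclosure (fun a : k => (0%N, a)).
Canonical pcl_of_pi_morph := PiEmbed pcl_of.

Lemma frobe0 a : F 0 a = a. Proof. by rewrite /frobe expr1. Qed.

Lemma pcl_addA : associative pcl_add.
Proof.
elim/quotW=> x; elim/quotW=> y; elim/quotW=> z; rewrite !piE; congr (\pi _).
by rewrite /pcl_add0 /= !rmorphD /= !frobe_comp !addnA !addrA [(z.1 + y.1)%N]addnC [(z.1 + x.1)%N]addnC.
Qed.
Lemma pcl_addC : commutative pcl_add.
Proof. by elim/quotW=> x; elim/quotW=> y; rewrite !piE /pcl_add0 addrC addnC. Qed.
Lemma pcl_add0l : left_id (pcl_of 0) pcl_add.
Proof.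
by elim/quotW=> x; rewrite !piE /pcl_add0 /= rmorph0 add0r frobe0; case: x.
Qed.
Lemma pcl_addN : left_inverse (pcl_of 0) pcl_opp pcl_add.
Proof.
elim/quotW=> x; apply/eqP; rewrite !piE /pcl_equiv /pcl_add0 /=.
by rewrite rmorphN addNr !rmorph0.
Qed.
HB.instance Definition _ := GRing.isZmodule.Build pclosure pcl_addA pcl_addC pcl_add0l pcl_addN.

Lemma pcl_mulA : associative pcl_mul.
Proof.
elim/quotW=> x; elim/quotW=> y; elim/quotW=> z; rewrite !piE; congr (\pi _).
by rewrite /pcl_mul0 /= !rmorphM /= !frobe_comp !addnA !mulrA [(z.1 + y.1)%N]addnC [(z.1 + x.1)%N]addnC.
Qed.
Lemma pcl_mulC : commutative pcl_mul.
Proof. by elim/quotW=> x; elim/quotW=> y; rewrite !piE /pcl_mul0 mulrC addnC. Qed.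
Lemma pcl_mul1 : left_id (pcl_of 1) pcl_mul.
Proof.
by elim/quotW=> x; rewrite !piE /pcl_mul0 /= rmorph1 mul1r frobe0; case: x.
Qed.
Lemma pcl_mulDl : left_distributive pcl_mul pcl_add.
Proof.
elim/quotW=> x; elim/quotW=> y; elim/quotW=> z; apply/eqP.
rewrite !piE /pcl_equiv /pcl_mul0 /pcl_add0 /= !(rmorphD, rmorphM) /= !frobe_comp mulrDl.
by apply/eqP; congr (_ * _ + _ * _); congr (F _ _); lia.
Qed.
Lemma pcl_1neq0 : pcl_of 1 != pcl_of 0.
Proof. by rewrite piE /pcl_equiv /= !frobe0 oner_eq0. Qed.
HB.instance Definition _ :=
  GRing.Zmodule_isComNzRing.Build pclosure pcl_mulA pcl_mulC pcl_mul1 pcl_mulDl pcl_1neq0.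

Lemma pcl_mulV a : a != pcl_of 0 -> pcl_mul (pcl_inv a) a = pcl_of 1.
Proof.
elim/quotW: a => x; rewrite !piE /pcl_equiv /= frobe0 rmorph0 => x0.
apply/eqmodP/eqP; rewrite /= frobe0 rmorph1 fmorphV mulVf //.
by rewrite fmorph_eq0.
Qed.
Lemma pcl_inv_0 : pcl_inv (pcl_of 0) = pcl_of 0.
Proof. by rewrite !piE /pcl_inv0 /= invr0. Qed.
HB.instance Definition _ := GRing.ComNzRing_isField.Build pclosure pcl_mulV pcl_inv_0.

Lemma pcl_of_zmod : zmod_morphism pcl_of.
Proof.
move=> a b; rewrite -[RHS]/(pcl_add (pcl_of a) (pcl_opp (pcl_of b))) !piE; apply/eqP; rewrite piE.
by rewrite /pcl_equiv /pcl_add0 /= !frobe0.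
Qed.
Lemma pcl_of_monoid : monoid_morphism pcl_of.
Proof.
split=> // a b; rewrite -[RHS]/(pcl_mul (pcl_of a) (pcl_of b)) !piE; apply/eqP; rewrite piE.
by rewrite /pcl_equiv /pcl_mul0 /= !frobe0.
Qed.
HB.instance Definition _ := GRing.isZmodMorphism.Build k pclosure pcl_of pcl_of_zmod.
HB.instance Definition _ := GRing.isMonoidMorphism.Build k pclosure pcl_of pcl_of_monoid.

Lemma pcl_pow e a n : (0 < n)%N -> \pi_pclosure (e, a) ^+ n = \pi_pclosure (e, a ^+ n).
Proof.
case: n => // n _; elim: n => [//|n IH]; rewrite exprS IH.
rewrite -[LHS]/(pcl_mul _ _) -pi_pcl_mul; apply/eqmodP/eqP.
by rewrite /= -rmorphM -exprS frobe_comp.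
Qed.

Lemma perfect_closure : exists (K : fieldType) (i : {rmorphism k -> K}),
  forall a : K, exists b, a = b ^+ p.
Proof.
have p0 : (0 < p)%N by rewrite prime_gt0 ?(pcharf_prime hp).
(* Raising the index by one takes a [p]-th root. *)
exists pclosure, pcl_of; elim/quotW=> -[e a]; exists (\pi_pclosure (e.+1, a)).
rewrite pcl_pow //; apply/eqmodP/eqP => /=.
by rewrite /frobe -exprM -expnS.
Qed.

End PerfectClosure.

Section Retraction.
Variables (k K : fieldType) (i : {rmorphism k -> K}).

(** A maximal [k]-subspace [C] of [K] that meets the image of [k] in 0 is a complement of it, and
    [rho] is the projection along [C]. Its [k]-linearity suffices to contract extended
    submodules. *)
Lemma field_retraction : exists rho : K -> k,
  [/\ {morph rho : a b / a + b}, forall c a, rho (i c * a) = c * rho a & rho 1 = 1].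
Proof.
pose sp (C : set K) := [/\ C 0, forall a b, C a -> C b -> C (a + b), forall c a, C a -> C (i c * a)
   & forall c, C (i c) -> c = 0].
pose P (C : set K) := C = set0 \/ sp C.
have sp0 : sp [set 0].
  split=> [//|a b -> ->|c a ->|c]; rewrite /= ?addr0 ?mulr0 //.
  by move=> /eqP; rewrite fmorph_eq0 => /eqP.
have [F FP tot|C [PC maxC]] := @Zorn_bigcup K P.
  have [[X0 FX0 X0n]|h] := pselect (exists2 X, F X & X !=set0); last first.
    left; apply/seteqP; split=> // x [X FX Xx]; case: h; exists X => //; by exists x.
  have spX X : F X -> X !=set0 -> sp X by move=> /FP[->|//] [].
  right; split.
  - by exists X0 => //; case: (spX _ FX0 X0n).
  - move=> a b [X FX Xa] [Y FY Yb].
    have [XY|YX] := tot _ _ FX FY.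
      by exists Y => //; have [|_ h _ _] := spX Y FY; [exists b|apply: h => //; exact: XY].
    by exists X => //; have [|_ h _ _] := spX X FX; [exists a|apply: h => //; exact: YX].
  - by move=> c a [X FX Xa]; exists X => //; have [|_ _ h _] := spX X FX; [exists a|exact: h].
  - by move=> c [X FX Xa]; have [|_ _ _ h] := spX X FX; [exists (i c)|exact: h].
have {PC} [C0 CD CZ Ci] : sp C.
  by case: PC => // C0; case: (maxC [set 0]); [rewrite C0; split=> // /(_ 0 erefl)|right].
have ex a : exists c, C (a - i c).
  have [Ca|Ca] := pselect (C a); first by exists 0; rewrite rmorph0 subr0.
  apply: contrapT => h.
  pose D := [set b | exists2 c, C c & exists e, b = c + i e * a].
  apply: (maxC D).
    split=> [b Cb|CD']; first by exists b => //; exists 0; rewrite rmorph0 mul0r addr0.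
    by apply/Ca/CD'; exists 0 => //; exists 1; rewrite rmorph1 mul1r add0r.
  right; split.
  - by exists 0 => //; exists 0; rewrite rmorph0 mul0r addr0.
  - move=> _ _ [b Cb [e ->]] [b' Cb' [e' ->]]; exists (b + b'); first exact: CD.
    by exists (e + e'); rewrite rmorphD mulrDl addrACA.
  - move=> c _ [b Cb [e ->]]; exists (i c * b); first exact: CZ.
    by exists (c * e); rewrite rmorphM mulrDr mulrA.
  - move=> c [b Cb [e ec]]; have [e0|e0] := eqVneq e 0.
      by apply: Ci; rewrite ec e0 rmorph0 mul0r addr0.
    case: h; exists (e^-1 * c); rewrite rmorphM ec fmorphV mulrDr mulrA mulVf ?fmorph_eq0 // mul1r.
    by rewrite opprD addrC addrNK -mulN1r -(rmorph1 i) -rmorphN mulrA -fmorphV -rmorphM; exact: CZ.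
have /all_sig[rho hrho] : forall a, {c | C (a - i c)} by move=> a; apply: cid.
have CB a b : C a -> C b -> C (a - b).
  by move=> Ca Cb; apply: CD => //; rewrite -mulN1r -(rmorph1 i) -rmorphN; exact: CZ.
have uniq a c c' : C (a - i c) -> C (a - i c') -> c = c'.
  move=> h1 h2; apply/eqP; rewrite -subr_eq0; apply/eqP/Ci; rewrite rmorphB.
  have -> : i c - i c' = (a - i c') - (a - i c) by ring.
  exact: CB.
exists rho; split.
- move=> a b; apply: (uniq (a + b)) => //; rewrite rmorphD opprD addrACA; exact: CD.
- by move=> c a; apply: (uniq (i c * a)) => //; rewrite rmorphM -mulrBr; exact: CZ.
- by apply: (uniq 1) => //; rewrite rmorph1 subrr.
Qed.

End Retraction.

(** * Approximate homomorphisms and base change of lengths *)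

Lemma sub_approx (V : zmodType) (x y z : V) : z = x - y - (x - (z + y)).
Proof. by rewrite opprB [RHS]addrC addrA subrK addrK. Qed.

Section ApproximateHom.
Variables (A R : comNzRingType) (NA : lmodType A) (N : lmodType R).
Variables (e : A -> R) (ev : NA -> N) (Z : set N).
Hypothesis evD : forall u v, Z (ev (u + v) - (ev u + ev v)).
Hypothesis evZ : forall a u, Z (ev (a *: u) - e a *: ev u).
Hypothesis evS : forall y, exists u, Z (y - ev u).
Hypothesis eS : forall r, exists a, forall y, Z ((r - e a) *: y).

Lemma submodule_approx W : submodule W -> Z `<=` W -> submodule (ev @^-1` W).
Proof.
move=> hW ZW.
have adj y z : W (y - z) -> W z -> W y by move=> h1 h2; rewrite -(subrK z y); exact: (subD hW).
split=> /=.
- have := ZW _ (evD 0 0); rewrite addr0 opprD addrA subrr sub0r => /(subN hW).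
  by rewrite opprK.
- by move=> u v hu hv; apply: (adj _ _ (ZW _ (evD u v))); exact: (subD hW).
- by move=> a u hu; apply: (adj _ _ (ZW _ (evZ a u))); exact: (subZ _ hW).
Qed.

Lemma chain_approx W n : submodule W -> Z `<=` W ->
  chain (ev @^-1` W) [set: NA] n <-> chain W [set: N] n.
Proof.
move=> hW ZW.
  split.
    pose im (L : set NA) : set N := [set y | exists2 u, L u & W (y - ev u)].
    apply: (@chain_transfer _ _ _ _ im).
    - move=> L hL WL _; split=> //.
        split.
        + by exists 0; [exact: (sub0 hL)|rewrite sub0r; apply: (subN hW); exact: (sub0 (submodule_approx hW ZW))].
        + move=> y z [u Lu hu] [v Lv hv]; exists (u + v); first exact: (subD hL).
          have -> : y + z - ev (u + v) = (y - ev u) + (z - ev v) - (ev (u + v) - (ev u + ev v)).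
            by rewrite addrACA -opprD opprB addrA subrK.
          by apply: (subB hW); [exact: (subD hW)|exact: ZW].
        + move=> r y [u Lu hu]; have [a ha] := eS r; exists (a *: u); first exact: (subZ _ hL).
          have -> : r *: y - ev (a *: u) = r *: (y - ev u) + (r - e a) *: ev u - (ev (a *: u) - e a *: ev u).
            by rewrite scalerBr scalerBl addrA subrK opprB addrA subrK.
          apply: (subB hW); last exact: ZW.
          by apply: (subD hW); [exact: (subZ _ hW)|exact: ZW].
      by move=> y Wy; exists 0; [exact: (sub0 hL)|apply: (subB hW) => //; exact: (sub0 (submodule_approx hW ZW))].
    - by move=> L1 L2 L12 y [u Lu hu]; exists u => //; exact: L12.
    - move=> L1 L2 h1 h2 WL1 L12 _ sub u L2u.
      have [|v L1v hv] := sub (ev u); first by exists u => //; rewrite subrr; exact: (sub0 hW).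
      rewrite -(subrK v u); apply: (subD h1) => //; apply: WL1 => /=.
      have -> : ev (u - v) = (ev u - ev v) - (ev ((u - v) + v) - (ev (u - v) + ev v)).
        by rewrite subrK; exact: sub_approx.
      by apply: (subB hW) => //; exact: ZW.
  apply: (@chain_transfer _ _ _ _ (fun L => ev @^-1` L)).
  - by move=> L hL WL _; split=> //; [apply: submodule_approx => //; exact: subset_trans WL|exact: preimage_subset].
  - by move=> L1 L2; exact: preimage_subset.
  - move=> L1 L2 h1 h2 WL1 L12 _ sub y L2y; have [u hu] := evS y.
    have hu1 : L1 (y - ev u) by apply/WL1/ZW.
    rewrite -(subrK (ev u) y); apply: (subD h1) => //; apply: sub => /=.
    by rewrite -(subKr y (ev u)); apply: (subB h2) => //; exact: L12.
Qed.

Lemma lenle_approx W n : submodule W -> Z `<=` W ->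
  lenle (ev @^-1` W) [set: NA] n <-> lenle W [set: N] n.
Proof. by move=> hW ZW; split=> h l /(chain_approx _ hW ZW); exact: h. Qed.

Lemma len_approx W : submodule W -> Z `<=` W ->
  len (ev @^-1` W) [set: NA] = len W [set: N].
Proof.
move=> hW ZW; rewrite /len; congr (get _); apply/seteqP.
by split=> n [/(chain_approx _ hW ZW) h1 /(lenle_approx _ hW ZW) h2].
Qed.

End ApproximateHom.

Section Socle.
Variables (A : comNzRingType) (m : set A) (hm : noetherian_local m).

(** As long as some [a] in [m] moves [w] outside [Phi], replace [X] by the submodule spanned by
    [Phi] and [a *: w]. Nakayama makes this descent strict and the length bound stops it. *)
Lemma exists_socle (N : lmodType A) (Phi X : set N) : submodule Phi -> submodule X ->
  Phi `<` X -> finlen Phi X -> exists w, [/\ X w, ~ Phi w & forall a, m a -> Phi (a *: w)].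
Proof.
move=> hP hX PX [n hn]; elim: n X hX PX hn => [|n IH] X hX PX hn.
  have /hn // : chain Phi X 1.
  by apply: (chain_ext (chain0 hP (@subset_refl _ Phi)) hX PX).
have [PX1 /existsNP[w /not_implyP[Xw Pw]]] := PX.
have [h|/existsNP[a /not_implyP[ma nP]]] := pselect (forall a, m a -> Phi (a *: w)).
  by exists w.
pose X' := sadd Phi (span [set a *: w]).
have hs := @span_submodule _ N [set a *: w].
have hX' : submodule X' by exact: submodule_sadd.
have X'aw : X' (a *: w) by apply: (saddr hP); exact: sub_span.
have PX' : Phi `<` X' by split=> [|h]; [exact: saddl|exact/nP/h].
have X'X : X' `<` X.
  split=> [|h].
    apply: (sadd_sub hX PX1); apply: (span_sub hX) => _ ->; exact: (subZ _ hX).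
  apply: Pw; apply: (@nakayama _ _ hm _ Phi [:: w] hP); last first.
    by apply: sub_span; rewrite /= mem_head.
  have hsw := @span_submodule _ N [set` [:: w]].
  apply: (span_sub (submodule_sadd hP (submodule_smul _ _))) => y.
  rewrite /= inE => /eqP ->; have [x Px [z /span1P[b ->] xw]] := h _ Xw.
  exists x => //; exists (b *: (a *: w)); rewrite ?xw //; apply: (subZ _ (submodule_smul _ _)).
  by apply: smul_in => //; apply: sub_span; rewrite /= mem_head.
have [|w' [X'w' nw' hw']] := IH X' hX' PX'.
  by move=> l hl; rewrite -ltnS; apply: hn; exact: (chain_ext hl hX X'X).
by exists w'; split=> //; apply: X'X.1.
Qed.

End Socle.

Section BaseChange.
Variables (A B : comNzRingType) (mA : set A) (mB : set B) (f : {rmorphism A -> B}).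
Hypotheses (hA : noetherian_local mA) (hB : noetherian_local mB).
Hypothesis mAB : mB = ideal_gen (f @` mA).
Variables (N : lmodType A) (N' : lmodType B) (io : N -> N') (rho : N' -> N).
Hypothesis ioD : {morph io : x y / x + y}.
Hypothesis ioZ : forall a x, io (a *: x) = f a *: io x.
Hypothesis rhoD : {morph rho : x y / x + y}.
Hypothesis rhoZ : forall b x, exists a, rho (b *: io x) = a *: x.
Hypothesis rhoK : cancel io rho.
Hypothesis ioT : span (range io) = [set: N'].

Definition extend (Phi : set N) : set N' := span (io @` Phi).

Lemma submodule_extend Phi : submodule (extend Phi).
Proof. exact: span_submodule. Qed.

Lemma extend_in Phi x : Phi x -> extend Phi (io x).
Proof. by move=> Px; apply: sub_span; exists x. Qed.

Lemma extendS Phi Psi : Phi `<=` Psi -> extend Phi `<=` extend Psi.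
Proof. by move=> h; apply: span_mono; exact: image_subset. Qed.

Lemma span_rec (X : set N') (Q : set N') : Q 0 -> (forall x y, Q x -> Q y -> Q (x + y)) ->
  (forall b x, X x -> Q (b *: x)) -> span X `<=` Q.
Proof.
move=> Q0 QD QX.
(* [Q] is only closed under sums; the elements all of whose multiples lie in [Q] form a
   submodule. *)
pose W : set N' := [set x | forall b, Q (b *: x)].
have hW : submodule W.
  split=> [b|x y hx hy b|a x hx b]; first by rewrite scaler0.
    by rewrite scalerDr; exact: QD.
  by rewrite scalerA.
by move=> x /(_ W)h; rewrite -(scale1r x); apply: h; split=> // y Xy b; exact: QX.
Qed.

(** The retraction sends [b *: io x] to a multiple of [x], so it maps the extension of [Phi] back
    into [Phi]. This is the substitute for faithful flatness. *)
Lemma extend_contract Phi x : submodule Phi -> extend Phi (io x) -> Phi x.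
Proof.
move=> hP h; rewrite -(rhoK x).
have io0 : io 0 = 0 by apply: (addrI (io 0)); rewrite -ioD !addr0.
have : extend Phi `<=` rho @^-1` Phi; last exact.
apply: span_rec => /=.
- by rewrite -io0 rhoK; exact: (sub0 hP).
- by move=> y z hy hz; rewrite rhoD; exact: (subD hP).
- by move=> b _ [y Py <-]; have [a ->] := rhoZ b y; exact: (subZ _ hP).
Qed.

(** A socle element of [N / Phi] extends to an element killed by [mB], because [mB] is generated by
    the image of [mA]; so each enlargement of [Phi] by such an element adds at most one to the
    length. *)
Lemma lenle_extend n Phi : submodule Phi -> lenle Phi [set: N] n ->
  lenle (extend Phi) [set: N'] n.
Proof.
elim: n Phi => [|n IH] Phi hP hn.
  have -> : Phi = [set: N].
    apply: contrapT => h; have /hn // : chain Phi [set: N] 1.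
    apply: (chain_ext (chain0 hP (@subset_refl _ Phi)) (submoduleT _)).
    by split=> // h'; apply: h; apply/seteqP; split.
  by rewrite /extend ioT; exact: lenle0.
have [PT|PT] := pselect (Phi = [set: N]).
  by rewrite PT /extend ioT; apply: lenle_leq (@lenle0 _ _ _).
have [||w [_ nw hw]] := @exists_socle _ _ hA _ Phi [set: N] hP (submoduleT _).
- by split=> // h'; apply: PT; apply/seteqP; split.
- by exists n.+1.
pose Phi' := sadd Phi (span [set w]).
have hs := @span_submodule _ N [set w].
have hP' : submodule Phi' by exact: submodule_sadd.
have lt : Phi `<` Phi'.
  split=> [|h]; first exact: saddl.
  by apply/nw/h; apply: (saddr hP); exact: sub_span.
have h1 : lenle (extend Phi') [set: N'] n.
  apply: IH => // l hl; rewrite -ltnS; apply: hn.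
  have [L [h1 h2 h3 h4]] := hl.
  have h0 : chain Phi Phi' 1 by exact: (chain_ext (chain0 hP (@subset_refl _ Phi))).
  exact: (chain_cat h0 hl).
have hE := submodule_extend Phi.
have hb b : mB b -> extend Phi (b *: io w).
  rewrite mAB; move: b; apply: (@ideal_gen_sub B _ (colon (extend Phi) (io w))); first exact: ideal_colon.
  by move=> _ [a ma <-]; rewrite /colon /= -ioZ; apply: extend_in; exact: hw.
have h2 : lenle (extend Phi) (sadd (extend Phi) (span [set io w])) 1.
  by apply: (lenle_cyc hE (local_ideal hB) hb); exact: lenle_residue.
have sub : extend Phi' `<=` sadd (extend Phi) (span [set io w]).
  apply: span_sub; first by apply: submodule_sadd => //; exact: span_submodule.
  move=> _ [_ [x Px [_ /span1P[a ->] <-]] <-]; rewrite ioD ioZ.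
  exists (io x); first exact: extend_in.
  by exists (f a *: io w) => //; apply: (subZ _ (@span_submodule _ _ _)); exact: sub_span.
rewrite -[n.+1]add1n.
apply: (lenle_cat hE _ (submoduleT _) _ _ (lenleS (@subset_refl _ _) sub h2) h1) => //; first exact: submodule_extend.
apply: extendS; exact: lt.1.
Qed.

Lemma len_extend Phi : submodule Phi -> finlen Phi [set: N] ->
  len (extend Phi) [set: N'] = len Phi [set: N] /\ finlen (extend Phi) [set: N'].
Proof.
move=> hP fP.
have le := lenle_extend hP (lenle_len hP (@subsetT _ _) fP).
have fin : finlen (extend Phi) [set: N'] by exists (len Phi [set: N]).
split=> //; apply/eqP; rewrite eqn_leq; apply/andP; split.
  by apply: len_leq => //; exact: submodule_extend.
apply: leq_len => //; first exact: submodule_extend.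
apply: (@chain_transfer _ _ _ _ extend); last exact: (chain_len hP (@subsetT _ _) fP).
- by move=> L hL PL _; split=> //; [exact: submodule_extend|exact: extendS].
- by move=> L1 L2; exact: extendS.
- move=> L1 L2 h1 h2 _ _ _ sub x L2x; apply: (extend_contract h1); apply: sub; exact: extend_in.
Qed.

End BaseChange.

(** * Presentations up to a power of the maximal ideal *)

Section LevelMap.
Variables (S R : comNzRingType) (v1 : set S) (m : set R) (t : nat).

(* [e] induces an isomorphism from a quotient of [S] to [R / m ^ t] under which the powers of [v1]
   and [m] correspond, up to choice of representatives. *)
Definition level_map (e : S -> R) : Prop :=
  [/\ forall f g, ideal_exp m t (e (f + g) - (e f + e g)),
      forall f g, ideal_exp m t (e (f * g) - e f * e g),
      forall i f, (i <= t)%N -> ideal_exp v1 i f -> ideal_exp m i (e f)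
    & forall i r, ideal_exp m i r -> exists2 f, ideal_exp v1 i f & ideal_exp m t (r - e f)].

Variables (e : S -> R) (he : level_map e) (hm : ideal m).
Let me i := @ideal_ideal_exp R m i.

Lemma levelD f g : ideal_exp m t (e (f + g) - (e f + e g)).
Proof. by case: he. Qed.
Lemma levelM f g : ideal_exp m t (e (f * g) - e f * e g).
Proof. by case: he. Qed.
Lemma levelV i f : (i <= t)%N -> ideal_exp v1 i f -> ideal_exp m i (e f).
Proof. by case: he => _ _ h _; exact: h. Qed.
Lemma levelS i r : ideal_exp m i r -> exists2 f, ideal_exp v1 i f & ideal_exp m t (r - e f).
Proof. by case: he => _ _ _ h; exact: h. Qed.

Lemma level_ideal I : ideal I -> ideal_exp m t `<=` I -> ideal [set f | I (e f)].
Proof.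
by move=> hI tI; apply: (@submodule_approx S R S^o R^o e e (ideal_exp m t)) => //;
  [exact: levelD|exact: levelM].
Qed.

Lemma level_lenle I l : ideal I -> ideal_exp m t `<=` I ->
  @lenle S S^o [set f | I (e f)] [set: S] l <-> @lenle R R^o I [set: R] l.
Proof.
move=> hI tI; apply: (@lenle_approx S R S^o R^o e e (ideal_exp m t)) => //.
- exact: levelD.
- exact: levelM.
- by move=> y; have [//|f _ hf] := @levelS 0 y; exists f.
- move=> r; have [//|f _ hf] := @levelS 0 r; exists f => y; exact: (idealMr _ (me t)).
Qed.

Lemma levelX f i : ideal_exp m t (e (f ^+ i.+1) - e f ^+ i.+1).
Proof.
elim: i => [|i IH]; first by rewrite !expr1 subrr; exact: (ideal0 (me _)).
rewrite exprS [in X in _ - X]exprS -(subrKA (e f * e (f ^+ i.+1))).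
by apply: (idealD (me t)); [exact: levelM|rewrite -mulrBr; exact: (idealMl _ (me t))].
Qed.

Lemma level_Ipow_sub a q f : ideal v1 -> (0 < q)%N -> (a <= t)%N -> Ipow v1 a q f -> Ipow m a q (e f).
Proof.
move=> hv q0 at_; have hI := ideal_Ipow m a q.
have tI : ideal_exp m t `<=` Ipow m a q.
  by apply: subset_trans (@exp_Ipow _ m a q); exact: exp_antitone.
have [t0|t0] := posnP t.
  by rewrite t0 in at_ *; move: at_; rewrite leqn0 => /eqP -> _; apply: exp_Ipow.
move: f; apply: (Ipow_sub (level_ideal hI tI)) => [f|f vf] /=.
  by move=> /(levelV at_); exact: exp_Ipow.
have hx : Ipow m a q (e f ^+ q).
  apply: (ideal_addrP (ideal_ideal_exp m a)); apply: sub_ideal_gen; exists (e f) => //.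
  by rewrite -(exp1_sub hm); apply: (levelV t0); rewrite exp1_sub.
have h := tI _ (levelX f q.-1); rewrite prednK // in h.
by rewrite -(subrK (e f ^+ q) (e _)); exact: (idealD hI).
Qed.

Lemma level_Ipow_surj a q r : ideal v1 -> (0 < q)%N -> Ipow m a q r ->
  exists2 f, Ipow v1 a q f & ideal_exp m t (r - e f).
Proof.
move=> hv q0; have hJ := ideal_Ipow v1 a q.
have hW : ideal [set r | exists2 f, Ipow v1 a q f & ideal_exp m t (r - e f)].
  apply: ideal_ofP.
  - exists 0; first exact: (ideal0 hJ).
    have := levelD 0 0; rewrite addr0 opprD addrA subrr !sub0r; exact.
  - move=> x y [f Jf hf] [g Jg hg]; exists (f + g); first exact: (idealD hJ).
    have -> : x + y - e (f + g) = (x - e f) + (y - e g) - (e (f + g) - (e f + e g)) by ring.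
    by apply: (idealB (me t)); [exact: (idealD (me t))|exact: levelD].
  - move=> b y [f Jf hf]; have [//|g _ hg] := @levelS 0 b.
    exists (g * f); first exact: (idealMl _ hJ).
    have -> : b * y - e (g * f) = b * (y - e f) + (b - e g) * e f - (e (g * f) - e g * e f) by ring.
    apply: (idealB (me t)); last exact: levelM.
    by apply: (idealD (me t)); [exact: (idealMl _ (me t))|exact: (idealMr _ (me t))].
move: r; apply: (Ipow_sub hW) => [x hx|x mx].
  by have [f vf hf] := levelS hx; exists f => //; exact: exp_Ipow.
have [|f vf hf] := @levelS 1 x; first by rewrite exp1_sub.
rewrite exp1_sub // in vf; exists (f ^+ q).
  by apply: (ideal_addrP (ideal_ideal_exp _ _)); apply: sub_ideal_gen; exists f.
rewrite -(subrKA (e f ^+ q)); apply: (idealD (me t)).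
  by rewrite subrXX; exact: (idealMr _ (me t)).
rewrite -opprB; apply: (@subN R R^o _ _ (me t)); rewrite -(prednK q0).
exact: levelX.
Qed.

End LevelMap.

Section Presentation.
Variables (k : fieldType) (n : nat) (R : comNzRingType) (m : set R).
Local Notation S := (mpseries n k).
Local Notation v := (@vanish n k).

(* [e t] is a surjection from power series to [R / m ^ t], up to choice of representatives. *)
Definition presents (e : nat -> S -> R) : Prop :=
  [/\ forall t f g, ideal_exp m t (e t (f + g) - (e t f + e t g)),
      forall t f g, ideal_exp m t (e t (f * g) - e t f * e t g),
      forall t i f, (i <= t)%N -> v i f -> ideal_exp m i (e t f),
      forall t i r, ideal_exp m i r -> exists2 f, v i f & ideal_exp m t (r - e t f)
    & forall t f, ideal_exp m t (e t.+1 f - e t f)].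

Variables (e : nat -> S -> R) (he : presents e) (hm : ideal m).
Let me t := @ideal_ideal_exp R m t.
Let vi t := @ideal_vanish n k t.

Lemma presD t f g : ideal_exp m t (e t (f + g) - (e t f + e t g)).
Proof. by case: he. Qed.
Lemma presM t f g : ideal_exp m t (e t (f * g) - e t f * e t g).
Proof. by case: he. Qed.
Lemma presV t i f : (i <= t)%N -> v i f -> ideal_exp m i (e t f).
Proof. by case: he => _ _ h _ _; exact: h. Qed.
Lemma presS t i r : ideal_exp m i r -> exists2 f, v i f & ideal_exp m t (r - e t f).
Proof. by case: he => _ _ _ h _; exact: h. Qed.
Lemma presC t i f : (t <= i)%N -> ideal_exp m t (e i f - e t f).
Proof.
elim: i => [|i IH]; first by rewrite leqn0 => /eqP ->; rewrite subrr; exact: ideal0 (me 0).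
rewrite leq_eqVlt => /orP[/eqP ->|]; first by rewrite subrr; exact: ideal0 (me _).
rewrite ltnS => ti; rewrite -(subrKA (e i f)); apply: (idealD (me t)); last exact: IH.
by case: he => _ _ _ _ h; apply: exp_antitone ti _ (h i f).
Qed.

Section OfModule.
Variables (N : lmodType R) (s : seq N).
Hypothesis hs : span [set` s] = [set: N].
Local Notation a := (size s).
Local Notation V := 'rV[S]_a.
Local Notation mN t := (smul (ideal_exp m t) [set: N]).
Let mNs t : submodule (mN t) := submodule_smul _ _.

Definition pev t (u : V) : N := \sum_(j < a) e t (u ord0 j) *: s`_j.

Definition vvanish t : set V := [set u | forall j, v t (u ord0 j)].

Lemma submodule_vvanish t : submodule (vvanish t).
Proof.
split=> [j|x y hx hy j|b x hx j]; rewrite mxE; first exact: (ideal0 (vi _)).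
  exact: (idealD (vi _)).
exact: (idealMl _ (vi _)).
Qed.

Lemma pevD t u w : mN t (pev t (u + w) - (pev t u + pev t w)).
Proof.
rewrite /pev -big_split -sumrB /=; apply: (sub_sum _ (mNs t)) => j _.
by rewrite -scalerDl -scalerBl mxE; apply: smul_in => //; exact: presD.
Qed.

Lemma pevZ t b u : mN t (pev t (b *: u) - e t b *: pev t u).
Proof.
rewrite /pev scaler_sumr -sumrB; apply: (sub_sum _ (mNs t)) => j _.
by rewrite scalerA -scalerBl mxE; apply: smul_in => //; exact: presM.
Qed.

Lemma pevV t i u : (i <= t)%N -> vvanish i u -> mN i (pev t u).
Proof.
move=> it hu; apply: (sub_sum _ (mNs i)) => j _; apply: smul_in => //; exact: presV.
Qed.

Lemma mN_gens I y : ideal I -> smul I [set: N] y ->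
  exists2 c : nat -> R, (forall j, I (c j)) & y = \sum_(j < a) c j *: s`_j.
Proof. by move=> hI; rewrite -hs => /(smul_span_seqP _ _ hI). Qed.

Lemma pevS t i y : mN i y -> exists2 u, vvanish i u & mN t (y - pev t u).
Proof.
move=> /(mN_gens (me i))[c hc ->].
have /all_sig2[w hw hw'] : forall j, {f | v i f & ideal_exp m t (c j - e t f)}.
  by move=> j; apply: cid2; exact: presS.
exists (\row_j w j) => [j|]; first by rewrite mxE.
rewrite /pev -sumrB; apply: (sub_sum _ (mNs t)) => j _.
by rewrite -scalerBl mxE; apply: smul_in.
Qed.

Lemma pevC t i u : (t <= i)%N -> mN t (pev i u - pev t u).
Proof.
move=> ti; rewrite /pev -sumrB; apply: (sub_sum _ (mNs t)) => j _.
by rewrite -scalerBl; apply: smul_in => //; exact: presC.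
Qed.

Lemma mN_antitone t i : (t <= i)%N -> mN i `<=` mN t.
Proof. by move=> ti; apply: smulS => //; exact: exp_antitone. Qed.

Lemma pev_approx t W : submodule W -> mN t `<=` W ->
  submodule (pev t @^-1` W) /\ len (pev t @^-1` W) [set: V] = len W [set: N].
Proof.
move=> hW tW.
have e1 y : exists u, mN t (y - pev t u).
  have [|u _ hu] := @pevS t 0 y; last by exists u.
  by rewrite smul_exp0 //; exact: submoduleT.
have e2 r : exists b, forall y, mN t ((r - e t b) *: y).
  have [//|b _ hb] := @presS t 0 r; exists b => y; exact: smul_in.
split; first exact: (@submodule_approx S R V N (e t) (pev t) (mN t) (@pevD t) (@pevZ t) W hW tW).
exact: (@len_approx S R V N (e t) (pev t) (mN t) (@pevD t) (@pevZ t) e1 e2 W hW tW).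
Qed.

Lemma pevB t u w W : submodule W -> mN t `<=` W -> W (pev t u) -> W (pev t w) ->
  W (pev t (u - w)).
Proof. by move=> hW tW; have [h _] := pev_approx hW tW; exact: (subB h). Qed.

(** The kernel of the map from vectors of power series to the [m]-adic completion of [N]. A single
    [pev t] has a meaning only modulo [m ^ t], hence the condition at every level. *)
Definition relations : set V := [set u | forall t, mN t (pev t u)].

Lemma submodule_relations : submodule relations.
Proof.
have h t : submodule (pev t @^-1` mN t) by have [] := @pev_approx t (mN t) (mNs t) (@subset_refl _ _).
split=> [t|x y hx hy t|b x hx t].
- exact: (sub0 (h t)).
- exact: (subD (h t) (hx t) (hy t)).
- exact: (subZ _ (h t) (hx t)).
Qed.

(** A relation modulo [m ^ t] is corrected by vectors of order [t], [t + 1] and so on, so as to hold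
    at each next level; the corrections converge. *)
Lemma relations_lift t u : mN t (pev t u) -> exists2 w, relations w & vvanish t (u - w).
Proof.
move=> hu.
have stE (iu : nat * V) : {w | mN iu.1 (pev iu.1 iu.2) ->
    mN iu.1.+1 (pev iu.1.+1 w) /\ vvanish iu.1 (iu.2 - w)}.
  case: iu => i x /=; apply: cid.
  have [h|h] := pselect (mN i (pev i x)); last by exists 0.
  have h1 : mN i (pev i.+1 x).
    by rewrite -(subrK (pev i x) (pev _ _)); apply: (subD (mNs i)) => //; exact: pevC.
  have [w vw hw] := pevS i.+1 h1; exists (x - w) => _; split; last by rewrite opprB addrC subrK.
  have -> : pev i.+1 (x - w) = pev i.+1 x - pev i.+1 w
      - (pev i.+1 ((x - w) + w) - (pev i.+1 (x - w) + pev i.+1 w)).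
    by rewrite subrK; exact: sub_approx.
  apply: (subB (mNs _)) => //; exact: pevD.
pose us := fix us i := if i is i'.+1 then projT1 (stE ((t + i')%N, us i')) else u.
have usP i : mN (t + i) (pev (t + i) (us i)).
  elim: i => [|i IH]; first by rewrite addn0.
  by rewrite addnS; case: (projT2 (stE ((t + i)%N, us i)) IH).
have usB i : vvanish (t + i) (us i - us i.+1).
  by case: (projT2 (stE ((t + i)%N, us i)) (usP i)).
have usBB i j : vvanish (t + i) (us i - us (i + j)%N).
  elim: j => [|j IH]; first by rewrite addn0 subrr; exact: (sub0 (submodule_vvanish _)).
  rewrite addnS -(subrKA (us (i + j)%N)); apply: (subD (submodule_vvanish _)) => // l.
  by apply: vanishS (usB (i + j)%N l); rewrite addnA leq_addr.
(* The coefficient at [mu] no longer changes from the index [(mdeg mu).+1] on. *)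
pose w : V := \row_j (fun mu => us (mpoly.mdeg mu).+1 ord0 j mu).
have hw i : vvanish (t + i) (us i - w).
  move=> j mu hmu; rewrite !mxE mpsB.
  have [le|le] := leqP i (mpoly.mdeg mu).+1.
    by have := usBB i ((mpoly.mdeg mu).+1 - i)%N j mu hmu; rewrite subnKC // !mxE mpsB.
  have := usBB (mpoly.mdeg mu).+1 (i - (mpoly.mdeg mu).+1)%N j mu.
  rewrite subnKC ?(ltnW le) // !mxE mpsB => h.
  by apply/eqP; rewrite subr_eq0 eq_sym -subr_eq0; apply/eqP/h; rewrite addnS ltnS leq_addl.
exists w; last by have := hw 0; rewrite addn0.
have rel i : mN (t + i) (pev (t + i) w).
  have -> : w = us i - (us i - w) by rewrite opprB addrC subrK.
  apply: (pevB (mNs _)) => //; exact: pevV.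
move=> i; have ti : (i <= t + i)%N := leq_addl t i.
have -> : pev i w = pev (t + i) w - (pev (t + i) w - pev i w) by rewrite opprB addrC subrK.
by apply: (subB (mNs _)); [exact: mN_antitone (rel i)|exact: pevC].
Qed.

(** A vector in the preimage is matched with one having coordinates in [J]; the difference is a
    relation modulo [m ^ t], which [relations_lift] turns into a true relation up to a vector of
    order [t], absorbed by [J]. *)
Lemma pev_preimage t (I : set R) (J : set S) : ideal I -> ideal J -> ideal_exp m t `<=` I ->
    v t `<=` J -> (forall f, J f -> I (e t f)) ->
    (forall r, I r -> exists2 f, J f & ideal_exp m t (r - e t f)) ->
  pev t @^-1` (smul I [set: N]) = sadd relations (smul J [set: V]).
Proof.
move=> hI hJ tI tJ JI IJ.
have hIN : submodule (smul I [set: N]) by exact: submodule_smul.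
have hJV : submodule (smul J [set: V]) by exact: submodule_smul.
have tIN : mN t `<=` smul I [set: N] by exact: smulS.
have [hP _] := pev_approx hIN tIN.
have rowJ (u : V) : (forall j, J (u ord0 j)) -> smul J [set: V] u.
  move=> hu; rewrite (row_sum_delta u); apply: (sub_sum _ hJV) => j _.
  by apply: smul_in.
apply/seteqP; split=> [u /= hu|].
  have [c hc ec] := mN_gens hI hu.
  have /all_sig2[w hw hw'] : forall j, {f | J f & ideal_exp m t (c j - e t f)}.
    by move=> j; apply: cid2; exact: IJ.
  pose x : V := \row_j w j.
  have hx : mN t (pev t u - pev t x).
    rewrite ec /pev -sumrB; apply: (sub_sum _ (mNs t)) => j _.
    by rewrite -scalerBl mxE; apply: smul_in.
  have h : mN t (pev t (u - x)).
    have -> : pev t (u - x) = pev t u - pev t x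
        - (pev t ((u - x) + x) - (pev t (u - x) + pev t x)).
      by rewrite subrK; exact: sub_approx.
    by apply: (subB (mNs _)) => //; exact: pevD.
  have [y ry vy] := relations_lift h.
  exists y => //; exists (u - y); last by rewrite addrC subrK.
  rewrite -(subrK x u) addrAC; apply: (subD hJV).
    by apply: rowJ => j; exact/tJ/vy.
  by apply: rowJ => j; rewrite mxE.
apply: (sadd_sub hP) => [u hu|]; first exact: (tIN _ (hu t)).
apply: (smul_sub hP) => f u Jf _ /=.
rewrite -(subrK (e t f *: pev t u) (pev _ _)); apply: (subD hIN).
  by apply: tIN; exact: pevZ.
by apply: smul_in => //; exact: JI.
Qed.

End OfModule.

Lemma pres_level t : level_map (vanish 1) m t (e t).
Proof.
split; [exact: presD|exact: presM| |].
  by move=> i f it; rewrite exp_vanish; exact: presV.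
by move=> i r /(presS t)[f vf hf]; exists f => //; rewrite exp_vanish.
Qed.

End Presentation.

Arguments pev {k n R} e {N} s t u.
Arguments relations {k n R} m e {N} s.

Section MapSeries.
Variables (n : nat) (k K : fieldType) (i : {rmorphism k -> K}).
Local Notation S := (mpseries n k).
Local Notation SK := (mpseries n K).

Definition mps_map (f : S) : SK := fun m => i (f m).

Lemma mps_map_zmod : zmod_morphism mps_map.
Proof. by move=> f g; apply/funext => m; rewrite /mps_map !mpsB rmorphB. Qed.
Lemma mps_map_monoid : monoid_morphism mps_map.
Proof.
split; first by apply/funext => m; exact: rmorph_nat.
move=> f g; apply/funext => m; rewrite /mps_map -[(f * g) m]/(mpseries_mul f g m).
rewrite -[RHS]/(mpseries_mul _ _ m) /mpseries_mul rmorph_sum.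
by apply: eq_bigr => c _; rewrite rmorphM.
Qed.
HB.instance Definition _ := GRing.isZmodMorphism.Build S SK mps_map mps_map_zmod.
HB.instance Definition _ := GRing.isMonoidMorphism.Build S SK mps_map mps_map_monoid.

Lemma mps_map_X j : mps_map (mps_of (mpoly.mpolyX k (mpoly.mnm1 j))) =
  mps_of (mpoly.mpolyX K (mpoly.mnm1 j)).
Proof. by apply/funext => m; rewrite /mps_map /mps_of !mpoly.mcoeffX rmorph_nat. Qed.

Lemma mps_map_vanish : ideal_gen (mps_map @` vanish 1) = vanish 1.
Proof.
apply/seteqP; split.
  apply: ideal_gen_sub; first exact: ideal_vanish.
  by move=> _ [f hf <-] m hm; rewrite /mps_map hf ?rmorph0.
rewrite -{1}ideal_gen_Xs; apply: ideal_gen_sub; first exact: ideal_ideal_gen.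
move=> _ /mapP[j _ ->]; apply: sub_ideal_gen.
exists (mps_of (mpoly.mpolyX k (mpoly.mnm1 j))); last exact: mps_map_X.
by rewrite -ideal_gen_Xs; apply: sub_ideal_gen; apply/mapP; exists j; rewrite ?mem_enum.
Qed.

Variable rho : K -> k.
Hypothesis rhoD : {morph rho : a b / a + b}.
Hypothesis rhoZ : forall c a, rho (i c * a) = c * rho a.
Hypothesis rho1 : rho 1 = 1.

Lemma retraction_sum (J : Type) (r : seq J) (Q : pred J) (F : J -> K) :
  rho (\sum_(j <- r | Q j) F j) = \sum_(j <- r | Q j) rho (F j).
Proof.
elim/big_rec2 : _ => [|j x y _ <-]; last by rewrite rhoD.
by apply: (addrI (rho 0)); rewrite -rhoD !addr0.
Qed.

Definition mps_retract (f : SK) : S := fun m => rho (f m).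

Lemma mps_retractD : {morph mps_retract : f g / f + g}.
Proof. by move=> f g; apply/funext => m; rewrite /mps_retract !mpsD rhoD. Qed.

Lemma mps_retractZ b f : mps_retract (b * mps_map f) = mps_retract b * f.
Proof.
apply/funext => m; rewrite /mps_retract -[(b * _) m]/(mpseries_mul b (mps_map f) m).
rewrite -[RHS]/(mpseries_mul _ f m) /mpseries_mul retraction_sum.
by apply: eq_bigr => c _; rewrite /mps_map mulrC rhoZ mulrC.
Qed.

Lemma mps_mapK : cancel mps_map mps_retract.
Proof.
by move=> f; apply/funext => m; rewrite /mps_retract /mps_map -[i (f m)]mulr1 rhoZ rho1 mulr1.
Qed.

End MapSeries.

Lemma span_delta (A : comNzRingType) a :
  @span A 'rV[A]_a (range (fun j => delta_mx ord0 j)) = [set: 'rV[A]_a].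
Proof.
apply/seteqP; split=> // u _; rewrite (row_sum_delta u).
have hs := @span_submodule A 'rV[A]_a (range (fun j => delta_mx ord0 j)).
by apply: (sub_sum _ hs) => j _; apply: (subZ _ hs); apply: sub_span; exists j.
Qed.

Lemma fg_row (A : comNzRingType) a : finitely_generated 'rV[A]_a.
Proof.
exists [seq delta_mx ord0 j | j <- enum 'I_a]; apply/seteqP; split=> // u _.
have : [set: 'rV[A]_a] u by []; rewrite -span_delta; move: u; apply: span_mono => _ [j _ <-].
by apply/mapP; exists j; rewrite ?mem_enum.
Qed.

Section ExtendIdeals.
Variables (A B : comNzRingType) (f : {rmorphism A -> B}).
Local Notation ext J := (ideal_gen (f @` J)).

Lemma extend_exp J a : ideal_exp (ext J) a `<=` ext (ideal_exp J a).
Proof.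
have hE X : ideal (ideal_gen X : set B) := ideal_ideal_gen X.
elim: a => [|a IH].
  move=> x _; rewrite (ideal_full (hE _)) //; apply: sub_ideal_gen.
  by exists 1; rewrite ?rmorph1.
rewrite ideal_expS; apply: (@smul_sub B B^o); first exact: hE.
move=> x y hx /IH hy; change (ext (ideal_exp J a.+1) (x * y)).
have hc z : ideal [set x | ext (ideal_exp J a.+1) (x * z)].
  apply: ideal_ofP => [|b c|b c] /=; rewrite ?mul0r ?mulrDl -?mulrA.
  - exact: (ideal0 (hE _)).
  - exact: (idealD (hE _)).
  - exact: (idealMl _ (hE _)).
move: x hx; apply: (ideal_gen_sub (hc y)) => _ [u Ju <-] /=; rewrite mulrC.
move: y hy; apply: (ideal_gen_sub (hc (f u))) => _ [w Jw <-] /=.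
rewrite -rmorphM mulrC; apply: sub_ideal_gen; exists (u * w) => //.
by rewrite ideal_expS; apply: (@smul_in A A^o).
Qed.

Lemma extend_Ipow J p a j : p \in [pchar B] ->
  ext (Ipow J a (p ^ j)) = Ipow (ext J) a (p ^ j).
Proof.
move=> hp; have hE X : ideal (ideal_gen X : set B) := ideal_ideal_gen X.
have hI := ideal_Ipow (ext J) a (p ^ j).
have p0 : (0 < p ^ j)%N by rewrite expn_gt0 prime_gt0 ?(prime_pchar hp).
apply/seteqP; split.
  apply: (ideal_gen_sub hI) => _ [x hx <-]; move: x hx.
  have hf : ideal (f @^-1` Ipow (ext J) a (p ^ j)).
    apply: ideal_ofP => [|x y|x y] /=; rewrite ?rmorph0 ?rmorphD ?rmorphM.
    - exact: (ideal0 hI).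
    - exact: (idealD hI).
    - exact: (idealMl _ hI).
  apply: (Ipow_sub hf) => [x hx|x Jx] /=.
    apply: exp_Ipow; elim: a x hx {hI hf} => [//|a IH] x.
    rewrite ideal_expS.
    have hf : ideal (f @^-1` ideal_exp (ext J) a.+1).
      have hI := ideal_ideal_exp (ext J) a.+1.
      apply: ideal_ofP => [|y z|y z] /=; rewrite ?rmorph0 ?rmorphD ?rmorphM.
      - exact: (ideal0 hI).
      - exact: (idealD hI).
      - exact: (idealMl _ hI).
    apply: (@smul_sub A A^o _ _ _ hf) => y z Jy /IH hz.
    change (ideal_exp (ext J) a.+1 (f (y * z))); rewrite rmorphM ideal_expS.
    by apply: (@smul_in B B^o) => //; apply: sub_ideal_gen; exists y.
  rewrite rmorphXn; apply: (ideal_addrP (ideal_ideal_exp _ _)); apply: sub_ideal_gen.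
  by exists (f x) => //; apply: sub_ideal_gen; exists x.
apply: (Ipow_sub (hE _)) => [x /extend_exp|x].
  apply: ideal_gen_sub => // _ [y hy <-]; apply: sub_ideal_gen; exists y => //; exact: exp_Ipow.
(* The exponent is a power of the characteristic, so the power map is additive. *)
have hq : ideal [set x | ext (Ipow J a (p ^ j)) (x ^+ (p ^ j))].
  apply: ideal_ofP => [|y z|y z] /=.
  - by rewrite expr0n eqn0Ngt p0; exact: (ideal0 (hE _)).
  - by rewrite (exprDp hp); exact: (idealD (hE _)).
  - by rewrite exprMn; exact: (idealMl _ (hE _)).
move: x; apply: (ideal_gen_sub hq) => _ [y Jy <-] /=; rewrite -rmorphXn; apply: sub_ideal_gen.
exists (y ^+ (p ^ j)) => //; apply: (ideal_addrP (ideal_ideal_exp _ _)); apply: sub_ideal_gen.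
by exists y.
Qed.

End ExtendIdeals.

(** * Convergence of the normalized lengths *)

Section Convergence.
Variables (RR : realType) (R : comNzRingType) (m : set R) (hm : noetherian_local m).
Variables (p : nat) (hpR : p \in [pchar R]) (k : fieldType) (hpk : p \in [pchar k]) (n : nat).
Variables (e : nat -> mpseries n k -> R) (he : presents m e).
Local Notation S := (mpseries n k).
Let hmi := local_ideal hm.

Section Extension.
Variables (K : fieldType) (i : {rmorphism k -> K}) (rho : K -> k).
Hypothesis rhoD : {morph rho : a b / a + b}.
Hypothesis rhoZ : forall c a, rho (i c * a) = c * rho a.
Hypothesis rho1 : rho 1 = 1.
Local Notation SK := (mpseries n K).
Local Notation f := (mps_map i : {rmorphism S -> SK}).

Section Row.
Variable a : nat.
Definition row_map (u : 'rV[S]_a) : 'rV[SK]_a := map_mx (mps_map i) u.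
Definition row_retract (u : 'rV[SK]_a) : 'rV[S]_a := map_mx (mps_retract rho) u.
Local Notation ext := (@extend S SK 'rV[S]_a 'rV[SK]_a row_map).

Lemma row_mapD : {morph row_map : x y / x + y}.
Proof. by move=> x y; rewrite /row_map map_mxD. Qed.
Lemma row_mapZ b x : row_map (b *: x) = mps_map i b *: row_map x.
Proof. by rewrite /row_map map_mxZ. Qed.
Lemma row_retractD : {morph row_retract : x y / x + y}.
Proof. by move=> x y; apply/rowP => j; rewrite !mxE (mps_retractD rhoD). Qed.
Lemma row_retractZ b x : exists c, row_retract (b *: row_map x) = c *: x.
Proof.
exists (mps_retract rho b); apply/rowP => j.
by rewrite !mxE (mps_retractZ rhoD rhoZ).
Qed.
Lemma row_mapK : cancel row_map row_retract.
Proof. by move=> x; apply/rowP => j; rewrite !mxE (mps_mapK rhoZ rho1). Qed.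
Lemma span_row_map : span (range row_map) = [set: 'rV[SK]_a].
Proof.
rewrite -(span_delta SK a); apply/seteqP; split; first by rewrite span_delta.
apply: span_mono => _ [j _ <-]; exists (delta_mx ord0 j) => //.
by rewrite /row_map map_delta_mx.
Qed.

Lemma extend_sadd (U : set 'rV[S]_a) (J : set S) : submodule U -> ideal J ->
  ext (sadd U (smul J [set: _])) = sadd (ext U) (smul (ideal_gen (mps_map i @` J)) [set: _]).
Proof.
move=> hU hJ; have hs := @submodule_smul S 'rV[S]_a J [set: _].
have hs' := @submodule_smul SK 'rV[SK]_a (ideal_gen (mps_map i @` J)) [set: _].
have hE V : submodule (ext V) := @submodule_extend _ _ _ _ _ V.
apply/seteqP; split.
  apply: (span_sub (submodule_sadd (hE _) hs')) => _ [_ [x Ux [y hy <-]] <-].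
  rewrite row_mapD; exists (row_map x); first exact: extend_in.
  exists (row_map y) => //; move: y hy.
  have hp : submodule (row_map @^-1` smul (ideal_gen (mps_map i @` J)) [set: _]).
    split=> [|y z|b y] /=; rewrite ?row_mapD ?row_mapZ.
    - by rewrite /row_map map_mx0; exact: (sub0 hs').
    - exact: (subD hs').
    - exact: (subZ _ hs').
  apply: (smul_sub hp) => b y Jb _ /=; rewrite row_mapZ; apply: smul_in => //.
  by apply: sub_ideal_gen; exists b.
apply: (sadd_sub (hE _)); first by apply: extendS; exact: saddl.
apply: (smul_sub (hE _)) => b x hb _; move: b hb.
apply: (@ideal_gen_sub SK _ (colon (ext (sadd U (smul J [set: _]))) x)); first exact: ideal_colon.
move=> _ [b Jb <-]; rewrite /colon /=.
have : [set: 'rV[SK]_a] x by []; rewrite -span_row_map; move: x.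
have hp : submodule [set x | ext (sadd U (smul J [set: _])) (mps_map i b *: x)].
  split=> [|x y|c x] /=; rewrite ?scaler0 ?scalerDr ?scalerA 1?mulrC -?scalerA.
  - exact: (sub0 (hE _)).
  - exact: (subD (hE _)).
  - exact: (subZ _ (hE _)).
apply: (span_sub hp) => _ [x _ <-] /=; rewrite -row_mapZ; apply: extend_in.
by apply: (saddr hU); apply: smul_in.
Qed.

End Row.

Section OfModule.
Variables (N : lmodType R) (s : seq N) (hs : span [set` s] = [set: N]).
Definition relationsK := @extend S SK 'rV[S]_(size s) 'rV[SK]_(size s) (@row_map _) (relations m e s).

(** Lengths pass from [N] to its presentation over [k[[x]]] by [pev_approx] and [pev_preimage], and
    from [k] to [K] by [len_extend]. *)
Lemma len_relationsK t (I : set R) (J : set S) : ideal I -> ideal J -> ideal_exp m t `<=` I ->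
    vanish t `<=` J -> (forall f, J f -> I (e t f)) ->
    (forall r, I r -> exists2 f, J f & ideal_exp m t (r - e t f)) ->
  let W := sadd relationsK (smul (ideal_gen (mps_map i @` J)) [set: _]) in
  len W [set: _] = len (smul I [set: N]) [set: N] /\ finlen W [set: _].
Proof.
move=> hI hJ tI tJ JI IJ W; have hr := submodule_relations he hs.
have hsm := @submodule_smul S 'rV[S]_(size s) J [set: _].
have hW' : submodule (sadd (relations m e s) (smul J [set: _])) by exact: submodule_sadd.
have fin : finlen (sadd (relations m e s) (smul J [set: _])) [set: _].
  apply: finlenS (@finlen_exp _ _ (mps_noetherian_local n k) _ _ t (fg_row _ _) hr) => //.
  by apply: saddS => //; apply: smulS => //; rewrite exp_vanish.
have -> : W = @extend S SK _ _ (@row_map _) (sadd (relations m e s) (smul J [set: _])).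
  by rewrite /W extend_sadd.
have [-> ?] := @len_extend S SK (vanish 1) (vanish 1) f (mps_noetherian_local n k)
  (mps_noetherian_local n K) (esym (mps_map_vanish n i)) _ _ (@row_map (size s))
  (@row_retract (size s)) (@row_mapD _) (@row_mapZ _) (@row_retractD _) (@row_retractZ _)
  (@row_mapK _) (@span_row_map _) _ hW' fin.
split=> //; rewrite -(pev_preimage he hs hI hJ tI tJ JI IJ).
have [_ ->//] := pev_approx he hs (submodule_smul I [set: N]) (smulS tI (@subset_refl _ _)).
Qed.

End OfModule.

Arguments relationsK {N} s.

(** For the cyclic module [R] the relations have a single coordinate; read there, they form the
    ideal of [SK] that defines the completion of [R] with scalars extended to [K]. *)
Definition annihilatorK : set SK := colon (relationsK [:: 1 : R^o]) (delta_mx ord0 ord0).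

Lemma span_one : span [set` [:: 1 : R^o]] = [set: R^o].
Proof.
apply/seteqP; split=> // x _; rewrite -[x]mulr1; apply: (subZ _ (@span_submodule R R^o _)).
by apply: sub_span; rewrite /= mem_head.
Qed.

Lemma ideal_annihilatorK : ideal annihilatorK.
Proof. by apply: ideal_colon; exact: submodule_extend. Qed.

Lemma annihilatorK_growth d : growth m [set 0] d -> growth (vanish 1) annihilatorK d.
Proof.
move=> [C hC]; exists C => t l hl; rewrite exp_vanish in hl.
have mei := ideal_ideal_exp m t.
have [||eW fW] := @len_relationsK R^o [:: 1] span_one t (ideal_exp m t) (vanish t) mei
  (@ideal_vanish n k t) (@subset_refl _ _) (@subset_refl _ _).
- by move=> h; apply: (presV he).
- by move=> r; exact: (presS he).
set W := sadd _ _ in eW fW.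
have hW : submodule W by apply: submodule_sadd; [exact: submodule_extend|exact: submodule_smul].
have le : (l <= len W [set: _])%N.
  apply: (leq_len hW (@subsetT _ _) fW).
  apply: (@chainS _ _ W (sadd W (span [set delta_mx ord0 ord0]))) => //.
  apply: chain_cyc hl => // b [y hy [z hz yz]].
  have [c vc ec] : exists2 c, vanish t c & z = c *: delta_mx ord0 ord0.
    have hv : submodule [set z : 'rV[SK]_1 | exists2 c, vanish t c & z = c *: delta_mx ord0 ord0].
      have vt := @ideal_vanish n K t.
      split=> [|_ _ [c hc ->] [c' hc' ->]|b' _ [c hc ->]].
      - by exists 0; [exact: (ideal0 vt)|rewrite scale0r].
      - by exists (c + c'); [exact: (idealD vt)|rewrite scalerDl].
      - by exists (b' * c); [exact: (idealMl _ vt)|rewrite scalerA].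
    apply: (smul_sub hv) hz => c x hc _; exists (c * x ord0 ord0).
      apply: (idealMr _ (@ideal_vanish n K t)); move: c hc; apply: ideal_gen_sub; first exact: ideal_vanish.
      by move=> _ [c hc <-] mu hmu; rewrite /mps_map hc ?rmorph0.
    apply/rowP => j; rewrite !mxE (ord1 j) !eqxx mulr1 //.
  exists (b - c); last by exists c => //; rewrite subrK.
  by rewrite /annihilatorK /colon /= scalerBl -yz ec addrK.
apply: leq_trans le _; rewrite eW.
have m0 : ideal_add [set 0] (ideal_exp m t) = ideal_exp m t.
  by rewrite ideal_addE (@sadd_idl R R^o) //; [exact: submodule_zero|move=> _ ->; exact: (ideal0 mei)].
have -> : @smul R R^o (ideal_exp m t) [set: _] = ideal_exp m t.
  apply/seteqP; split; first by apply: (@smul_sub R R^o _ _ _ mei) => a x ha _; exact: (idealMr _ mei).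
  by move=> x hx; rewrite -[x]mulr1; apply: (@smul_in R R^o).
by apply: len_leq => //; rewrite -m0; exact: hC.
Qed.

(** A relation on the generator 1 of [R] holds in every [R]-module, in each coordinate; both sides
    are then extended to [K]. *)
Lemma annihilatorK_kills (N : lmodType R) (s : seq N) b x :
  annihilatorK b -> relationsK s (b *: x).
Proof.
have hR := @submodule_extend S SK _ _ (@row_map (size s)) (relations m e s).
pose Q : set 'rV[SK]_1 := [set y | forall x, relationsK s (y ord0 ord0 *: x)].
have hQ : submodule Q.
  split=> [z|y y' hy hy' z|c y hy z]; rewrite mxE.
  - by rewrite scale0r; exact: (sub0 hR).
  - by rewrite scalerDl; exact: (subD hR (hy z) (hy' z)).
  - by rewrite -scalerA; exact: (subZ _ hR (hy z)).
have sub : relationsK [:: 1 : R^o] `<=` Q.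
  apply: (span_sub hQ) => _ [u hu <-] y; rewrite mxE.
  have hp : submodule [set y | relationsK s (mps_map i (u ord0 ord0) *: y)].
    split=> [|y1 y2|c y1] /=; rewrite ?scaler0 ?scalerDr ?scalerA 1?mulrC -?scalerA.
    - exact: (sub0 hR).
    - exact: (subD hR).
    - exact: (subZ _ hR).
  have : [set: 'rV[SK]_(size s)] y by []; rewrite -(span_row_map (size s)); move: y.
  apply: (span_sub hp) => _ [y _ <-] /=; rewrite -row_mapZ; apply: extend_in => t.
  rewrite -(subrK (e t (u ord0 ord0) *: pev e s t y) (pev _ _ _ _)).
  apply: (subD (submodule_smul _ _)); first exact: (pevZ he).
  apply: smul_in => //; have := hu t; rewrite /pev big_ord1 /=.
  have mei := ideal_ideal_exp m t.
  move: (e t _) => c; rewrite -[c *: 1]/(c * 1) mulr1.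
  by move: c; apply: (@smul_sub R R^o _ _ _ mei) => c' c hc _; exact: (idealMr _ mei).
by move=> /sub h; have := h x; rewrite !mxE !eqxx mulr1.
Qed.

End Extension.

Arguments relationsK {K} i {N} s.

(* The perfect closure [K] of [k] makes the power series ring Frobenius-finite with perfect residue
   field, and the extension of scalars from [k] to [K] preserves lengths. *)
Lemma pres_cvg (N : lmodType R) (s : RR) d : finitely_generated N ->
  growth m [set 0] d.+1 -> 0 < s ->
  cvgn (fun j => (len (smul (Ipow m (ceil_exp p s j) (p ^ j)) [set: N]) [set: N])%:R
    / (p ^ (j * d.+1))%:R : RR).
Proof.
move=> [g hg] hgr s0.
have [K [i perf]] := perfect_closure hpk.
have [rho [rhoD rhoZ rho1]] := field_retraction i.
have hpK : p \in [pchar K] := rmorph_pchar i hpk.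
have hpS := mps_pchar n hpK.
have [bs hbs] := mps_ffinite n hpK perf.
have hSK := mps_noetherian_local n K.
have perfS (a : mpseries n K) : exists b, vanish 1 (a - b ^+ p).
  have [b eb] := perf (a mpoly.mnm0); exists (mpsC n K b); rewrite -rmorphXn -eb.
  exact: vanish1_const.
have key j : len (sadd (relationsK i g)
    (smul (Ipow (vanish 1) (ceil_exp p s j) (p ^ j)) [set: _])) [set: _] =
  len (smul (Ipow m (ceil_exp p s j) (p ^ j)) [set: N]) [set: N].
  set a := ceil_exp p s j; set q := (p ^ j)%N.
  have q0 : (0 < q)%N by rewrite expn_gt0 prime_gt0 ?(prime_pchar hpR).
  have [|||| <- _] := @len_relationsK K i rho rhoD rhoZ rho1 N g hg a (Ipow m a q)
     (Ipow (vanish 1) a q) (ideal_Ipow m a q) (ideal_Ipow _ a q).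
  - exact: exp_Ipow.
  - by rewrite -exp_vanish; exact: exp_Ipow.
  - by move=> h; exact: (level_Ipow_sub (pres_level he a) hmi (@ideal_vanish n k 1) q0 (leqnn a)).
  - by move=> r; apply: (level_Ipow_surj (pres_level he a) hmi (@ideal_vanish n k 1) q0).
  by rewrite (extend_Ipow (mps_map i) _ _ _ hpS) mps_map_vanish.
have := @length_ratio_cvg RR _ _ hSK p hpS s perfS bs hbs s0 _ (relationsK i g)
  (annihilatorK i) d (fg_row _ _) (@submodule_extend _ _ _ _ _ _) (ideal_annihilatorK i)
  (@annihilatorK_kills K i N g)
  (annihilatorK_growth rhoD rhoZ rho1 hgr).
by under eq_fun => j do rewrite key.
Qed.

End Convergence.

Section QuotientRing.
Local Open Scope quotient_scope.
Variables (A : comNzRingType) (I : set A) (hI : ideal I) (n1 : ~ I 1).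

(** The proofs are arguments so that the ideal structure can be attached to the predicate itself. *)
Definition in_ideal (_ : ideal I) (_ : ~ I 1) : {pred A} := fun x => `[< I x >].

Lemma in_ideal_closed : idealr_closed (in_ideal hI n1).
Proof.
split; first exact/asboolP/(ideal0 hI).
  by apply/negP => /asboolP.
move=> a x y /asboolP Ix /asboolP Iy; apply/asboolP.
by apply: (idealD hI) => //; exact: (idealMl _ hI).
Qed.
HB.instance Definition _ := isIdealr.Build A (in_ideal hI n1) in_ideal_closed.

Lemma quotient_ring : exists (Q : comNzRingType) (pi : {rmorphism A -> Q}),
  (forall q, exists a, pi a = q) /\ forall a, pi a = 0 <-> I a.
Proof.
exists {ideal_quot (in_ideal hI n1)}, \pi_{ideal_quot (in_ideal hI n1)}; split=> [q|a].
  by elim/quotW: q => x; exists x.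
rewrite -(rmorph0 (\pi_{ideal_quot (in_ideal hI n1)})).
split=> [/eqP|Ia]; last apply/eqP.
  by rewrite -Quotient.idealrBE subr0 => /asboolP.
by rewrite -Quotient.idealrBE subr0; apply/asboolP.
Qed.

End QuotientRing.

(** * Lifting coefficient fields in characteristic [p] *)

Section PurelyInseparable.
Variables (k : fieldType) (p : nat) (hp : p \in [pchar k]) (L : set k).
Hypotheses (L1 : L 1) (LB : forall a b, L a -> L b -> L (a - b)).
Hypotheses (LM : forall a b, L a -> L b -> L (a * b)) (Lp : forall a, L (a ^+ p)).

Let L0 : L 0. Proof. by rewrite -(subrr 1); exact: LB. Qed.
Let LN a : L a -> L (- a). Proof. by move=> ?; rewrite -sub0r; exact: LB. Qed.
Let LD a b : L a -> L b -> L (a + b).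
Proof. by move=> ? ?; rewrite -(opprK b); apply: LB => //; exact: LN. Qed.
Let LV a : L a -> L a^-1.
Proof.
move=> La; have [->|a0] := eqVneq a 0; first by rewrite invr0.
have LX i : L (a ^+ i) by elim: i => [//|i IH]; rewrite exprS; exact: LM.
have -> : a^-1 = a ^+ p.-1 * a^-1 ^+ p.
  rewrite -[in X in _ * X](prednK (prime_gt0 (pcharf_prime hp))) exprS exprVn.
  by rewrite mulrCA mulfV ?mulr1 // expf_neq0.
exact: LM.
Qed.

Definition coefs_in (f : {poly k}) := forall i, L f`_i.

Lemma coefs_inD f g : coefs_in f -> coefs_in g -> coefs_in (f + g).
Proof. by move=> hf hg i; rewrite coefD; exact: LD. Qed.
Lemma coefs_inN f : coefs_in f -> coefs_in (- f).
Proof. by move=> hf i; rewrite coefN; exact: LN. Qed.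
Lemma coefs_inM f g : coefs_in f -> coefs_in g -> coefs_in (f * g).
Proof.
move=> hf hg i; rewrite coefM; elim/big_ind : _ => [//||j _]; [exact: LD|exact: LM].
Qed.
Lemma coefs_inZX c i : L c -> coefs_in (c *: 'X^i).
Proof. by move=> Lc j; rewrite coefZ coefXn; case: eqP => _; rewrite ?mulr1 ?mulr0. Qed.

Lemma divide_monic (f h : {poly k}) : f \is monic -> coefs_in f -> coefs_in h ->
  exists2 q, coefs_in q & (coefs_in (h - q * f) /\ (size (h - q * f)%R < size f)%N).
Proof.
move=> fm hf; have [n] := ubnP (size h); elim: n h => // n IH h hn hh.
have [lt|le] := ltnP (size h) (size f).
  by exists 0 => [i|]; rewrite ?coef0 // mul0r subr0.
have f0 : (0 < size f)%N by rewrite size_poly_gt0 monic_neq0.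
have h0 : (0 < size h)%N by exact: leq_trans le.
pose c := lead_coef h *: 'X^(size h - size f) : {poly k}.
have hc : coefs_in c by apply: coefs_inZX; exact: hh.
have hh' : coefs_in (h - c * f) by apply: coefs_inD => //; exact/coefs_inN/coefs_inM.
have [|//|q hq [h1 h2]] := IH (h - c * f).
  rewrite ltnS in hn; apply: leq_trans hn; rewrite -(prednK h0) ltnS; apply/leq_sizeP => j hj.
  rewrite coefB /c -scalerAl coefZ coefXnM.
  have [lt|ge] := ltnP j (size h - size f).
    by move: hj f0 lt le; lia.
  move: hj; rewrite leq_eqVlt => /orP[/eqP <-|hj].
    have -> : ((size h).-1 - (size h - size f) = (size f).-1)%N by move: le f0; lia.
    by rewrite -[X in _ - _ * X]lead_coefE (monicP fm) mulr1 lead_coefE subrr.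
  have -> : h`_j = 0 by apply: nth_default; move: hj; rewrite prednK.
  have -> : f`_(j - (size h - size f)) = 0 by apply: nth_default; move: hj f0 le ge; move: (size f) (size h) => sf sh; lia.
  by rewrite mulr0 subrr.
exists (c + q); first exact: coefs_inD.
by rewrite mulrDl opprD addrA.
Qed.

(** [L] is a subfield containing all [p]-th powers, and [al] has degree [p] over it. A monic [g1] of
    minimal degree divides [X ^ p - al ^ p = (X - al) ^ p], so it is [(X - al) ^ j] with [j < p].
    For [j = 1], [al] would be in [L]; for larger [j], the derivative is a smaller polynomial with
    root [al], hence zero, which contradicts [0 < j < p]. *)
Lemma root_coefs_in (al : k) (f : {poly k}) : ~ L al -> coefs_in f -> root f al ->
  (size f <= p)%N -> f = 0.
Proof.
move=> nL hf0 rf0 sf0; apply/eqP; apply: contrapT => /negP f0.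
have p0 := prime_gt0 (pcharf_prime hp).
pose Q n := `[< exists g : {poly k}, [/\ coefs_in g, root g al, g != 0 & size g = n] >].
have exQ : exists n, Q n by exists (size f); apply/asboolP; exists f.
case: (ex_minnP exQ) => n /asboolP[g [hg rg g0 sg]] gmin.
have gm h : coefs_in h -> root h al -> (size h < n)%N -> h = 0.
  move=> hh rh sh; apply/eqP; apply: contraTT (sh) => h0; rewrite -leqNgt.
  by apply: gmin; apply/asboolP; exists h.
have np : (n <= p)%N.
  by apply: leq_trans sf0; apply: gmin; apply/asboolP; exists f.
pose g1 := (lead_coef g)^-1 *: g.
have l0 : lead_coef g != 0 by rewrite lead_coef_eq0.
have g1m : g1 \is monic by rewrite monicE lead_coefZ mulVf.
have hg1 : coefs_in g1 by move=> i; rewrite coefZ; apply: LM => //; exact/LV/hg.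
have sg1 : size g1 = n by rewrite size_scale ?invr_eq0.
have rg1 : root g1 al by rewrite rootZ ?invr_eq0.
pose h := 'X^p - (al ^+ p)%:P : {poly k}.
have hh : coefs_in h.
  move=> i; rewrite coefB coefXn coefC; apply: LB; case: eqP => // _.
have [q hq [hr sr]] := divide_monic g1m hg1 hh.
have r0 : h - q * g1 = 0.
  apply: gm => //; last by rewrite -sg1.
  rewrite /root hornerD hornerN hornerM (eqP rg1) mulr0 subr0 /h.
  by rewrite !(hornerE, hornerXn) subrr.
have hP : p \in [pchar {poly k}] := rmorph_pchar (@polyC k) hp.
have eh : h = ('X - al%:P) ^+ p.
  by rewrite /h -[RHS]/(pFrobenius_aut hP _) rmorphB /= !pFrobenius_autE polyC_exp.
have : g1 %| ('X - al%:P) ^+ p.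
  by rewrite -eh -(subrK (q * g1) h) r0 add0r dvdp_mull.
move=> /dvdp_exp_XsubCP[j [jp]]; rewrite eqp_monic ?monic_exp ?monicXsubC // => /eqP eg.
have sj : n = j.+1 by rewrite -sg1 eg size_exp_XsubC.
have jp1 : (j < p)%N by rewrite -sj.
have [j0|j0] := posnP j.
  by move: rg1; rewrite eg j0 expr0 rootC oner_eq0.
have [j1|j1] := eqVneq j 1%N.
  apply: nL; have := hg1 0%N; rewrite eg j1 expr1 coefB coefX coefC sub0r => /LN.
  by rewrite opprK.
have d0 : g1^`() = 0.
  apply: gm.
  - move=> i; rewrite coef_deriv; move: (g1`_i.+1) (hg1 i.+1) => a La.
    by elim: i.+1 => [|l IH]; rewrite ?mulr0n // mulrS; exact: LD.
  - rewrite eg deriv_exp derivXsubC mul1r /root hornerMn horner_exp hornerXsubC subrr.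
    by rewrite expr0n; case: j j0 j1 {sj jp jp1 eg} => [|[|j]] //=; rewrite mul0rn.
  - by rewrite -sg1; apply: lt_size_deriv; rewrite monic_neq0.
move/eqP: d0; rewrite eg deriv_exp derivXsubC mul1r -mulr_natl mulf_eq0.
rewrite expf_eq0 polyXsubC_eq0 andbF orbF.
by rewrite -polyC_natr polyC_eq0 -(dvdn_pcharf hp) gtnNdvd.
Qed.

End PurelyInseparable.

Section LiftStep.
Variables (k : fieldType) (R : comNzRingType) (p : nat).
Hypotheses (hpk : p \in [pchar k]) (hpR : p \in [pchar R]).

(* [c] is a ring morphism from [k] to [R / I], up to choice of representatives. *)
Definition hom_mod (I : set R) (c : k -> R) :=
  [/\ forall a b, I (c (a + b) - (c a + c b)), forall a b, I (c (a * b) - c a * c b)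
    & I (c 1 - 1)].

Variables (I I' : set R) (c : k -> R).
Hypotheses (hI : ideal I) (hI' : ideal I') (n1 : ~ I 1).
Hypothesis I'I : I' `<=` I.
Hypothesis II' : forall x y, I x -> I y -> I' (x * y).
Hypothesis hc : hom_mod I c.

Definition graph_closed (G : set (k * R)) :=
  [/\ forall a b r s, G (a, r) -> G (b, s) -> G (a + b, r + s),
      forall a b r s, G (a, r) -> G (b, s) -> G (a * b, r * s)
    & G (1, 1)].

Lemma graph_horner G (al : k) (be : R) (f : {poly k}) (g : {poly R}) : graph_closed G ->
  G (0, 0) -> G (al, be) -> (forall i, G (f`_i, g`_i)) -> G (f.[al], g.[be]).
Proof.
move=> [GD GM G1] G0 Gab hfg.
pose n := maxn (size f) (size g).
rewrite (horner_coef_wide al (leq_maxl _ _ : (size f <= n)%N)).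
rewrite (horner_coef_wide be (leq_maxr _ _ : (size g <= n)%N)).
elim/big_ind2 : _ => [//|a r b s|i _]; first exact: GD.
apply: (GM) => //; elim: (val i) => [|j IH]; first by rewrite !expr0.
by rewrite !exprS; exact: GM.
Qed.

(* Partial sections of [R / I' -> R / I] over subfields of [k], closed under the canonical lift
   [r ^+ p] of [p]-th powers; a maximal one is defined everywhere. *)
Definition good_graph (G : set (k * R)) :=
  [/\ graph_closed G, forall a r, G (a, r) -> G (- a, - r),
      forall a r x, I (r - c a) -> I' x -> G (a ^+ p, r ^+ p + x),
      forall a r, G (a, r) -> I (r - c a) & forall r, G (0, r) -> I' r].

Let c0 : I (c 0).
Proof.
case: hc => hD _ _; have := hD 0 0; rewrite addr0 opprD addrA subrr sub0r.
by rewrite -mulN1r => /(idealMl (-1) hI); rewrite mulrA mulrNN !mul1r.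
Qed.

Let IN x : I x -> I (- x). Proof. exact: (@subN R R^o _ _ hI). Qed.
Let I'N x : I' x -> I' (- x). Proof. exact: (@subN R R^o _ _ hI'). Qed.
Let p2 : (1 < p)%N. Proof. exact: prime_gt1 (pcharf_prime hpk). Qed.

Lemma graph_hom_mod : graph_closed [set ar : k * R | I (ar.2 - c ar.1)].
Proof.
case: hc => hD hM h1; split=> /= [a b r s ha hb|a b r s ha hb|].
- have -> : r + s - c (a + b) = (r - c a) + (s - c b) - (c (a + b) - (c a + c b)) by ring.
  by apply: (idealB hI) => //; exact: (idealD hI).
- have -> : r * s - c (a * b) = (r - c a) * s + c a * (s - c b) - (c (a * b) - c a * c b) by ring.
  apply: (idealB hI) => //; apply: (idealD hI); [exact: (idealMr _ hI)|exact: (idealMl _ hI)].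
- by rewrite -opprB; exact: IN.
Qed.

(** As a consequence [r ^+ p] modulo [I'] depends only on [r] modulo [I]: this is the canonical lift
    of [p]-th powers. *)
Let powI' x : I x -> I' (x ^+ p).
Proof.
move=> Ix; rewrite -(subnK p2) exprD; apply: (idealMl _ hI').
by rewrite expr2; exact: II'.
Qed.

Let frobRB (x y : R) : (x - y) ^+ p = x ^+ p - y ^+ p.
Proof. by rewrite -!(pFrobenius_autE hpR) rmorphB. Qed.
Let frobkB (x y : k) : (x - y) ^+ p = x ^+ p - y ^+ p.
Proof. by rewrite -!(pFrobenius_autE hpk) rmorphB. Qed.
Let frobRD (x y : R) : (x + y) ^+ p = x ^+ p + y ^+ p.
Proof. by rewrite -!(pFrobenius_autE hpR) rmorphD. Qed.
Let frobkD (x y : k) : (x + y) ^+ p = x ^+ p + y ^+ p.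
Proof. by rewrite -!(pFrobenius_autE hpk) rmorphD. Qed.

Definition frobenius_graph : set (k * R) :=
  [set ar | exists a r x, [/\ I (r - c a), I' x & ar = (a ^+ p, r ^+ p + x)]].

Lemma hom_modN a r : I (r - c a) -> I (- r - c (- a)).
Proof.
case: hc => hD _ _ h; have -> : - r - c (- a) = - (r - c a) + (c (a + - a) - (c a + c (- a))) - c (a - a) by ring.
by apply: (idealB hI); rewrite ?subrr //; apply: (idealD hI); [exact: IN|have := hD a (- a); rewrite subrr].
Qed.

Lemma good_frobenius_graph : good_graph frobenius_graph.
Proof.
have [gD gM g1] := graph_hom_mod.
split.
- split.
  + move=> _ _ _ _ [a [r [x [h Ix [-> ->]]]]] [b [s [y [h' Iy [-> ->]]]]].
    exists (a + b), (r + s), (x + y); split; first exact: (gD _ _ _ _ h h').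
      exact: (idealD hI').
    by rewrite frobRD frobkD addrACA.
  + move=> _ _ _ _ [a [r [x [h Ix [-> ->]]]]] [b [s [y [h' Iy [-> ->]]]]].
    exists (a * b), (r * s), (r ^+ p * y + x * s ^+ p + x * y); split.
    * exact: (gM _ _ _ _ h h').
    * by apply: (idealD hI'); [apply: (idealD hI'); [exact: (idealMl _ hI')|exact: (idealMr _ hI')]|exact: (idealMl _ hI')].
    * by rewrite !exprMn; congr pair; ring.
  + by exists 1, 1, 0; rewrite !expr1n addr0; split=> //; exact: (ideal0 hI').
- move=> _ _ [a [r [x [h Ix [-> ->]]]]]; exists (- a), (- r), (- x); split.
  + exact: hom_modN.
  + exact: I'N.
  + by rewrite -(sub0r a) -(sub0r r) frobkB frobRB !expr0n eqn0Ngt (ltnW p2) !sub0r opprD.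
- by move=> a r x h Ix; exists a, r, x.
- move=> _ _ [a [r [x [h Ix [-> ->]]]]].
  rewrite addrAC; apply: (idealD hI); last exact: I'I.
  have hX i : I (r ^+ i - c (a ^+ i)).
    by elim: i => [|i IH]; rewrite ?expr0 // !exprS; exact: (gM _ _ _ _ h IH).
  exact: hX.
- move=> _ [a [r [x [h Ix [/esym/eqP + ->]]]]].
  rewrite expf_eq0 (ltnW p2) => /eqP a0; apply: (idealD hI') => //; apply: powI'.
  rewrite -(subrK (c a) r); apply: (idealD hI) => //; rewrite a0; exact: c0.
Qed.

(** A maximal partial lift is defined on a subfield [L] containing the [p]-th powers. For [al]
    outside [L], any representative [be] extends it to [L[al]]: the relations of [al] over [L] all
    come from its [p]-th power, whose lift [be ^+ p] the graph already prescribes. *)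
Lemma lift_hom_mod : exists2 c', hom_mod I' c' & forall a, I (c' a - c a).
Proof.
have [gD gM g1] := graph_hom_mod.
pose P (G : set (k * R)) := G = set0 \/ good_graph G.
have [F FP tot|G [PG maxG]] := @Zorn_bigcup _ P.
  have [[X0 FX0 X0n]|h] := pselect (exists2 X, F X & X !=set0); last first.
    left; apply/seteqP; split=> // x [X FX Xx]; case: h; exists X => //; by exists x.
  have gX X : F X -> X !=set0 -> good_graph X by move=> /FP[->|//] [].
  have two ar bs X Y : F X -> F Y -> X ar -> Y bs -> exists Z, [/\ F Z, Z ar, Z bs & good_graph Z].
    move=> FX FY Xa Yb; have [XY|YX] := tot _ _ FX FY.
      by exists Y; split=> //; [exact: XY|apply: gX => //; exists bs].
    by exists X; split=> //; [exact: YX|apply: gX => //; exists ar].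
  have [[_ _ X01] _ X0p _ _] := gX _ FX0 X0n.
  right; split.
  - split=> [a b r s [X FX Xa] [Y FY Yb]|a b r s [X FX Xa] [Y FY Yb]|]; last by exists X0.
      by have [Z [FZ Za Zb [[ZD _ _] _ _ _ _]]] := two _ _ _ _ FX FY Xa Yb; exists Z => //; exact: ZD.
    by have [Z [FZ Za Zb [[_ ZM _] _ _ _ _]]] := two _ _ _ _ FX FY Xa Yb; exists Z => //; exact: ZM.
  - by move=> a r [X FX Xa]; have [_ XN _ _ _] := gX X FX (ex_intro _ _ Xa); exists X => //; exact: XN.
  - by move=> a r x h Ix; exists X0 => //; exact: X0p.
  - by move=> a r [X FX Xa]; have [_ _ _ h _] := gX X FX (ex_intro _ _ Xa); exact: h.
  - by move=> r [X FX Xa]; have [_ _ _ _ h] := gX X FX (ex_intro _ _ Xa); exact: h.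
have {PG} [[GD GM G1] GN Gp GI G0] : good_graph G.
  case: PG => // G0; case: (maxG frobenius_graph); last by right; exact: good_frobenius_graph.
  have [[_ _ h1] _ _ _ _] := good_frobenius_graph.
  by rewrite G0; split=> // /(_ _ h1).
have G00 x : I' x -> G (0, x).
  move=> Ix; have : G (0 ^+ p, 0 ^+ p + x) by apply: Gp => //; rewrite sub0r; exact: IN.
  by rewrite !expr0n eqn0Ngt (ltnW p2) add0r.
pose L : set k := [set a | exists r, G (a, r)].
have L1 : L 1 by exists 1.
have LB a b : L a -> L b -> L (a - b).
  by move=> [r ha] [s hb]; exists (r - s); apply: GD => //; exact: GN.
have LM a b : L a -> L b -> L (a * b) by move=> [r ha] [s hb]; exists (r * s); exact: GM.
have Lp a : L (a ^+ p).
  exists (c a ^+ p + 0); apply: Gp; last exact: (ideal0 hI').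
  by rewrite subrr; exact: (ideal0 hI).
have LT al : L al.
  apply: contrapT => nL; pose be := c al.
  have hp0 : G (al ^+ p, be ^+ p).
    by rewrite -[be ^+ p]addr0; apply: Gp; rewrite ?subrr; [exact: (ideal0 hI)|exact: (ideal0 hI')].
  pose pairs (f : {poly k}) (g : {poly R}) := forall i, G (f`_i, g`_i).
  have pD f g f' g' : pairs f g -> pairs f' g' -> pairs (f + f') (g + g').
    by move=> h h' i; rewrite !coefD; exact: GD.
  have pM f g f' g' : pairs f g -> pairs f' g' -> pairs (f * f') (g * g').
    move=> h h' i; rewrite !coefM; elim/big_ind2 : _ => [|a r b s|j _].
    + exact: G00 (ideal0 hI').
    + exact: GD.
    + exact: GM.
  have pC a r : G (a, r) -> pairs a%:P r%:P.
    by move=> h i; rewrite !coefC; case: ifP => // _; exact: G00 (ideal0 hI').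
  have pX i : pairs 'X^i 'X^i.
    by move=> j; rewrite !coefXn; case: eqP => // _; exact: G00 (ideal0 hI').
  (* Well-definedness of the extension: if [f] over [L] vanishes at [al], its lift [g] vanishes at
     [be] modulo [I']. Multiples of [X ^ n - al ^ p X ^ (n - p)] lower the degree below [p], where
     [root_coefs_in] makes [f] zero. *)
  have zero n (f : {poly k}) (g : {poly R}) : (size f <= n)%N -> (size g <= n)%N -> pairs f g -> f.[al] = 0 -> I' g.[be].
    elim: n f g => [|n IH] f g sf sg hfg f0.
      by move: sg; rewrite leqn0 size_poly_eq0 => /eqP ->; rewrite horner0; exact: (ideal0 hI').
    have [np|pn] := ltnP n p.
      have f00 : f = 0.
        apply: (root_coefs_in hpk L1 LB LM Lp nL) => //; last exact: leq_trans np.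
          by move=> i; exists g`_i; exact: hfg.
        exact/eqP.
      rewrite horner_coef; apply: (ideal_sum _ hI') => i _; apply: (idealMr _ hI').
      by apply: G0; have := hfg i; rewrite f00 coef0.
    pose f' := f - f`_n *: 'X^n + (f`_n * al ^+ p) *: 'X^(n - p).
    pose g' := g - g`_n *: 'X^n + (g`_n * be ^+ p) *: 'X^(n - p).
    have e1 : f'.[al] = 0.
      rewrite /f' !(hornerE, hornerXn) f0 add0r -mulrA -exprD subnKC // addNr //.
    have e2 : g'.[be] = g.[be].
      by rewrite /g' !(hornerE, hornerXn) -mulrA -exprD subnKC // subrK.
    rewrite -e2; apply: (IH f') => //.
    - apply/leq_sizeP => j nj; rewrite /f' coefD coefB !coefZ !coefXn.
      have -> : (j == n - p)%N = false by apply/negbTE; move: (ltnW p2) pn nj; lia.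
      rewrite mulr0 addr0; case: eqVneq => [->|jn]; first by rewrite mulr1 subrr.
      rewrite mulr0 subr0 nth_default //; apply: leq_trans sf _; rewrite ltn_neqAle eq_sym jn //.
    - apply/leq_sizeP => j nj; rewrite /g' coefD coefB !coefZ !coefXn.
      have -> : (j == n - p)%N = false by apply/negbTE; move: (ltnW p2) pn nj; lia.
      rewrite mulr0 addr0; case: eqVneq => [->|jn]; first by rewrite mulr1 subrr.
      rewrite mulr0 subr0 nth_default //; apply: leq_trans sg _; rewrite ltn_neqAle eq_sym jn //.
    - apply: (pD); first apply: (pD) => //; rewrite -?mul_polyC.
        rewrite -!mulNr -!polyCN; apply: pM => //; apply: pC; exact: GN.
      by apply: pM => //; apply: pC; exact: GM.
  pose G' : set (k * R) := [set ar | exists f g, pairs f g /\ ar = (f.[al], g.[be])].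
  have Gab : G' (al, be).
    by exists 'X, 'X; split; [exact: (pX 1%N)|rewrite !hornerX].
  have GG' : G `<=` G'.
    by move=> [a r] h; exists a%:P, r%:P; split; [exact: pC|rewrite !hornerC].
  apply: (maxG G'); first by split=> // h; apply: nL; exists be; exact: h.
  right; split.
  - split.
    + move=> _ _ _ _ [f [g [h [-> ->]]]] [f' [g' [h' [-> ->]]]].
      by exists (f + f'), (g + g'); rewrite !hornerD; split=> //; exact: pD.
    + move=> _ _ _ _ [f [g [h [-> ->]]]] [f' [g' [h' [-> ->]]]].
      by exists (f * f'), (g * g'); rewrite !hornerM; split=> //; exact: pM.
    + exact: GG'.
  - move=> _ _ [f [g [h [-> ->]]]]; exists (- f), (- g); rewrite !hornerN; split=> //.
    by move=> i; rewrite !coefN; exact: GN.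
  - by move=> a r x h Ix; apply: GG'; exact: Gp.
  - move=> _ _ [f [g [h [-> ->]]]]; apply: (@graph_horner [set ar | I (ar.2 - c ar.1)]) => //=.
    + by rewrite sub0r; exact: IN.
    + by rewrite subrr; exact: (ideal0 hI).
    + by move=> i; exact: GI.
  - by move=> _ [f [g [h [/esym e0 ->]]]]; apply: (zero (maxn (size f) (size g)) f) => //; rewrite ?leq_maxl ?leq_maxr.
have /all_sig[c' hc'] : forall a, {r | G (a, r)} by move=> a; apply: cid; exact: LT.
exists c'; last by move=> a; exact: GI.
have G0B a r s : G (a, r) -> G (a, s) -> I' (r - s).
  by move=> h h'; apply: G0; rewrite -(subrr a); apply: GD => //; exact: GN.
split.
- by move=> a b; apply: (G0B (a + b)) => //; exact: GD.
- by move=> a b; apply: (G0B (a * b)) => //; exact: GM.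
- exact: (G0B 1).
Qed.

End LiftStep.

Section CoefficientMaps.
Variables (k : fieldType) (R : comNzRingType) (m : set R) (hm : noetherian_local m).
Variables (p : nat) (hpk : p \in [pchar k]) (hpR : p \in [pchar R]).
Variable res : {rmorphism R -> k}.
Hypotheses (res_surj : forall c, exists r, res r = c) (res_ker : forall r, res r = 0 <-> m r).
Let hmi := local_ideal hm.
Let me t := @ideal_ideal_exp R m t.

(** Each map is lifted from [R / m ^ t.+1] to [R / m ^ t.+2]; the square of [m ^ t.+1] lies in
    [m ^ t.+2]. The index is shifted by one because level 0 imposes no congruence. *)
Lemma coefficient_maps : exists c : nat -> k -> R,
  [/\ forall t, hom_mod (ideal_exp m t) (c t), forall t a, res (c t a) = a
    & forall t a, ideal_exp m t (c t.+1 a - c t a)].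
Proof.
have /all_sig[c1 hc1] : forall a, {r | res r = a} by move=> a; apply: cid; exact: res_surj.
have hom1 : hom_mod (ideal_exp m 1) c1.
  rewrite (exp1_sub hmi).
  by split=> [a b|a b|]; apply/res_ker; rewrite ?(rmorphB, rmorphD, rmorphM, rmorph1) /= ?hc1 subrr.
pose St t := {c : k -> R | hom_mod (ideal_exp m t.+1) c /\ forall a, res (c a) = a}.
have sub_m t x : ideal_exp m t.+1 x -> res x = 0.
  by move=> hx; apply/res_ker; rewrite -(exp1_sub hmi); exact: exp_antitone hx.
have step t (c : St t) : {c' : St t.+1 | forall a, ideal_exp m t.+1 (projT1 c' a - projT1 c a)}.
  case: c => c [hc rc] /=; apply: cid.
  have [||c' hc' h] := @lift_hom_mod k R p hpk hpR _ (ideal_exp m t.+2) c (me _) (me _) _ _ hc.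
  - exact: exp_antitone.
  - move=> x y hx hy; apply: (@exp_antitone _ m _ (t.+1 + t.+1)); first by lia.
    exact: exp_mul.
  have hc'2 : forall a, res (c' a) = a.
    by move=> a; rewrite -[RHS]rc; apply/eqP; rewrite -subr_eq0 -rmorphB; apply/eqP/(sub_m t).
  by exists (exist _ c' (conj hc' hc'2)).
pose cs := nat_rect St (exist _ c1 (conj hom1 hc1)) (fun t c => projT1 (step t c)).
exists (fun t => projT1 (cs t.-1)); split=> [[|t]|t a|[|t] a] //.
- by case: (projT2 (cs t)).
- by case: (projT2 (cs t.-1)).
- exact: (projT2 (step t (cs t))).
Qed.

Variables (s : seq R).
Hypothesis ms : ideal_gen [set` s] = m.
Local Notation n := (size s).
Local Notation S := (mpseries n k).
Local Notation mdeg := mpoly.mdeg.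
Let x (i : 'I_n) := s`_i.

Definition monomial (mu : mpoly.multinom n) : R := mpoly.mmap1 x mu.

Lemma monomial_exp mu : ideal_exp m (mdeg mu) (monomial mu).
Proof.
have mx i : m (x i) by rewrite -ms; apply: sub_ideal_gen; exact: mem_nth.
rewrite /monomial /mpoly.mmap1 mpoly.mdegE; elim/big_ind2 : _ => [//|a r b r'|i _].
  exact: exp_mul.
exact: expX.
Qed.

Lemma exists_presents : exists e : nat -> S -> R, presents m e /\
  forall t i, ideal_exp m t (e t (mps_of (mpoly.mpolyX k (mpoly.mnm1 i))) - s`_i).
Proof.
have [c [hom rc cc]] := coefficient_maps.
pose e t (f : S) : R := \sum_(mu : mpoly.bmultinom n t) c t (f mu) * monomial mu.
have hD t f g : ideal_exp m t (e t (f + g) - (e t f + e t g)).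
  rewrite /e -big_split -sumrB; apply: (ideal_sum _ (me t)) => mu _ /=.
  by rewrite -mulrDl -mulrBl mpsD; apply: (idealMr _ (me t)); case: (hom t).
have c0 t : ideal_exp m t (c t 0).
  case: (hom t) => h _ _; have := h 0 0; rewrite addr0 opprD addrA subrr sub0r.
  by move=> /(@subN R R^o _ _ (me t)); rewrite opprK.
(* Multiplicativity is checked in [R / m ^ t], where [c t] becomes a genuine morphism and [e t] the
   evaluation of a truncation by [mmap]; terms of degree at least [t] evaluate to zero. *)
have hM t f g : ideal_exp m t (e t (f * g) - e t f * e t g).
  case: (pselect (ideal_exp m t 1)) => [h1|n1].
    by rewrite (ideal_full (me t) h1).
  have [Q [pi [_ piI]]] := quotient_ring (me t) n1.
  pose sig a := pi (c t a).
  have pieq a b : ideal_exp m t (a - b) -> pi a = pi b.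
    by move=> /piI; rewrite rmorphB => /eqP; rewrite subr_eq0 => /eqP.
  have [homD homM hom1] := hom t.
  have sigD a b : sig (a + b) = sig a + sig b by rewrite -rmorphD; exact/pieq/homD.
  have sz : zmod_morphism sig by move=> a b; apply/eqP; rewrite eq_sym subr_eq -sigD subrK.
  have sm : monoid_morphism sig.
    by split=> [|a b]; rewrite -?(rmorph1 pi) -?rmorphM; [exact/pieq|exact/pieq/homM].
  pose sR : {rmorphism k -> Q} := HB.pack sig (GRing.isZmodMorphism.Build _ _ sig sz)
    (GRing.isMonoidMorphism.Build _ _ sig sm).
  pose M := mpoly.mmap sR (fun i => pi (x i)).
  have pimon mu : pi (monomial mu) = mpoly.mmap1 (fun i => pi (x i)) mu.
    by rewrite /monomial /mpoly.mmap1 rmorph_prod; apply: eq_bigr => i _; rewrite rmorphXn.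
  have Me h : pi (e t h) = M (mpseries_trunc t h).
    rewrite /e /M /mpseries_trunc !rmorph_sum; apply: eq_bigr => mu _.
    rewrite -[RHS]/(mpoly.mmap sR (fun i => pi (x i)) (h mu *: mpoly.mpolyX k mu)).
    by rewrite mpoly.mmapZ mpoly.mmapX rmorphM pimon.
  have M0 q : (forall mu, (mdeg mu < t)%N -> mpoly.mcoeff mu q = 0) -> M q = 0.
    move=> hq; rewrite /M /mpoly.mmap big1 // => mu _.
    have [lt|ge] := ltnP (mdeg mu) t; first by rewrite hq // rmorph0 mul0r.
    rewrite -pimon; have -> : pi (monomial mu) = 0; last by rewrite mulr0.
    by apply/piI; apply: exp_antitone ge _ (monomial_exp mu).
  apply/piI; rewrite rmorphB rmorphM !Me; apply/eqP.
  rewrite /M -rmorphM -rmorphB; apply/eqP/M0 => mu lt.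
  rewrite raddfB /= mpseries_truncE // -[(f * g) mu]/(mpseries_mul f g mu).
  by rewrite (@mpseries_mulE _ _ f g (mpseries_trunc t f) (mpseries_trunc t g) t) ?subrr // => mu'; exact: mpseries_truncE.
pose single a (mu : mpoly.multinom n) : S := fun m => if m == mu then a else 0.
have hS t a mu : ideal_exp m t (e t (single a mu) - c t a * monomial mu).
  have h0 (b : bool) (nu : mpoly.multinom n) : ideal_exp m t ((if b then c t 0 else 0) * monomial nu).
    by case: b; [exact: (idealMr _ (me t))|rewrite mul0r; exact: (ideal0 (me t))].
  have hz (Q : pred (mpoly.bmultinom n t)) : (forall nu, Q nu -> (nu : mpoly.multinom n) != mu) ->
      ideal_exp m t (\sum_(nu | Q nu) c t (single a mu nu) * monomial nu).
    move=> hQ; apply: (ideal_sum _ (me t)) => nu /hQ /negPf hnu.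
    by rewrite /single hnu; exact: (h0 true).
  have [lt|ge] := ltnP (mdeg mu) t.
    rewrite /e (bigD1 (mpoly.BMultinom lt)) //= {1}/single eqxx addrAC subrr add0r.
    by apply: hz => nu; apply: contraNneq => h; apply/eqP/val_inj.
  apply: (idealB (me t)); last first.
    by apply: (idealMl _ (me t)); apply: exp_antitone ge _ (monomial_exp mu).
  apply: hz => nu _; apply: contraTneq ge => <-; rewrite -ltnNge; exact: mpoly.bmdeg.
have hV t i f : (i <= t)%N -> vanish i f -> ideal_exp m i (e t f).
  move=> it vf; apply: (ideal_sum _ (me i)) => mu _.
  have [lt|ge] := ltnP (mdeg mu) i.
    by rewrite vf //; apply: (idealMr _ (me i)); apply: exp_antitone it _ (c0 t).
  by apply: (idealMl _ (me i)); apply: exp_antitone ge _ (monomial_exp mu).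
have single_v a mu : vanish (mdeg mu) (single a mu).
  by move=> nu; rewrite /single; case: eqP => // ->; rewrite ltnn.
(* One order of approximation: on a monomial of degree [i] in the generators of [m], a coefficient
   matters only modulo [m]. Iteration up to order [t] gives surjectivity. *)
have one t i r : (i < t)%N -> ideal_exp m i r ->
    exists2 f, vanish i f & ideal_exp m i.+1 (r - e t f).
  move=> it hr; have vi := @ideal_vanish n k i.
  pose W : set R := [set r | ideal_exp m i r /\
    exists2 f, vanish i f & ideal_exp m i.+1 (r - e t f)].
  suff /(_ r hr)[] : ideal_exp m i `<=` W by [].
  have hW : ideal W.
    apply: ideal_ofP.
    - split; first exact: (ideal0 (me i)).
      exists 0; first exact: (ideal0 vi).
      rewrite sub0r; apply: (@subN R R^o _ _ (me _)); apply: exp_antitone it _ _.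
      have := hD t 0 0; rewrite addr0 opprD addrA subrr sub0r.
      by move=> /(@subN R R^o _ _ (me t)); rewrite opprK.
    - move=> y z [iy [f vf hf]] [iz [g vg hg]]; split; first exact: (idealD (me i)).
      exists (f + g); first exact: (idealD vi).
      have -> : y + z - e t (f + g) = (y - e t f) + (z - e t g) - (e t (f + g) - (e t f + e t g)) by ring.
      by apply: (idealB (me _)); [exact: (idealD (me _))|apply: exp_antitone it _ (hD _ _ _)].
    - move=> b y [iy [f vf hf]]; split; first exact: (idealMl _ (me i)).
      pose g := single (res b) mpoly.mnm0.
      exists (g * f); first exact: (idealMl _ vi).
      have hg : ideal_exp m t (e t g - c t (res b)).
        by have := hS t (res b) mpoly.mnm0; rewrite /monomial mpoly.mmap11 mulr1.
      have -> : b * y - e t (g * f) = (b - c t (res b)) * y + c t (res b) * (y - e t f)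
          - (e t g - c t (res b)) * e t f - (e t (g * f) - e t g * e t f) by ring.
      apply: (idealB (me _)); last by apply: exp_antitone it _ (hM _ _ _).
      apply: (idealB (me _)); last by apply: (idealMr _ (me _)); apply: exp_antitone it _ hg.
      apply: (idealD (me _)); last exact: (idealMl _ (me _)).
      rewrite -add1n; apply: exp_mul => //; rewrite (exp1_sub hmi); apply/res_ker.
      by rewrite rmorphB rc subrr.
  rewrite -{1}ms => y /exp_monomials; move: y; apply: (ideal_gen_sub hW) => _ [al hal ->].
  pose mu : mpoly.multinom n := mpoly.Multinom [tuple al j | j < n].
  have dmu : mdeg mu = i.
    by rewrite -hal mpoly.mdegE; apply: eq_bigr => j _; rewrite mpoly.mnmE.
  have emu : \prod_(j < n) s`_j ^+ al j = monomial mu.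
    by rewrite /monomial /mpoly.mmap1; apply: eq_bigr => j _; rewrite mpoly.mnmE.
  rewrite emu; split; first by rewrite -dmu; exact: monomial_exp.
  exists (single 1 mu); first by rewrite -dmu; exact: single_v.
  have [_ _ h1] := hom t.
  rewrite -opprB; apply: (@subN R R^o _ _ (me _)); apply: exp_antitone it _ _.
  rewrite -(subrKA (c t 1 * monomial mu)); apply: (idealD (me t)) => //.
  by rewrite -{2}[monomial mu]mul1r -mulrBl; exact: (idealMr _ (me t)).
exists e; split; last first.
  move=> t i; have [_ _ h1] := hom t.
  have -> : mps_of (mpoly.mpolyX k (mpoly.mnm1 i)) = single 1 (mpoly.mnm1 i).
    by apply/funext => mu; rewrite /mps_of mpoly.mcoeffX /single eq_sym; case: eqP.
  rewrite -(subrKA (c t 1 * monomial (mpoly.mnm1 i))); apply: (idealD (me t)) => //.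
  have -> : monomial (mpoly.mnm1 i) = s`_i by rewrite /monomial mpoly.mmap1U.
  by rewrite -{2}[s`_i]mul1r -mulrBl; exact: (idealMr _ (me t)).
split=> // [t i r|t f].
  have [d] := ubnP (t - i); elim: d i r => // d IH i r hd hr.
  have [ti|it] := leqP t i.
    exists 0; first exact: (ideal0 (@ideal_vanish n k i)).
    apply: (idealB (me t)); first exact: exp_antitone ti _ hr.
    have := hD t 0 0; rewrite addr0 opprD addrA subrr sub0r.
    by move=> /(@subN R R^o _ _ (me t)); rewrite opprK.
  have [f vf hf] := one t i r it hr.
  have [|g vg hg] := IH i.+1 _ _ hf; first by move: hd it; lia.
  exists (f + g); first by apply: (idealD (@ideal_vanish n k i)) => //; exact: vanishS vg.
  have -> : r - e t (f + g) = (r - e t f - e t g) - (e t (f + g) - (e t f + e t g)) by ring.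
  exact: (idealB (me t)).
have [t0|t0] := posnP t; first by rewrite t0.
have {}t0 : (mdeg (mpoly.mnm0 : mpoly.multinom n) < t)%N by rewrite mpoly.mdeg0.
pose E u d := \sum_(mu : mpoly.bmultinom n d) u (f mu) * monomial mu.
have -> : e t.+1 f - e t f = (E (c t.+1) t.+1 - E (c t) t.+1) + (E (c t) t.+1 - E (c t) t).
  by rewrite subrKA.
apply: (idealD (me t)).
  rewrite -sumrB; apply: (ideal_sum _ (me t)) => mu _; rewrite -mulrBl.
  exact: (idealMr _ (me t)).
have -> : E (c t) t = \sum_(mu : mpoly.bmultinom n t.+1 | (mdeg mu < t)%N) c t (f mu) * monomial mu.
  rewrite (reindex_onto (fun mu : mpoly.bmultinom n t => mpoly.BMultinom (leqW (mpoly.bmdeg mu)))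
    (fun mu : mpoly.bmultinom n t.+1 => insubd (mpoly.BMultinom t0) (mu : mpoly.multinom n))) /=.
    by apply: eq_bigl => mu; rewrite mpoly.bmdeg valKd eqxx.
  by move=> mu lt; apply: val_inj; rewrite /= insubdK.
rewrite /E (bigID (fun mu : mpoly.bmultinom n t.+1 => (mdeg mu < t)%N)) /= addrAC subrr add0r.
apply: (ideal_sum _ (me t)) => mu; rewrite -leqNgt => ge.
by apply: (idealMl _ (me t)); apply: exp_antitone ge _ (monomial_exp mu).
Qed.

End CoefficientMaps.

(** * Degeneration to the quadric *)

Section PolynomialFiltration.
Variables (n : nat) (k : fieldType).
Local Notation P := (mpoly.mpoly n k).
Local Notation mdeg := mpoly.mdeg.

(** Polynomials replace power series here because substitution into them is an evaluation morphism;
    quotients by ideals containing some [low i] are the same as for series. *)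
Definition low i : set P := [set q | forall mu, (mdeg mu < i)%N -> mpoly.mcoeff mu q = 0].

Lemma low_vanish i q : low i q <-> vanish i (mps_of q).
Proof. by []. Qed.

Lemma ideal_low i : ideal (low i).
Proof.
have hv := @ideal_vanish n k i.
apply: ideal_ofP => [mu _|f g hf hg|f g hg]; first by rewrite mpoly.mcoeff0.
  by apply/low_vanish; rewrite rmorphD; exact: (idealD hv).
by apply/low_vanish; rewrite rmorphM; exact: (idealMl _ hv).
Qed.

Lemma low_mul a b f g : low a f -> low b g -> low (a + b) (f * g).
Proof. by move=> hf hg; apply/low_vanish; rewrite rmorphM; exact: vanish_mul. Qed.

Lemma lowS a b : (a <= b)%N -> low b `<=` low a.
Proof. by move=> ab f hf mu hm; apply: hf; exact: leq_trans ab. Qed.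

Lemma low_X i : low 1 (mpoly.mpolyX k (mpoly.mnm1 i)).
Proof.
move=> mu; rewrite ltnS leqn0 mpoly.mdeg_eq0 => /eqP ->.
by rewrite mpoly.mcoeffX mpoly.mnm1_eq0.
Qed.

Lemma low_exp i : ideal_exp (low 1) i = low i.
Proof.
have hI j := ideal_ideal_exp (low 1) j.
apply/seteqP; split.
  elim: i => [//|i IH]; rewrite ideal_expS.
  apply: (@smul_sub P P^o _ _ _ (ideal_low i.+1)) => f g hf /IH hg.
  by rewrite -add1n; exact: low_mul.
move=> q hq; rewrite (mpoly.mpolyE q); apply: (ideal_sum _ (hI i)) => mu _.
have [lt|ge] := ltnP (mdeg mu) i; first by rewrite hq // scale0r; exact: (ideal0 (hI i)).
rewrite -mpoly.mul_mpolyC; apply: (idealMl _ (hI i)); apply: exp_antitone ge _ _.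
rewrite mpoly.mpolyXE_id mpoly.mdegE; elim/big_ind2 : _ => [//|a r b s|j _].
  exact: exp_mul.
exact/expX/low_X.
Qed.

Lemma low_const (q : P) : low 1 (q - mpoly.mpolyC n (mpoly.mcoeff mpoly.mnm0 q)).
Proof.
move=> mu; rewrite ltnS leqn0 mpoly.mdeg_eq0 => /eqP ->.
by rewrite mpoly.mcoeffB mpoly.mcoeffC eqxx mulr1 subrr.
Qed.

Lemma low2P (h : P) : low 1 h -> (forall i, mpoly.mcoeff (mpoly.mnm1 i) h = 0) -> low 2 h.
Proof.
move=> h1 hi mu; rewrite ltnS leq_eqVlt => /orP[/mpoly.mdeg1P[i /eqP ->] //|]; exact: h1.
Qed.

End PolynomialFiltration.

Section Morse.
Variables (k : fieldType) (c1 d : nat).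
Local Notation n := (c1 + d.+1)%N.
Local Notation P := (mpoly.mpoly n k).
Local Notation S' := (mpseries d.+1 k).
Local Notation T := {poly S'}.
Local Notation mdeg := mpoly.mdeg.

Definition cvanish i : set T := [set f | forall j, vanish i f`_j].

Lemma ideal_coefs (I : set S') : ideal I -> ideal [set f : T | forall j, I f`_j].
Proof.
move=> hI; apply: ideal_ofP => [j|f g hf hg j|f g hg j].
- by rewrite coef0; exact: (ideal0 hI).
- by rewrite coefD; exact: (idealD hI).
- by rewrite coefM; apply: (ideal_sum _ hI) => l _; exact: (idealMl _ hI).
Qed.

Lemma ideal_cvanish i : ideal (cvanish i).
Proof. exact: ideal_coefs (@ideal_vanish _ _ i). Qed.

Lemma cvanish_mul a b f g : cvanish a f -> cvanish b g -> cvanish (a + b) (f * g).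
Proof.
move=> hf hg j; rewrite coefM; apply: (ideal_sum _ (@ideal_vanish _ _ _)) => l _.
exact: vanish_mul.
Qed.

Lemma cvanish_divX i g j : cvanish i (g * 'X^j) -> cvanish i g.
Proof. by move=> h l; have := h (l + j)%N; rewrite coefMXn ltnNge leq_addl /= addnK. Qed.

Definition tconst : {rmorphism k -> T} := polyC \o mpsC d.+1 k.

Definition subst (w : 'I_n -> T) : P -> T := mpoly.mmap tconst w.
HB.instance Definition _ w := GRing.RMorphism.on (subst w).

Lemma subst_const w c : subst w (mpoly.mpolyC n c) = tconst c.
Proof. exact: mpoly.mmapC. Qed.
Lemma subst_X w i : subst w (mpoly.mpolyX k (mpoly.mnm1 i)) = w i.
Proof. by rewrite /subst mpoly.mmapX mpoly.mmap1U. Qed.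

Lemma subst_vanish w j q : (forall i, cvanish 1 (w i)) -> low j q -> cvanish j (subst w q).
Proof.
move=> hw hq; apply: (ideal_sum _ (ideal_cvanish j)) => mu _.
have [lt|ge] := ltnP (mdeg mu) j.
  by rewrite hq // rmorph0 mul0r; exact: (ideal0 (ideal_cvanish j)).
apply: (idealMl _ (ideal_cvanish j)) => l; apply: vanishS ge _ _; move: l.
suff : cvanish (mdeg mu) (mpoly.mmap1 w mu) by [].
rewrite /mpoly.mmap1 mpoly.mdegE; elim/big_ind2 : _ => [l|a r b s|i _].
- exact: vanish0.
- exact: cvanish_mul.
- elim: (mu i) => [|e IH]; first by move=> l; exact: vanish0.
  by rewrite exprS -add1n; exact: cvanish_mul.
Qed.

Lemma subst_congr w w' (D : set T) q : ideal D -> (forall i, D (w i - w' i)) ->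
  D (subst w q - subst w' q).
Proof.
move=> hD hw; rewrite /subst /mpoly.mmap -sumrB; apply: (ideal_sum _ hD) => mu _.
rewrite -mulrBr; apply: (idealMl _ hD).
have prodD a b a' b' : D (a - a') -> D (b - b') -> D (a * b - a' * b').
  move=> h h'; have -> : a * b - a' * b' = (a - a') * b + a' * (b - b') by ring.
  by apply: (idealD hD); [exact: (idealMr _ hD)|exact: (idealMl _ hD)].
rewrite /mpoly.mmap1; elim/big_ind2 : _ => [|a a' b b'|i _].
- by rewrite subrr; exact: (ideal0 hD).
- exact: prodD.
- elim: (mu i) => [|e IH]; first by rewrite !expr0 subrr; exact: (ideal0 hD).
  by rewrite !exprS; exact: prodD.
Qed.

Lemma cvanish_div_coordinates (f : T) : cvanish 2 f -> exists g : 'I_d.+1 -> T,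
  (forall l, cvanish 1 (g l)) /\ f = \sum_l g l * (mpseriesX k l)%:P.
Proof.
move=> hf.
have /all_sig[g hg] : forall j, {g : 'I_d.+1 -> S' | (forall i, vanish 1 (g i)) /\
    f`_j = \sum_i mps_of (mpoly.mpolyX k (mpoly.mnm1 i)) * g i}.
  by move=> j; apply: cid; have [g hg] := vanish_divX (hf j); exists g.
exists (fun l => \poly_(j < size f) g j l); split=> [l j|].
  rewrite coef_poly; case: ifP => _; last exact: (ideal0 (@ideal_vanish _ _ 1)).
  by case: (hg j).
apply/polyP => j; rewrite coef_sum.
have [lt|ge] := ltnP j (size f); last first.
  rewrite nth_default // big1 // => l _.
  by rewrite coefMC coef_poly ltnNge ge mul0r.
have [_ {1}->] := hg j; apply: eq_bigr => l _.
rewrite coefMC coef_poly lt mulrC; congr (_ * _); apply/funext => mu.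
by rewrite /mps_of mpoly.mcoeffX /mpseriesX eq_sym.
Qed.

Lemma vanish_coordinate l : vanish 1 (mpseriesX k l : S').
Proof.
by apply/vanish1P; rewrite /mpseriesX eq_sym mpoly.mnm1_eq0.
Qed.

Variables (F : 'I_c1 -> P) (H : P).
Hypotheses (hF : forall i, low 1 (F i)) (hH : low 2 H).
Hypothesis two : (2%:R : k) != 0.

Local Notation x i := (lshift d.+1 i : 'I_n).
Local Notation y l := (rshift c1 l : 'I_n).
Local Notation Y l := ((mpseriesX k l)%:P : T).

(* A change of coordinates over [k[[y]][t]], written [T] with [t = 'X]: modulo [t ^ j] it
   straightens the family of equations [x_i + t F_i], [sum y_l ^ 2 + t H] to the quadric. *)
Definition adapted j (w : 'I_n -> T) : Prop :=
  [/\ forall i, cvanish 1 (w i),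
      forall l, exists z, w (y l) - Y l = z * 'X,
      forall i, exists2 xi, cvanish 1 xi & w (x i) + 'X * subst w (F i) = xi * 'X^j
    & exists2 eta, cvanish 2 eta &
        \sum_l w (y l) ^+ 2 + 'X * subst w H - \sum_l Y l ^+ 2 = eta * 'X^j].

Lemma cvanishC i (f : S') : vanish i f -> cvanish i f%:P.
Proof. by move=> hf j; rewrite coefC; case: eqP => // _; exact: (ideal0 (@ideal_vanish _ _ i)). Qed.

(** Newton iteration on the power of [t], starting from [x_i = 0] and [y_l = Y l]. An error
    [xi t ^ j.+1] in a linear equation is subtracted from [x_i]. An error [eta t ^ j.+1] in the
    quadratic one, with [eta] the sum of the [g l * Y l], is removed by moving [y_l] by half of
    [g l * t ^ j.+1], as in the Morse lemma. *)
Lemma exists_adapted j : exists w, adapted j.+1 w.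
Proof.
have h1 := ideal_cvanish 1; have h2 := ideal_cvanish 2.
elim: j => [|j [w [w1 wy wF wH]]].
  pose w (i : 'I_n) : T := match fintype.split i with inl _ => 0 | inr l => Y l end.
  have wx i : w (x i) = 0 by rewrite /w (unsplitK (inl i)).
  have wyE l : w (y l) = Y l by rewrite /w (unsplitK (inr l)).
  have w1 i : cvanish 1 (w i).
    rewrite /w; case: fintype.split => [_|l]; first exact: (ideal0 h1).
    exact/cvanishC/vanish_coordinate.
  exists w; split=> // [l|i|].
  - by exists 0; rewrite wyE subrr mul0r.
  - exists (subst w (F i)); first exact: subst_vanish.
    by rewrite wx add0r expr1 mulrC.
  - exists (subst w H); first exact: subst_vanish.
    by rewrite expr1; under eq_bigr do rewrite wyE; rewrite addrAC subrr add0r mulrC.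
have /all_sig2[xi xi1 hxi] : forall i, {xi | cvanish 1 xi & w (x i) + 'X * subst w (F i) = xi * 'X^(j.+1)}.
  by move=> i; apply: cid2.
have [eta eta2 heta] := wH.
have /all_sig[z hz] : forall l, {z | w (y l) - Y l = z * 'X} by move=> l; apply: cid.
have [g [g1 eg]] := cvanish_div_coordinates eta2.
pose hf : T := tconst (2%:R^-1).
have hf2 : hf * 2%:R = 1.
  by rewrite -(rmorph_nat tconst) -rmorphM mulVf // rmorph1.
pose dl (i : 'I_n) : T := match fintype.split i with inl i => xi i | inr l => hf * g l end.
have dx i : dl (x i) = xi i by rewrite /dl (unsplitK (inl i)).
have dy l : dl (y l) = hf * g l by rewrite /dl (unsplitK (inr l)).
have d1 i : cvanish 1 (dl i).
  by rewrite /dl; case: fintype.split => [i'|l]; [exact: xi1|exact: (idealMl _ h1)].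
pose w' i := w i - dl i * 'X^(j.+1).
have w'1 i : cvanish 1 (w' i).
  by apply: (idealB h1) => //; exact: (idealMr _ h1).
have hD := ideal_ideal_gen [set ('X^(j.+1) : T)].
have cong q : exists a, subst w' q - subst w q = a * 'X^(j.+1).
  apply/ideal_gen1P; apply: subst_congr => // i; apply/ideal_gen1P; exists (- dl i).
  by rewrite /w' addrAC subrr add0r mulNr.
have congV i q : low i q -> exists2 a, cvanish i a & subst w' q - subst w q = a * 'X^(j.+1).
  move=> hq; have [a ea] := cong q; exists a => //; apply: (@cvanish_divX _ _ j.+1); rewrite -ea.
  by apply: (idealB (ideal_cvanish i)); exact: subst_vanish.
exists w'; split=> // [l|i|].
- exists (z l - dl (y l) * 'X^j); rewrite /w' addrAC hz mulrBl -mulrA -exprSr //.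
- have [a a1 ea] := congV 1 (F i) (hF i); exists a => //.
  have -> : w' (x i) + 'X * subst w' (F i) =
      (w (x i) + 'X * subst w (F i)) - dl (x i) * 'X^(j.+1) + 'X * (subst w' (F i) - subst w (F i)).
    by rewrite /w'; ring.
  by rewrite hxi dx subrr add0r ea [LHS]mulrCA -exprS.
- have [a a2 ea] := congV 2 H hH.
  (* What the correction leaves at order [j.+2]: the variation of [subst w H], the cross terms with
     [w (y l) - Y l], and the square of the correction. *)
  pose G := a - \sum_l 2%:R * z l * dl (y l) + 'X^j * \sum_l dl (y l) ^+ 2.
  suff eG : \sum_l w' (y l) ^+ 2 + 'X * subst w' H - \sum_l Y l ^+ 2 = G * 'X^(j.+2).
    exists G => //; apply: (@cvanish_divX _ _ j.+2); rewrite -eG.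
    have sq (v : 'I_d.+1 -> T) : (forall l, cvanish 1 (v l)) -> cvanish 2 (\sum_l v l ^+ 2).
      by move=> hv; apply: (ideal_sum _ h2) => l _; rewrite expr2; exact: (cvanish_mul (hv l) (hv l)).
    apply: (idealB h2); last by apply: sq => l; exact/cvanishC/vanish_coordinate.
    by apply: (idealD h2); [exact: sq|apply: (idealMl _ h2); exact: subst_vanish].
  rewrite /G.
  have -> : \sum_l w' (y l) ^+ 2 = \sum_l w (y l) ^+ 2 - 'X^(j.+1) * \sum_l g l * Y l
      - 'X^(j.+2) * (\sum_l 2%:R * z l * dl (y l)) + 'X^(j.+2) * ('X^j * \sum_l dl (y l) ^+ 2).
    rewrite !mulr_sumr -!sumrB -big_split /=; apply: eq_bigr => l _.
    have -> : w' (y l) = w (y l) - dl (y l) * 'X^(j.+1) by [].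
    have ew : w (y l) = Y l + z l * 'X by rewrite -hz addrC subrK.
    have eg2 : g l = 2%:R * dl (y l) by rewrite dy mulrA [2%:R * _]mulrC hf2 mul1r.
    by rewrite eg2 ew !exprS; ring.
  rewrite -eg.
  have e1 : \sum_l w (y l) ^+ 2 = eta * 'X^(j.+1) - 'X * subst w H + \sum_l Y l ^+ 2.
    by rewrite -heta; ring.
  have e2 : subst w' H = a * 'X^(j.+1) + subst w H by rewrite -ea subrK.
  by rewrite e1 e2 !exprS; ring.
Qed.

End Morse.

(** * Comparison of colengths along the degeneration *)

Section Semicontinuity.
Variables (k : fieldType) (c1 d : nat) (p : nat) (hp : p \in [pchar k]).
Local Notation n := (c1 + d.+1)%N.
Local Notation P := (mpoly.mpoly n k).
Local Notation S' := (mpseries d.+1 k).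
Local Notation T := {poly S'}.
Variables (F : 'I_c1 -> P) (H : P).
Hypotheses (hF : forall i, low 1 (F i)) (hH : low 2 H).
Hypothesis two : (2%:R : k) != 0.
Variables (a e : nat).
Local Notation q := (p ^ e)%N.

(** The fibre of the family at [t = infinity], with equations [F_i] and [H]; [quadric_power]
    corresponds to the fibre at [t = 0], where the [x_i] are eliminated. *)
Definition deformed : set P := ideal_add (ideal_gen [set f | f = H \/ exists i, f = F i]) (Ipow (low 1) a q).
Definition quadric_power : set S' := ideal_add (ideal_gen [set @sum_squares k d]) (Ipow (vanish 1) a q).

Let q0 : (0 < q)%N. Proof. by rewrite expn_gt0 prime_gt0 ?(prime_pchar hp). Qed.

Lemma ideal_deformed : ideal deformed.
Proof. exact: ideal_ideal_add (ideal_ideal_gen _) (ideal_Ipow _ _ _). Qed.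
Lemma ideal_quadric_power : ideal quadric_power.
Proof. exact: ideal_ideal_add (ideal_ideal_gen _) (ideal_Ipow _ _ _). Qed.

Local Notation PM := (rscal (polyC \o @mpoly.mpolyC n k : {rmorphism k -> {poly P}}) {poly P}^o).
Local Notation TM := (rscal (tconst k d) T^o).
Local Notation PK := (rscal (@mpoly.mpolyC n k : {rmorphism k -> P}) P^o).
Local Notation SK := (rscal (mpsC d.+1 k) S'^o).

(** Raising to the power [q] is additive, so the coefficients in [t] of [f ^+ q] are, up to sign and
    position, [q]-th powers of those of [f]; no mixed products occur. *)
Lemma subst_Ipow (w : 'I_n -> T) h : (forall i, cvanish 1 (w i)) -> Ipow (low 1) a q h ->
  forall j, Ipow (vanish 1) a q (subst w h)`_j.
Proof.
move=> hw; have hI := ideal_Ipow (vanish 1 : set S') a q.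
have hc := ideal_coefs hI.
have hpre : ideal [set h | forall j, Ipow (vanish 1) a q (subst w h)`_j].
  apply: ideal_ofP => [|f g hf hg|f g hg].
  - by have := ideal0 hc; rewrite -(rmorph0 (subst w)).
  - by have := idealD hc hf hg; rewrite -(rmorphD (subst w)).
  - by have := idealMl (subst w f) hc hg; rewrite -(rmorphM (subst w)).
move: h; apply: (Ipow_sub hpre) => h hh j.
  move: hh; rewrite low_exp => /(subst_vanish hw)/(_ j); rewrite -exp_vanish; exact: exp_Ipow.
have h1 := subst_vanish hw hh.
have hpT : p \in [pchar T] := rmorph_pchar (tconst k d) hp.
have -> : subst w (h ^+ q) = subst w h ^+ q := rmorphXn (subst w) q h.
move: (subst w h) h1 => {h hh} f h1; move: j.
suff : [set f : T | forall j, Ipow (vanish 1) a q f`_j] (f ^+ q) by [].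
rewrite -[f]coefK poly_def -[_ ^+ q]/(frobe hpT e _) rmorph_sum; apply: (ideal_sum _ hc) => i _ j.
rewrite /= /frobe exprZn coefZ; apply: (idealMr _ hI).
by apply: (ideal_addrP (ideal_ideal_exp _ _)); apply: sub_ideal_gen; exists f`_i.
Qed.

Section Fixed.
Variables (L : nat) (w : 'I_n -> T) (hw : adapted F H L w).

Definition Theta (h : {poly P}) : T := \sum_(j < size h) subst w h`_j * 'X^j.

Lemma ThetaE N (h : {poly P}) : (size h <= N)%N -> Theta h = \sum_(j < N) subst w h`_j * 'X^j.
Proof.
move=> sN; rewrite /Theta (big_ord_widen N (fun j => subst w h`_j * 'X^j)) // big_mkcond.
apply: eq_bigr => j _; case: ltnP => // hj.
by rewrite nth_default // rmorph0 mul0r.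
Qed.

Lemma ThetaD : {morph Theta : f g / f + g}.
Proof.
move=> f g; pose N := maxn (size f) (size g).
rewrite (@ThetaE N (f + g)) ?size_polyD // (@ThetaE N f) ?leq_maxl // (@ThetaE N g) ?leq_maxr //.
by rewrite -big_split; apply: eq_bigr => j _; rewrite coefD rmorphD mulrDl.
Qed.

Lemma ThetaC (c : P) h : Theta (c%:P * h) = subst w c * Theta h.
Proof.
rewrite (@ThetaE (size h)) ?mulr_sumr; last first.
  by apply: leq_trans (size_mul_leq _ _) _; rewrite size_polyC; case: (c != 0); rewrite ?add1n ?add0n //= ?leq_pred.
by apply: eq_bigr => j _; rewrite coefCM rmorphM mulrA.
Qed.

Lemma Theta_monom (c : P) j : Theta (c%:P * 'X^j) = subst w c * 'X^j.
Proof.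
rewrite ThetaC; congr (_ * _); rewrite (@ThetaE j.+1) ?size_polyXn // big_ord_recr /=.
rewrite coefXn eqxx rmorph1 mul1r big1 ?add0r // => i _.
by rewrite coefXn ltn_eqF // rmorph0 mul0r.
Qed.

Lemma Theta_pull (U : set TM) : submodule U -> @submodule k PM (Theta @^-1` U).
Proof.
move=> hU; split => /=.
- by rewrite /Theta size_poly0 big_ord0; exact: (sub0 hU).
- by move=> f g hf hg; rewrite /= ThetaD; exact: (subD hU).
- move=> c f hf; change (U (Theta ((mpoly.mpolyC n c)%:P * f))).
  by rewrite ThetaC subst_const; exact: (subZ c hU hf).
Qed.

Definition trunc_power i : set TM := [set g | forall j, (j < i)%N -> quadric_power g`_j].
Definition short j : set PM := [set h : {poly P} | (size h <= j)%N].

Lemma ideal_trunc_power i : @ideal T (trunc_power i).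
Proof.
have hI := ideal_quadric_power; apply: ideal_ofP => [j jL|f g hf hg j jL|f g hg j jL].
- by rewrite coef0; exact: (ideal0 hI).
- by rewrite coefD; apply: (idealD hI); [exact: hf|exact: hg].
- rewrite coefM; apply: (ideal_sum _ hI) => l _; apply: (idealMl _ hI); apply: hg.
  exact: leq_ltn_trans (leq_subr _ _) jL.
Qed.

Lemma submodule_trunc_power i : submodule (trunc_power i).
Proof.
have hI := ideal_trunc_power i; split=> [|f g|c f]; first exact: (ideal0 hI).
  exact: (idealD hI).
exact: (idealMl (tconst k d c) hI).
Qed.

Lemma submodule_short j : submodule (short j).
Proof.
split=> [|f g hf hg|c f hf]; rewrite /short /=.
- by rewrite size_poly0.
- by apply: leq_trans (size_polyD _ _) _; rewrite geq_max hf.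
- change (size ((mpoly.mpolyC n c)%:P * (f : {poly P}))%R <= j)%N.
  apply: leq_trans (size_mul_leq _ _) _; rewrite size_polyC.
  by case: (_ != 0); rewrite ?add1n ?add0n //=; apply: leq_trans (leq_pred _) _.
Qed.

(** The kernel of the map from [P[t]] to [(S' / quadric_power)[t] / (t ^ L)]; by [Theta_surj] that
    map is onto already on polynomials of degree less than [L] in [t]. *)
Definition kern : set PM := Theta @^-1` trunc_power L.
Lemma submodule_kern : submodule kern.
Proof. exact: Theta_pull (submodule_trunc_power L). Qed.

Lemma trunc_power_Ipow h : Ipow (low 1) a q h -> trunc_power L (subst w h).
Proof.
case: hw => w1 _ _ _ hh j _; apply: (ideal_addrP (ideal_ideal_gen _)).
exact: subst_Ipow w1 hh j.
Qed.

Lemma trunc_power_XL g : trunc_power L (g * 'X^L).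
Proof. by move=> j jL; rewrite coefMXn jL; exact: (ideal0 ideal_quadric_power). Qed.

(* On the adapted coordinates [t F_i = - x_i] and [t H = - sum y_l ^ 2 + sum Y_l ^ 2], so an
   equation times [t ^ j.+1] can be traded for a polynomial times [t ^ j]. *)
Lemma deformed_reduce j h : deformed h ->
  exists h', kern (h%:P * 'X^(j.+1) + h'%:P * 'X^j).
Proof.
move: h; have hT := ideal_trunc_power L; case: hw => w1 wy wF wH.
pose D : set P := [set h | exists h', kern (h%:P * 'X^(j.+1) + h'%:P * 'X^j)].
have kE h h' : Theta (h%:P * 'X^(j.+1) + h'%:P * 'X^j) = (subst w h' + 'X * subst w h) * 'X^j.
  by rewrite ThetaD !Theta_monom exprS; ring.
have kI h h' : kern (h%:P * 'X^(j.+1) + h'%:P * 'X^j) <->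
    trunc_power L ((subst w h' + 'X * subst w h) * 'X^j).
  by rewrite /kern /preimage /= kE.
have hD : ideal D.
  apply: ideal_ofP => [|f g [f' /kI hf] [g' /kI hg]|f g [g' /kI hg]].
  - by exists 0; apply/kI; rewrite !rmorph0 mulr0 addr0 mul0r; exact: (ideal0 hT).
  - exists (f' + g'); apply/kI; rewrite !(rmorphD (subst w)).
    rewrite mulrDr addrACA mulrDl; exact: (idealD hT).
  - exists (f * g'); apply/kI; rewrite !(rmorphM (subst w)).
    by rewrite [X in _ + X]mulrCA -mulrDr -mulrA; exact: (idealMl _ hT).
suff : deformed `<=` D by [].
apply: (ideal_add_sub hD).
  apply: (ideal_gen_sub hD) => _ [->|[i ->]].
    exists (\sum_l mpoly.mpolyX k (mpoly.mnm1 (rshift c1 l)) ^+ 2).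
    apply/kI; rewrite rmorph_sum; apply: (idealMr _ hT).
    have [eta _ e2] := wH.
    have -> : \sum_l subst w (mpoly.mpolyX k (mpoly.mnm1 (rshift c1 l)) ^+ 2) =
        \sum_l w (rshift c1 l) ^+ 2.
      by apply: eq_bigr => l _; rewrite rmorphXn /= subst_X.
    rewrite -(subrK (\sum_l (mpseriesX k l)%:P ^+ 2) (_ + _)) e2; apply: (idealD hT).
      exact: trunc_power_XL.
    have -> : \sum_l (mpseriesX k l)%:P ^+ 2 = (@sum_squares k d)%:P :> T.
      by rewrite /sum_squares rmorph_sum; apply: eq_bigr => l _; rewrite -rmorphXn.
    move=> l _; rewrite coefC; case: eqP => _; last exact: (ideal0 ideal_quadric_power).
    by apply: (ideal_addlP (ideal_Ipow _ _ _)); apply: sub_ideal_gen.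
  exists (mpoly.mpolyX k (mpoly.mnm1 (lshift d.+1 i))).
  apply/kI; rewrite subst_X; apply: (idealMr _ hT).
  by have [xi _ ->] := wF i; exact: trunc_power_XL.
move=> h hh; exists 0; apply/kI; rewrite rmorph0 add0r; apply: (idealMr _ hT).
by apply: (idealMl _ hT); exact: trunc_power_Ipow.
Qed.

(** Induction on the degree in [t]: constants contribute at most [C]. In degree [j.+1], a leading
    coefficient in [deformed] can be traded for terms of lower degree by [deformed_reduce], so the
    new layer is a quotient of [P / deformed]. *)
Lemma lenle_kern C lam : @lenle k PK (Ipow (low 1) a q) [set: PK] C ->
  @lenle k PK deformed [set: PK] lam ->
  forall j, lenle (kern `&` short j.+1) (short j.+1) (C + j * lam).
Proof.
move=> hC hlam.
have hs j := submodule_short j; have hk := submodule_kern.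
have hks j : submodule (kern `&` short j) by exact: submoduleI.
have shortS i j : (i <= j)%N -> short i `<=` short j by move=> ij h hh; exact: leq_trans ij.
pose mo j : PK -> PM := fun x : P => x%:P * 'X^j : {poly P}.
have pull j (U : set PM) : submodule U -> @submodule k PK (mo j @^-1` U).
  move=> hU; split; rewrite /mo /=.
  - by rewrite polyC0 mul0r; exact: (sub0 hU).
  - by move=> f g hf hg; rewrite polyCD mulrDl; exact: (subD hU).
  - move=> c f hf; change (U ((mpoly.mpolyC n c * f)%:P * 'X^j)).
    by rewrite polyCM -mulrA; exact: (subZ c hU hf).
have addf j : {morph mo j : x y / x + y}.
  by move=> x y; rewrite /mo polyCD mulrDl.
have sz j (x : P) : short j.+1 (x%:P * 'X^j).
  rewrite /short /= ; have [->|x0] := eqVneq x 0; first by rewrite polyC0 mul0r size_poly0.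
  by rewrite mul_polyC size_scale ?size_polyXn.
elim=> [|j IH].
  rewrite mul0n addn0.
  apply: (@lenle_pull k k PK PM (mo 0) (Ipow (low 1) a q) [set: PK] (kern `&` short 1) (short 1) C
    (submoduleT _) (hs 1) (addf 0) (pull 0) _ _ _ hC).
  - move=> x hx; split; last exact: sz.
    by rewrite /kern /preimage /= /mo Theta_monom expr0 mulr1; exact: trunc_power_Ipow.
  - by [].
  - move=> y hy; exists (y : {poly P})`_0 => //; rewrite /mo expr0 mulr1 -size1_polyC // subrr.
    exact: (sub0 (hks _)).
rewrite (mulSn j) (addnCA C); pose W := sadd (short j.+1) (kern `&` short j.+2).
have hW : submodule W by exact: submodule_sadd.
have WV : W `<=` short j.+2 by apply: (sadd_sub (hs _)) => [|h []//]; exact: shortS.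
rewrite (addnC lam); apply: (lenle_cat (hks _) hW (hs _)) => //; first exact: (saddr (hs _)).
  move=> l hl; apply: IH; apply: (@chain_second_iso_inv _ _ _ (kern `&` short j.+2)) => //.
    by move=> h [h1 h2]; split=> //; split=> //; exact: shortS h2.
  by rewrite saddC.
apply: (@lenle_pull k k PK PM (mo j.+1) deformed [set: PK] W (short j.+2) lam
  (submoduleT _) (hs _) (addf _) (pull _) _ _ _ hlam).
- move=> x /(deformed_reduce j)[x' hx'].
  exists (- (x'%:P * 'X^j)); first by apply: (subN (hs _)); exact: sz.
  exists (x%:P * 'X^(j.+1) + x'%:P * 'X^j); last by rewrite addrC addrK.
  split=> //; apply: (subD (hs _)); first exact: sz.
  by apply: (shortS j.+1) => //; exact: sz.
- by [].
- move=> y hy; exists (y : {poly P})`_j.+1 => //; apply: (saddl (hks _)).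
  rewrite /short /=; apply/leq_sizeP => i hi; rewrite coefB coefCM coefXn.
  case: eqVneq => [->|ij]; first by rewrite mulr1 subrr.
  rewrite mulr0 subr0 nth_default //; apply: leq_trans hy _.
  by rewrite ltn_neqAle eq_sym ij.
Qed.

(** The coefficients in [t] are matched one after the other: modulo [t], [subst w] sends [y_l] to
    [Y l], so polynomials in the [y_l] approximate every series to the order [a] that matters. *)
Lemma Theta_surj (y : TM) : exists2 x, short L x & trunc_power L (y - Theta x).
Proof.
case: hw => w1 wy _ _.
have phiD f g : (subst w (f + g))`_0 = (subst w f)`_0 + (subst w g)`_0 by rewrite rmorphD coefD.
have phi i (f : S') : exists c : P, vanish i (f - (subst w c)`_0).
  elim: i f => [|i IH] f; first by exists 0.
  have [g [_ eg]] := @vanish_divX _ _ 0 _ (vanish1_const f).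
  have /all_sig[c hc] : forall l, {c | vanish i (g l - (subst w c)`_0)} by move=> l; apply: cid; exact: IH.
  exists (mpoly.mpolyC n (f mpoly.mnm0) + \sum_l mpoly.mpolyX k (mpoly.mnm1 (rshift c1 l)) * c l).
  have -> : f = mpsC d.+1 k (f mpoly.mnm0) +
      \sum_l mps_of (mpoly.mpolyX k (mpoly.mnm1 l)) * g l by rewrite -eg addrC subrK.
  rewrite phiD subst_const /= coefC eqxx /= opprD addrACA.
  have -> : (mpsC d.+1 k (f mpoly.mnm0) + \sum_l mps_of (mpoly.mpolyX k (mpoly.mnm1 l)) * g l) mpoly.mnm0
     = f mpoly.mnm0 by rewrite -eg addrC subrK.
  rewrite subrr add0r rmorph_sum coef_sum -sumrB.
  apply: (ideal_sum _ (@ideal_vanish _ _ _)) => l _.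
  rewrite rmorphM /= subst_X coefM big_ord1 /=.
  have -> : (w (rshift c1 l))`_0 = mps_of (mpoly.mpolyX k (mpoly.mnm1 l)).
    have [z ez] := wy l; rewrite -(subrK (mpseriesX k l)%:P (w _)) ez coefD coefMX coefC /= add0r.
    by apply/funext => mu; rewrite /mps_of mpoly.mcoeffX /mpseriesX eq_sym.
  rewrite -mulrBr; apply: (@vanish_mul _ _ 1 i) => //; exact: (@low_X _ k l).
have hI := ideal_quadric_power.
suff main i : (i <= L)%N -> exists2 x, short L x & trunc_power i (y - Theta x) by exact: main.
elim: i => [|i IH] iL; first by exists 0; rewrite /short /= ?size_poly0.
have [x hx ht] := IH (ltnW iL).
have [c hc] := phi a (y - Theta x)`_i.
have sc : short L (c%:P * 'X^i).
  rewrite /short /=; have [->|x0] := eqVneq c 0; first by rewrite polyC0 mul0r size_poly0.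
  by rewrite mul_polyC size_scale ?size_polyXn.
exists (x + c%:P * 'X^i); first exact: (subD (submodule_short L)).
move=> j; rewrite ltnS leq_eqVlt => /orP[/eqP ->|ji].
  rewrite ThetaD Theta_monom opprD addrA coefB coefMXn ltnn subnn.
  by apply: (ideal_addrP (ideal_ideal_gen _)); apply: exp_Ipow; rewrite exp_vanish.
by rewrite ThetaD Theta_monom opprD addrA coefB coefMXn ji subr0; exact: ht.
Qed.

(** Each of the [L] layers in powers of [t] is a copy of [S' / quadric_power]. *)
Lemma chain_trunc_power l : @chain k SK quadric_power [set: SK] l ->
  chain (trunc_power L) [set: TM] (L * l).
Proof.
move=> hl; have ht := submodule_trunc_power.
have step i : chain (trunc_power i.+1) (trunc_power i) l.
  apply: (@chain_pull k k TM SK (fun g : TM => (g : T)`_i : SK) (trunc_power i.+1) (trunc_power i)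
    quadric_power [set: SK] l (ht i) (submoduleT _) _ _ _ _ _ hl).
  - by move=> f g; rewrite coefD.
  - move=> U hU; split => /=.
    + by rewrite coef0; exact: (sub0 hU).
    + by move=> f g hf hg; rewrite coefD; exact: (subD hU).
    + move=> c f hf; change (U ((mpsC d.+1 k c)%:P * (f : T))`_i); rewrite coefCM.
      exact: (subZ c hU hf).
  - by move=> g; apply; exact: ltnSn.
  - by move=> g hg j ji; apply: hg; exact: ltnW.
  - move=> z _; exists (z%:P * 'X^i).
      by move=> j ji; rewrite coefMXn ji; exact: (ideal0 ideal_quadric_power).
    by rewrite coefMXn ltnn subnn coefC eqxx subrr; exact: (ideal0 ideal_quadric_power).
elim: (L) => [|i IH]; first by apply: chain0.
rewrite mulSn; exact: chain_cat (step i) IH.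
Qed.

Lemma quadric_count C lam l : (0 < L)%N -> @lenle k PK (Ipow (low 1) a q) [set: PK] C ->
  @lenle k PK deformed [set: PK] lam -> @chain k SK quadric_power [set: SK] l ->
  (L * l <= C + L.-1 * lam)%N.
Proof.
move=> L0 hC hlam hl; have := @lenle_kern C lam hC hlam L.-1 (L * l); rewrite (prednK L0); apply.
apply: (@chain_pull k k PM TM Theta (kern `&` short L) (short L) (trunc_power L) [set: TM] (L * l)
  (submodule_short L) (submoduleT _) ThetaD Theta_pull _ _ _ (chain_trunc_power hl)).
- by move=> h [].
- by move=> h [].
- by move=> y _; have [x hx hy] := Theta_surj y; exists x.
Qed.

End Fixed.

Lemma quadric_semicontinuity C lam l : @lenle k PK (Ipow (low 1) a q) [set: PK] C ->
  @lenle k PK deformed [set: PK] lam -> @chain k SK quadric_power [set: SK] l ->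
  (l <= lam)%N.
Proof.
(* The count is used for [L = C.+1], where it reads [(C + 1) l <= C + C lam] and excludes
   [l > lam]. *)
move=> hC hlam hl; have [w hw] := exists_adapted hF hH two C.
have /= := quadric_count hw (ltn0Sn C) hC hlam hl.
by move: C l lam {hC hl hlam w hw} => C l lam; nia.
Qed.

End Semicontinuity.

(** A positive value is not the default of [get], so it is a true maximum. *)
Lemma max_chainP (T : Type) (Pr : set (set T)) : (0 < max_chain Pr)%N ->
  has_chain Pr (max_chain Pr) /\ forall l, has_chain Pr l -> (l <= max_chain Pr)%N.
Proof.
move=> h; have [[n hn]|e] := pselect ([set n | has_chain Pr n /\ forall l, has_chain Pr l -> (l <= n)%N] !=set0).
  exact: (@getPex _ _ (ex_intro _ n hn)).
move: h; rewrite /max_chain getPN // => n hn; apply: e; by exists n.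
Qed.

Lemma exp_morph (A B : comNzRingType) (f : {rmorphism A -> B}) (I : set A) (J : set B) t x :
  (forall a, I a -> J (f a)) -> ideal_exp I t x -> ideal_exp J t (f x).
Proof.
move=> IJ; elim: t x => [//|t IH] x; rewrite ideal_expS.
have hJ := ideal_ideal_exp J t.+1.
have hf : ideal (f @^-1` ideal_exp J t.+1).
  apply: ideal_ofP => [|y z|y z] /=; rewrite ?rmorph0 ?rmorphD ?rmorphM.
  - exact: (ideal0 hJ).
  - exact: (idealD hJ).
  - exact: (idealMl _ hJ).
apply: (@smul_sub A A^o _ _ _ hf) => a y Ia /IH hy.
change (ideal_exp J t.+1 (f (a * y))); rewrite rmorphM ideal_expS.
by apply: (@smul_in B B^o) => //; exact: IJ.
Qed.

(** * Equations of a complete intersection *)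

Section CompleteIntersection.
Variables (R : comNzRingType) (m : set R) (hm : noetherian_local m).
Variables (B : comNzRingType) (f : {rmorphism R -> B}) (hf : is_adic_completion m f).
Variables (Q : comNzRingType) (mQ : set Q) (hQ : noetherian_local mQ).
Variables (y : seq Q) (hy : ideal_gen [set` y] = mQ).
Variables (s : seq Q) (g : {rmorphism Q -> B}).
Hypotheses (hs : regular_sequence s) (gsurj : range g = [set: B]).
Hypothesis gker : g @^-1` [set 0] = ideal_gen [set` s].
Let hmi := local_ideal hm.
Let hQi := local_ideal hQ.

Definition bexp t : set B := ideal_gen (f @` ideal_exp m t).
Let hb t : ideal (bexp t) := ideal_ideal_gen _.

Lemma g_surj b : exists z, g z = b.
Proof. by have : range g b by [rewrite gsurj]; case=> z _ <-; exists z. Qed.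

Lemma g_ker z : g z = 0 <-> ideal_gen [set` s] z.
Proof. by rewrite -gker. Qed.

Lemma bexp_f t a : bexp t (f a) <-> ideal_exp m t a.
Proof.
case: hf => h _ _ _; split; first exact: h.
by move=> ha; apply: sub_ideal_gen; exists a.
Qed.

Lemma bexp_approx t b : exists a, bexp t (b - f a).
Proof. by case: hf => _ h _ _; exact: h. Qed.

Lemma bexp_antitone t u : (t <= u)%N -> bexp u `<=` bexp t.
Proof.
move=> tu; apply: ideal_gen_sub => // _ [a ha <-]; apply/bexp_f; exact: exp_antitone ha.
Qed.

Lemma bexpM t u b c : bexp t b -> bexp u c -> bexp (t + u) (b * c).
Proof.
move=> ht hu.
have hc c' : ideal [set b | bexp (t + u) (b * c')].
  apply: ideal_ofP => [|b1 c1|b1 c1] /=; rewrite ?mul0r ?mulrDl -?mulrA.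
  - exact: (ideal0 (hb _)).
  - exact: (idealD (hb _)).
  - exact: (idealMl _ (hb _)).
move: b ht; apply: (ideal_gen_sub (hc c)) => _ [a ha <-] /=; rewrite mulrC.
move: c hu; apply: (ideal_gen_sub (hc _)) => _ [c hc' <-] /=.
by rewrite -rmorphM mulrC; apply/bexp_f; exact: exp_mul.
Qed.

Lemma g_ideal I : ideal I -> ideal (g @^-1` I).
Proof.
move=> hI; apply: ideal_ofP => [|b c|b c] /=; rewrite ?rmorph0 ?rmorphD ?rmorphM.
- exact: (ideal0 hI).
- exact: (idealD hI).
- exact: (idealMl _ hI).
Qed.

(** If a member of [mQ] had an image outside [bexp 1], an inverse modulo [bexp 1] would lift to [Q]
    and put 1 into [mQ]. *)
Lemma bexp_g1 z : bexp 1 (g z) <-> mQ z.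
Proof.
have sub : g @^-1` bexp 1 `<=` mQ.
  apply: (local_max hQ); first exact: g_ideal.
  rewrite /preimage /= rmorph1 -(rmorph1 f) bexp_f exp1_sub //; exact: local_n1 hm.
split; first exact: sub.
move=> mz; have [a ha] := bexp_approx 1 (g z).
have [ma|nma] := pselect (m a).
  rewrite -(subrK (f a) (g z)); apply: (idealD (hb 1)) => //.
  by apply/bexp_f; rewrite exp1_sub.
have [a' ea] := local_unit hm nma; have [z' ez] := g_surj (f a').
have : mQ (z' * z - 1).
  apply: sub; rewrite /preimage /= rmorphB rmorphM rmorph1 ez -(rmorph1 f) -ea rmorphM -mulrBr.
  exact: (idealMl _ (hb 1)).
move=> h; case: (local_n1 hQ); rewrite -(subKr (z' * z) 1); apply: (idealB hQi) => //.
exact: (idealMl _ hQi).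
Qed.

Lemma bexp_g t z : ideal_exp mQ t z -> bexp t (g z).
Proof.
have h : forall a, mQ a -> ideal_gen (f @` m) (g a).
  by move=> a /bexp_g1; rewrite /bexp exp1_sub.
by move=> /(exp_morph h)/extend_exp.
Qed.

Lemma bexp_lift t b : bexp t b -> exists2 z, ideal_exp mQ t z & g z = b.
Proof.
have hG u : ideal [set b | exists2 z, ideal_exp mQ u z & g z = b].
  have hu := ideal_ideal_exp mQ u; apply: ideal_ofP.
  - by exists 0; [exact: (ideal0 hu)|rewrite rmorph0].
  - by move=> _ _ [z hz <-] [w hw <-]; exists (z + w); [exact: (idealD hu)|rewrite rmorphD].
  - move=> c _ [w hw <-]; have [z <-] := g_surj c.
    by exists (z * w); [exact: (idealMl _ hu)|rewrite rmorphM].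
move: b; apply: (ideal_gen_sub (hG t)) => _ [a ha <-].
elim: t a ha => [|t IH] a.
  by move=> _; have [z ez] := g_surj (f a); exists z.
rewrite ideal_expS.
have hp : ideal [set a | exists2 z, ideal_exp mQ t.+1 z & g z = f a].
  have h := hG t.+1; apply: ideal_ofP => [|x z|x z] /=; rewrite ?rmorph0 ?rmorphD ?rmorphM.
  - exact: (ideal0 h).
  - exact: (idealD h).
  - exact: (idealMl _ h).
apply: (@smul_sub R R^o _ _ _ hp) => x w mx /IH[w' hw' ew].
have [z ez] := g_surj (f x).
have mz : mQ z by apply/bexp_g1; rewrite ez; apply/bexp_f; rewrite exp1_sub.
exists (z * w'); last by rewrite rmorphM ez ew -rmorphM.
by rewrite ideal_expS; apply: (@smul_in Q Q^o).
Qed.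

Lemma s_proper : ideal_gen [set` s] `<=` mQ.
Proof. by case: hs => h _; exact: (local_max hQ (ideal_ideal_gen _) h). Qed.

(** Each element of the regular sequence lowers the growth by one; if growth 0 were reached too
    early, the sequence would generate the unit ideal. *)
Lemma growth_sequence i : growth mQ [set 0] (size y) -> (i <= size s)%N ->
  (i <= size y)%N /\ growth mQ (ideal_gen [set` take i s]) (size y - i).
Proof.
move=> gQ; elim: i => [|i IH] hi.
  rewrite subn0 take0; split=> //; apply: growthS gQ => _ ->; exact: (ideal0 (ideal_ideal_gen _)).
have [iy gi] := IH (ltnW hi); case: hs => sp hreg.
have nz : nzd (ideal_gen [set` take i s]) s`_i.
  by move=> a h; apply: (hreg i hi); rewrite mulrC.
have eq : ideal_gen [set` take i.+1 s] =
    ideal_add (ideal_gen [set` take i s]) (ideal_gen [set s`_i]).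
  rewrite (take_nth 0 hi); apply/seteqP; split.
    apply: ideal_gen_sub; first exact: ideal_ideal_add (ideal_ideal_gen _) (ideal_ideal_gen _).
    move=> x; rewrite /= mem_rcons inE => /orP[/eqP ->|xs].
      by apply: (ideal_addrP (ideal_ideal_gen _)); apply: sub_ideal_gen.
    by apply: (ideal_addlP (ideal_ideal_gen _)); apply: sub_ideal_gen.
  apply: (ideal_add_sub (ideal_ideal_gen _)).
    by apply: ideal_gen_sub; [exact: ideal_ideal_gen|move=> x xs; apply: sub_ideal_gen; rewrite /= mem_rcons inE xs orbT].
  by apply: ideal_gen_sub; [exact: ideal_ideal_gen|move=> x ->; apply: sub_ideal_gen; rewrite /= mem_rcons mem_head].
have [e0|pos] := posnP (size y - i).
  rewrite e0 in gi; have := growth0_nzd hQ (ideal_ideal_gen _) nz gi; rewrite -eq => h1.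
  case: sp; move: h1; apply: ideal_gen_sub; first exact: ideal_ideal_gen.
  by move=> x /mem_take xs; apply: sub_ideal_gen.
split; first by rewrite -subn_gt0.
rewrite eq subnS; apply: (growth_nzd hQ (ideal_ideal_gen _) nz); by rewrite prednK.
Qed.

(** The quotients [R / m ^ t], [B / m ^ t B] and [Q / ((s) + mQ ^ t)] are isomorphic; [er] chooses
    representatives in [R] of the images of elements of [Q]. *)
Lemma growth_quotient : growth mQ (ideal_gen [set` s]) (size y - size s) ->
  growth m [set 0] (size y - size s).
Proof.
move=> [C hC]; exists C => t.
have /all_sig[er her] : forall z, {a | bexp t (g z - f a)} by move=> z; apply: cid; exact: bexp_approx.
have mt := ideal_ideal_exp m t.
have -> : ideal_add [set 0] (ideal_exp m t) = ideal_exp m t.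
  by rewrite ideal_addE (@sadd_idl R R^o) //; [exact: submodule_zero|move=> _ ->; exact: (ideal0 mt)].
have fin : @finlen R R^o (ideal_exp m t) [set: R].
  have := finlen_add hm t (@submodule_zero R R^o).
  by rewrite ideal_addE (@sadd_idl R R^o) //; [exact: submodule_zero|move=> _ ->; exact: (ideal0 mt)].
have adj a b : bexp t (f a - f b) -> ideal_exp m t (a - b) by rewrite -rmorphB => /bexp_f.
have elen := @len_approx Q R Q^o R^o er er (ideal_exp m t) _ _ _ _ (ideal_exp m t) mt (@subset_refl _ _).
apply: lenle_leq (lenle_len mt (@subsetT _ _) fin); rewrite -elen; first last.
- move=> r; have [z ez] := g_surj (f r); exists z => x; apply: (idealMr _ mt).
  by apply: adj; rewrite -ez; exact: her.
- move=> r; have [z ez] := g_surj (f r); exists z.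
  by apply: adj; rewrite -ez; exact: her.
- move=> a u; apply: adj; change (bexp t (f (er (a * u)) - f (er a * er u))).
  have -> : f (er (a * u)) - f (er a * er u) =
      (g a - f (er a)) * g u + f (er a) * (g u - f (er u)) - (g (a * u) - f (er (a * u))).
    by rewrite !rmorphM; ring.
  apply: (idealB (hb t)) => //; apply: (idealD (hb t)); [exact: (idealMr _ (hb t))|exact: (idealMl _ (hb t))].
- move=> a u; apply: adj.
  have -> : f (er (a + u)) - f (er a + er u) =
      (g a - f (er a)) + (g u - f (er u)) - (g (a + u) - f (er (a + u))).
    by rewrite !rmorphD; ring.
  by apply: (idealB (hb t)) => //; exact: (idealD (hb t)).
have hJ : ideal (ideal_add (ideal_gen [set` s]) (ideal_exp mQ t)).
  exact: ideal_ideal_add (ideal_ideal_gen _) (ideal_ideal_exp _ _).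
have -> : er @^-1` ideal_exp m t = ideal_add (ideal_gen [set` s]) (ideal_exp mQ t).
  apply/seteqP; split=> [z /= hz|].
    have : bexp t (g z).
      by rewrite -(subrK (f (er z)) (g z)); apply: (idealD (hb t)) => //; exact/bexp_f.
    move=> /bexp_lift[w hw ew]; exists (z - w); last by exists w => //; rewrite subrK.
    by apply/g_ker; rewrite rmorphB ew subrr.
  move=> _ [u hu [w hw <-]] /=; apply/bexp_f.
  rewrite -(subKr (g (u + w)) (f _)); apply: (idealB (hb t)) => //.
  by rewrite rmorphD (iffRL (g_ker u) hu) add0r; exact: bexp_g.
apply: len_leq => //; exact: hC.
Qed.

(** The images of the parameters are approximated in [R]; since [N > 1], the approximations generate
    [m] modulo [m ^ 2], and Nakayama applies. *)
Lemma lift_parameters N : (1 < N)%N -> exists x : seq R,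
  [/\ size x = size y, forall i, (i < size y)%N -> bexp N (g y`_i - f x`_i)
    & ideal_gen [set` x] = m].
Proof.
move=> N1.
have /all_sig[c hc] : forall z, {a | bexp N (g z - f a)} by move=> z; apply: cid; exact: bexp_approx.
have my z : z \in y -> mQ z by move=> zy; rewrite -hy; exact: sub_ideal_gen.
have mc z : z \in y -> m (c z).
  move=> /my/bexp_g1 hz; rewrite -(exp1_sub hmi); apply/bexp_f.
  rewrite -(subKr (g z) (f _)); apply: (idealB (hb 1)) => //.
  exact: bexp_antitone (ltnW N1) _ (hc z).
exists (map c y); split; first by rewrite size_map.
  by move=> i hi; rewrite (nth_map 0).
apply/seteqP; split.
  by apply: ideal_gen_sub => // _ /mapP[z zy ->]; exact: mc.
have [sm hsm] := local_noeth hm hmi.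
have hG := ideal_ideal_gen [set` map c y].
suff /(@nakayama _ _ hm R^o _ sm hG) : ideal_gen [set` sm] `<=`
    @sadd R R^o (ideal_gen [set` map c y]) (@smul R R^o m (ideal_gen [set` sm])) by rewrite -hsm.
rewrite hsm => r mr; have [z ez] := g_surj (f r).
have : mQ z by apply/bexp_g1; rewrite ez; apply/bexp_f; rewrite exp1_sub.
rewrite -hy => /ideal_gen_seqP[b eb].
have /all_sig[b' hb'] : forall z, {a | bexp 1 (g z - f a)} by move=> w; apply: cid; exact: bexp_approx.
exists (\sum_(i < size y) b' (b i) * c y`_i).
  apply: (ideal_sum _ hG) => i _; apply: (idealMl _ hG); apply: sub_ideal_gen.
  by apply/mapP; exists y`_i => //; exact: mem_nth.
exists (r - \sum_(i < size y) b' (b i) * c y`_i); last by rewrite addrC subrK.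
have -> : @smul R R^o m m = ideal_exp m 2 by rewrite ideal_expS exp1_sub.
apply/bexp_f; rewrite rmorphB -ez eb !rmorph_sum -sumrB; apply: (ideal_sum _ (hb 2)) => i _.
rewrite !rmorphM.
have -> : g (b i) * g y`_i - f (b' (b i)) * f (c y`_i) =
  (g (b i) - f (b' (b i))) * g y`_i + f (b' (b i)) * (g y`_i - f (c y`_i)) by ring.
apply: (idealD (hb 2)).
  by apply: (@bexpM 1 1) => //; apply/bexp_g1; apply: my; exact: mem_nth.
apply: (idealMl _ (hb 2)); exact: bexp_antitone N1 _ (hc _).
Qed.

Section Coefficients.
Variables (k : fieldType) (p : nat) (hpk : p \in [pchar k]) (hpR : p \in [pchar R]).
Variable res : {rmorphism R -> k}.
Hypotheses (res_surj : forall c, exists r, res r = c) (res_ker : forall r, res r = 0 <-> m r).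
Hypothesis two : (2%:R : k) != 0.
Hypothesis hreg : forall d, d.+1 = size y -> ~ growth mQ [set 0] d.

(* The syzygies of the regular system of parameters [y] are Koszul, and [f x_i] agrees with [g y_i]
   modulo a high power, so relations in [R] lift to multiples of the equations [s]. *)
Lemma presentation_kernel N : (1 < N)%N -> exists (n : nat) (e : mpoly.mpoly n k -> R)
    (F : seq (mpoly.mpoly n k)),
  [/\ n = size y /\ size F = size s, level_map (@low n k 1) m N e,
      forall j, @low n k 1 F`_j /\ ideal_exp m N (e F`_j)
    & forall h, ideal_exp m N (e h) -> ideal_add (ideal_gen [set` F]) (@low n k N) h].
Proof.
move=> N1; have [x [sx hx hmx]] := lift_parameters N1.
have [e0 [he0 eX0]] := exists_presents hm hpk hpR res_surj res_ker hmx.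
pose n := size x; pose P := mpoly.mpoly n k.
pose e (h : P) := e0 N (mps_of h).
have mN := ideal_ideal_exp m N.
have hlow i : ideal (@low n k i) := @ideal_low n k i.
have he : level_map (@low n k 1) m N e.
  split=> [h h'|h h'|i h iN|i r hr].
  - by rewrite /e rmorphD; exact: (presD he0).
  - by rewrite /e rmorphM; exact: (presM he0).
  - by rewrite low_exp => hl; apply: (presV he0).
  - have [u vu hu] := presS he0 N hr; exists (mpseries_trunc (maxn N i) u).
      rewrite low_exp => mu lt; rewrite mpseries_truncE; first exact: vu.
      by apply: leq_trans lt _; exact: leq_maxr.
    set tr := mpseries_trunc _ u.
    have h0 : ideal_exp m N (e0 N (u - mps_of tr)).
      apply: (presV he0) => //; exact: (vanishS (leq_maxl _ _) (@trunc_vanish n k _ u)).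
    have -> : r - e tr = (r - e0 N u) + (e0 N (u - mps_of tr))
        + (e0 N ((u - mps_of tr) + mps_of tr) - (e0 N (u - mps_of tr) + e0 N (mps_of tr))).
      by rewrite subrK /e; ring.
    by apply: (idealD mN); [exact: (idealD mN)|exact: (presD he0)].
(* The polynomial [h] and the element [z] of [Q] agree in [B / m ^ N B]. Relations are found on [z],
   in the regular ring, and carried back to [h]. *)
pose rel (h : P) z := bexp N (g z - f (e h)).
have relD h z h' z' : rel h z -> rel h' z' -> rel (h + h') (z + z').
  move=> h1 h2; rewrite /rel.
  have -> : g (z + z') - f (e (h + h')) =
      (g z - f (e h)) + (g z' - f (e h')) - f (e (h + h') - (e h + e h')).
    by rewrite !(rmorphD, rmorphB) /=; ring.
  by apply: (idealB (hb N)); [exact: (idealD (hb N))|apply/bexp_f; exact: (levelD he)].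
have relM h z h' z' : rel h z -> rel h' z' -> rel (h * h') (z * z').
  move=> h1 h2; rewrite /rel.
  have -> : g (z * z') - f (e (h * h')) = (g z - f (e h)) * g z' + f (e h) * (g z' - f (e h'))
      - f (e (h * h') - e h * e h').
    by rewrite !(rmorphM, rmorphB) /=; ring.
  apply: (idealB (hb N)); last by apply/bexp_f; exact: (levelM he).
  by apply: (idealD (hb N)); [exact: (idealMr _ (hb N))|exact: (idealMl _ (hb N))].
have rel0 : rel 0 0.
  rewrite /rel rmorph0 sub0r; apply: (@subN B B^o _ _ (hb N)); apply/bexp_f.
  have := levelD he 0 0; rewrite addr0 opprD addrA subrr sub0r.
  by move=> /(@subN R R^o _ _ mN); rewrite opprK.
have relN h z : rel h z -> rel (- h) (- z).
  move=> h1; have h2 := levelD he h (- h); rewrite subrr in h2.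
  have e0m : ideal_exp m N (e 0).
    by apply/bexp_f; move: rel0; rewrite /rel rmorph0 sub0r => /(@subN B B^o _ _ (hb N)); rewrite opprK.
  rewrite /rel; have -> : g (- z) - f (e (- h)) =
      f (e 0 - (e h + e (- h))) - f (e 0) - (g z - f (e h)).
    by rewrite !(rmorphN, rmorphB, rmorphD) /=; ring.
  by apply: (idealB (hb N)) => //; apply: (idealB (hb N)); exact/bexp_f.
have rel_sum (J : finType) (h : J -> P) z : (forall j, rel (h j) (z j)) ->
    rel (\sum_j h j) (\sum_j z j).
  by move=> hz; elim/big_ind2 : _ => // a b a' b'; exact: relD.
have rel_lift z : exists h, rel h z.
  have [r hr] := bexp_approx N (g z); have [//|h _ hh] := @levelS _ _ _ _ _ _ he 0 r.
  exists h; rewrite /rel -(subrKA (f r)); apply: (idealD (hb N)) => //.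
  by rewrite -rmorphB; exact/bexp_f.
have rel_level M h z : (M <= N)%N -> rel h z -> ideal_exp m M (e h) <-> bexp M (g z).
  move=> MN hz; have hz' := bexp_antitone MN hz.
  rewrite -bexp_f; split=> hh.
    by rewrite -(subrK (f (e h)) (g z)); exact: (idealD (hb M)).
  by rewrite -(subKr (g z) (f _)); exact: (idealB (hb M)).
pose X (i : 'I_n) : P := mpoly.mpolyX k (mpoly.mnm1 i).
have relX i : rel (X i) y`_i.
  rewrite /rel -(subrKA (f x`_i)); apply: (idealD (hb N)); first by apply: hx; rewrite -sx.
  rewrite -rmorphB -opprB rmorphN; apply: (@subN B B^o _ _ (hb N)); apply/bexp_f; exact: eX0.
have /all_sig[sg hsg] : forall j, {c : nat -> Q | (j < size s)%N -> s`_j = \sum_(i < n) c i * y`_i}.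
  move=> j; apply: cid; case: (pselect (j < size s)%N) => hj; last by exists (fun _ => 0).
  have : mQ s`_j by apply: s_proper; apply: sub_ideal_gen; exact: mem_nth.
  by rewrite -hy => /ideal_gen_seqP[c ec]; exists c; rewrite /n sx.
have /all_sig[li hli] : forall z, {h | rel h z} by move=> z; apply: cid; exact: rel_lift.
(* The equations lift an expression of each [s_j] in the parameters coefficient by coefficient, so
   that syzygies of the parameters can be followed on the polynomials. *)
pose G j i := li (sg j i).
pose Fn j : P := \sum_(i < n) G j i * X i.
have relF j : (j < size s)%N -> rel (Fn j) s`_j.
  by move=> hj; rewrite (hsg j hj); apply: rel_sum => i; exact: (relM _ _ _ _ (hli _) (relX _)).
have lowF j : low 1 (Fn j).
  by rewrite /Fn; apply: (ideal_sum _ (hlow 1)) => i _; apply: (idealMl _ (hlow 1)); exact: low_X.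
have mF j : (j < size s)%N -> ideal_exp m N (e (Fn j)).
  move=> hj; apply/(rel_level N _ _ (leqnn N) (relF j hj)).
  rewrite (iffRL (g_ker _)); first exact: (ideal0 (hb N)).
  by apply: sub_ideal_gen; exact: mem_nth.
exists n, e, (mkseq Fn (size s)); rewrite size_mkseq; split=> // [j|].
  have [lt|ge] := ltnP j (size s); first by rewrite nth_mkseq //; split; [exact: lowF|exact: mF].
  rewrite nth_default ?size_mkseq //; split; first exact: (ideal0 (hlow 1)).
  by apply/(rel_level N _ _ (leqnn N) rel0); rewrite rmorph0; exact: (ideal0 (hb N)).
set J := ideal_gen _; have hJ : ideal J by exact: ideal_ideal_gen.
have FJ j : (j < size s)%N -> J (Fn j).
  by move=> hj; apply: sub_ideal_gen; apply/mapP; exists j; rewrite ?mem_iota.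
(* Induction on the order [M]. Up to order [N], [h] is a sum of terms [X_i h_i], and its counterpart
   in [Q] is a combination of the [s_j] plus a sum of terms [w_i y_i] with [w_i] of order [M]. After
   subtracting multiples of the equations and a Koszul term, [h_i] corresponds to [w_i] and the
   induction hypothesis applies to it. *)
have claim M h : (M <= N)%N -> ideal_exp m M (e h) -> ideal_add J (@low n k M) h.
  elim: M h => [|M IH] h MN hh; first by apply: (ideal_addrP hJ).
  have hJM i : ideal (ideal_add J (@low n k i)) by apply: ideal_ideal_add => //; exact: hlow.
  have h1 : low 1 h.
    have lev := level_ideal he (ideal_ideal_exp m 1) (exp_antitone (ltnW N1)).
    have [//|nl] := pselect (low 1 h); exfalso.
    pose c := mpoly.mcoeff mpoly.mnm0 h.
    have c0 : c != 0.
      apply: contra_notN nl => /eqP c0 mu; rewrite ltnS leqn0 mpoly.mdeg_eq0 => /eqP ->; exact: c0.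
    have lc : ideal_exp m 1 (e (mpoly.mpolyC n c)).
      have -> : mpoly.mpolyC n c = h - (h - mpoly.mpolyC n c) by rewrite subKr.
      apply: (idealB lev); first exact: exp_antitone hh.
      by apply: (levelV he (ltnW N1)); rewrite low_exp; exact: low_const.
    have [//|f1 _ hf1] := @levelS _ _ _ _ _ _ he 0 1.
    have : ideal_exp m 1 (e f1).
      have -> : f1 = (f1 * mpoly.mpolyC n c^-1) * mpoly.mpolyC n c.
        by rewrite -mulrA -rmorphM mulVf // rmorph1 mulr1.
      exact: (idealMl _ lev).
    move=> h1; apply: (local_n1 hm); rewrite -(exp1_sub hmi) -(subrK (e f1) 1).
    by apply: (idealD (ideal_ideal_exp m 1)) => //; exact: (exp_antitone (ltnW N1)).
  have [gq [_ eh]] := @vanish_divX n k 0 (mps_of h) h1.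
  pose hi i : P := mpseries_trunc N (gq i).
  pose h' : P := \sum_i X i * hi i.
  have hh' : low N (h - h').
    apply/low_vanish; rewrite rmorphB /= eh rmorph_sum -sumrB.
    apply: (ideal_sum _ (@ideal_vanish _ _ N)) => i _; rewrite rmorphM -mulrBr.
    by apply: (idealMl _ (@ideal_vanish _ _ N)); exact: trunc_vanish.
  have lev := level_ideal he (ideal_ideal_exp m M.+1) (exp_antitone MN).
  have mh' : ideal_exp m M.+1 (e h').
    rewrite -(subKr h h'); apply: (idealB lev) => //.
    by apply: (levelV he MN); rewrite low_exp; exact: lowS hh'.
  have /all_sig[z hz] : forall i, {z | rel (hi i) z}.
    move=> i; apply: cid; have [z ez] := g_surj (f (e (hi i))); exists z.
    by rewrite /rel ez subrr; exact: (ideal0 (hb N)).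
  have relh' : rel h' (\sum_(i < n) y`_i * z i).
    by apply: rel_sum => i; exact: (relM _ _ _ _ (relX _) (hz _)).
  have [w hw ew] := bexp_lift (iffLR (rel_level _ _ _ MN relh') mh').
  have /ideal_gen_seqP[qs eqs] : ideal_gen [set` s] (\sum_(i < n) y`_i * z i - w).
    by apply/g_ker; rewrite rmorphB ew subrr.
  have [wi hwi ewi] : exists2 wi : nat -> Q, (forall i, ideal_exp mQ M (wi i)) &
      w = \sum_(i < n) wi i * y`_i.
    have mM := ideal_ideal_exp mQ M.
    pose W : set Q := [set w | exists2 wi : nat -> Q, (forall i, ideal_exp mQ M (wi i)) &
      w = \sum_(i < n) wi i * y`_i].
    suff : ideal_exp mQ M.+1 `<=` W by exact.
    have hW : ideal W.
      apply: ideal_ofP.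
      - exists (fun _ => 0) => [i|]; first exact: (ideal0 mM).
        by rewrite big1 // => i _; rewrite mul0r.
      - move=> _ _ [u hu ->] [v hv ->]; exists (fun i => u i + v i) => [i|]; first exact: (idealD mM).
        by rewrite -big_split; apply: eq_bigr => i _; rewrite mulrDl.
      - move=> b _ [u hu ->]; exists (fun i => b * u i) => [i|]; first exact: (idealMl _ mM).
        by rewrite mulr_sumr; apply: eq_bigr => i _; rewrite mulrA.
    rewrite ideal_expS; apply: (@smul_sub Q Q^o _ _ _ hW) => b v.
    rewrite -{1}hy => /ideal_gen_seqP[c ->] hv; exists (fun i => c i * v) => [i|].
      exact: (idealMl _ mM).
    change ((\sum_(i < size y) c i * y`_i) * v = \sum_(i < n) c i * v * y`_i).
    by rewrite /n sx mulr_suml; apply: eq_bigr => i _; rewrite mulrAC.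
  pose zn i := if insub i is Some j then z j else 0.
  pose b i := zn i - \sum_(j < size s) qs j * sg j i - wi i.
  have znE (i : 'I_n) : zn i = z i by rewrite /zn valK.
  have bz : \sum_(i < n) b i * y`_i = 0.
    rewrite /b; under eq_bigr => i _ do rewrite !mulrBl znE mulr_suml [z i * _]mulrC.
    rewrite !sumrB -ewi exchange_big /=.
    have -> : \sum_(j < size s) \sum_(i < n) qs j * sg j i * y`_i = \sum_(j < size s) qs j * s`_j.
      apply: eq_bigr => j _; rewrite (hsg j) ?ltn_ord // mulr_sumr.
      by apply: eq_bigr => i _; rewrite mulrA.
    by rewrite -eqs opprB addrCA subrr addr0 subrr.
  have my u : u \in y -> mQ u by move=> uy; rewrite -hy; exact: sub_ideal_gen.
  have mys : mQ `<=` ideal_gen [set` y] by rewrite hy.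
  have [|K [Ka K0 Kb]] := koszul_syzygy _ bz.
    move=> t a tn; have ty : (t < size y)%N by rewrite -sx.
    have tk : size (take t y) = t by rewrite size_takel // ltnW.
    have nz := regular_nzd hQ my mys hreg ty.
    have conv u : (exists c : nat -> Q, u = \sum_(i < t) c i * y`_i) <-> ideal_gen [set` take t y] u.
      split=> [[c ->]|/ideal_gen_seqP[c ->]].
        apply: (ideal_sum _ (ideal_ideal_gen _)) => i _; apply: (idealMl _ (ideal_ideal_gen _)).
        by apply: sub_ideal_gen; rewrite -(nth_take 0 (ltn_ord i)); apply: mem_nth; rewrite tk.
      exists c; rewrite tk; apply: eq_bigr => i _; by rewrite nth_take.
    by move=> /conv/nz/conv.
  (* Lifts are chosen for [i < l] only, which keeps the lifted matrix antisymmetric. *)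
  pose Kt i l : P := if (i < l)%N then li (K i l) else if (l < i)%N then - li (K l i) else 0.
  have relK i l : rel (Kt i l) (K i l).
    rewrite /Kt; case: ltngtP => [_|_|->]; first exact: hli.
      by rewrite (Ka i l); exact: relN (hli _).
    by rewrite K0.
  pose h2 (i : 'I_n) : P := hi i - \sum_(j < size s) li (qs j) * G j i - \sum_(l < n) Kt i l * X l.
  have relh2 i : rel (h2 i) (wi i).
    have -> : wi i = z i - \sum_(j < size s) qs j * sg j i - \sum_(l < n) K i l * y`_l.
      by rewrite -Kb // /b znE opprB addrC subrK.
    apply: (relD); last by apply: (relN); apply: rel_sum => l; exact: (relM _ _ _ _ (relK _ _) (relX _)).
    apply: (relD); first exact: hz.
    by apply: (relN); apply: rel_sum => j; exact: (relM _ _ _ _ (hli _) (hli _)).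
  have h2J i : ideal_add J (@low n k M) (h2 i).
    apply: IH; first exact: ltnW.
    by apply/(rel_level M _ _ (ltnW MN) (relh2 i)); exact: bexp_g.
  have -> : h = (h - h') + (\sum_i X i * h2 i + \sum_(j < size s) li (qs j) * Fn j
      + \sum_(i < n) \sum_(l < n) Kt i l * X l * X i).
    rewrite -[LHS](subrK h'); congr (_ + _); rewrite /h' /h2.
    under [X in _ = X + _ + _]eq_bigr do rewrite !mulrBr.
    rewrite !sumrB.
    have -> : \sum_(j < size s) li (qs j) * Fn j =
        \sum_(i < n) X i * \sum_(j < size s) li (qs j) * G j i.
      under [RHS]eq_bigr do rewrite mulr_sumr.
      rewrite [RHS]exchange_big /=; apply: eq_bigr => j _; rewrite /Fn mulr_sumr.
      by apply: eq_bigr => i _; rewrite mulrA mulrC.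
    have -> : \sum_(i < n) X i * \sum_(l < n) Kt i l * X l =
        \sum_(i < n) \sum_(l < n) Kt i l * X l * X i.
      by apply: eq_bigr => i _; rewrite mulrC mulr_suml.
    by rewrite addrAC !subrK.
  (* The Koszul terms cancel exactly: exchanging [i] and [l] changes the sign of the sum, and 2 is
     invertible in [k]. *)
  have -> : \sum_(i < n) \sum_(l < n) Kt i l * X l * X i = 0.
    set Z := \sum_(i < n) _.
    have ZN : Z = - Z.
      rewrite {1}/Z exchange_big /= -sumrN; apply: eq_bigr => i _; rewrite -sumrN.
      apply: eq_bigr => l _; rewrite -mulrA [X i * X l]mulrC mulrA -!mulNr; congr (_ * _ * _).
      by rewrite /Kt; case: ltngtP => _; rewrite ?opprK ?oppr0.
    have : 2%:R * Z = 0 by rewrite mulr_natl mulr2n {2}ZN subrr.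
    move/eqP; rewrite mulf_eq0 => /orP[|/eqP //].
    by rewrite -(rmorph_nat (@mpoly.mpolyC n k)) mpoly.mpolyC_eq0 (negPf two).
  rewrite addr0; apply: (idealD (hJM _)).
    by apply: (ideal_addrP hJ); exact: lowS hh'.
  apply: (idealD (hJM _)).
    apply: (ideal_sum _ (hJM _)) => i _; have [u Ju [v lv <-]] := h2J i.
    rewrite mulrDr; apply: (idealD (hJM _)).
      by apply: (ideal_addlP (hlow _)); exact: (idealMl _ hJ).
    by apply: (ideal_addrP hJ); apply: (@low_mul n k 1 M) => //; exact: low_X.
  apply: (ideal_addlP (hlow _)); apply: (ideal_sum _ hJ) => j _.
  by apply: (idealMl _ hJ); exact: FJ.
by move=> h; exact: claim.
Qed.

(** Modulo [m ^ 2], [m] is spanned by the linear forms and the rows of [L] vanish. A complement of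
    the row space has dimension [d], so [d] linear forms generate [m] by Nakayama. *)
Lemma independent_regular n N (e : mpoly.mpoly n k -> R) (F : seq (mpoly.mpoly n k)) d :
  (1 < N)%N -> level_map (@low n k 1) m N e ->
  (forall j, @low n k 1 F`_j /\ ideal_exp m N (e F`_j)) ->
  (size F + d)%N = n -> krull_dim R = d ->
  row_free (\matrix_(j < size F, i < n) mpoly.mcoeff (mpoly.mnm1 i) F`_j) -> regular_local m.
Proof.
move=> N1 he hF en dR; set L := \matrix_(j, i) _ => rfL.
pose C := row_base (L^C)%MS; pose P := mpoly.mpoly n k.
have rC : \rank (L^C)%MS = d by rewrite mxrank_compl (eqP rfL) -{1}en addKn.
pose lin (v : 'rV[k]_n) : P := \sum_i v ord0 i *: mpoly.mpolyX k (mpoly.mnm1 i).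
have low_lin v : low 1 (lin v).
  apply: (ideal_sum _ (@ideal_low n k 1)) => i _.
  by rewrite -mpoly.mul_mpolyC; apply: (idealMl _ (@ideal_low n k 1)); exact: low_X.
have lin_coef v i : mpoly.mcoeff (mpoly.mnm1 i) (lin v) = v ord0 i.
  rewrite /lin raddf_sum /= (bigD1 i) //= mpoly.mcoeffZ mpoly.mcoeffX eqxx mulr1.
  rewrite big1 ?addr0 // => l li; rewrite mpoly.mcoeffZ mpoly.mcoeffX.
  case: eqP => [e1|]; last by rewrite mulr0.
  have := congr1 (fun mu : mpoly.multinom n => mu l) e1; rewrite !mpoly.mnm1E eqxx eq_sym.
  by rewrite (negPf li).
pose w := [seq e (lin (row l C)) | l <- enum 'I_(\rank (L^C)%MS)].
have hG := ideal_ideal_gen [set` w].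
have m2 := ideal_ideal_exp m 2.
have N2m := exp_antitone N1 : ideal_exp m N `<=` ideal_exp m 2.
have hW : ideal (ideal_add (ideal_gen [set` w]) (ideal_exp m 2)) by exact: ideal_ideal_add.
have lev : ideal [set h | ideal_add (ideal_gen [set` w]) (ideal_exp m 2) (e h)].
  apply: (level_ideal he hW); apply: subset_trans N2m _; exact: ideal_addrP.
have linZ a v : lin (a *: v) = mpoly.mpolyC n a * lin v.
  rewrite mpoly.mul_mpolyC /lin scaler_sumr; apply: eq_bigr => i _; by rewrite mxE scalerA.
have linD u v : lin (u + v) = lin u + lin v.
  by rewrite /lin -big_split; apply: eq_bigr => i _; rewrite mxE scalerDl.
have lin0 : lin 0 = 0 by rewrite /lin big1 // => i _; rewrite mxE scale0r.
pose V := [set v : 'rV[k]_n | ideal_add (ideal_gen [set` w]) (ideal_exp m 2) (e (lin v))].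
have VD u v : V u -> V v -> V (u + v) by rewrite /V /= linD; exact: (idealD lev).
have VZ a v : V v -> V (a *: v) by rewrite /V /= linZ; exact: (idealMl _ lev).
have V0 : V 0 by rewrite /V /= lin0; exact: (ideal0 lev).
have VM c' (A : 'M[k]_(c', n)) (u : 'rV[k]_c') : (forall j, V (row j A)) -> V (u *m A).
  move=> hA; rewrite mulmx_sum_row; elim/big_ind : _ => [//|a b|j _]; [exact: VD|exact: VZ].
have VL j : V (row j L).
  have hlow : low 2 (F`_j - lin (row j L)).
    apply: low2P => [|i]; first by apply: (idealB (@ideal_low n k 1)) => //; case: (hF j).
    by rewrite mpoly.mcoeffB lin_coef !mxE subrr.
  have -> : V (row j L) = ideal_add (ideal_gen [set` w]) (ideal_exp m 2)
      (e (F`_j - (F`_j - lin (row j L)))) by rewrite subKr.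
  apply: (idealB lev); apply: (ideal_addrP hG).
    by apply: N2m; case: (hF j).
  by apply: (levelV he N1); rewrite low_exp.
have VC l : V (row l C).
  rewrite /V /=; apply: (ideal_addlP m2); apply: sub_ideal_gen.
  by apply/mapP; exists l; rewrite ?mem_enum.
have VT v : V v.
  have : (v <= L + C)%MS.
    apply: submx_full; rewrite -sub1mx.
    have := addsmx_compl_full L; rewrite -sub1mx => /submx_trans; apply.
    by apply: addsmxS => //; rewrite eq_row_base.
  by move=> /sub_addsmxP[u ->]; apply: VD; exact: VM.
have low1W h : low 1 h -> ideal_add (ideal_gen [set` w]) (ideal_exp m 2) (e h).
  move=> hh; pose v : 'rV[k]_n := \row_i mpoly.mcoeff (mpoly.mnm1 i) h.
  have hlow : low 2 (h - lin v).
    apply: low2P => [|i]; first by apply: (idealB (@ideal_low n k 1)).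
    by rewrite mpoly.mcoeffB lin_coef !mxE subrr.
  have -> : h = (h - lin v) + lin v by rewrite subrK.
  apply: (idealD lev); last exact: VT.
  by apply: (ideal_addrP hG); apply: (levelV he N1); rewrite low_exp.
split=> //; exists w; split; first by rewrite size_map size_enum_ord rC dR.
apply/seteqP; split.
  apply: ideal_gen_sub => // _ /mapP[l _ ->]; rewrite -(exp1_sub hmi).
  by apply: (levelV he (ltnW N1)); rewrite low_exp; exact: low_lin.
have [sm hsm] := local_noeth hm hmi.
suff /(@nakayama _ _ hm R^o _ sm hG) : ideal_gen [set` sm] `<=`
    @sadd R R^o (ideal_gen [set` w]) (@smul R R^o m (ideal_gen [set` sm])) by rewrite -hsm.
rewrite hsm => r mr.
have -> : @smul R R^o m m = ideal_exp m 2 by rewrite ideal_expS exp1_sub.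
rewrite -ideal_addE.
have [|h hl hr] := @levelS _ _ _ _ _ _ he 1 r; first by rewrite exp1_sub.
rewrite -(subrK (e h) r); apply: (idealD hW).
  by apply: (ideal_addrP hG); exact: N2m.
by apply: low1W; rewrite -low_exp.
Qed.

Lemma ci_equations d N : (1 < N)%N -> (0 < d)%N -> krull_dim R = d ->
    growth mQ [set 0] (size y) -> ~ regular_local m ->
  exists (c1 : nat) (e : mpoly.mpoly (c1 + d.+1) k -> R)
    (F : 'I_c1 -> mpoly.mpoly (c1 + d.+1) k) (H : mpoly.mpoly (c1 + d.+1) k),
  [/\ level_map (@low (c1 + d.+1) k 1) m N e, forall i, low 1 (F i), low 2 H
    & forall h, ideal_exp m N (e h) ->
      ideal_add (ideal_gen [set f | f = H \/ exists i, f = F i]) (@low (c1 + d.+1) k N) h].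
Proof.
move=> N1 d0 dR gQ nreg.
have [sy gs] := growth_sequence gQ (leqnn (size s)); rewrite take_size in gs.
have gR := growth_quotient gs.
have dn : (d <= size y - size s)%N.
  have [] := @max_chainP R (@prime_ideal R); first by rewrite -/(krull_dim R) dR.
  by rewrite -/(krull_dim R) dR => /(krull_growth hm gR).
have [n [e [F [[en eF] he hF hJ]]]] := presentation_kernel N1.
(* So far only [size F + d <= n] is known. If this is strict there is room for [H = 0], and the
   missing [F_i] are the default value 0 of the sequence. *)
have [lt|ge] := ltnP (size F + d) n.
  have [c1 ec] : exists c1, n = (c1 + d.+1)%N by exists (n - d.+1)%N; lia.
  clear en; subst n; exists c1, e, (fun i => F`_i), 0; split=> // [i||h /hJ].
  - by case: (hF i).
  - exact: (ideal0 (@ideal_low _ k 2)).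
  - apply: ideal_addS => //; apply: ideal_gen_sub; first exact: ideal_ideal_gen.
    move=> x /(nthP 0)[i hi <-]; apply: sub_ideal_gen; right.
    have hi' : (i < c1)%N by move: hi lt; move: (size F) => sz; lia.
    by exists (Ordinal hi').
have eFd : (size F + d)%N = n by lia.
pose L := \matrix_(j < size F, i < n) mpoly.mcoeff (mpoly.mnm1 i) F`_j.
have [rf|] := boolP (row_free L).
  by case: nreg; exact: independent_regular N1 he hF eFd dR rf.
(* In the case of equality, non-regularity makes the linear parts dependent. A relation [u] between
   them defines [H], without linear term, and [H] replaces an equation [F_j0] that occurs in it with
   nonzero coefficient. *)
rewrite -kermx_eq0 => /rowV0Pn[u /sub_kermxP uL u0].
have [j0 uj0] : exists j0, u ord0 j0 != 0 by apply/rV0Pn.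
have c0 : (0 < size F)%N by apply: leq_ltn_trans (ltn_ord j0).
have [c1 ec] : exists c1, n = (c1 + d.+1)%N by exists (size F).-1; lia.
have sF : size F = c1.+1 by lia.
pose H := \sum_(j < size F) mpoly.mpolyC n (u ord0 j) * F`_j.
have lowH : low 2 H.
  apply: low2P => [|i].
    by apply: (ideal_sum _ (@ideal_low n k 1)) => j _; apply: (idealMl _ (@ideal_low n k 1)); case: (hF j).
  have := congr1 (fun v : 'rV[k]_n => v ord0 i) uL; rewrite !mxE => e0.
  rewrite -[RHS]e0 /H raddf_sum; apply: eq_bigr => j _.
  by rewrite /= mpoly.mcoeffCM mxE.
clear L uL; clear en; subst n.
exists c1, e, (fun i => F`_(bump j0 i)), H; split=> // [i|h /hJ]; first by case: (hF (bump j0 i)).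
apply: ideal_addS => //; pose J := ideal_gen [set x | x = H \/ exists i : 'I_c1, x = F`_(bump j0 i)].
change (ideal_gen [set` F] `<=` J).
have hJ' : ideal J by exact: ideal_ideal_gen.
have other j : (j < size F)%N -> j != j0 :> nat -> J F`_j.
  move=> hj jj0; apply: sub_ideal_gen; right.
  have hu : (unbump j0 j < c1)%N.
    have := ltn_ord j0; rewrite [X in (_ < X)%N]sF => lj0; move: jj0 lj0; rewrite /unbump.
    by move: (nat_of_ord j0) hj => i; rewrite sF; case: ltnP => /=; lia.
  exists (Ordinal hu) => /=; by rewrite unbumpK // inE.
apply: ideal_gen_sub => // x /(nthP 0)[j hj <-].
have [->|jj0] := eqVneq j (nat_of_ord j0); last exact: other.
have JH : J H by apply: sub_ideal_gen; left.
have e1 : F`_j0 = mpoly.mpolyC _ (u ord0 j0)^-1 *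
   (H - \sum_(j < size F | j != j0) mpoly.mpolyC _ (u ord0 j) * F`_j).
  by rewrite /H (bigD1 j0) //= addrK mulrA -rmorphM mulVf // rmorph1 mul1r.
rewrite e1; apply: (idealMl _ hJ'); apply: (idealB hJ') => //.
apply: (ideal_sum _ hJ') => l lj0; apply: (idealMl _ hJ'); exact: other.
Qed.

End Coefficients.

End CompleteIntersection.

Lemma finlen_Ipow (R : comNzRingType) (m : set R) (hm : noetherian_local m) a q :
  @finlen R R^o (Ipow m a q) [set: R].
Proof.
have := finlen_add hm a (ideal_Ipow m a q); apply: finlenS => //.
by apply: ideal_add_sub => //; [exact: ideal_Ipow | exact: exp_Ipow].
Qed.

(** Above a power of the ideal of the variables, whose residue field is [k], length over polynomials
    is dimension over [k]. *)
Lemma lenle_scalars n (k : fieldType) a (D : set (mpoly.mpoly n k)) l : ideal D -> @low n k a `<=` D ->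
  @lenle _ (mpoly.mpoly n k)^o D [set: mpoly.mpoly n k] l ->
  @lenle k (rscal (@mpoly.mpolyC n k : {rmorphism k -> mpoly.mpoly n k}) (mpoly.mpoly n k)^o)
    D [set: mpoly.mpoly n k] l.
Proof.
pose P := mpoly.mpoly n k => hD aD hl.
have fm h : exists c, @low n k 1 (h - mpoly.mpolyC n c).
  by exists (mpoly.mcoeff mpoly.mnm0 h); exact: low_const.
have kV : smul (ideal_exp (@low n k 1) a) [set: P^o] `<=` D.
  apply: smul_sub => // h h' hh _; apply: (idealMr _ hD).
  by apply: aD; rewrite -low_exp.
have fD : @finlen P P^o D [set: P] by exists l.
have hlD : (@len P P^o D [set: P] <= l)%N by apply: len_leq.
have := @lenle_rscal k P (@mpoly.mpolyC n k : {rmorphism k -> P}) (@low n k 1) P^o fm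
  D [set: P] a hD (@submoduleT P P^o) (@subsetT _ _) kV fD.
exact: lenle_leq.
Qed.

(** * Colengths and dimension of the quadric *)

Section QuadricInequality.
Variables (R : comNzRingType) (m : set R) (hm : noetherian_local m).
Variables (k : fieldType) (p : nat) (hpk : p \in [pchar k]) (hpR : p \in [pchar R]).
Variable res : {rmorphism R -> k}.
Hypotheses (res_surj : forall c, exists r, res r = c) (res_ker : forall r, res r = 0 <-> m r).
Hypothesis p2 : (2 < p)%N.

Lemma lenle_low n a q : exists C, @lenle k (rscal (@mpoly.mpolyC n k : {rmorphism k -> mpoly.mpoly n k})
  (mpoly.mpoly n k)^o) (Ipow (@low n k 1) a q) [set: mpoly.mpoly n k] C.
Proof.
pose P := mpoly.mpoly n k; pose S := mpseries n k.
have hS : noetherian_local (vanish 1 : set S) by exact: mps_noetherian_local.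
have lev : @level_map P S (@low n k 1) (vanish 1) a (@mps_of n k).
  split.
  - by move=> f g; rewrite raddfD subrr; apply: (ideal0 (ideal_ideal_exp _ _)).
  - by move=> f g; rewrite rmorphM subrr; apply: (ideal0 (ideal_ideal_exp _ _)).
  - by move=> i f _; rewrite low_exp exp_vanish => /low_vanish.
  - move=> i r; rewrite exp_vanish => hr; exists (mpseries_trunc (maxn a i) r).
      rewrite low_exp; apply/low_vanish.
      have h := @trunc_vanish n k (maxn a i) r.
      rewrite -[X in vanish i X](subKr r); apply: (idealB (@ideal_vanish n k i)) => //.
      by apply: vanishS h; exact: leq_maxr.
    by rewrite exp_vanish; apply: vanishS (@trunc_vanish n k (maxn a i) r); exact: leq_maxl.
have [C hC] := finlen_Ipow hS a 1.
have hI : ideal (vanish a : set S) by exact: ideal_vanish.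
have [C' hC'] : @finlen S S^o (vanish a) [set: S].
  apply: finlenS (finlen_add hS a hI) => //.
  by apply: ideal_add_sub => //; rewrite exp_vanish.
have /(level_lenle lev C' hI) hP : @lenle S S^o (vanish a) [set: S] C' by [].
have e0 : [set f : P | vanish a (mps_of f)] = @low n k a.
  by apply/seteqP; split=> f /low_vanish.
have {}hP : @lenle P P^o (@low n k a) [set: P] C'.
  by rewrite -e0; apply: hP; rewrite exp_vanish.
exists C'.
apply: (@lenleS k (rscal (@mpoly.mpolyC n k : {rmorphism k -> P}) P^o) (@low n k a) [set: P] _ [set: P] _ _ (@subset_refl _ _)).
  by rewrite -low_exp; exact: exp_Ipow.
by apply: (@lenle_scalars n k a) => //; exact: (@ideal_low n k a).
Qed.

(** The preimage of [Ipow m a q] under the presentation lies in [deformed], whose colength is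
    therefore at most the one in [R]; [quadric_semicontinuity] then bounds the colength in the
    quadric. *)
Lemma quadric_leq d a e : (0 < d)%N -> krull_dim R = d -> complete_intersection m ->
    ~ regular_local m ->
  (@len (mpseries d.+1 k) (mpseries d.+1 k)^o (quadric_power (k := k) (d := d) p a e) [set: _]
   <= @len R R^o (Ipow m a (p ^ e)) [set: R])%N.
Proof.
move=> d0 dR [_ [B [f [hf [Q [mQ [s [g [[hQ [y [sy hy]]] hs gsurj gker]]]]]]]]] nreg.
have two : (2%:R : k) != 0.
  by rewrite -(dvdn_pcharf hpk) gtnNdvd.
pose S := mpseries d.+1 k; have hS : noetherian_local (vanish 1 : set S) by exact: mps_noetherian_local.
have gQ : growth mQ [set 0] (size y).
  apply: growth_gens => //; first exact: (@submodule_zero Q Q^o).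
    by move=> x xy; rewrite -hy; apply: sub_ideal_gen.
  by rewrite hy; apply: ideal_addrP; exact: (@submodule_zero Q Q^o).
have hreg d' : d'.+1 = size y -> ~ growth mQ [set 0] d'.
  move=> e1 /(krull_growth hQ) gd; have [] := @max_chainP Q (@prime_ideal Q).
    by rewrite -/(krull_dim Q) -sy -e1.
  by rewrite -/(krull_dim Q) -sy -e1 => /gd; rewrite ltnn.
(* Order [a] makes the truncation invisible modulo [m ^ a], and order 2 is the least at which linear
   terms are seen. *)
pose N := maxn a 2; have N1 : (1 < N)%N by exact: leq_maxr.
have [c1 [ev [F [H [lev hF hH hker]]]]] := ci_equations hm hf hQ hy hs gsurj gker hpk hpR res_surj res_ker two hreg N1 d0 dR gQ nreg.
pose n := (c1 + d.+1)%N; pose P := mpoly.mpoly n k; set q := (p ^ e)%N.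
have q0 : (0 < q)%N by rewrite expn_gt0 (prime_gt0 (pcharf_prime hpk)).
have hI := ideal_Ipow m a q.
have mI : ideal_exp m N `<=` Ipow m a q.
  by apply: subset_trans (exp_antitone (leq_maxl a 2)) _; exact: exp_Ipow.
have hl1 := @ideal_low n k 1.
pose D := @deformed k c1 d p F H a e; have hD : ideal D by exact: ideal_deformed.
have ker_sub : [set h | Ipow m a q (ev h)] `<=` D.
  move=> h /= hh.
  have [f' hf' ef'] := level_Ipow_surj lev (local_ideal hm) hl1 q0 hh.
  have mD := @ideal_ideal_exp R m N.
  have hN : ideal_exp m N (ev (h - f')).
    have := levelD lev (h - f') f'; rewrite subrK => e1.
    have -> : ev (h - f') = (ev h - ev f') - (ev h - (ev (h - f') + ev f')) by ring.
    exact: (idealB mD).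
  have -> : h = (h - f') + f' by rewrite subrK.
  apply: (idealD hD); last first.
    by apply: ideal_addrP hf'; exact: ideal_ideal_gen.
  move: (hker _ hN); apply: ideal_addS => //.
  apply: subset_trans (lowS (leq_maxl a 2)) _; rewrite -low_exp; exact: exp_Ipow.
have fR := finlen_Ipow hm a q.
set lam := @len R R^o (Ipow m a q) _.
have hlam : @lenle R R^o (Ipow m a q) [set: R] lam by exact: lenle_len.
have hP : @lenle P P^o D [set: P] lam.
  have := (level_lenle lev lam hI mI).2 hlam; exact: lenleS.
have hk : @lenle k (rscal (@mpoly.mpolyC n k : {rmorphism k -> P}) P^o) D [set: P] lam.
  apply: (@lenle_scalars n k a) => //; rewrite -low_exp.
  by apply: subset_trans (@exp_Ipow _ (@low n k 1) a q) _; apply: ideal_addrP; exact: ideal_ideal_gen.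
have [C hC] := lenle_low n a q.
have hq := @ideal_quadric_power k d p a e.
have fS : @finlen S S^o (quadric_power (k := k) (d := d) p a e) [set: S].
  apply: finlenS (finlen_Ipow hS a q) => //.
  by apply: ideal_addrP; exact: ideal_ideal_gen.
apply: (quadric_semicontinuity hpk hF hH two hC hk).
apply: (@chain_rscal k S (mpsC d.+1 k) S^o); exact: chain_len.
Qed.

End QuadricInequality.

Lemma max_chain_eq (T : Type) (Pr : set (set T)) n :
  has_chain Pr n -> (forall l, has_chain Pr l -> (l <= n)%N) -> max_chain Pr = n.
Proof.
move=> hn le; rewrite /max_chain; case: xgetP => [y _ [hy ley]|/(_ n)[]//].
by apply/eqP; rewrite eqn_leq le // ley.
Qed.

Lemma get_maximal (R : comNzRingType) (m : set R) : noetherian_local m ->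
  get (@maximal_ideal R) = m.
Proof.
by case=> _ hm u; case: xgetP => [y _ /u//|/(_ m)[]].
Qed.

Section QuotientModule.
Local Open Scope quotient_scope.

Lemma len_quotmod (R : comNzRingType) (N : lmodType R) (X : set N) :
  module_length (quotmod X) = len (span X) [set: N].
Proof.
pose Qm := Quotient.quot (span_pred X).
pose ev (x : N) : quotmod X := \pi_Qm x.
have ev0 : ev 0 = 0 := raddf0 \pi_Qm.
rewrite module_lengthE -(@len_approx R R N (quotmod X) id ev [set 0]) //.
- congr (len _ _); apply/seteqP; split=> x /=.
    move=> e; apply/asboolP; change (x \in span_pred X).
    by rewrite -(subr0 x) Quotient.idealrBE; apply/eqP; exact: (etrans e (esym ev0)).
  move=> hx; have : x - 0 \in span_pred X by rewrite subr0; apply/asboolP.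
  by rewrite Quotient.idealrBE => /eqP e; exact: (etrans e ev0).
- by move=> u v /=; rewrite /ev -quotmod_pi_add subrr.
- by move=> a u /=; rewrite /ev -quotmod_scale_pi subrr.
- move=> y; exists (repr (y : Qm)); rewrite /= /ev reprK subrr //.
- by move=> r; exists r => y; rewrite /= subrr scale0r.
- exact: submodule_zero.
Qed.

End QuotientModule.

Section QuotientOfLocal.
Variables (S A : comNzRingType) (pi : {rmorphism S -> A}) (mS : set S).
Hypotheses (hS : noetherian_local mS) (pi_surj : forall a, exists f, pi f = a).
Let mA : set A := pi @` mS.

Lemma ideal_preimage I : ideal I -> ideal (pi @^-1` I).
Proof.
move=> hI; apply: ideal_ofP => [|x y|a x] /=.
- by rewrite rmorph0; exact: (ideal0 hI).
- by rewrite rmorphD; exact: (idealD hI).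
- by rewrite rmorphM; exact: (idealMl _ hI).
Qed.

Lemma ideal_image J : ideal J -> ideal (pi @` J).
Proof.
move=> hJ; apply: ideal_ofP.
- by exists 0; [exact: (ideal0 hJ) | rewrite rmorph0].
- move=> _ _ [x Jx <-] [y Jy <-]; exists (x + y); last by rewrite rmorphD.
  exact: (idealD hJ).
- move=> a _ [x Jx <-]; have [b <-] := pi_surj a; exists (b * x); last by rewrite rmorphM.
  exact: (idealMl _ hJ).
Qed.

Lemma noetherian_quotient : noetherian A.
Proof.
move=> I hI; have [s hs] := local_noeth hS (ideal_preimage hI).
exists [seq pi x | x <- s]; apply/seteqP; split.
  apply: ideal_gen_sub => // _ /mapP[x xs ->]; change ((pi @^-1` I) x).
  by rewrite -hs; apply: sub_ideal_gen.
move=> a Ia; have [f fa] := pi_surj a.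
have : ideal_gen [set` s] f by rewrite hs /= fa.
have hG : ideal (pi @^-1` ideal_gen [set` [seq pi x | x <- s]]).
  by apply: ideal_preimage; exact: ideal_ideal_gen.
rewrite -fa; move: f {fa}; apply: ideal_gen_sub => // x xs /=.
by apply: sub_ideal_gen; exact: map_f.
Qed.

Lemma noetherian_local_quotient : noetherian_local mA.
Proof.
have hm := local_ideal hS; have hA := ideal_image hm.
have sub I : ideal I -> ~ I 1 -> I `<=` mA.
  move=> hI I1 a Ia; have [f fa] := pi_surj a; exists f => //.
  apply: (local_max hS (ideal_preimage hI)); first by rewrite /= rmorph1.
  by rewrite /= fa.
have mA1 : ~ mA 1.
  move=> [x mx x1]; have /local_unit[//|b] : ~ mS (1 - x).
    move=> h; apply: (local_n1 hS); rewrite -(subrK x 1); exact: (idealD hm).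
  move=> b1; have := congr1 pi b1; rewrite rmorphM rmorphB x1 rmorph1 subrr mulr0.
  by move/esym/eqP; rewrite oner_eq0.
split; first exact: noetherian_quotient.
  split=> // J hJ J1 mJ; apply/seteqP; split=> //; exact: sub.
move=> I [hI I1 Imax]; symmetry; apply: Imax => //; exact: sub.
Qed.

Lemma exp_image t r : ideal_exp mA t r -> exists2 f, ideal_exp mS t f & pi f = r.
Proof.
elim: t r => [|t IH] r; first by have [f <-] := pi_surj r; exists f.
rewrite ideal_expS.
have hI : ideal (pi @` ideal_exp mS t.+1) by apply: ideal_image; exact: ideal_ideal_exp.
move: r; apply: (@smul_sub A A^o _ _ _ hI) => _ r [x mx <-] /IH[f hf <-].
exists (x * f); last by rewrite rmorphM.
by rewrite ideal_expS; apply: (@smul_in S S^o).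
Qed.

Lemma level_quotient t : level_map mS mA t pi.
Proof.
have h0 := ideal0 (@ideal_ideal_exp A mA t).
split=> [f g|f g|i f _|i r].
- by rewrite rmorphD subrr.
- by rewrite rmorphM subrr.
- by apply: exp_morph => a ma; exists a.
- by move=> /exp_image[f hf <-]; exists f => //; rewrite subrr.
Qed.

Lemma preimage_Ipow a q : (0 < q)%N ->
  pi @^-1` Ipow mA a q = ideal_add (pi @^-1` [set 0]) (Ipow mS a q).
Proof.
move=> q0; have hm := local_ideal hS; have hmA := ideal_image hm.
have hI := @ideal_Ipow A mA a q; apply/seteqP; split=> [f /= hf|]; last first.
  apply: ideal_add_sub; first exact: ideal_preimage.
    by move=> f /= ->; exact: (ideal0 hI).
  by move=> f; apply: (level_Ipow_sub (level_quotient a) hmA hm q0 (leqnn a)).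
have [g hg] := level_Ipow_surj (level_quotient a) hmA hm q0 hf.
move=> /exp_image[h hh eh].
exists (f - (h + g)); first by rewrite /= !rmorphB rmorphD eh; ring.
exists (h + g); last by rewrite subrK.
by apply: (idealD (@ideal_Ipow S mS a q)) => //; exact: exp_Ipow.
Qed.

Lemma lenle_quotient I n : ideal I ->
  @lenle S S^o (pi @^-1` I) [set: S] n <-> @lenle A A^o I [set: A] n.
Proof.
move=> hI; apply: (@lenle_approx S A S^o A^o pi pi [set 0]) => //=.
- by move=> u v; rewrite rmorphD subrr.
- by move=> a u; rewrite rmorphM subrr.
- by move=> y; have [f <-] := pi_surj y; exists f; rewrite subrr.
- by move=> r; have [f <-] := pi_surj r; exists f => y; rewrite subrr scale0r.
- by move=> x ->; exact: (ideal0 hI).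
Qed.

Lemma len_quotient I : ideal I ->
  @len S S^o (pi @^-1` I) [set: S] = @len A A^o I [set: A].
Proof.
move=> hI; apply: (@len_approx S A S^o A^o pi pi [set 0]) => //=.
- by move=> u v; rewrite rmorphD subrr.
- by move=> a u; rewrite rmorphM subrr.
- by move=> y; have [f <-] := pi_surj y; exists f; rewrite subrr.
- by move=> r; have [f <-] := pi_surj r; exists f => y; rewrite subrr scale0r.
- by move=> x ->; exact: (ideal0 hI).
Qed.

Lemma growth_quotient_local d : growth mS (pi @^-1` [set 0]) d <-> growth mA [set 0] d.
Proof.
have hm := local_ideal hS; have hmA := ideal_image hm.
have e N : pi @^-1` (ideal_add [set 0] (ideal_exp mA N)) =
    ideal_add (pi @^-1` [set 0]) (ideal_exp mS N).
  apply/seteqP; split=> f /=.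
    move=> [_ -> [r /exp_image[g hg <-]]]; rewrite add0r => e.
    exists (f - g); first by rewrite /= rmorphB e subrr.
    by exists g => //; rewrite subrK.
  move=> [x /= x0 [y hy <-]]; exists 0 => //; exists (pi y); last by rewrite rmorphD x0.
  by move: hy; apply: exp_morph => a ma; exists a.
have hI N : ideal (ideal_add [set 0] (ideal_exp mA N)).
  by apply: ideal_ideal_add; [exact: (@submodule_zero A A^o) | exact: ideal_ideal_exp].
by split=> -[C hC]; exists C => N; have := lenle_quotient (C * N.+1 ^ d) (hI N);
  rewrite e => -[h1 h2]; auto.
Qed.

End QuotientOfLocal.

(** [J i] is the ideal of the first [i] variables, described by supports. Each [X i] is a
    nonzerodivisor modulo [J i], so growth [d] for 0 would become growth 0 for [J d], and one more
    step would put 1 into [J d.+1]. *)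
Lemma series_growth (k : fieldType) d : ~ growth (vanish 1 : set (mpseries d.+1 k)) [set 0] d.
Proof.
move=> g0; pose S := mpseries d.+1 k.
have hS : noetherian_local (vanish 1 : set S) by exact: mps_noetherian_local.
pose J i : set S := [set f | forall mu : mpoly.multinom d.+1,
  (forall j : 'I_d.+1, (j < i)%N -> mu j = 0%N) -> f mu = 0].
pose X i : S := mps_of (mpoly.mpolyX k (mpoly.mnm1 (inord i : 'I_d.+1))).
have XE i f mu : (X i * f) mu = if (0 < mu (inord i : 'I_d.+1))%N
    then f (mpoly.mnm_sub mu (mpoly.mnm1 (inord i))) else 0 by exact: mps_mulX.
have X0 i : (i <= d)%N -> forall f, J i.+1 (X i * f).
  move=> id f mu h; rewrite XE h // inordK //.
have hJ i : ideal (J i).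
  apply: ideal_ofP => [//|x y Jx Jy mu h|a x Jx mu h].
    by rewrite mpsD Jx // Jy // addr0.
  change (mpseries_mul a x mu = 0); rewrite /mpseries_mul big1 // => -[c1 c2] /= /eqP e.
  rewrite Jx ?mulr0 // => j /h; have := congr1 (fun z : mpoly.multinom d.+1 => z j) e.
  rewrite mpoly.mnmDE => -> /eqP.
  by rewrite addn_eq0 => /andP[_ /eqP].
have nzdJ i : (i <= d)%N -> nzd (J i) (X i).
  move=> id f Jf mu h; have := Jf (mpoly.mnm_add mu (mpoly.mnm1 (inord i))).
  rewrite mulrC XE mpoly.mnmDE mpoly.mnmE eqxx addn1 /= mpoly.addmK; apply=> j ji.
  rewrite mpoly.mnmDE h // mpoly.mnmE; case: eqP => // e; move: ji.
  by rewrite -e inordK // ltnn.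
have JS i : (i <= d)%N -> ideal_add (J i) (ideal_gen [set X i]) `<=` J i.+1.
  move=> id; apply: ideal_add_sub => //.
    by move=> f Jf mu h; apply: Jf => j ji; apply: h; exact: ltnW.
  by apply: ideal_gen_sub => // _ -> ; rewrite -(mulr1 (X i)); exact: X0.
have gJ i : (i <= d)%N -> growth (vanish 1 : set S) (J i) (d - i).
  elim: i => [|i IH] id.
    rewrite subn0; apply: growthS g0 => f -> mu _ //.
  have := IH (ltnW id); rewrite (_ : d - i = (d - i.+1).+1)%N => [g|]; last by rewrite -subSn.
  apply: growthS (JS i (ltnW id)) _; apply: (growth_nzd hS) => //; first exact: nzdJ (ltnW id).
have := gJ d (leqnn d); rewrite subnn => /(growth0_nzd hS (hJ d) (nzdJ d (leqnn d))).
move=> /(JS d (leqnn d)) J1; have := J1 mpoly.mnm0; rewrite -[X in X = _]/((_ == _)%:R).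
move=> h; have /eqP := h (fun j _ => mpoly.mnm0E j); by rewrite eqxx oner_eq0.
Qed.

Section QuadricRing.
Variables (k : fieldType) (d : nat).
Local Open Scope quotient_scope.
Let S := mpseries d.+1 k.
Let A := quadric_ring k d.
Let pi : {rmorphism S -> A} := \pi_A.
Let hS : noetherian_local (vanish 1 : set S) := @mps_noetherian_local d.+1 k.

Lemma quadric_pi_surj (a : A) : exists f, pi f = a.
Proof. by exists (repr a); rewrite /pi /= reprK. Qed.

Lemma quadric_pi_ker : pi @^-1` [set 0] = ideal_gen [set @sum_squares k d].
Proof.
have e (f : S) : pi f = 0 <-> f \in @quadric_ideal k d.
  rewrite -[f in X in _ <-> X]subr0 Quotient.idealrBE; split=> [h|/eqP h].
    by apply/eqP; rewrite [LHS]h -[LHS](rmorph0 pi).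
  by rewrite [LHS]h [LHS](rmorph0 pi).
apply/seteqP; split=> f /=; first by move=> /e /asboolP.
by move=> h; apply/e/asboolP.
Qed.

Definition quadric_max : set A := pi @` (vanish 1 : set S).

Lemma quadric_local : noetherian_local quadric_max.
Proof. exact: noetherian_local_quotient quadric_pi_surj. Qed.

Lemma quadric_len p a e : (0 < p)%N ->
  @len A A^o (Ipow quadric_max a (p ^ e)) [set: A] =
  @len S S^o (quadric_power (k := k) (d := d) p a e) [set: S].
Proof.
move=> p0; rewrite -(len_quotient quadric_pi_surj); last exact: ideal_Ipow.
by rewrite (preimage_Ipow hS quadric_pi_surj) ?expn_gt0 ?p0 // quadric_pi_ker.
Qed.

End QuadricRing.

Lemma sum_squares_vanish (k : fieldType) d : vanish 1 (@sum_squares k d).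
Proof.
apply: (ideal_sum _ (@ideal_vanish d.+1 k 1)) => i _.
by apply: idealX => //; [exact: ideal_vanish | exact: vanish_coordinate].
Qed.

(* The quadric is compared with [R] for both bounds of its dimension: the length inequality with
   [p ^ e >= a] bounds the growth of its Hilbert function, and a smaller growth would contradict
   the growth of the power series ring, of which it is a hypersurface. *)
Lemma quadric_dim (R : comNzRingType) (m : set R) (hm : noetherian_local m)
    (k : fieldType) (p : nat) (hpk : p \in [pchar k]) (hpR : p \in [pchar R])
    (res : {rmorphism R -> k}) (res_surj : forall c, exists r, res r = c)
    (res_ker : forall r, res r = 0 <-> m r) (p2 : (2 < p)%N) d :
  (0 < d)%N -> krull_dim R = d -> complete_intersection m -> ~ regular_local m ->
  krull_dim (quadric_ring k d) = d.
Proof.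
move=> d0 dR hci nreg; pose S := mpseries d.+1 k.
have hS : noetherian_local (vanish 1 : set S) by exact: mps_noetherian_local.
have [] := @max_chainP R (@prime_ideal R); first by rewrite -/(krull_dim R) dR.
rewrite -/(krull_dim R) dR => _ /(growth_krull hm)[C hC].
have gS : growth (vanish 1 : set S) (ideal_gen [set @sum_squares k d]) d.
  exists C => N; pose q := (p ^ N)%N.
  have qN : (N <= q)%N by apply/ltnW/ltn_expl/ltnW.
  pose I := quadric_power (k := k) (d := d) p N N.
  have hI : ideal I by exact: ideal_quadric_power.
  have IJ : I `<=` ideal_add (ideal_gen [set @sum_squares k d]) (ideal_exp (vanish 1) N).
    apply: ideal_addS => //; apply: Ipow_sub => // [|x vx]; first exact: ideal_ideal_exp.
    by apply: exp_antitone qN _ _; exact: expX.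
  have fI : @finlen S S^o I [set: S].
    apply: finlenS (finlen_Ipow hS N q) => //.
    by apply: ideal_addrP; exact: ideal_ideal_gen.
  apply: (@lenleS S S^o I [set: S] _ [set: S] _ IJ (@subset_refl _ _)).
  apply: (lenle_leq _ (lenle_len hI (@subsetT _ _) fI)).
  apply: leq_trans (quadric_leq hm hpk hpR res_surj res_ker p2 N N d0 dR hci nreg) _.
  apply: len_leq => //; first exact: ideal_Ipow.
  apply: lenleS (hC N) => //; apply: ideal_add_sub; first exact: ideal_Ipow.
    by move=> _ ->; exact: (ideal0 (@ideal_Ipow R m N q)).
  exact: exp_Ipow.
have gA : growth (@quadric_max k d) [set 0] d.
  by apply/(growth_quotient_local hS (@quadric_pi_surj k d)); rewrite quadric_pi_ker.
have hA := quadric_local k d.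
have [hch|nch] := pselect (has_chain (@prime_ideal (quadric_ring k d)) d).
  by apply: max_chain_eq => // l /(krull_growth hA gA).
have le l : has_chain (@prime_ideal (quadric_ring k d)) l -> (l <= d.-1)%N.
  move=> [L [hL Lstr]]; rewrite leqNgt prednK //; apply/negP => dl; apply: nch.
  exists L; split=> i id; [apply: hL | apply: Lstr]; exact: leq_trans id _.
have /(growth_quotient_local hS (@quadric_pi_surj k d)) := growth_krull hA le.
rewrite quadric_pi_ker => g.
have : growth (vanish 1 : set S) [set 0] d.-1.+1.
  have h0 : ideal [set (0 : S)] by exact: (@submodule_zero S S^o).
  apply: (growth_step h0 _ (@sum_squares_vanish k d)).
  by apply: growthS g; apply: ideal_addrP.
by rewrite prednK // => /series_growth.
Qed.

(** * Normalization and idealization *)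

Section NormalizationConstant.
Variable RR : realType.
Implicit Types s : RR.

(* [d`!] times the normalising constant [H_norm], with the summation range made independent of [s]. *)
Definition alt_sum (d : nat) s n : RR :=
  \sum_(i < n) (-1) ^+ i * 'C(d, i)%:R * (s - i%:R) ^+ d.

Lemma alt_sum0 d s : alt_sum d s 0 = 0.
Proof. by rewrite /alt_sum big_ord0. Qed.

(** With [n] the integer part of [s] plus one, [alt_sum d s n / d!] is the volume of the part of the
    unit cube where the coordinates add up to at most [s]. The recursion follows term by term from
    Pascal's rule. *)
Lemma alt_sumS d s n :
  alt_sum d.+1 s n.+1 = s * alt_sum d s n.+1 + (d.+1%:R - s) * alt_sum d (s - 1) n.
Proof.
have e i : (-1) ^+ i.+1 * 'C(d.+1, i.+1)%:R * (s - i.+1%:R) ^+ d.+1 =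
    s * ((-1) ^+ i.+1 * 'C(d, i.+1)%:R * (s - i.+1%:R) ^+ d) +
    (d.+1%:R - s) * ((-1) ^+ i * 'C(d, i)%:R * (s - 1 - i%:R) ^+ d) :> RR.
  have -> : s - 1 - i%:R = s - i.+1%:R by rewrite -addrA -opprD -natr1 [1 + _]addrC.
  have h : (i.+1%:R : RR) * 'C(d, i.+1)%:R = (d%:R - i%:R) * 'C(d, i)%:R.
    have [id|di] := leqP i d; last by rewrite !bin_small ?mulr0 // ltnW.
    by rewrite -natrB // -!natrM mul_bin_left.
  rewrite binS natrD [in LHS]exprS.
  rewrite !exprS -[d.+1%:R]natr1.
  have {}h : (i%:R + 1) * 'C(d, i.+1)%:R = (d%:R - i%:R) * 'C(d, i)%:R :> RR by rewrite natr1.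
  rewrite -[i.+1%:R]natr1; move: ((s - (i%:R + 1)) ^+ d) => X.
  apply/eqP; rewrite -subr_eq0; apply/eqP.
  transitivity ((-1) ^+ i * X * ((i%:R + 1) * 'C(d, i.+1)%:R - (d%:R - i%:R) * 'C(d, i)%:R)); first by ring.
  by rewrite h subrr mulr0.
rewrite /alt_sum big_ord_recl /= [in X in s * X]big_ord_recl /= bin0 [in X in s * X]bin0 mulrDr -addrA.
congr (_ + _); first by rewrite exprS; ring.
under eq_bigr => i _ do rewrite /bump /= add1n e.
by rewrite big_split /= -!mulr_sumr.
Qed.

(** The conditions make [n] the integer part of [s] plus one, or 0 when [s] is negative, a case the
    recursion meets at [s - 1]. For [s <= d.+1] both terms of the recursion are nonnegative; beyond,
    the sum is constant, the whole cube having volume 1. *)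
Lemma alt_sum_ge0 d s n : s < n%:R -> ((0 < n)%N -> n.-1%:R <= s) ->
  0 <= alt_sum d s n /\ (d%:R <= s -> alt_sum d s n = d`!%:R).
Proof.
elim: d s n => [|d IH] s [|n] sn hn.
- by rewrite alt_sum0; split=> // /le_lt_trans/(_ sn); rewrite ltxx.
- have -> : alt_sum 0 s n.+1 = 1.
    rewrite /alt_sum big_ord_recl big1 ?addr0 /= ?expr0 ?mul1r // => i _.
    by rewrite bin_small // mulr0 mul0r.
  by split.
- rewrite alt_sum0; split=> // /le_lt_trans/(_ sn) h.
  by have := ler0n RR d.+1; rewrite leNgt h.
have ns : n%:R <= s by exact: hn.
have s0 : 0 <= s by apply: le_trans ns; exact: ler0n.
have [g1 e1] := IH s n.+1 sn hn.
have [g2 e2] : 0 <= alt_sum d (s - 1) n /\ (d%:R <= s - 1 -> alt_sum d (s - 1) n = d`!%:R).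
  apply: IH; first by rewrite ltrBlDr natr1.
  by move=> n0; rewrite lerBrDr natr1 prednK.
have e : d.+1%:R <= s -> alt_sum d.+1 s n.+1 = d.+1`!%:R.
  move=> ds; have ds1 : d%:R <= s by apply: le_trans ds; rewrite ler_nat.
  rewrite alt_sumS e1 // e2; first by rewrite -mulrDl addrC subrK -natrM.
  by rewrite lerBrDr natr1.
split=> //; have [ds|/ltW ds] := leP s d.+1%:R; last by rewrite e.
by rewrite alt_sumS addr_ge0 // mulr_ge0 // subr_ge0.
Qed.

Lemma H_norm_ge0 d s : 0 <= s -> 0 <= H_norm s d.
Proof.
move=> s0; have e : H_norm s d = alt_sum d s (Num.truncn s).+1 / d`!%:R.
  rewrite /H_norm /alt_sum big_mkord mulr_suml; apply: eq_bigr => i _; ring.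
have /andP[h1 h2] := truncn_itv s0.
rewrite e divr_ge0 //; by have [] := @alt_sum_ge0 d s (Num.truncn s).+1 h2 (fun=> h1).
Qed.

End NormalizationConstant.

Section IdealizationLength.
Variables (R : comNzRingType) (m : set R) (M : lmodType R).
Local Notation E := (idealization M).

Definition ideal_in (r : R) : E := (r, 0).
Definition ideal_fst (x : E) : R := x.1.

Lemma ideal_in_zmod : zmod_morphism ideal_in.
Proof. by move=> x y; congr pair; rewrite subr0. Qed.
Lemma ideal_in_monoid : monoid_morphism ideal_in.
Proof. by split=> // x y; congr pair; rewrite /= !scaler0 addr0. Qed.
Lemma ideal_fst_zmod : zmod_morphism ideal_fst. Proof. by []. Qed.
Lemma ideal_fst_monoid : monoid_morphism ideal_fst. Proof. by []. Qed.
HB.instance Definition _ := GRing.isZmodMorphism.Build R E ideal_in ideal_in_zmod.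
HB.instance Definition _ := GRing.isMonoidMorphism.Build R E ideal_in ideal_in_monoid.
HB.instance Definition _ := GRing.isZmodMorphism.Build E R ideal_fst ideal_fst_zmod.
HB.instance Definition _ := GRing.isMonoidMorphism.Build E R ideal_fst ideal_fst_monoid.

Local Notation RM := (rscal (ideal_in : {rmorphism R -> E}) E^o).

Lemma rscal_idealE (r : R) (x : RM) : r *: x = (r * x.1, r *: x.2) :> E.
Proof. by rewrite rscalE; congr pair; rewrite /= scaler0 addr0. Qed.

Lemma smul_ideal_gen (K : set R) : ideal K ->
  @smul R RM K [set: RM] = ideal_gen (ideal_in @` K).
Proof.
move=> hK; have hG := @ideal_ideal_gen E (ideal_in @` K); apply/seteqP; split.
  apply: smul_sub; first by apply: (@rscal_submodule R E _ E^o).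
  move=> r x Kr _; apply: (idealMr x hG); apply: sub_ideal_gen; by exists r.
apply: ideal_gen_sub.
  have hs := @submodule_smul R RM K [set: RM].
  apply: ideal_ofP.
  - exact: (sub0 hs).
  - by move=> x y; exact: (subD hs).
  - move=> a.
    have hL : @submodule R RM [set x : RM | @smul R RM K [set: RM] ((a : E) * (x : E))].
      split=> [|x y|r x] /=.
      + by rewrite mulr0; exact: (sub0 hs).
      + by rewrite mulrDr; exact: (subD hs).
      + move=> h; have -> : a * (r *: x : RM) = r *: (a * x : RM) :> E by rewrite !rscalE /=; apply: mulrCA.
        exact: (subZ _ hs).
    apply: (smul_sub hL) => r x Kr _ /=.
    have -> : a * (r *: x : RM) = r *: (a * x : RM) :> E by rewrite !rscalE /=; apply: mulrCA.
    exact: smul_in.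
move=> _ [r Kr <-].
have -> : ideal_in r = r *: (1 : RM) :> E by rewrite rscalE; apply/esym/mulr1.
exact: smul_in.
Qed.

(** The ideal of the theorem is the extension of [m] to the idealization, so its powers and
    Frobenius powers are the extensions of those of [m]. *)
Lemma idealization_extension : ideal m ->
  (m `*` ideal_smul M m : set E) = ideal_gen (ideal_in @` m).
Proof.
move=> hm; rewrite -smul_ideal_gen // ideal_smulE; apply/seteqP; split=> [[r x] [/= mr mx]|].
  have hs := @submodule_smul R RM m [set: RM].
  have -> : (r, x) = r *: (1 : RM) + ((0, x) : RM) :> E.
    by rewrite rscal_idealE; congr pair; rewrite /= ?mulr1 ?addr0 // scaler0 add0r.
  apply: (subD hs); first exact: smul_in.
  have hL : submodule [set y : M | @smul R RM m [set: RM] (0, y)].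
    split=> [|y z|a y] /=.
    - exact: (sub0 hs).
    - have -> : (0, y + z) = ((0, y) : RM) + ((0, z) : RM) :> E by congr pair; rewrite addr0.
      exact: (subD hs).
    - have -> : (0, a *: y) = a *: ((0, y) : RM) :> E by rewrite rscal_idealE /= mulr0.
      exact: (subZ _ hs).
  move: x mx; apply: (smul_sub hL) => a y ma _ /=.
  have -> : (0, a *: y) = a *: ((0, y) : RM) :> E by rewrite rscal_idealE /= mulr0.
  exact: smul_in.
apply: (@smul_sub R RM).
  split=> [|[a x] [b y] /= [ma mx] [mb my]|c [a x] /= [ma mx]].
  - by split; [exact: (ideal0 hm) | exact: (sub0 (submodule_smul _ _))].
  - by split; [exact: (idealD hm) | exact: (subD (submodule_smul _ _))].
  - split=> /=; first exact: (idealMl _ hm).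
    by rewrite scaler0 addr0; exact: (subZ _ (submodule_smul _ _)).
move=> a [b y] ma _; rewrite rscal_idealE; split=> /=; first exact: (idealMr _ hm).
exact: smul_in.
Qed.

Lemma idealization_fg : finitely_generated M -> finitely_generated RM.
Proof.
move=> [s hs]; exists ((1 : RM) :: [seq ((0, x) : RM) | x <- s]).
apply/seteqP; split=> // -[r x] _; set X := [set` _].
have hX := span_submodule X.
have -> : (r, x) = r *: (1 : RM) + ((0, x) : RM) :> E.
  by rewrite rscal_idealE; congr pair; rewrite /= ?mulr1 ?addr0 // scaler0 add0r.
apply: (subD hX); first by apply: (subZ _ hX); apply: sub_span; rewrite /X /= mem_head.
have hL : submodule [set y : M | @span R RM X (0, y)].
  split=> [|y z|a y] /=.
  - exact: (sub0 hX).
  - have -> : (0, y + z) = ((0, y) : RM) + ((0, z) : RM) :> E by congr pair; rewrite addr0.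
    exact: (subD hX).
  - have -> : (0, a *: y) = a *: ((0, y) : RM) :> E by rewrite rscal_idealE /= mulr0.
    exact: (subZ _ hX).
have : span [set` s] x by rewrite hs.
move: x; apply: (span_sub hL) => x xs /=; apply: sub_span; rewrite /X /= inE; apply/orP; right.
exact: (map_f (fun x => (0, x) : RM)).
Qed.

(* The kernel [0 * M] of the projection to [R] has square zero, so the lengths over [E] and over
   [R] agree. *)
Lemma idealization_len (Z : set E) : ideal Z -> @finlen R RM Z [set: RM] ->
  @len E E^o Z [set: E] = @len R RM Z [set: RM].
Proof.
move=> hZ fin; pose m' : set E := [set x | x.1 = 0].
have fm x : exists r, m' (x - ideal_in r) by exists x.1; rewrite /m' /= subrr.
have kV : smul (ideal_exp m' 2) [set: E^o] `<=` Z.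
  apply: smul_sub => // a x ha _; apply: (idealMr x hZ); move: a ha.
  have e0 : ideal_exp m' 2 `<=` [set 0].
    rewrite ideal_expS; apply: (@smul_sub E E^o); first exact: submodule_zero.
    move=> [a x'] [b y] a0 hb; have {}a0 : a = 0 := a0; subst a; have {hb}: m' (b, y).
      move: hb; rewrite exp1_sub //; apply: ideal_ofP => // [u v|u v]; rewrite /m' /=.
        by move=> -> ->; rewrite addr0.
      by move=> ->; rewrite mulr0.
    by rewrite /m' /= => ->; congr pair; rewrite /= ?mul0r // !scale0r addr0.
  by move=> a /e0 ->; exact: (ideal0 hZ).
have finE : @finlen E E^o Z [set: E] := finlen_rscal_inv fin.
exact: (esym (@len_rscal R E (ideal_in : {rmorphism R -> E}) m' E^o fm Z [set: E] 2 hZ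
  (@submoduleT E E^o) (@subsetT _ _) kV finE)).
Qed.

Lemma len_fst (K : set R) : ideal K -> @finlen R RM (smul K [set: RM]) [set: RM] ->
  (@len R R^o K [set: R] <= @len R RM (smul K [set: RM]) [set: RM])%N.
Proof.
move=> hK fin; have hs := @submodule_smul R RM K [set: RM].
apply: len_leq => //.
apply: (@lenle_pull R R RM R^o ideal_fst (smul K [set: RM]) [set: RM] K [set: R]) => //.
- move=> L hL; split=> [|x y|a x] /=.
  + exact: (sub0 hL).
  + exact: (subD hL).
  + exact: (subZ a hL).
- have hL : submodule [set x : RM | K (ideal_fst x)].
    split=> [|x y|a x] /=.
    + exact: (ideal0 hK).
    + exact: (idealD hK).
    + exact: (idealMl _ hK).
  by apply: (smul_sub hL) => a x Ka _ /=; exact: (idealMr _ hK).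
- by move=> y _; exists (ideal_in y) => //; rewrite subrr; exact: (ideal0 hK).
- exact: lenle_len.
Qed.

(** The elements [(0, y)] have square zero, so every prime of the idealization contains them and is
    the inverse image of a prime of [R]. *)
Lemma idealization_dim d : (0 < d)%N -> krull_dim R = d -> krull_dim E = d.
Proof.
move=> d0 dR; have [] := @max_chainP R (@prime_ideal R); first by rewrite -/(krull_dim R) dR.
rewrite -/(krull_dim R) dR => -[L [hL Ls]] le.
have fstP (P : set R) : prime_ideal P -> prime_ideal (ideal_fst @^-1` P).
  move=> [hP P1 Pp]; split=> [||a b]; last exact: Pp.
    exact: ideal_preimage.
  by [].
have inP (Q : set E) : prime_ideal Q ->
    prime_ideal (ideal_in @^-1` Q) /\ Q = ideal_fst @^-1` (ideal_in @^-1` Q).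
  move=> [hQ Q1 Qp]; split.
    split=> [||a b] /=; [exact: ideal_preimage | by rewrite rmorph1 | by rewrite rmorphM => /Qp].
  have Q0 y : Q (0, y).
    pose z : E := (0, y); have h : Q (z * z).
      by rewrite (_ : z * z = 0) ; [exact: (ideal0 hQ) | congr pair; rewrite /= ?mulr0 // !scale0r addr0].
    by have [] := Qp _ _ h.
  apply/seteqP; split=> -[a x] /= h.
    have -> : ideal_in (ideal_fst (a, x)) = (a, x) - (0, x) by congr pair; rewrite /= ?subr0 ?subrr.
    exact: (idealB hQ).
  have -> : (a, x) = ideal_in (ideal_fst (a, x)) + (0, x) by congr pair; rewrite /= ?addr0 ?add0r.
  exact: (idealD hQ).
apply: max_chain_eq.
  exists (fun i => ideal_fst @^-1` L i); split=> i hi; first by apply: fstP; exact: hL.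
  have [sub nsub] := Ls i hi; split=> [x|h]; first exact: sub.
  by apply: nsub => r Lr; have := h (ideal_in r) Lr.
move=> l [L' [hL' Ls']]; apply: le; exists (fun i => ideal_in @^-1` L' i).
split=> i hi; first by have [] := inP _ (hL' i hi).
have [sub nsub] := Ls' i hi; split=> [x|h]; first exact: sub.
apply: nsub; have [_ ->] := inP _ (hL' i (ltnW hi)); have [_ ->] := inP _ (hL' i.+1 hi).
by move=> x /=; exact: h.
Qed.

End IdealizationLength.

(** If [u] diverges, [limn u] is the default value 0 and [limn v] is nonnegative. *)
Lemma lim_le_cvg (RR : realType) (u v : nat -> RR) : (forall j, 0 <= v j) -> (forall j, u j <= v j) ->
  cvgn v -> limn u <= limn v.
Proof.
move=> v0 uv cv; have [cu|du] := pselect (cvgn u).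
  by apply: ler_lim => //; near=> j.
rewrite (dvgP du); change (0 <= limn v); apply: limr_ge => //; by near=> j.
Unshelve. all: by end_near. Qed.

Lemma len_quotient_ideal (A : comNzRingType) (J : set A) : ideal J ->
  module_length (quotmod (ideal_smul A^o J)) = @len A A^o J [set: A].
Proof.
move=> hJ; rewrite len_quotmod ideal_smulE span_id; last exact: submodule_smul.
congr (len _ _); apply/seteqP; split.
  by apply: (@smul_sub A A^o) => // a x Ja _; exact: (idealMr _ hJ).
by move=> x Jx; rewrite -(mulr1 x); exact: (@smul_in A A^o).
Qed.

Theorem theorem1p4 (RR : realType) (d p : nat) (k : fieldType)
    (R : comNzRingType) (m : set R) (M : lmodType R)
    (res : {rmorphism R -> k}) (s : RR)
    (hd : (2 <= d)%N) (hp : (2 < p)%N)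
    (hk : p \in [pchar k]) (hR : p \in [pchar R])
    (hlocal : noetherian_local m)
    (hres_surj : range res = [set: k])
    (hres_ker : res @^-1` [set 0] = m)
    (hdim : krull_dim R = d)
    (hci : complete_intersection m)
    (hnonreg : ~ regular_local m)
    (hM : finitely_generated M)
    (hs : 0 < s) :
  s_mult_ring p s (quadric_ring k d) <=
  s_mult_ideal p s (m `*` ideal_smul M m : set (idealization M)).
Proof.
have surj c : exists r, res r = c by have [r _ <-] : range res c; [rewrite hres_surj|exists r].
have ker r : res r = 0 <-> m r by rewrite -hres_ker.
have d0 : (0 < d)%N by apply: leq_trans hd.
have p0 : (0 < p)%N by apply: leq_trans hp.
have hm := local_ideal hlocal.
have dimE : krull_dim (idealization M) = d by exact: idealization_dim.
have dimA : krull_dim (quadric_ring k d) = d.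
  exact: (quadric_dim hlocal hk hR surj ker hp d0 hdim hci hnonreg).
pose RM := rscal (@ideal_in R M : {rmorphism R -> idealization M}) (idealization M)^o.
have hRM : finitely_generated RM by exact: idealization_fg.
have hE : p \in [pchar (idealization M)] by exact: (rmorph_pchar (@ideal_in R M) hR).
(* [v] is the normalized sequence of the idealization, computed over [R] on the finitely generated
   module [RM], where [pres_cvg] gives its convergence. *)
pose c j := ceil_exp p s j; pose v j : RR :=
  (len (smul (Ipow m (c j) (p ^ j)) [set: RM]) [set: RM])%:R / (p ^ (j * d))%:R.
have fin a q : finlen (smul (Ipow m a q) [set: RM]) [set: RM].
  have hz := @submodule_smul R RM (Ipow m a q) [set: RM].
  apply: finlenS (finlen_exp hlocal a hRM hz) => //; apply: sadd_sub => //.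
  by apply: smulS => //; exact: exp_Ipow.
have lenE a j : @len _ (idealization M)^o
    (Ipow (m `*` ideal_smul M m : set (idealization M)) a (p ^ j)) [set: _] =
    len (smul (Ipow m a (p ^ j)) [set: RM]) [set: RM].
  have hI := ideal_Ipow m a (p ^ j).
  have eI : Ipow (m `*` ideal_smul M m : set (idealization M)) a (p ^ j) =
      smul (Ipow m a (p ^ j)) [set: RM].
    rewrite (smul_ideal_gen M hI) (idealization_extension M hm).
    exact: (esym (extend_Ipow (@ideal_in R M) m a j hE)).
  rewrite eI; apply: idealization_len; last exact: fin.
  by rewrite (smul_ideal_gen M hI); exact: ideal_ideal_gen.
have ineq a j : (@len _ (quadric_ring k d)^o (Ipow (@quadric_max k d) a (p ^ j)) [set: _] <=
    len (smul (Ipow m a (p ^ j)) [set: RM]) [set: RM])%N.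
  rewrite quadric_len //.
  apply: leq_trans (quadric_leq hlocal hk hR surj ker hp a j d0 hdim hci hnonreg) _.
  apply: len_fst; [exact: ideal_Ipow | exact: fin].
have gR : growth m [set 0] d.-1.+1.
  rewrite prednK //; have [] := @max_chainP R (@prime_ideal R).
    by rewrite -/(krull_dim R) hdim.
  by rewrite -/(krull_dim R) hdim => _; exact: growth_krull.
have cv : cvgn v.
  have [gs hgs] := local_noeth hlocal hm.
  have [e [he _]] := exists_presents hlocal hk hR surj ker hgs.
  by have := pres_cvg hlocal hR hk he hRM gR hs; rewrite prednK.
rewrite /s_mult_ring (get_maximal (quadric_local k d)) /s_mult_ideal /s_mult dimE dimA.
rewrite ler_wpM2r // ?invr_ge0; first exact: H_norm_ge0 (ltW hs).
have hv : h_mult p s (m `*` ideal_smul M m : set (idealization M)) (m `*` ideal_smul M m)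
    (idealization M)^o = limn v.
  rewrite /h_mult dimE; congr (limn _); apply/funext => j.
  by rewrite len_quotient_ideal ?lenE //; exact: ideal_Ipow.
rewrite hv /h_mult dimA; apply: lim_le_cvg => // j; first by rewrite divr_ge0.
rewrite len_quotient_ideal; last exact: ideal_Ipow.
by rewrite ler_wpM2r ?invr_ge0 // ler_nat; exact: ineq.
Qed.
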